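(* Let $p\in(1,\infty)$, let $\Omega\subset\mathbb{R}^d$ be a bounded domain of class $C^2$, let the kernel $\eta:[0,\infty)\to[0,\infty)$ be continuous, monotonously decreasing (nonincreasing), with $\mathrm{supp}(\eta)\subset[0,r_\eta]$ for some $r_\eta>0$, and let $\{s_n\}_{n\in\mathbb{N}}\subset(0,\infty)$ satisfy $s_n\to0$ and $\lim_{n\to\infty}\frac{\delta_n}{s_n}=0$. Then with probability one, any bounded sequence $(u_n)_{n\in\mathbb{N}}\subset L^\infty(\Omega)$ such that $$\lim_{n\to\infty}\Big(E_{n,\mathrm{cons}}(u_n)-\inf_{u\in L^\infty(\Omega)}E_{n,\mathrm{cons}}(u)\Big)=0$$ is relatively compact in $L^\infty(\Omega)$ and $$\lim_{n\to\infty}E_{n,\mathrm{cons}}(u_n)=\sigma_\eta\,\nu(\Omega)^{-\frac1p}\min_{u\in L^\infty(\Omega)}\mathcal{E}_{\mathrm{cons}}(u).$$ Furthermore, every cluster point of $(u_n)_{n\in\mathbb{N}}$ is a minimizer of $\mathcal{E}_{\mathrm{cons}}$.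
   Context: $\nu$ is the Lebesgue measure of $\mathbb{R}^d$ restricted to $\Omega$. $x_1,\dots,x_N$ are arbitrary fixed points of $\Omega$ and $x_{N+1},x_{N+2},\dots$ are i.i.d. random points with distribution $\nu/\nu(\Omega)$. $\mathcal{O}=\{x_1,\dots,x_N\}$ is the label set; $\Omega_n=\{x_i: 1\le i\le|\Omega_n|\}$ with $N<|\Omega_1|<|\Omega_2|<\dots<\infty$; $g:\bar\Omega\to\mathbb{R}$ is a fixed Lipschitz function. $\nu_n=\frac1{|\Omega_n|}\sum_{x\in\Omega_n}\delta_x$ is the empirical measure (here $\delta_x$ is the Dirac measure at $x$). Rates: $\delta_n=\sqrt{\ln\ln n/n}$ if $d=1$; $\delta_n=(\ln n)^{3/4}/\sqrt n$ if $d=2$; $\delta_n=(\ln n)^{1/d}/n^{1/d}$ if $d\ge3$. Transportation maps: with probability one there are maps $T_n:\Omega\to\Omega$ with $(T_n)_\#\big(\nu/\nu(\Omega)\big)=\nu_n$ and constants $C\ge c\ge0$ with $c\le\liminf_n\|T_n-\mathrm{Id}\|_{L^\infty(\Omega)}/\delta_n\le\limsup_n\|T_n-\mathrm{Id}\|_{L^\infty(\Omega)}/\delta_n\le C$ (a known result). Such a sequence is fixed; modifying on null sets, $T_n(\Omega)\subset\Omega_n$ and $T_n=\mathrm{Id}$ on $\Omega_n$. Kernel: $\eta_s(t)=s^{-d}\eta(t/s)$ for $s>0$, and $\sigma_\eta=\big(\int_{B(r_\eta)}\eta(|z|)|z\cdot e_1|^p\,dz\big)^{1/p}$ with $e_1=(1,0,\dots,0)\in\mathbb{R}^d$,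 $B(r)=\{x\in\mathbb{R}^d:|x|<r\}$. Functionals: for $u:\Omega_n\to\mathbb{R}$, $E_n(u)=\frac1{s_n}\max_{x\in\Omega_n}\Big(\frac1{|\Omega_n|}\sum_{y\in\Omega_n}\eta_{s_n}(|x-y|)|u(x)-u(y)|^p\Big)^{1/p}$ if $u=g$ on $\mathcal{O}$, and $E_n(u)=\infty$ otherwise. For $u\in L^\infty(\Omega)$: $E_{n,\mathrm{cons}}(u)=E_n(\tilde u)$ if $u=\tilde u\circ T_n$ for some $\tilde u:\Omega_n\to\mathbb{R}$, and $\infty$ otherwise. For $u\in L^\infty(\Omega)$: $\mathcal{E}(u)=\operatorname{ess\,sup}_{x\in\Omega}|\nabla u(x)|$ if $u\in W^{1,\infty}(\Omega)$, and $\infty$ otherwise; $\mathcal{E}_{\mathrm{cons}}(u)=\mathcal{E}(u)$ if $u=g$ on $\mathcal{O}$, and $\infty$ otherwise.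
   Formalization: The kernel η is additionally assumed not identically zero on [0,∞); for η ≡ 0 every bounded sequence of functions ũ∘T_n matching the labels is minimizing, so relative compactness fails. *)

(* Defs.v *)
(* MathComp-Analysis development over an abstract [R : realType].  A point of
   R^d is a row vector ['rV[R]_d]; the library topology of ['rV[R]_d] is that of
   the sup norm, hence the usual one, while lengths are measured below with the
   Euclidean norm [enorm]. *)
From HB Require Import structures.
From mathcomp Require Import all_boot all_order all_algebra.
From mathcomp Require Import all_classical all_reals all_analysis.
From mathcomp Require Import measurable_realfun ess_sup_inf.

Set Implicit Arguments.
Unset Strict Implicit.
Unset Printing Implicit Defensive.

Import Order.TTheory GRing.Theory Num.Def Num.Theory.
Import numFieldNormedType.Exports.

Local Open Scope classical_set_scope.
Local Open Scope ring_scope.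

Section borel.
Context (R : realType) (d : nat).
Definition borel_display : measure_display. Proof. by []. Qed.
Let B : set (set 'rV[R]_d) := <<s @open 'rV[R]_d >>.
Let B0 : B set0. Proof. exact: sigma_algebra0. Qed.
Let BC A : B A -> B (~` A). Proof. exact: sigma_algebraC. Qed.
Let BU (F : (set _)^nat) : (forall i, B (F i)) -> B (\bigcup_i F i).
Proof. exact: sigma_algebra_bigcup. Qed.
HB.instance Definition _ := @isMeasurable.Build borel_display 'rV[R]_d B B0 BC BU.

Lemma open_measurable_rV (A : set 'rV[R]_d) : open A -> measurable A.
Proof. by move=> oA; exact: sub_sigma_algebra. Qed.
End borel.

Section box.
Context (R : realType) (d : nat).

Definition rat_box (q : {ffun 'I_d -> rat * rat}) : set 'rV[R]_d :=
  [set v | forall i, ratr (q i).1 < v ord0 i < ratr (q i).2].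

Lemma open_rat_box (A : set 'rV[R]_d) : open A ->
  A = \bigcup_(q in [set q | rat_box q `<=` A]) rat_box q.
Proof.
move=> oA; apply/seteqP; split=> [v Av|v [q]]; last exact.
have /nbhs_ballP[e /= e0 vA] : nbhs v A by exact: open_nbhs_nbhs.
have ex i : exists q : rat * rat, v ord0 i - e < ratr q.1 < v ord0 i /\
   v ord0 i < ratr q.2 < v ord0 i + e.
  have /rat_in_itvoo[a] : v ord0 i - e < v ord0 i by rewrite gtrBl.
  have /rat_in_itvoo[b] : v ord0 i < v ord0 i + e by rewrite ltrDl.
  by rewrite !in_itv /= => ? ?; exists (a, b).
pose q := [ffun i => projT1 (cid (ex i))].
have qP i : v ord0 i - e < ratr (q i).1 < v ord0 i /\
   v ord0 i < ratr (q i).2 < v ord0 i + e by rewrite ffunE; case: cid.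
exists q => /=; last first.
  by move=> i; have [/andP[_ ->] /andP[-> _]] := qP i.
move=> w /= qw; apply: vA; split => // i j.
rewrite ord1 /ball /= ltr_norml.
have [/andP[a1 a2] /andP[b1 b2]] := qP j; have /andP[c1 c2] := qw j.
apply/andP; split; [rewrite ltrNl opprB|].
  by rewrite ltrBlDl (lt_trans c2).
by rewrite ltrBlDl -ltrBlDr (lt_trans a1).
Qed.

End box.


Lemma measurable_coord (R : realType) (n : nat) (i : 'I_n) :
  measurable_fun [set: 'rV[R]_n] (fun v => v ord0 i : measurableTypeR R).
Proof.
apply: (measurability _ (RGenOpens.measurableE R)).
move=> _ [_ [a [b ->]] <-]; rewrite setTI; apply: open_measurable_rV.
apply: open_comp; last exact: interval_open.
by move=> v _; exact: coord_continuous.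
Qed.

Lemma measurable_fun_rV (R : realType) d' (T : measurableType d') (n : nat)
    (f : T -> 'rV[R]_n) :
  (forall i, measurable_fun setT (fun x => f x ord0 i : measurableTypeR R)) ->
  measurable_fun setT f.
Proof.
move=> mf; apply: (@measurability _ _ _ _ _ _ (@open 'rV[R]_n)) => //.
move=> _ [A oA <-]; rewrite setTI (open_rat_box oA) preimage_bigcup.
rewrite bigcup_mkcond; apply: countable_bigcupT_measurable => // q.
case: ifP => // _.
rewrite (_ : _ @^-1` _ = ~` \bigcup_i
    ~` ((fun x => f x ord0 i : measurableTypeR R)
          @^-1` `]ratr (q i).1, ratr (q i).2[)).
  apply: measurableC; apply: countable_bigcupT_measurable => // i.
  by apply: measurableC; rewrite -[X in measurable X]setTI; exact: mf.
rewrite setC_bigcup; apply/seteqP; split => [x /= xq i _|x /= xq i].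
  by rewrite setCK /= in_itv /=; exact: xq.
by have := xq i I; rewrite setCK /= in_itv.
Qed.

Section lebesgue_rV.
Context (R : realType).

Definition cons_rV n (xv : measurableTypeR R * 'rV[R]_n) : 'rV[R]_n.+1 :=
  \row_i (if unlift ord0 i is Some j then xv.2 ord0 j else xv.1).

Lemma cons_rV0 n x (v : 'rV[R]_n) : cons_rV (x, v) ord0 ord0 = x.
Proof.
by rewrite mxE unlift_none.
Qed.

Lemma cons_rVS n x (v : 'rV[R]_n) i : cons_rV (x, v) ord0 (lift ord0 i) = v ord0 i.
Proof.
by rewrite mxE liftK.
Qed.

Lemma measurable_cons_rV n : measurable_fun setT (@cons_rV n).
Proof.
apply: measurable_fun_rV => i.
case: (unliftP ord0 i) => [j ->|->].
  have -> : (fun x => cons_rV x ord0 (lift ord0 j)) =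
      (fun v : 'rV[R]_n => v ord0 j : measurableTypeR R) \o snd.
    by apply/funext => -[x v] /=; rewrite cons_rVS.
  exact: measurableT_comp (measurable_coord j) (@measurable_snd _ _ _ _).
have -> : (fun x => @cons_rV n x ord0 ord0) = fst.
  by apply/funext => -[x v]; rewrite cons_rV0.
exact: measurable_fst.
Qed.

Definition uncons_rV n (v : 'rV[R]_n.+1) : measurableTypeR R * 'rV[R]_n :=
  (v ord0 ord0, \row_i v ord0 (lift ord0 i)).

Lemma cons_rVK n : cancel (@cons_rV n) (@uncons_rV n).
Proof.
move=> [x v]; rewrite /uncons_rV cons_rV0; congr pair.
by apply/rowP => i; rewrite mxE cons_rVS.
Qed.

Lemma measurable_uncons_rV n : measurable_fun setT (@uncons_rV n).
Proof.
apply: measurable_fun_pair; first exact: measurable_coord.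
apply: measurable_fun_rV => i.
under eq_fun do rewrite mxE.
exact: measurable_coord.
Qed.

Section step.
Context n (m : {sigma_finite_measure set 'rV[R]_n -> \bar R}).

Definition leb_cons : set 'rV[R]_n.+1 -> \bar R :=
  pushforward (@lebesgue_measure R \x m)%E (@cons_rV n).

Let leb_cons0 : leb_cons set0 = 0%E.
Proof. by rewrite /leb_cons /pushforward preimage_set0 measure0. Qed.

Let leb_cons_ge0 A : (0 <= leb_cons A)%E.
Proof. by rewrite /leb_cons /pushforward; exact: measure_ge0. Qed.

Let leb_cons_sigma_additive : semi_sigma_additive leb_cons.
Proof.
move=> F mF tF mUF; rewrite /leb_cons /pushforward preimage_bigcup.
have mcons A : measurable A -> measurable (@cons_rV n @^-1` A).
  by rewrite -[X in _ -> measurable X]setTI; exact: measurable_cons_rV.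
apply: measure_semi_sigma_additive.
- by move=> k; exact: mcons.
- apply/trivIsetP => /= i j _ _ ij; rewrite -preimage_setI.
  by move/trivIsetP : tF => /(_ _ _ _ _ ij) ->//; rewrite preimage_set0.
- by rewrite -preimage_bigcup; exact: mcons.
Qed.

HB.instance Definition _ := isMeasure.Build _ _ _ leb_cons
  leb_cons0 leb_cons_ge0 leb_cons_sigma_additive.

Let leb_cons_sigma_finite : sigma_finite setT leb_cons.
Proof.
have /sigma_finiteP[F [TF ndF Foo]] := sigma_finiteT (@lebesgue_measure R).
have /sigma_finiteP[G [TG ndG Goo]] := sigma_finiteT m.
exists (fun k => @uncons_rV n @^-1` (F k `*` G k)).
  apply/esym/seteqP; split => // v _.
  have [k _ Fk] : (\bigcup_i F i) (uncons_rV v).1 by rewrite -TF.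
  have [l _ Gl] : (\bigcup_i G i) (uncons_rV v).2 by rewrite -TG.
  exists (maxn k l) => //; split.
    by move: Fk; exact/subsetPset/ndF/leq_maxl.
  by move: Gl; exact/subsetPset/ndG/leq_maxr.
move=> k; have [mF Fk] := Foo k; have [mG Gk] := Goo k.
split.
  rewrite -[X in measurable X]setTI; apply: measurable_uncons_rV => //.
  exact: measurableX.
rewrite /leb_cons /pushforward -comp_preimage (_ : _ \o _ = id); last first.
  by apply/funext => xv; exact: cons_rVK.
by rewrite product_measure1E// lte_mul_pinfty// ge0_fin_numE.
Qed.

HB.instance Definition _ := Measure_isSigmaFinite.Build _ _ _ leb_cons
  leb_cons_sigma_finite.

End step.

Fixpoint lebesgue_rV n : {sigma_finite_measure set 'rV[R]_n -> \bar R} :=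
  if n is n'.+1 then leb_cons (lebesgue_rV n') else \d_(0 : 'rV[R]_0).

End lebesgue_rV.

Lemma lebesgue_rVS (R : realType) n (A : set 'rV[R]_n.+1) :
  lebesgue_rV R n.+1 A =
  (@lebesgue_measure R \x lebesgue_rV R n)%E (@cons_rV R n @^-1` A).
Proof. by []. Qed.

Definition open_box (R : realType) n (a b : 'rV[R]_n) : set 'rV[R]_n :=
  [set v | forall i, a ord0 i < v ord0 i < b ord0 i].

Lemma measurable_box (R : realType) n (a b : 'rV[R]_n) :
  measurable (open_box a b).
Proof.
rewrite (_ : open_box a b = ~` \bigcup_i ~` ((fun v : 'rV[R]_n =>
    v ord0 i : measurableTypeR R) @^-1` `]a ord0 i, b ord0 i[)).
  apply: measurableC; apply: countable_bigcupT_measurable => // i.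
  apply: measurableC; rewrite -[X in measurable X]setTI.
  exact: measurable_coord.
rewrite setC_bigcup; apply/seteqP; split => [x /= xq i _|x /= xq i].
  by rewrite setCK /= in_itv /=; exact: xq.
by have := xq i I; rewrite setCK /= in_itv.
Qed.

Lemma lebesgue_rV_box (R : realType) n (a b : 'rV[R]_n) :
  (forall i, a ord0 i <= b ord0 i) ->
  lebesgue_rV R n (open_box a b) =
  (\prod_i (b ord0 i - a ord0 i))%:E.
Proof.
elim: n a b => [|n IH] a b ab.
  rewrite big_ord0 (_ : lebesgue_rV R 0 = \d_(0 : 'rV[R]_0) :> (set _ -> _))//.
  by rewrite diracE mem_set// => -[].
pose tl (u : 'rV[R]_n.+1) : 'rV[R]_n := \row_i u ord0 (lift ord0 i).
have -> : open_box a b =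
    @uncons_rV R n @^-1` (`]a ord0 ord0, b ord0 ord0[ `*`
      open_box (tl a) (tl b)).
  apply/seteqP; split=> v /=.
    move=> xv; split; first by have := xv ord0; rewrite in_itv.
    by move=> i; have := xv (lift ord0 i); rewrite !mxE.
  move=> [+ xv] i; case: (unliftP ord0 i) => [j ->|->].
    by move=> _; have := xv j; rewrite !mxE.
  by rewrite in_itv.
rewrite lebesgue_rVS -comp_preimage (_ : _ \o _ = id); last first.
  by apply/funext => xv; exact: cons_rVK.
rewrite preimage_id.
rewrite product_measure1E//; last first.
  exact: measurable_box.
rewrite IH => [|i]; last by rewrite !mxE.
rewrite big_ord_recl EFinM; congr (_ * _)%E; last first.
  by congr EFin; apply: eq_bigr => i _; rewrite !mxE.
transitivity (@lebesgue_measure R `]a ord0 ord0, b ord0 ord0[) => //.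
rewrite lebesgue_measure_itv /= lte_fin; case: ltP => // ba; congr EFin.
by apply/esym/eqP; rewrite subr_eq0 eq_le ba ab.
Qed.

(* L^oo(mu), i.e. the library's quotient by almost-everywhere equality, with the
   distance induced by the essential sup norm. *)
Section Linfty.
Context d (T : measurableType d) (R : realType) (mu : {measure set T -> \bar R}).

Definition Linfty := LspaceType mu (leey 1).
HB.instance Definition _ := gen_eqMixin Linfty.
HB.instance Definition _ := gen_choiceMixin Linfty.

Definition Linfty_dist (f g : Linfty) : R :=
  fine ('N[mu]_+oo[(fun x => (f x - g x : R)%:E)])%E.

Let Ndist (f g : Linfty) := ('N[mu]_+oo[(fun x => (f x - g x : R)%:E)])%E.

Let mf (f : Linfty) : measurable_fun setT (f : T -> R).
Proof. exact: (@measurable_funPT _ _ _ _ (repr (LebesgueSpace.sort f))). Qed.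

Let mB (f g : Linfty) : measurable_fun setT (fun x => f x - g x : R).
Proof. by apply: measurable_funB; exact: mf. Qed.

Let Ntri (g f h : Linfty) : (Ndist f h <= Ndist f g + Ndist g h)%E.
Proof.
rewrite /Ndist.
have -> : (fun x => (f x - h x : R)%:E) =
  (EFin \o (((fun x => f x - g x : R) : T -> R) \+ (fun x => g x - h x : R))).
  by apply/funext => x /=; rewrite addrA subrK.
by apply: eminkowski; rewrite ?leey//; exact: mB.
Qed.

Let Nsym (f g : Linfty) : Ndist f g = Ndist g f.
Proof.
rewrite /Ndist -[LHS]oppe_Lnorm; congr Lnorm.
by apply/funext => x /=; rewrite opprB.
Qed.

Let Nfin (f g : Linfty) : Ndist f g \is a fin_num.
Proof.
rewrite ge0_fin_numE ?Lnorm_ge0// /Ndist.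
have -> : (fun x => (f x - g x : R)%:E) =
  (EFin \o ((f : T -> R) \+ (fun x => - g x : R))) by [].
apply: (le_lt_trans (@eminkowski _ _ _ mu _ _ +oo%E (mf f) _ (leey 1))).
  exact: (measurable_funN (mf g)).
apply: lte_add_pinfty; first exact: Lebesgue_finite.
rewrite -oppe_Lnorm.
have -> : (fun x => - (- g x : R)%:E)%E = EFin \o (g : T -> R).
  by apply/funext => x /=; rewrite opprK.
exact: Lebesgue_finite.
Qed.

Let dxx (f : Linfty) : Linfty_dist f f = 0.
Proof.
rewrite /Linfty_dist.
have -> : (fun x => (f x - f x : R)%:E) = cst 0%E :> (T -> \bar R).
  by apply/funext => x; rewrite subrr.
by rewrite Lnorm0// eqe.
Qed.

Let d0 (f g : Linfty) : Linfty_dist f g = 0 -> f = g.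
Proof.
move=> fg; have fg0 : Ndist f g = 0%E.
  by rewrite -(fineK (Nfin f g)); congr EFin.
have fgE : LebesgueSpace.sort f = LebesgueSpace.sort g.
  apply/eqP; rewrite -(reprK (LebesgueSpace.sort f)) -(reprK (LebesgueSpace.sort g)).
  rewrite eqmodE; apply/asboolP.
  have := @Lnorm_eq0_eq0 _ _ _ mu _ _ _ _ fg0.
  have /measurable_EFinP mfg := mB f g.
  move=> /(_ mfg (ltey 0)); apply: filterS => x /(_ I) /= [] /eqP.
  by rewrite subr_eq0 => /eqP fgx _.
move: f g fgE {fg fg0} => [f [[Pf]]] [g [[Pg]]] /= fg.
by case: _ / fg Pg => Pg; rewrite (Prop_irrelevance Pf Pg).
Qed.

Let dsym (f g : Linfty) : Linfty_dist f g = Linfty_dist g f.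
Proof. by rewrite /Linfty_dist -/(Ndist f g) Nsym. Qed.

Let dtri (g f h : Linfty) : Linfty_dist f h <= Linfty_dist f g + Linfty_dist g h.
Proof. by rewrite -lee_fin EFinD !fineK ?Nfin//; exact: Ntri. Qed.

HB.instance Definition _ := isMetric.Build R Linfty dxx d0 dsym dtri.

End Linfty.

Section euclidean.
Context {R : realType} {d : nat}.
Implicit Types x y : 'rV[R]_d.

Definition dotp x y : R := \sum_i x ord0 i * y ord0 i.
Definition enorm x : R := Num.sqrt (dotp x x).
Definition eball x (r : R) : set 'rV[R]_d := [set y | enorm (y - x) < r].
Definition e1 : 'rV[R]_d := \row_i (i == 0%N :> nat)%:R.

End euclidean.

Section domains.
Context {R : realType} {d : nat}.

Fixpoint Ck (k : nat) (f : 'rV[R]_d -> R) : Prop :=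
  continuous f /\
  if k is k'.+1 then
    forall i : 'I_d, (forall x, derivable f x (delta_mx 0 i)) /\
                     Ck k' ('D_(delta_mx 0 i) f)
  else True.

Definition smooth (f : 'rV[R]_d -> R) := forall k, Ck k f.

(* Near each boundary point, up to a rigid change of coordinates, Omega is the
   strict epigraph of a C^2 function of d - 1 variables.  The unit vector [e] is
   the vertical direction, and a function of the d - 1 horizontal coordinates is
   a function on R^d that is invariant under translations along [e]. *)
Definition C2_boundary (Omega : set 'rV[R]_d) :=
  forall x0, (closure Omega `\` interior Omega) x0 ->
  exists (r : R) (e : 'rV[R]_d) (gamma : 'rV[R]_d -> R),
    [/\ 0 < r, enorm e = 1, Ck 2 gamma,
        (forall x t, gamma (x + t *: e) = gamma x) &
        forall x, eball x0 r x -> (Omega x <-> gamma x < dotp x e)].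

End domains.

Record C2_domain (R : realType) (d : nat) := MkC2Domain {
  domain_set : set 'rV[R]_d ;
  dom_nonempty : domain_set !=set0 ;
  dom_open : open domain_set ;
  dom_connected : connected domain_set ;
  dom_bounded : bounded_set domain_set ;
  dom_C2 : C2_boundary domain_set }.

Section sampling.
Context {R : realType} {d : nat} (Omega : C2_domain R d).

Definition nu : {measure set 'rV[R]_d -> \bar R} :=
  mrestr (lebesgue_rV R d) (open_measurable_rV (@dom_open _ _ Omega)).

Definition vol : R := fine (nu (domain_set Omega)).

Definition unif (A : set 'rV[R]_d) : \bar R := ((vol^-1)%:E * nu A)%E.

Definition cloud (x : nat -> 'rV[R]_d) (m : nat) : set 'rV[R]_d := x @` `I_m.

Definition empirical (x : nat -> 'rV[R]_d) (m : nat) (A : set 'rV[R]_d) : \bar R :=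
  ((m%:R^-1)%:E * \sum_(i < m) \d_(x i) A)%E.

Definition rate (d n : nat) : R :=
  if d == 1%N then Num.sqrt (ln (ln n%:R) / n%:R)
  else if d == 2%N then (ln n%:R) `^ (3 / 4) / Num.sqrt n%:R
  else (ln n%:R) `^ (d%:R^-1) / n%:R `^ (d%:R^-1).

(* Here and below sequences are indexed from 0: the term of rank [n] carries the
   mathematical index n + 1, whence [rate n.+1].  [x] is the sequence of points
   and [m] the sequence of the cardinals |Omega_n|. *)
Definition transport_maps (m : nat -> nat) (x : nat -> 'rV[R]_d)
    (T : nat -> 'rV[R]_d -> 'rV[R]_d) : Prop :=
  [/\ (forall n, measurable_fun (domain_set Omega) (T n)),
      (forall n y, domain_set Omega y -> domain_set Omega (T n y) /\ cloud x (m n) (T n y)),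
      (forall n y, cloud x (m n) y -> T n y = y),
      (forall n A, measurable A ->
         pushforward unif (T n) A = empirical x (m n) A) &
      exists c C : R,
        let ratio n :=
          (ess_sup nu (fun y => (enorm (T n y - y))%:E) * ((rate d n.+1)^-1)%:E)%E in
        [/\ 0 <= c, c <= C, (c%:E <= limn_einf ratio)%E &
            (limn_esup ratio <= C%:E)%E]].

End sampling.

Section iid.
Context {R : realType} {dW : measure_display} {W : measurableType dW}
  (P : probability W R) {dT : measure_display} {T : measurableType dT}.

Definition mutually_independent (X : nat -> {RV P >-> T}) :=
  forall (J : seq nat) (A : nat -> set T), uniq J ->
    (forall j, measurable (A j)) ->
    P (\bigcap_(j in [set` J]) X j @^-1` A j) =
    (\big[*%E/1%E]_(j <- J) P (X j @^-1` A j)).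

Definition iid_with_law (X : nat -> {RV P >-> T}) (law : set T -> \bar R) :=
  mutually_independent X /\
  forall i A, measurable A -> distribution P (X i) A = law A.

End iid.

Section graph_energy.
Context {R : realType} {d : nat}.

Definition interaction_kernel (eta : R -> R) (r : R) :=
  [/\ {within [set t | 0 <= t], continuous eta},
      (forall t, 0 <= t -> 0 <= eta t),
      (forall t t', 0 <= t -> t <= t' -> eta t' <= eta t),
      closure [set t | 0 <= t /\ eta t != 0] `<=` [set t | 0 <= t <= r] &
      0 < r].

Definition eta_scaled (eta : R -> R) (s t : R) : R := s ^- d * eta (t / s).

Definition sigma_eta (eta : R -> R) (r p : R) : R :=
  (\int[lebesgue_rV R d]_(z in eball 0 r)
     (eta (enorm z) * `|dotp z e1| `^ p)) `^ p^-1.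

Context (eta : R -> R) (p : R) (g : 'rV[R]_d -> R) (N : nat)
  (a : 'I_N -> 'rV[R]_d).

(* [s] is the length scale, [x] the sequence of points and [m] the cardinal of
   Omega_n; the first [m] points are almost surely distinct, so that sums and
   maxima over Omega_n are sums and maxima over ['I_m].  A function Omega_n -> R
   is given by a function on R^d, whose values off Omega_n play no role. *)
Definition graph_energy (s : R) (m : nat) (x : nat -> 'rV[R]_d)
    (w : 'rV[R]_d -> R) : \bar R :=
  if `[< forall j, w (a j) = g (a j) >] then
    (s^-1 * \big[Num.max/0]_(i < m)
      (m%:R^-1 * \sum_(j < m) eta_scaled eta s (enorm (x i - x j)) *
                              `|w (x i) - w (x j)| `^ p) `^ p^-1)%:E
  else +oo%E.

(* [w] is unique on Omega_n, as each point of Omega_n has positive mass under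
   the image of [nu] by [T]. *)
Definition graph_energy_cons (Omega : C2_domain R d) (s : R) (m : nat)
    (x : nat -> 'rV[R]_d) (T : 'rV[R]_d -> 'rV[R]_d)
    (u : Linfty (nu Omega)) : \bar R :=
  match pselect (exists w : 'rV[R]_d -> R,
                   {ae nu Omega, forall y, u y = w (T y)}) with
  | left h => graph_energy s m x (projT1 (cid h))
  | right _ => +oo%E
  end.

End graph_energy.

Arguments sigma_eta {R} d eta r p.
Arguments graph_energy_cons {R d} eta p g {N} a Omega s m x T u.

Section continuum_energy.
Context {R : realType} {d : nat} (Omega : C2_domain R d).

Definition test_function (phi : 'rV[R]_d -> R) :=
  smooth phi /\ exists K : set 'rV[R]_d,
    [/\ compact K, K `<=` domain_set Omega & forall y, ~ K y -> phi y = 0].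

Definition weak_gradient (u : Linfty (nu Omega)) (v : 'I_d -> Linfty (nu Omega)) :=
  forall i phi, test_function phi ->
    \int[nu Omega]_y ((u y : R) * 'D_(delta_mx 0 i) phi y) =
    - \int[nu Omega]_y ((v i y : R) * phi y).

Definition W1infty (u : Linfty (nu Omega)) := exists v, weak_gradient u v.

Definition energy (u : Linfty (nu Omega)) : \bar R :=
  match pselect (W1infty u) with
  | left h => ess_sup (nu Omega)
                (fun y => (enorm (\row_i (projT1 (cid h) i y : R)))%:E)
  | right _ => +oo%E
  end.

(* Point values of an element of W^{1,oo} are those of its continuous
   representative, which is unique since Omega is open. *)
Definition energy_cons (g : 'rV[R]_d -> R) (N : nat) (a : 'I_N -> 'rV[R]_d)
    (u : Linfty (nu Omega)) : \bar R :=
  if `[< exists w : 'rV[R]_d -> R,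
         [/\ {within domain_set Omega, continuous w}, {ae nu Omega, forall y, u y = w y} &
             forall j, w (a j) = g (a j)] >]
  then energy u else +oo%E.

End continuum_energy.

Arguments energy_cons {R d} Omega g {N} a u.

(* Main.v *)
Require Import Defs.
From HB Require Import structures.
From mathcomp Require Import all_boot all_order all_algebra.
From mathcomp Require Import all_classical all_reals all_analysis.
From mathcomp Require Import measurable_realfun ess_sup_inf.
From mathcomp Require Import ring lra.

Set Implicit Arguments.
Unset Strict Implicit.
Unset Printing Implicit Defensive.

Import Order.TTheory GRing.Theory Num.Def Num.Theory.
Import numFieldNormedType.Exports.

Local Open Scope classical_set_scope.
Local Open Scope ring_scope.

(* The continuum problem is the minimal Lipschitz extension problem for the inner
   metric of Omega: E(u) <= L says that the continuous representative of u is
   L-Lipschitz on every ball inside Omega, and the least L compatible with the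
   labels is the largest difference quotient of g for the distance d_Omega(x, y)
   = sup of f y - f x over locally 1-Lipschitz f.

   Composing with T_n turns the sums over the cloud into Lebesgue integrals, so
   that E_n(u) <= K bounds, for almost every y,
     int eta_s(|T_n y - T_n z|) |u y - u z|^p dz   by   nu(Omega) (K s)^p.
   - Equicontinuity: two points at distance at most c s share a ball of common
     neighbours, hence |u y - u y'| <= C K s, and chaining along segments (pushed
     inside Omega near the boundary) gives |u y - u y'| <= C K (|y - y'| + s).
     Bounded sequences of bounded energy are therefore precompact.
   - Lower bound: if V is the gradient of u mollified, then Young's
     inequality and Tonelli's theorem give |V| sigma^p <= L sigma^p + C s with
     L = K nu(Omega)^(1/p) / sigma; in the limit E(u) <= L.
   - Upper bound: an optimal extension is approximated, with the same labels, by
     functions U with a uniform second order Taylor bound and |DU| <= L + e; the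
     integral at each point of the cloud is then estimated directly, and it does
     not depend on the direction of DU by rotation invariance.
   All this holds for every sample for which the transportation maps exist. *)

(** * Euclidean and Lebesgue preliminaries *)

(** Two obstacles shape the proof. First, Omega is not convex, so a local slope L does not bound
    difference quotients between distant points. Local information becomes global by pushing
    segments inwards: at small scale a C^1 boundary function exceeds its chords by at most eps |y -
    x|, so the detour multiplies lengths by 1 + 2 eps only. Thus the extension from which the
    recovery functions are built keeps a slope close to L up to the boundary. Second, [energy] and
    [graph_energy_cons] select a weak gradient, or a function on the cloud, by choice. Uniqueness of
    weak gradients and positivity of the mass of each fibre of T_n make the values independent of
    the selection.

    The lower bound loses nothing in the limit: Young's inequality, with weight L s, is an equality
    for increments of an affine function of slope L, and the displacement of T_n enters only through
    the kernel moment at 2 delta / s, which tends to the moment at 0. *)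

Section euclidean_norm.
Context {R : realType} {d : nat}.
Implicit Types x y z : 'rV[R]_d.

Lemma dotpC x y : dotp x y = dotp y x.
Proof. by apply: eq_bigr => i _; rewrite mulrC. Qed.

Lemma dotpDl x y z : dotp (x + y) z = dotp x z + dotp y z.
Proof. by rewrite -big_split; apply: eq_bigr => i _; rewrite mxE mulrDl. Qed.

Lemma dotpZl k x y : dotp (k *: x) y = k * dotp x y.
Proof. by rewrite mulr_sumr; apply: eq_bigr => i _; rewrite mxE mulrA. Qed.

Lemma dotpNl x y : dotp (- x) y = - dotp x y.
Proof. by rewrite -scaleN1r dotpZl mulN1r. Qed.

Lemma dotpBl x y z : dotp (x - y) z = dotp x z - dotp y z.
Proof. by rewrite dotpDl dotpNl. Qed.

Lemma dotpDr x y z : dotp x (y + z) = dotp x y + dotp x z.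
Proof. by rewrite dotpC dotpDl !(dotpC x). Qed.

Lemma dotpZr k x y : dotp x (k *: y) = k * dotp x y.
Proof. by rewrite dotpC dotpZl dotpC. Qed.

Lemma dotpNr x y : dotp x (- y) = - dotp x y.
Proof. by rewrite dotpC dotpNl dotpC. Qed.

Lemma dotpBr x y z : dotp x (y - z) = dotp x y - dotp x z.
Proof. by rewrite dotpDr dotpNr. Qed.

Lemma dotp0l y : dotp 0 y = 0.
Proof. by rewrite -(scale0r y) dotpZl mul0r. Qed.

Lemma dotpp_ge0 x : 0 <= dotp x x.
Proof. by apply: sumr_ge0 => i _; rewrite -expr2 sqr_ge0. Qed.

Lemma enorm_ge0 x : 0 <= enorm x.
Proof. exact: sqrtr_ge0. Qed.

Lemma sqr_enorm x : enorm x ^+ 2 = dotp x x.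
Proof. by rewrite sqr_sqrtr ?dotpp_ge0. Qed.

Lemma enormZ k x : enorm (k *: x) = `|k| * enorm x.
Proof.
by rewrite /enorm dotpZl dotpZr mulrA -expr2 sqrtrM ?sqr_ge0// sqrtr_sqr.
Qed.

Lemma enorm0 : enorm (0 : 'rV[R]_d) = 0.
Proof. by rewrite -(scale0r 0) enormZ normr0 mul0r. Qed.

Lemma enormN x : enorm (- x) = enorm x.
Proof. by rewrite -scaleN1r enormZ normrN1 mul1r. Qed.

Lemma enormB x y : enorm (x - y) = enorm (y - x).
Proof. by rewrite -enormN opprB. Qed.

Lemma coord_le_enorm x i : `|x ord0 i| <= enorm x.
Proof.
rewrite -sqrtr_sqr ler_sqrt; last exact: dotpp_ge0.
rewrite /dotp (bigD1 i)//= -expr2 lerDl; apply: sumr_ge0 => j _.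
by rewrite -expr2 sqr_ge0.
Qed.

Lemma enorm_eq0 x : (enorm x == 0) = (x == 0).
Proof.
apply/eqP/eqP => [x0|->]; last exact: enorm0.
apply/rowP => i; rewrite mxE; apply/eqP; rewrite -normr_le0 -x0.
exact: coord_le_enorm.
Qed.

Lemma enorm_gt0 x : (0 < enorm x) = (x != 0).
Proof. by rewrite lt_neqAle enorm_ge0 andbT eq_sym enorm_eq0. Qed.

(** Cauchy-Schwarz: the square norm of [enorm y *: x - enorm x *: y] is twice [enorm x * enorm y]
    times the gap. *)
Lemma dotp_le_enorm x y : dotp x y <= enorm x * enorm y.
Proof.
have [->|x0] := eqVneq x 0; first by rewrite dotp0l enorm0 mul0r.
have [->|y0] := eqVneq y 0; first by rewrite dotpC dotp0l enorm0 mulr0.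
have xn : 0 < enorm x by rewrite enorm_gt0.
have yn : 0 < enorm y by rewrite enorm_gt0.
have := dotpp_ge0 (enorm y *: x - enorm x *: y).
rewrite dotpBl !dotpBr !dotpZl !dotpZr (dotpC y x) -!sqr_enorm.
rewrite (_ : _ - _ = 2 * (enorm x * enorm y) * (enorm x * enorm y - dotp x y));
  last by ring.
by rewrite pmulr_rge0 ?subr_ge0// mulr_gt0// mulr_gt0.
Qed.

Lemma normr_dotp_le x y : `|dotp x y| <= enorm x * enorm y.
Proof.
rewrite ler_norml dotp_le_enorm andbT lerNl -dotpNl -(enormN x).
exact: dotp_le_enorm.
Qed.

Lemma enormD x y : enorm (x + y) <= enorm x + enorm y.
Proof.
rewrite -(@ler_sqr R) ?nnegrE ?addr_ge0 ?enorm_ge0//.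
rewrite sqrrD !sqr_enorm dotpDl !dotpDr (dotpC y x).
by have := dotp_le_enorm x y; lra.
Qed.

Lemma enorm_triangle z x y : enorm (x - y) <= enorm (x - z) + enorm (z - y).
Proof. by rewrite (le_trans _ (enormD _ _))// addrA subrK. Qed.

Lemma enormB_ge x y : enorm x - enorm y <= enorm (x - y).
Proof. by rewrite lerBlDr (le_trans _ (enormD _ _))// subrK. Qed.

Lemma enormB_norm x y : `|enorm x - enorm y| <= enorm (x - y).
Proof. by rewrite ler_norml lerNl opprB enormB_ge andbT enormB enormB_ge. Qed.

Lemma enorm_le_sum x : enorm x <= \sum_i `|x ord0 i|.
Proof.
rewrite -(@ler_sqr R) ?nnegrE ?enorm_ge0 ?sumr_ge0// sqr_enorm expr2.
rewrite mulr_sumr; apply: ler_sum => i _; rewrite -expr2 -real_normK ?num_real//.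
rewrite expr2 ler_wpM2r// (bigD1 i)//= lerDl sumr_ge0//.
Qed.

Lemma enorm_le_box x r : (forall i, `|x ord0 i| <= r) -> enorm x <= d%:R * r.
Proof.
move=> xr; rewrite (le_trans (enorm_le_sum x))//.
rewrite (le_trans (ler_sum _ (fun i _ => xr i)))//.
by rewrite sumr_const card_ord mulr_natl.
Qed.

Lemma enorm_le_norm x : enorm x <= d%:R * `|x|.
Proof.
apply: enorm_le_box => i; rewrite [leRHS]mx_normrE.
by rewrite (le_bigmax _ (fun i => `|x i.1 i.2|) (ord0, i)).
Qed.

Lemma norm_le_enorm x : `|x| <= enorm x.
Proof.
rewrite [leLHS]mx_normrE; apply/bigmax_leP; split=> [|[i j] _ /=].
  exact: enorm_ge0.
by rewrite ord1 coord_le_enorm.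
Qed.

Lemma continuous_enormP (f : 'rV[R]_d -> R) :
  continuous f <-> forall x e, 0 < e -> exists2 r, 0 < r &
    forall y, enorm (y - x) < r -> `|f y - f x| < e.
Proof.
split=> [cf x e e0|cf x s /(nbhs_ballP (f x)) [e /= e0 es]].
  have := cf x (ball (f x) e) (nbhsx_ballx (f x) e e0).
  rewrite nbhs_simpl/= => /nbhs_ballP[r /= r0 rf].
  exists r => // y yr; rewrite distrC; apply: rf.
  rewrite -ball_normE /ball_/=.
  by rewrite (le_lt_trans (norm_le_enorm _))// enormB.
have [r r0 rf] := cf x e e0.
(* Library balls are those of the sup norm, at most [d] times smaller than the Euclidean one;
   [d + 1] is nonzero even for d = 0. *)
apply/nbhs_ballP; exists (r / (d%:R + 1)); first by rewrite /= divr_gt0// ltr_wpDl.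
move=> y; rewrite -ball_normE /ball_/= ltr_pdivlMr ?ltr_wpDl// => xy.
apply: es; rewrite /ball/= distrC rf// enormB (le_lt_trans (enorm_le_norm _))//.
by rewrite (le_lt_trans _ xy)// mulrC ler_wpM2l// lerDl.
Qed.

Lemma continuous_enorm : continuous (@enorm R d).
Proof.
apply/continuous_enormP => x e e0; exists e => // y yx.
exact: le_lt_trans (enormB_norm _ _) yx.
Qed.

Lemma continuous_dotpl y : continuous (fun x => dotp x y).
Proof.
apply/continuous_enormP => x e e0.
have y0 : 0 < enorm y + 1 by rewrite ltr_wpDl ?enorm_ge0.
exists (e / (enorm y + 1)) => [|z]; first by rewrite divr_gt0.
rewrite ltr_pdivlMr// => xz.
rewrite -dotpBl (le_lt_trans (normr_dotp_le _ _))// (le_lt_trans _ xz)//.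
by rewrite ler_wpM2l ?enorm_ge0// lerDl.
Qed.

Lemma nbhs_enormP x (A : set 'rV[R]_d) :
  nbhs x A <-> exists2 r, 0 < r & eball x r `<=` A.
Proof.
split=> [/nbhs_ballP[r /= r0 rA]|[r r0 rA]].
  exists r => // y yr; apply: rA; rewrite -ball_normE /ball_/=.
  by rewrite (le_lt_trans (norm_le_enorm _))// enormB.
apply/nbhs_ballP; exists (r / (d%:R + 1)); first by rewrite /= divr_gt0// ltr_wpDl.
move=> y; rewrite -ball_normE /ball_/= ltr_pdivlMr ?ltr_wpDl// => xy.
apply: rA; rewrite /eball/= enormB (le_lt_trans (enorm_le_norm _))//.
by rewrite (le_lt_trans _ xy)// mulrC ler_wpM2l// lerDl.
Qed.

Lemma open_eballP (A : set 'rV[R]_d) x : open A -> A x ->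
  exists2 r, 0 < r & eball x r `<=` A.
Proof. by move=> oA Ax; apply/nbhs_enormP; exact: open_nbhs_nbhs. Qed.

Lemma eball_center x r : 0 < r -> eball x r x.
Proof. by rewrite /eball /= subrr enorm0. Qed.

Lemma eball_subset x y r : eball x r y -> eball y (r - enorm (y - x)) `<=` eball x r.
Proof.
move=> xy z /=; rewrite /eball/= ltrBrDr => yz.
by rewrite (le_lt_trans (enorm_triangle y _ _)).
Qed.

Lemma open_eball x r : open (eball x r).
Proof.
rewrite openE => y xy; apply/nbhs_enormP; exists (r - enorm (y - x)).
  by rewrite subr_gt0.
exact: eball_subset.
Qed.

Lemma nbhs_eball x r : 0 < r -> nbhs x (eball x r).
Proof. by move=> r0; apply/nbhs_enormP; exists r. Qed.

End euclidean_norm.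

Definition pushforward_measure {d1 d2 : measure_display} {T1 : measurableType d1}
    {T2 : measurableType d2} {R : realType} (m : {measure set T1 -> \bar R})
    (f : T1 -> T2) (mf : measurable_fun setT f) : {measure set T2 -> \bar R} :=
  measure_function_pushforward__canonical__measure_function_Measure m mf.

(** * Lebesgue measure: determination by boxes, translations *)

Section lebesgue_rV_theory.
Context {R : realType}.
Local Notation lam d := (lebesgue_rV R d).

Lemma continuous_measurable_fun d (f : 'rV[R]_d -> R) :
  continuous f -> measurable_fun setT f.
Proof.
move=> cf; apply: (measurability _ (RGenOpens.measurableE R)).
move=> _ [_ [a [b ->]] <-]; rewrite setTI; apply: open_measurable_rV.
by apply: open_comp; [move=> v _; exact: cf|exact: interval_open].
Qed.

Lemma measurable_enorm d : measurable_fun setT (@enorm R d).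
Proof. by apply: continuous_measurable_fun; exact: continuous_enorm. Qed.

Lemma measurable_eball d (x : 'rV[R]_d) r : measurable (eball x r).
Proof. by apply: open_measurable_rV; exact: open_eball. Qed.

Lemma measurable_addl d (t : 'rV[R]_d) : measurable_fun setT (fun x => t + x).
Proof.
apply: measurable_fun_rV => i.
under eq_fun do rewrite mxE.
by apply: measurable_funD => //; exact: measurable_coord.
Qed.

Lemma measurable_scale d (k : R) :
  measurable_fun setT (fun x : 'rV[R]_d => k *: x).
Proof.
apply: measurable_fun_rV => i.
under eq_fun do rewrite mxE.
by apply: measurable_funM => //; exact: measurable_coord.
Qed.

Lemma measurable_opp_rV d : measurable_fun setT (fun x : 'rV[R]_d => - x).
Proof. by under eq_fun do rewrite -scaleN1r; exact: measurable_scale. Qed.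

Lemma measurable_funD_rV d d' (T : measurableType d') (f g : T -> 'rV[R]_d) :
  measurable_fun setT f -> measurable_fun setT g ->
  measurable_fun setT (fun x => f x + g x).
Proof.
move=> mf mg; apply: measurable_fun_rV => i.
under eq_fun do rewrite !mxE.
apply: measurable_funD.
  exact: measurableT_comp (measurable_coord i) mf.
exact: measurableT_comp (measurable_coord i) mg.
Qed.

Lemma measurable_funB_rV d d' (T : measurableType d') (f g : T -> 'rV[R]_d) :
  measurable_fun setT f -> measurable_fun setT g ->
  measurable_fun setT (fun x => f x - g x).
Proof.
move=> mf mg; apply: measurable_funD_rV => //.
exact: measurableT_comp (@measurable_opp_rV d) mg.
Qed.

Let boxes d : set (set 'rV[R]_d) := [set A | exists a b, A = open_box a b].

(** Open sets are countable unions of rational boxes; [unpickle] reindexes the union by the natural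
    numbers, as closure of a sigma-algebra is stated for sequences. *)
Lemma boxes_generate d : @measurable _ 'rV[R]_d = <<s @boxes d >>.
Proof.
apply/seteqP; split=> [A mA|A mA].
  have {}mA : <<s @open 'rV[R]_d >> A by [].
  move: A mA; apply: smallest_sub; first exact: smallest_sigma_algebra.
  move=> {}A oA; rewrite (open_rat_box oA) bigcup_mkcond.
  set F : {ffun 'I_d -> rat * rat} -> set 'rV[R]_d := fun q => if _ then _ else _.
  have -> : \bigcup_q F q =
      \bigcup_k (if unpickle k is Some q then F q else set0).
    apply/seteqP; split=> [x [q _ xq]|x [k _]].
      by exists (pickle q) => //; rewrite pickleK.
    by case: unpickle => // q xq; exists q.
  apply: sigma_algebra_bigcup => k.
  case: unpickle => [q|]; last exact: sigma_algebra0.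
  rewrite /F; case: ifPn => _; last exact: sigma_algebra0.
  apply: sub_sigma_algebra.
  exists (\row_i ratr (q i).1), (\row_i ratr (q i).2).
  by apply/seteqP; split=> x xq i; have := xq i; rewrite !mxE.
apply: smallest_sub mA; first exact: sigma_algebra_measurable.
by move=> _ [a [b ->]]; exact: measurable_box.
Qed.

Lemma boxes_setI d : setI_closed (@boxes d).
Proof.
move=> _ _ [a [b ->]] [a' [b' ->]].
exists (\row_i Num.max (a ord0 i) (a' ord0 i)), (\row_i Num.min (b ord0 i) (b' ord0 i)).
apply/seteqP; split=> [x [xa xb] i|x xab].
  by rewrite !mxE gt_max lt_min; have /andP[-> ->] := xa i; have /andP[-> ->] := xb i.
by split=> i; have := xab i; rewrite !mxE gt_max lt_min => /andP[/andP[h1 h2] /andP[h3 h4]]; apply/andP.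
Qed.

Lemma open_box0 d (a b : 'rV[R]_d) i : b ord0 i < a ord0 i -> open_box a b = set0.
Proof.
move=> ba; apply/seteqP; split=> // x /(_ i) /andP[ax xb].
by have := lt_trans ax (lt_trans xb ba); rewrite ltxx.
Qed.

(** Boxes form a pi-system generating the Borel sets, and cubes of finite measure exhaust the space.
    Invariance properties of the measure are thereby checked on boxes only. *)
Lemma box_measure_unique d (m1 m2 : {measure set 'rV[R]_d -> \bar R}) :
  (forall a b : 'rV[R]_d, (forall i, a ord0 i <= b ord0 i) ->
     m1 (open_box a b) = m2 (open_box a b)) ->
  (forall a b : 'rV[R]_d, (m1 (open_box a b) < +oo)%E) ->
  forall A, measurable A -> m1 A = m2 A.
Proof.
move=> m12 m1oo A mA.
apply: (measure_unique (@boxes d) (fun k : nat =>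
  open_box (const_mx (- k%:R)) (const_mx k%:R))) => //.
- exact: boxes_generate.
- exact: boxes_setI.
- by move=> k; eexists; eexists.
- apply/seteqP; split=> // x _.
  exists (Num.truncn (enorm x)).+1 => // i; rewrite !mxE -ltr_norml.
  by rewrite (le_lt_trans (coord_le_enorm _ _))// truncnS_gt.
- move=> _ [a [b ->]].
  have [ab|/existsNP[i /negP]] := pselect (forall i, a ord0 i <= b ord0 i).
    exact: m12.
  by rewrite -ltNge => /open_box0 ->; rewrite !measure0.
Qed.

Lemma lebesgue_rV_box_lty d (a b : 'rV[R]_d) : (lam d (open_box a b) < +oo)%E.
Proof.
have [ab|/existsNP[i /negP]] := pselect (forall i, a ord0 i <= b ord0 i).
  by rewrite lebesgue_rV_box// ltry.
by rewrite -ltNge => /open_box0 ->; rewrite measure0.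
Qed.

Lemma open_box_center d (x : 'rV[R]_d) r :
  open_box (x - const_mx r) (x + const_mx r) =
  [set y | forall i, `|(y - x) ord0 i| < r].
Proof.
apply/seteqP; split=> y yx i; have := yx i; rewrite !mxE.
  by move=> /andP[h1 h2]; rewrite ltr_norml; apply/andP; split; lra.
by rewrite ltr_norml => /andP[h1 h2]; apply/andP; split; lra.
Qed.

Lemma lebesgue_rV_bounded_lty d (A : set 'rV[R]_d) r : measurable A ->
  (forall x, A x -> enorm x <= r) -> (lam d A < +oo)%E.
Proof.
move=> mA Ar; apply: le_lt_trans (lebesgue_rV_box_lty (0 - const_mx (r + 1)) (0 + const_mx (r + 1))).
apply: le_measure; rewrite ?inE//; first exact: measurable_box.
move=> x /Ar xr; rewrite open_box_center => i; rewrite subr0.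
by rewrite (le_lt_trans (coord_le_enorm _ _))// (le_lt_trans xr)// ltrDl.
Qed.

Lemma lebesgue_rV_eball_lty d x r : (lam d (eball x r) < +oo)%E.
Proof.
apply: (@lebesgue_rV_bounded_lty _ _ (r + enorm x)); first exact: measurable_eball.
move=> y; rewrite /eball/= => yx.
by rewrite -(subrK x y) (le_trans (enormD _ _))// lerD2r ltW.
Qed.

Lemma lebesgue_rV_open_gt0 d (A : set 'rV[R]_d) x : open A -> A x -> (0 < lam d A)%E.
Proof.
move=> oA Ax; have [r r0 rA] := open_eballP oA Ax.
pose r' := r / (d%:R + 1).
have r'0 : 0 < r' by rewrite divr_gt0// ltr_wpDl.
apply: (@lt_le_trans _ _ (lam d (open_box (x - const_mx r') (x + const_mx r')))).
  rewrite lebesgue_rV_box => [|i]; last first.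
    by rewrite !mxE lerD2l (le_trans _ (ltW r'0))// oppr_le0 ltW.
  rewrite lte_fin; apply: prodr_gt0 => i _; rewrite !mxE; lra.
apply: le_measure; rewrite ?inE//; [exact: measurable_box|exact: open_measurable_rV|].
rewrite open_box_center => y yr; apply: rA; rewrite /eball/=.
apply: (@le_lt_trans _ _ (d%:R * r')).
  by apply: enorm_le_box => i; exact/ltW/yr.
by rewrite /r' mulrA ltr_pdivrMr ?ltr_wpDl// mulrC ltr_pM2l// ltrDl.
Qed.

Lemma measurable_preimT d1 d2 (T1 : measurableType d1) (T2 : measurableType d2)
  (f : T1 -> T2) A : measurable_fun setT f -> measurable A -> measurable (f @^-1` A).
Proof. by move=> mf mA; rewrite -[X in measurable X]setTI; exact: mf. Qed.

Lemma lebesgue_rV_translate d (t : 'rV[R]_d) A : measurable A ->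
  lam d ((fun x => t + x) @^-1` A) = lam d A.
Proof.
move=> mA; have mt := measurable_addl t.
have E a b : (fun x : 'rV_d => t + x) @^-1` open_box a b = open_box (a - t) (b - t).
  apply/seteqP; split=> x xab i; have := xab i;
    by rewrite !mxE ltrBlDl ltrBrDl.
transitivity (pushforward (lam d) (fun x => t + x) A) => //.
pose m1 := pushforward_measure (lam d) mt.
apply: (@box_measure_unique _ m1 (lam d)) => //.
  move=> a b ab; rewrite /m1/= /pushforward E !lebesgue_rV_box//; last first.
    by move=> i; rewrite !mxE lerD2r.
  by congr EFin; apply: eq_bigr => i _; rewrite !mxE; ring.
by move=> a b; rewrite /m1/= /pushforward E lebesgue_rV_box_lty.
Qed.

End lebesgue_rV_theory.

(** * Invariance under isometries and behaviour under scaling *)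

Section lebesgue_rV_invariance.
Context {R : realType} {d : nat}.
Local Notation lam := (lebesgue_rV R d).

Lemma indic_integral_section (E : set ('rV[R]_d * 'rV[R]_d)) : measurable E ->
  (\int[lam]_x lam (xsection E x) = \int[lam]_y lam (ysection E y))%E.
Proof.
move=> mE; have := indic_fubini_tonelli lam lam mE.
by rewrite indic_fubini_tonelli_FE// indic_fubini_tonelli_GE.
Qed.

(* Tonelli applied to the sets of pairs (x, y) such that S x lies in the unit
   ball U and S x + y in B: since lam is translation invariant, one order of
   integration gives lam U * lam B and the other one lam U * lam (S^-1 B). *)
Lemma lebesgue_rV_isometry (S : 'rV[R]_d -> 'rV[R]_d) (B : set 'rV[R]_d) :
  measurable_fun setT S -> {morph S : x y / x + y} -> involutive S ->
  (forall x, enorm (S x) = enorm x) ->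
  measurable B -> lam (S @^-1` B) = lam B.
Proof.
move=> mS SD SS Sn mB; pose U := eball (0 : 'rV[R]_d) 1.
have mU : measurable U by exact: measurable_eball.
have UE x : U x = (enorm x < 1) :> Prop by rewrite /U /eball/= subr0.
have mS1 : measurable_fun setT (fun xy : 'rV[R]_d * 'rV[R]_d => S xy.1).
  exact: measurableT_comp mS (@measurable_fst _ _ _ _).
have mSD : measurable_fun setT (fun xy : 'rV[R]_d * 'rV[R]_d => S xy.1 + xy.2).
  by apply: measurable_funD_rV => //; exact: measurable_snd.
have mSB : measurable_fun setT (fun xy : 'rV[R]_d * 'rV[R]_d => S xy.1 - xy.2).
  by apply: measurable_funB_rV => //; exact: measurable_snd.
pose E1 : set ('rV[R]_d * 'rV[R]_d) := [set xy | U (S xy.1) /\ B (S xy.1 + xy.2)].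
pose E2 : set ('rV[R]_d * 'rV[R]_d) := [set xy | U (S xy.1 - xy.2) /\ B (S xy.1)].
have mE1 : measurable E1.
  by apply: measurableI; [exact: measurable_preimT mS1 mU|exact: measurable_preimT mSD mB].
have mE2 : measurable E2.
  by apply: measurableI; [exact: measurable_preimT mSB mU|exact: measurable_preimT mS1 mB].
have mSpB : measurable (S @^-1` B) by exact: measurable_preimT.
have I1 : (\int[lam]_x lam (xsection E1 x) = lam B * lam U)%E.
  rewrite -integral_cst// integral_mkcond; apply: eq_integral => x _.
  rewrite patchE; case: ifPn => [|/negP]; rewrite in_setE => Ux.
    rewrite -(lebesgue_rV_translate (S x) mB) /=; congr (lam _).
    apply/seteqP; split => y /=; rewrite /xsection/= in_setE /E1/=; first by case.
    by split=> //; rewrite UE Sn -UE.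
  rewrite (_ : xsection _ _ = set0) ?measure0//; apply/seteqP; split => y //=.
  by rewrite /xsection/= in_setE /E1/= UE Sn -UE => -[].
have I2 : (\int[lam]_x lam (xsection E2 x) = lam U * lam (S @^-1` B))%E.
  rewrite -integral_cst// [RHS]integral_mkcond; apply: eq_integral => x _.
  rewrite patchE; case: ifPn => [|/negP]; rewrite in_setE/= => Bx.
    rewrite -(lebesgue_rV_translate (- S x) mU) /=; congr (lam _).
    have UN y : U (S x - y) = U (- S x + y) by rewrite !UE -enormN opprB addrC.
    by apply/seteqP; split => y /=; rewrite /xsection/= in_setE /E2/= UN; [case|].
  rewrite (_ : xsection _ _ = set0) ?measure0//; apply/seteqP; split => y //=.
  by rewrite /xsection/= in_setE /E2/= => -[].
have I12 : (\int[lam]_y lam (ysection E1 y) = \int[lam]_y lam (ysection E2 y))%E.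
  apply: eq_integral => y _.
  rewrite -(lebesgue_rV_translate (S y) (measurable_ysection y mE2)).
  congr (lam _); apply/seteqP; split => x /=; rewrite /ysection/= !in_setE /E1 /E2/=;
    by rewrite SD SS (addrC y) addrK.
have lU : (lam U < +oo)%E by exact: lebesgue_rV_eball_lty.
have lU0 : (0 < lam U)%E.
  by apply: (@lebesgue_rV_open_gt0 _ _ U 0); [exact: open_eball|exact: eball_center].
move: I12; rewrite -!indic_integral_section// I1 I2 muleC => I12.
have cancel x y : (lam U * x = lam U * y -> x <= y)%E.
  by move=> xy; rewrite -(@lee_pmul2l _ (lam U)) ?ge0_fin_numE// xy.
by apply/eqP; rewrite eq_le !cancel.
Qed.

Lemma lebesgue_rV_scale (k : R) (B : set 'rV[R]_d) : 0 < k -> measurable B ->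
  lam ((fun x => k *: x) @^-1` B) = ((k ^- d)%:E * lam B)%E.
Proof.
move=> k0 mB; have mk := @measurable_scale R d k.
pose m1 := pushforward_measure lam mk.
have kd0 : 0 <= k ^- d by rewrite invr_ge0 exprn_ge0// ltW.
pose m2 := mscale (NngNum kd0) lam.
have E a b : (fun x : 'rV[R]_d => k *: x) @^-1` open_box a b = open_box (k^-1 *: a) (k^-1 *: b).
  apply/seteqP; split=> x xab i; have := xab i;
    by rewrite !mxE ltr_pdivrMl// ltr_pdivlMl.
apply: (@box_measure_unique _ _ m1 m2) => //.
- move=> a b ab; rewrite /m1/= /pushforward E /mscale/=.
  rewrite !lebesgue_rV_box//; last by move=> i; rewrite !mxE ler_pM2l ?invr_gt0.
  rewrite -EFinM; congr EFin; rewrite -exprVn.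
  under eq_bigr do rewrite !mxE -mulrBr.
  by rewrite big_split/= prodr_const card_ord.
- by move=> a b; rewrite /m1/= /pushforward E lebesgue_rV_box_lty.
Qed.

Lemma integral_measure_preserving (S : 'rV[R]_d -> 'rV[R]_d) (f : 'rV[R]_d -> \bar R) :
  measurable_fun setT S -> (forall B, measurable B -> lam (S @^-1` B) = lam B) ->
  measurable_fun setT f -> (forall x, 0 <= f x)%E ->
  (\int[lam]_x f (S x) = \int[lam]_x f x)%E.
Proof.
move=> mS lS mf f0.
have -> : (\int[lam]_x f x = \int[pushforward_measure lam mS]_x f x)%E.
  by apply: eq_measure_integral => A mA _; rewrite /= /pushforward lS.
by rewrite ge0_integral_pushforward// preimage_setT.
Qed.

Lemma integral_translate (t : 'rV[R]_d) (f : 'rV[R]_d -> \bar R) :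
  measurable_fun setT f -> (forall x, 0 <= f x)%E ->
  (\int[lam]_x f (t + x)%R = \int[lam]_x f x)%E.
Proof.
by apply: (@integral_measure_preserving (+%R t)); [exact: measurable_addl|exact: lebesgue_rV_translate].
Qed.

Lemma integral_scale (k : R) (f : 'rV[R]_d -> \bar R) : 0 < k ->
  measurable_fun setT f -> (forall x, 0 <= f x)%E ->
  (\int[lam]_x f (k *: x) = (k ^- d)%:E * \int[lam]_x f x)%E.
Proof.
move=> k0 mf f0; have mk := @measurable_scale R d k.
have kd0 : 0 <= k ^- d by rewrite invr_ge0 exprn_ge0// ltW.
transitivity (\int[mscale (NngNum kd0) lam]_x f x)%E; last first.
  by rewrite ge0_integral_mscale.
have -> : (\int[mscale (NngNum kd0) lam]_x f x = \int[pushforward_measure lam mk]_x f x)%E.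
  by apply: eq_measure_integral => A mA _; rewrite /= /pushforward lebesgue_rV_scale.
by rewrite ge0_integral_pushforward// preimage_setT.
Qed.

Lemma enorm_e1 : (0 < d)%N -> enorm (e1 : 'rV[R]_d) = 1.
Proof.
case: d => // d' _; rewrite /enorm /dotp (bigD1 ord0)//= !mxE/= mulr1 big1 ?addr0 ?sqrtr1// => i.
by rewrite !mxE -val_eqE/= => /negPf ->; rewrite mulr0.
Qed.

Definition householder (n : 'rV[R]_d) x := x - (2 * dotp x n) *: n.

Lemma householder_isometry n : enorm n = 1 ->
  [/\ measurable_fun setT (householder n), {morph householder n : x y / (x + y : 'rV[R]_d)},
     involutive (householder n) & forall x, enorm (householder n x) = enorm (x : 'rV[R]_d)].
Proof.
move=> n1; have nn : dotp n n = 1 by rewrite -sqr_enorm n1 expr1n.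
split.
- apply: measurable_fun_rV => i.
  under eq_fun do rewrite !mxE.
  apply: measurable_funB; first exact: measurable_coord.
  apply: measurable_funM => //; apply: measurable_funM => //.
  by apply: continuous_measurable_fun; exact: continuous_dotpl.
- by move=> x y; rewrite /householder dotpDl mulrDr scalerDl opprD addrACA.
- move=> x; rewrite /householder dotpBl dotpZl nn mulr1 -addrA -opprD -scalerDl.
  by rewrite (_ : 2 * dotp x n + _ = 0) ?scale0r ?subr0//; ring.
- move=> x; rewrite /enorm; congr Num.sqrt.
  by rewrite /householder dotpBl !dotpBr !dotpZl !dotpZr (dotpC n) nn; ring.
Qed.

(** The reflection in the hyperplane orthogonal to [e - e'] exchanges the two unit vectors and
    preserves both lengths and the measure. *)
Lemma integral_unit_dotp (f : R -> R -> \bar R) (e e' : 'rV[R]_d) :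
  (forall a b, 0 <= f a b)%E -> enorm e = 1 -> enorm e' = 1 ->
  measurable_fun setT (fun x : 'rV[R]_d => f (enorm x) (dotp x e')) ->
  (\int[lam]_x f (enorm x) (dotp x e) = \int[lam]_x f (enorm x) (dotp x e'))%E.
Proof.
move=> f0 e_1 e'_1 mf; have [->//|ee] := eqVneq e e'.
pose n := (enorm (e - e'))^-1 *: (e - e').
have dn : 0 < enorm (e - e') by rewrite enorm_gt0 subr_eq0.
have n1 : enorm n = 1.
  by rewrite enormZ ger0_norm ?invr_ge0 ?enorm_ge0// mulVf// gt_eqF.
have [mS SD SS Sn] := householder_isometry n1.
have E x : dotp (householder n x) e' = dotp x e.
  rewrite /householder /n dotpBl dotpZl dotpZr dotpZl.
  set N := enorm _; set a := dotp x (e - e').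
  have N2 : N ^+ 2 = 2 - 2 * dotp e e'.
    rewrite sqr_enorm dotpBl !dotpBr (dotpC e') -!sqr_enorm e_1 e'_1; ring.
  have -> : dotp (e - e') e' = - (N ^+ 2 / 2).
    by rewrite N2 dotpBl -(sqr_enorm e') e'_1; field.
  rewrite (_ : 2 * _ * _ = - a); last by field; rewrite gt_eqF.
  by rewrite opprK /a dotpBr; ring.
rewrite -[RHS](integral_measure_preserving mS (fun B => lebesgue_rV_isometry mS SD SS Sn))//.
by apply: eq_integral => x _; rewrite E Sn.
Qed.

End lebesgue_rV_invariance.

(** Mean value theorem without an order on the ends. The intermediate point is only known to be at
    most as far from [t] as [s] is, which is enough for Taylor remainders. *)
Lemma MVT_total {R : realType} (f df : R -> R) :
  (forall x : R, is_derive x (1 : R) f (df x)) -> forall s t : R,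
  exists2 x, `|x - t| <= `|s - t| & f s - f t = df x * (s - t).
Proof.
move=> fdf s t.
have cf a b : {within `[a, b], continuous f}.
  apply: continuous_subspaceT => x.
  by apply/differentiable_continuous/derivable1_diffP; have [] := fdf x.
have [st|/ltW st] := leP t s.
  have [x + ->] := MVT_segment st (fun x _ => fdf x) (cf t s).
  rewrite in_itv/= => /andP[tx xs]; exists x => //.
  by rewrite !ger0_norm ?subr_ge0// lerD2r.
have [x + E] := MVT_segment st (fun x _ => fdf x) (cf s t).
rewrite in_itv/= => /andP[tx xs]; exists x; last by rewrite -opprB E -mulrN opprB.
by rewrite !ler0_norm ?subr_le0// lerN2 lerD2r.
Qed.

(** * Taylor bounds and mollification *)

Section flat_function.
Context {R : realType}.
Implicit Types (q : {poly R}) (t : R).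

(** The functions q(1/t) exp(-1/t), extended by 0, form a class stable under differentiation;
    letting [q] vary makes smoothness an induction on the order. *)
Definition flat q t : R := if 0 < t then q.[t^-1] * expR (- t^-1) else 0.

Lemma flat_le0 q t : t <= 0 -> flat q t = 0.
Proof. by rewrite /flat ltNge => ->. Qed.

Lemma flat_gt0 q t : 0 < t -> flat q t = q.[t^-1] * expR (- t^-1).
Proof. by rewrite /flat => ->. Qed.

Lemma expR_Nmul_expn_le (y : R) n : 0 <= y -> y ^+ n * expR (- y) <= n`!%:R.
Proof.
move=> y0; rewrite expRN ler_pdivrMr ?expR_gt0//.
case: n => [|n]; first by rewrite expr0 fact0 mul1r (le_trans _ (expR_ge1Dx y))// lerDl.
have := expR_ge1Dxn n y0; have f0 : 0 < n.+1`!%:R :> R by rewrite ltr0n fact_gt0.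
rewrite -(ler_pM2l f0); apply: le_trans.
by rewrite mulrDr mulr1 mulrCA divff ?gt_eqF// mulr1 lerDr ltW.
Qed.

Lemma flat_bounded q : exists2 C : R, 0 <= C & forall t, `|flat q t| <= C.
Proof.
exists (\sum_(i < size q) `|q`_i| * i`!%:R); first by apply: sumr_ge0 => i _; rewrite mulr_ge0.
move=> t; have [t0|t0] := ltP 0 t; last first.
  by rewrite flat_le0// normr0; apply: sumr_ge0 => i _; rewrite mulr_ge0.
rewrite flat_gt0// horner_coef mulr_suml (le_trans (ler_norm_sum _ _ _))//.
apply: ler_sum => i _; rewrite -mulrA normrM ler_wpM2l//.
rewrite ger0_norm ?mulr_ge0 ?expR_ge0 ?exprn_ge0 ?invr_ge0 ?(ltW t0)//.
by rewrite expR_Nmul_expn_le// invr_ge0 ltW.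
Qed.

(** With a factor t^2 in front of a bounded function, the difference quotient at 0 tends to 0. *)
Lemma flat_sqr q t : flat q t = t ^+ 2 * flat ('X^2 * q) t.
Proof.
have [t0|t0] := ltP 0 t; last by rewrite !flat_le0// mulr0.
by rewrite !flat_gt0// hornerM hornerXn; field; rewrite gt_eqF.
Qed.

Definition flat_deriv q : {poly R} := 'X^2 * (q - q^`()).

Lemma is_derive_flat q t : is_derive t 1 (flat q) (flat (flat_deriv q) t).
Proof.
have [t0|t0|->] := ltgtP t 0.
- rewrite flat_le0 ?(ltW t0)//.
  apply: (@near_eq_is_derive _ _ _ (cst 0)) => //.
  near=> s; rewrite flat_le0//; near: s.
  by apply: filterS (lt_nbhsl t0) => s /ltW.
- rewrite flat_gt0//.
  apply: (@near_eq_is_derive _ _ _ (fun t => q.[t^-1] * expR (- t^-1))) => //.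
    by near=> s; rewrite flat_gt0//; near: s; exact: lt_nbhsr.
  have tn0 : t != 0 by rewrite gt_eqF.
  have dV : is_derive t 1 (fun t : R => t^-1) (- t ^- 2).
    by rewrite -[- _](mulr1); exact: (@is_deriveV _ id t 1 1 tn0).
  have dq := is_derive1_comp (is_derive_poly q t^-1) dV.
  have dN : is_derive t 1 (fun t : R => - t^-1) (- - t ^- 2) by exact: is_deriveN.
  have dE := @is_derive1_comp _ expR (fun t => - t^-1) t _ _ (is_derive_expR (- t^-1)) dN.
  apply: (is_derive_eq (is_deriveM dq dE)).
  rewrite /flat_deriv hornerM hornerXn hornerD hornerN /GRing.scale/=.
  by field.
- rewrite flat_le0//; apply/is_derive1_caratheodory.
  (* Caratheodory's criterion at 0: this slope is z times a bounded function, hence continuous with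
     value 0 there. *)
  exists (fun z => z * flat ('X^2 * q) z); split; last by rewrite mul0r.
    by move=> z; rewrite (flat_le0 _ (lexx 0)) !subr0 (flat_sqr q z) expr2 mulrAC.
  have [C C0 FC] := flat_bounded ('X^2 * q).
  apply/cvgrPdist_le => e e0; rewrite mul0r.
  have C1 : 0 < C + 1 by rewrite ltr_wpDl.
  apply/nbhs_ballP; exists (e / (C + 1)); first exact: divr_gt0.
  move=> z; rewrite /ball/= sub0r normrN ltr_pdivlMr// => /ltW ze.
  rewrite sub0r normrN normrM (le_trans _ ze)//.
  by rewrite ler_wpM2l// (le_trans (FC z))// lerDl.
Unshelve. all: by end_near. Qed.

Lemma flat_lipschitz q : exists2 C : R, 0 <= C &
  forall s t, `|flat q s - flat q t| <= C * `|s - t|.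
Proof.
have [C C0 FC] := flat_bounded (flat_deriv q); exists C => // s t.
have [x _ ->] := MVT_total (is_derive_flat q) s t.
by rewrite normrM ler_wpM2r.
Qed.

Lemma flat_taylor q : exists2 C : R, 0 <= C & forall s t,
  `|flat q s - flat q t - flat (flat_deriv q) t * (s - t)| <= C * `|s - t| ^+ 2.
Proof.
have [C C0 FC] := flat_lipschitz (flat_deriv q); exists C => // s t.
have [x xst ->] := MVT_total (is_derive_flat q) s t.
rewrite -mulrBl normrM expr2 mulrA ler_wpM2r//.
by rewrite (le_trans (FC x t))// ler_wpM2l.
Qed.

End flat_function.

Section taylor_functions.
Context {R : realType} {d : nat}.
Implicit Types (f g : 'rV[R]_d -> R) (F G : 'rV[R]_d -> 'rV[R]_d) (x y : 'rV[R]_d).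

(* [F] is the gradient of [f], and the first-order Taylor expansion of [f] holds
   uniformly with a quadratic remainder. *)
Definition taylor2 f F (C : R) := [/\ forall x, `|f x| <= C,
  forall x, enorm (F x) <= C &
  forall x y, `|f y - f x - dotp (F x) (y - x)| <= C * enorm (y - x) ^+ 2].

Lemma taylor2_ge0 f F C : taylor2 f F C -> 0 <= C.
Proof. by move=> [fC _ _]; exact: le_trans (fC 0). Qed.

(** Beyond distance 1 the bound on the values suffices; below it the quadratic remainder is at most
    linear. *)
Lemma taylor2_lipschitz f F C x y : taylor2 f F C ->
  `|f y - f x| <= 2 * C * enorm (y - x).
Proof.
move=> fC; have C0 := taylor2_ge0 fC; case: fC => f0 F0 T.
have [h1|/ltW h1] := leP (enorm (y - x)) 1; last first.
  rewrite (le_trans (ler_normB _ _))//.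
  by have := f0 x; have := f0 y; nra.
have := T x y; have := normr_dotp_le (F x) (y - x).
have := F0 x; have := enorm_ge0 (y - x); have := enorm_ge0 (F x).
set a := enorm (y - x) in h1 *; set b := enorm (F x); set c := dotp _ _.
move=> b0 a0 bC cab T'.
have c' : `|c| <= C * a by rewrite (le_trans cab)// ler_wpM2r.
have a2 : C * a ^+ 2 <= C * a by rewrite ler_wpM2l// expr2 ler_piMl.
rewrite -(subrK c (f y - f x)) (le_trans (ler_normD _ _))//; lra.
Qed.

Lemma taylor2_continuous f F C : taylor2 f F C -> continuous f.
Proof.
move=> fC; have C0 := taylor2_ge0 fC.
apply/continuous_enormP => x e e0.
have C1 : 0 < 2 * C + 1 by lra.
exists (e / (2 * C + 1)) => [|y]; first exact: divr_gt0.
rewrite ltr_pdivlMr// => yx; rewrite (le_lt_trans (taylor2_lipschitz x y fC))//.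
by apply: le_lt_trans yx; have := enorm_ge0 (y - x); nra.
Qed.

Lemma taylor2_cst (c : R) : taylor2 (cst c) (cst 0) `|c|.
Proof.
split=> // [x|x y]; first by rewrite enorm0.
by rewrite /= dotp0l !subrr normr0 mulr_ge0// sqr_ge0.
Qed.

Lemma taylor2M f g F G C C' : taylor2 f F C -> taylor2 g G C' ->
  taylor2 (fun x => f x * g x) (fun x => f x *: G x + g x *: F x) (6 * (C * C')).
Proof.
move=> fC gC; have C0 := taylor2_ge0 fC; have C'0 := taylor2_ge0 gC.
have Lf x y := taylor2_lipschitz x y fC; have Lg x y := taylor2_lipschitz x y gC.
case: fC => f0 F0 Tf; case: gC => g0 G0 Tg.
have CC : 0 <= C * C' by rewrite mulr_ge0.
have M (a b u v : R) : 0 <= u -> `|a| <= u -> `|b| <= v -> `|a * b| <= u * v.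
  by move=> u0 au bv; rewrite normrM ler_pM.
split=> [x|x|x y].
- by rewrite (le_trans (M _ _ _ _ C0 (f0 x) (g0 x)))//; lra.
- rewrite (le_trans (enormD _ _))// !enormZ.
  have h1 : `|f x| * enorm (G x) <= C * C' by rewrite ler_pM ?enorm_ge0.
  have h2 : `|g x| * enorm (F x) <= C' * C by rewrite ler_pM ?enorm_ge0.
  lra.
- rewrite dotpDl !dotpZl.
  set a := dotp (G x) _; set b := dotp (F x) _; set h := enorm _.
  (* The first two products are remainders, each at most C C' h^2. The third one is quadratic by the
     Lipschitz constants 2 C and 2 C', which gives 4 of the factor 6. *)
  rewrite (_ : _ - _ = f x * (g y - g x - a) + g x * (f y - f x - b)
     + (f y - f x) * (g y - g x)); last by ring.
  have h0 : 0 <= h by exact: enorm_ge0.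
  have t1 := M _ _ _ _ C0 (f0 x) (Tg x y).
  have t2 := M _ _ _ _ C'0 (g0 x) (Tf x y).
  have C2h : 0 <= 2 * C * h by rewrite !mulr_ge0.
  have t3 := M _ _ _ _ C2h (Lf x y) (Lg x y).
  rewrite (le_trans (ler_normD _ _))//; rewrite -/h in t1 t2 t3.
  rewrite (le_trans (lerD (le_trans (ler_normD _ _) (lerD t1 t2)) t3))//.
  by rewrite le_eqVlt; apply/orP; left; apply/eqP; ring.
Qed.

Lemma taylor2D f g F G C C' : taylor2 f F C -> taylor2 g G C' ->
  taylor2 (fun x => f x + g x) (fun x => F x + G x) (C + C').
Proof.
move=> [f0 F0 Tf] [g0 G0 Tg]; split=> [x|x|x y].
- by rewrite (le_trans (ler_normD _ _))// lerD.
- by rewrite (le_trans (enormD _ _))// lerD.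
- rewrite dotpDl mulrDl (le_trans _ (lerD (Tf x y) (Tg x y)))//.
  by rewrite (le_trans _ (ler_normD _ _))// le_eqVlt; apply/orP; left; apply/eqP; congr normr; ring.
Qed.

Lemma taylor2Z f F C (k : R) : taylor2 f F C ->
  taylor2 (fun x => k * f x) (fun x => k *: F x) (`|k| * C).
Proof.
move=> [f0 F0 Tf]; split=> [x|x|x y].
- by rewrite normrM ler_wpM2l.
- by rewrite enormZ ler_wpM2l.
- by rewrite dotpZl -!mulrBr normrM -mulrA ler_wpM2l.
Qed.

Lemma taylor2_comp_affine (h h' : R -> R) (c b : R) (i : 'I_d) (C : R) :
  (forall t, `|h t| <= C) -> (forall t, `|h' t| <= C) ->
  (forall s t, `|h s - h t - h' t * (s - t)| <= C * `|s - t| ^+ 2) ->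
  exists D, taylor2 (fun x => h (c * x ord0 i + b))
    (fun x => (c * h' (c * x ord0 i + b)) *: delta_mx 0 i) D.
Proof.
move=> hC h'C T.
have C0 : 0 <= C by exact: le_trans (hC 0).
have dE x : dotp (delta_mx 0 i) x = x ord0 i.
  rewrite /dotp (bigD1 i)//= mxE !eqxx mul1r big1 ?addr0// => j ji.
  by rewrite mxE (negPf ji) andbF mul0r.
have n1 : enorm (delta_mx 0 i : 'rV[R]_d) = 1.
  by rewrite /enorm dE mxE !eqxx sqrtr1.
exists (C * (1 + `|c| + `|c| ^+ 2)).
have k0 : 0 <= `|c| + `|c| ^+ 2 by rewrite addr_ge0// sqr_ge0.
split=> [x|x|x y].
- by rewrite (le_trans (hC _))// ler_peMr// -addrA lerDl.
- rewrite enormZ n1 mulr1 normrM mulrC ler_pM//.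
  by rewrite addrAC -[leLHS]add0r lerD// addr_ge0// sqr_ge0.
- rewrite dotpZl dE.
  have E : c * y ord0 i + b - (c * x ord0 i + b) = c * (y - x) ord0 i by rewrite !mxE; ring.
  have := T (c * y ord0 i + b) (c * x ord0 i + b).
  rewrite E mulrA (mulrC _ c) => /le_trans; apply.
  rewrite normrM exprMn mulrA ler_pM ?sqr_ge0// ?mulr_ge0 ?sqr_ge0//.
    by rewrite ler_wpM2l// lerDr addr_ge0.
  by rewrite ler_sqr ?nnegrE ?enorm_ge0// coord_le_enorm.
Qed.

Lemma taylor2_prod (I : finType) (f : I -> 'rV[R]_d -> R) :
  (forall i, exists F C, taylor2 (f i) F C) ->
  exists F C, taylor2 (fun x => \prod_i f i x) F C.
Proof.
move=> H; elim: (index_enum I) => [|i s [F [C IH]]].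
  exists (cst 0), `|1|; under [X in taylor2 X]eq_fun do rewrite big_nil.
  exact: taylor2_cst.
have [G [C' Hi]] := H i.
eexists; eexists; under [X in taylor2 X]eq_fun do rewrite big_cons.
exact: taylor2M Hi IH.
Qed.

Lemma taylor2_is_derive f F C x v : taylor2 f F C -> is_derive x v f (dotp (F x) v).
Proof.
move=> fC; have C0 := taylor2_ge0 fC; case: fC => _ _ T.
suff H : h^-1 *: ((f \o shift x) (h *: v) - f x) @[h --> 0^'] --> dotp (F x) v.
  by apply: DeriveDef; [apply/cvg_ex; exists (dotp (F x) v)|exact: cvg_lim].
apply/cvgrPdist_le => e e0.
have K1 : 0 < C * enorm v ^+ 2 + 1 by rewrite ltr_wpDl// mulr_ge0// sqr_ge0.
near=> h.
have hn0 : h != 0 by near: h; exact: nbhs_dnbhs_neq.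
rewrite distrC /= /GRing.scale/=.
have := T x (h *: v + x); rewrite addrK dotpZr enormZ.
rewrite -(ler_pM2l (_ : 0 < `|h|^-1)) ?invr_gt0 ?normr_gt0//.
rewrite -{1}normfV -normrM mulrBr mulKf// => /le_trans; apply.
rewrite exprMn (_ : _ * _ = `|h| * (C * enorm v ^+ 2)); last first.
  by field; rewrite normr_eq0.
rewrite (@le_trans _ _ (`|h| * (C * enorm v ^+ 2 + 1)))//.
  by rewrite ler_wpM2l// lerDl.
rewrite -ler_pdivlMr//; near: h.
by apply: dnbhs0_le; exact: divr_gt0.
Unshelve. all: by end_near. Qed.

Lemma Ck_pred k f : Ck k.+1 f -> Ck k f.
Proof.
elim: k f => [|k IH] f [cf H]; split=> // i.
by have [df Hf] := H i; split=> //; exact: IH.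
Qed.

Lemma Ck_cst k (c : R) : Ck k (cst c : 'rV[R]_d -> R).
Proof.
have cc : continuous (cst c : 'rV[R]_d -> R).
  by apply/continuous_enormP => x e e0; exists 1 => // y _; rewrite subrr normr0.
elim: k c cc => [|k IH] c cc; split=> //.
move=> i; split; first by move=> x; exact: derivable_cst.
rewrite (_ : 'D_ _ _ = cst 0).
  by apply: IH; apply/continuous_enormP => x e e0; exists 1 => // y _; rewrite subrr normr0.
by apply/funext => x; rewrite derive_cst.
Qed.

Lemma CkD k f g : Ck k f -> Ck k g -> Ck k (fun x => f x + g x).
Proof.
elim: k f g => [|k IH] f g [cf Hf] [cg Hg].
  by split=> // x; exact: (cvgD (cf x) (cg x)).
split; first by move=> x; exact: (cvgD (cf x) (cg x)).
move=> i; have [df Hf'] := Hf i; have [dg Hg'] := Hg i; split.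
  by move=> x; exact: derivableD.
rewrite (_ : 'D_ _ _ = fun x => 'D_(delta_mx 0 i) f x + 'D_(delta_mx 0 i) g x); first exact: IH.
by apply/funext => x; rewrite -deriveD.
Qed.

Lemma CkM k f g : Ck k f -> Ck k g -> Ck k (fun x => f x * g x).
Proof.
elim: k f g => [|k IH] f g Cf Cg; have [cf Hf] := Cf; have [cg Hg] := Cg.
  by split=> // x; exact: (cvgM (cf x) (cg x)).
split; first by move=> x; exact: (cvgM (cf x) (cg x)).
move=> i; have [df Hf'] := Hf i; have [dg Hg'] := Hg i; split.
  by move=> x; exact: derivableM.
rewrite (_ : 'D_ _ _ = fun x => f x * 'D_(delta_mx 0 i) g x + g x * 'D_(delta_mx 0 i) f x).
  by apply: CkD; apply: IH => //; exact: Ck_pred.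
by apply/funext => x; rewrite -deriveM.
Qed.

Lemma smooth_prod (I : finType) (f : I -> 'rV[R]_d -> R) :
  (forall i, smooth (f i)) -> smooth (fun x => \prod_i f i x).
Proof.
move=> H k; elim: (index_enum I) => [|i s IH].
  by under [X in Ck k X]eq_fun do rewrite big_nil; exact: Ck_cst.
by under [X in Ck k X]eq_fun do rewrite big_cons; exact: CkM (H i k) IH.
Qed.

Lemma taylor2_flat (q : {poly R}) (c b : R) i : exists D,
  taylor2 (fun x => flat q (c * x ord0 i + b))
    (fun x => (c * flat (flat_deriv q) (c * x ord0 i + b)) *: delta_mx 0 i) D.
Proof.
have [C1 C10 h1] := flat_bounded q.
have [C2 C20 h2] := flat_bounded (flat_deriv q).
have [C3 C30 h3] := flat_taylor q.
apply: (@taylor2_comp_affine _ _ _ _ _ (C1 + C2 + C3)).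
- by move=> t; rewrite (le_trans (h1 t))//; lra.
- by move=> t; rewrite (le_trans (h2 t))//; lra.
- by move=> s t; rewrite (le_trans (h3 s t))// ler_wpM2r ?sqr_ge0//; lra.
Qed.

Lemma smooth_flat (q : {poly R}) (c b : R) i :
  smooth (fun x : 'rV[R]_d => flat q (c * x ord0 i + b)).
Proof.
move=> k; elim: k q => [|k IH] q; have [D T] := taylor2_flat q c b i.
  by split=> //; exact: taylor2_continuous T.
split; first exact: taylor2_continuous T.
move=> j; have dT x := taylor2_is_derive x (delta_mx 0 j) T.
split; first by move=> x; have [] := dT x.
rewrite (_ : 'D_ _ _ = fun x => (c * (i == j)%:R) * flat (flat_deriv q) (c * x ord0 i + b)).
  by apply: CkM => //; exact: Ck_cst.
apply/funext => x; have [_ ->] := dT x.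
rewrite dotpZl /dotp (bigD1 i)//= big1 => [|l li]; last first.
  by rewrite !mxE (negPf li) andbF mul0r.
by rewrite !mxE !eqxx mul1r addr0/= mulrAC.
Qed.

End taylor_functions.

Section bounded_support.
Context {R : realType} {d : nat}.
Local Notation lam := (lebesgue_rV R d).
Implicit Types (f g u : 'rV[R]_d -> R).

(** These functions are integrable and stable under all the operations used below, so that real
    integrals can be manipulated without integrability side conditions. *)
Definition bounded_supported f := measurable_fun setT f /\
  exists M r : R, forall x, `|f x| <= M /\ (r <= enorm x -> f x = 0).

Definition bounded_measurable f := measurable_fun setT f /\ exists M : R, forall x, `|f x| <= M.

Lemma bounded_supported_integrable f : bounded_supported f ->
  lam.-integrable setT (EFin \o f).
Proof.
move=> [mf [M [r fMr]]].
have fE : f = f \_ (eball 0 r).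
  apply/funext => x; rewrite patchE; case: ifPn => // /negP.
  rewrite in_setE /eball/= subr0 => /negP; rewrite -leNgt => rx.
  by have [_ ->] := fMr x.
rewrite fE -restrict_EFin -integrable_mkcond; last exact: measurable_eball.
apply: measurable_bounded_integrable.
- exact: measurable_eball.
- exact: lebesgue_rV_eball_lty.
- exact: measurable_funS mf.
- exists M; split=> [|y My x _]; first exact: num_real.
  by have [fx _] := fMr x; exact: le_trans fx (ltW My).
Qed.

Lemma bounded_supportedD f g : bounded_supported f -> bounded_supported g ->
  bounded_supported (fun x => f x + g x).
Proof.
move=> [mf [M [r fM]]] [mg [M' [r' gM]]]; split; first exact: measurable_funD.
exists (M + M'), (Num.max r r') => x; have [f1 f2] := fM x; have [g1 g2] := gM x.
split; first by rewrite (le_trans (ler_normD _ _))// lerD.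
by rewrite ge_max => /andP[/f2 -> /g2 ->]; rewrite addr0.
Qed.

Lemma bounded_supportedM u f : bounded_measurable u -> bounded_supported f ->
  bounded_supported (fun x => u x * f x).
Proof.
move=> [mu [N uN]] [mf [M [r fM]]]; split; first exact: measurable_funM.
exists (N * M), r => x; have [f1 f2] := fM x.
split; first by rewrite normrM ler_pM.
by move=> /f2 ->; rewrite mulr0.
Qed.

Lemma bounded_measurable_cst (c : R) : bounded_measurable (cst c).
Proof. by split; [exact: measurable_cst|exists `|c|]. Qed.

Lemma bounded_supportedZ (c : R) f : bounded_supported f ->
  bounded_supported (fun x => c * f x).
Proof. exact/bounded_supportedM/bounded_measurable_cst. Qed.

Lemma bounded_supportedB f g : bounded_supported f -> bounded_supported g ->
  bounded_supported (fun x => f x - g x).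
Proof.
move=> bf bg; under eq_fun do rewrite -mulN1r.
by apply: bounded_supportedD => //; exact: bounded_supportedZ.
Qed.

Lemma bounded_supported_norm f : bounded_supported f ->
  bounded_supported (fun x => `|f x|).
Proof.
move=> [mf [M [r fM]]]; split; first exact: measurableT_comp.
exists M, r => x; have [f1 f2] := fM x.
by split; [rewrite normr_id|move=> /f2 ->; rewrite normr0].
Qed.

Lemma bounded_supported_measurable f : bounded_supported f -> bounded_measurable f.
Proof. by move=> [mf [M [r fM]]]; split=> //; exists M => x; have [] := fM x. Qed.

Lemma bounded_supported_sum (I : finType) (f : I -> 'rV[R]_d -> R) :
  (forall i, bounded_supported (f i)) -> bounded_supported (fun x => \sum_i f i x).
Proof.
move=> H; elim: (index_enum I) => [|i s IH].
  under eq_fun do rewrite big_nil; split; first exact: measurable_cst.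
  by exists 0, 0 => x; rewrite normr0.
by under eq_fun do rewrite big_cons; exact: bounded_supportedD.
Qed.

Lemma bounded_supported_shift f z : bounded_supported f ->
  bounded_supported (fun y => f (y - z)).
Proof.
move=> [mf [M [r fM]]]; split.
  under eq_fun do rewrite addrC.
  exact: measurableT_comp mf (measurable_addl (- z)).
exists M, (r + enorm z) => x; have [f1 f2] := fM (x - z); split=> // rx; apply: f2.
by have := enormB_ge x z; lra.
Qed.

Lemma RintD f g : bounded_supported f -> bounded_supported g ->
  \int[lam]_x (f x + g x) = \int[lam]_x f x + \int[lam]_x g x.
Proof. by move=> bf bg; rewrite RintegralD//; exact: bounded_supported_integrable. Qed.

Lemma RintB f g : bounded_supported f -> bounded_supported g ->
  \int[lam]_x (f x - g x) = \int[lam]_x f x - \int[lam]_x g x.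
Proof. by move=> bf bg; rewrite RintegralB//; exact: bounded_supported_integrable. Qed.

Lemma RintZ (c : R) f : bounded_supported f ->
  \int[lam]_x (c * f x) = c * \int[lam]_x f x.
Proof. by move=> bf; rewrite RintegralZl//; exact: bounded_supported_integrable. Qed.

Lemma Rint_sum (I : finType) (f : I -> 'rV[R]_d -> R) :
  (forall i, bounded_supported (f i)) ->
  \int[lam]_x (\sum_i f i x) = \sum_i \int[lam]_x f i x.
Proof.
move=> H.
suff [] : \int[lam]_x (\sum_(i <- index_enum I) f i x) = \sum_(i <- index_enum I) \int[lam]_x f i x
   /\ bounded_supported (fun x => \sum_(i <- index_enum I) f i x) by [].
elim: (index_enum I) => [|i s [IH bs]].
  under eq_Rintegral do rewrite big_nil; rewrite big_nil; split.
    by rewrite /Rintegral integral0.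
  by under eq_fun do rewrite big_nil; split; [exact: measurable_cst|exists 0, 0 => x; rewrite normr0].
under eq_Rintegral do rewrite big_cons; rewrite big_cons; split.
  by rewrite RintD// IH.
by under eq_fun do rewrite big_cons; exact: bounded_supportedD.
Qed.

Lemma le_Rint f g : bounded_supported f -> bounded_supported g ->
  (forall x, f x <= g x) -> \int[lam]_x f x <= \int[lam]_x g x.
Proof. by move=> bf bg fg; apply: le_Rintegral => //; exact: bounded_supported_integrable. Qed.

Lemma le_norm_Rint f : bounded_supported f ->
  `|\int[lam]_x f x| <= \int[lam]_x `|f x|.
Proof. by move=> bf; apply: le_normr_Rintegral => //; exact: bounded_supported_integrable. Qed.

Lemma Rint_shift f z : bounded_supported f ->
  \int[lam]_y f (y - z) = \int[lam]_y f y.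
Proof.
move=> [mf _]; rewrite /Rintegral; congr fine.
have mF : measurable_fun setT (EFin \o f) by exact/measurable_EFinP.
rewrite [LHS]integralE [RHS]integralE; congr (_ - _)%E.
  rewrite -(@integral_translate _ _ (- z) ((EFin \o f)^\+)%E) => [||x]; last exact: funepos_ge0.
    by apply: eq_integral => x _; rewrite !funeposE/= addrC.
  exact: measurable_funepos.
rewrite -(@integral_translate _ _ (- z) ((EFin \o f)^\-)%E) => [||x]; last exact: funeneg_ge0.
  by apply: eq_integral => x _; rewrite !funenegE/= addrC.
exact: measurable_funeneg.
Qed.

Lemma bounded_supported_indic (A : set 'rV[R]_d) (r : R) : measurable A ->
  (forall x, A x -> enorm x <= r) -> bounded_supported (\1_A : 'rV[R]_d -> R).
Proof.
move=> mA Ar; split; first exact: measurable_indic.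
exists 1, (r + 1) => x; split.
  by rewrite ger0_norm// indicE; case: (_ \in _).
move=> rx; rewrite indicE memNset// => /Ar; lra.
Qed.

Lemma Rint_indic (A : set 'rV[R]_d) : measurable A ->
  \int[lam]_x (\1_A x : R) = fine (lam A).
Proof. by move=> mA; rewrite /Rintegral integral_indic// setIT. Qed.

Lemma norm_Rint_le f (A : set 'rV[R]_d) (M r : R) : bounded_supported f -> measurable A ->
  (forall x, A x -> enorm x <= r) ->
  (forall x, `|f x| <= M) -> (forall x, ~ A x -> f x = 0) ->
  `|\int[lam]_x f x| <= M * fine (lam A).
Proof.
move=> bf mA Ar fM fA; have bA := bounded_supported_indic mA Ar.
rewrite -Rint_indic// -RintZ// (le_trans (le_norm_Rint bf))//.
apply: le_Rint; [exact: bounded_supported_norm|exact: bounded_supportedZ|].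
move=> x; rewrite indicE; have [xA|xA] := pselect (A x).
  by rewrite mem_set// mulr1.
by rewrite fA// normr0 memNset// mulr0.
Qed.

(** A step against a nonzero gradient would make [f] negative. This is how the gradient of a
    nonnegative bump is known to vanish wherever the bump does. *)
Lemma taylor2_min0 f F C x : taylor2 f F C -> (forall y, 0 <= f y) -> f x = 0 -> F x = 0.
Proof.
move=> fC f0 fx0; have C0 := taylor2_ge0 fC; case: fC => _ _ T.
apply/eqP; rewrite -enorm_eq0; apply/negPn/negP => F0.
have {F0}Fx : 0 < enorm (F x) by rewrite lt_neqAle eq_sym F0 enorm_ge0.
(* Then C t < 1, so the linear gain exceeds the quadratic remainder. *)
pose t := (C + 1)^-1; have t0 : 0 < t by rewrite invr_gt0; lra.
have := T x (x - t *: F x); have := f0 (x - t *: F x).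
rewrite fx0 subr0 (addrC x) addrK dotpNr dotpZr -sqr_enorm enormN enormZ (gtr0_norm t0).
rewrite opprK exprMn => h1 h2.
have {h2} : t * enorm (F x) ^+ 2 <= C * (t ^+ 2 * enorm (F x) ^+ 2).
  rewrite (le_trans _ h2)// (le_trans _ (ler_norm _))//; lra.
have F2 : 0 < t * enorm (F x) ^+ 2 by rewrite mulr_gt0// exprn_gt0.
have Ct : C * t < 1 by rewrite /t ltr_pdivrMr; lra.
rewrite (_ : C * _ = t * enorm (F x) ^+ 2 * (C * t)); last by ring.
by rewrite leNgt => /negP; apply; rewrite gtr_pMr.
Qed.

Lemma taylor2_grad_lipschitz f F C x y : taylor2 f F C ->
  enorm (F x - F y) <= 6 * C * enorm (y - x).
Proof.
move=> fC; have C0 := taylor2_ge0 fC; case: fC => _ _ T.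
have [->|xy] := eqVneq y x; first by rewrite !subrr enorm0 mulr0.
have h0 : 0 < enorm (y - x) by rewrite enorm_gt0 subr_eq0.
set D := F x - F y; have [->|D0] := eqVneq D 0.
  by rewrite enorm0 !mulr_ge0// enorm_ge0.
have Dn : 0 < enorm D by rewrite enorm_gt0.
set h := enorm (y - x) in h0 *.
(* The expansions at [x] and at [y] are compared at [w + y]. With the expansion from [x] to [y] the
   remainders are at most C h^2, 4 C h^2 and C h^2, whence the factor 6. *)
pose w := (h / enorm D) *: D.
have wn : enorm w = h by rewrite enormZ gtr0_norm ?divr_gt0// divfK// gt_eqF.
have Dw : dotp D w = h * enorm D.
  by rewrite dotpZr -sqr_enorm expr2 mulrA divfK// gt_eqF.
have := T y (w + y); have := T x (w + y); have := T x y.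
rewrite addrK wn -/h.
have zx : w + y - x = w + (y - x) by rewrite addrA.
have zn : enorm (w + y - x) ^+ 2 <= (2 * h) ^+ 2.
  rewrite ler_sqr ?nnegrE ?enorm_ge0 ?mulr_ge0 ?(ltW h0)//.
  by rewrite zx (le_trans (enormD _ _))// wn -/h; lra.
rewrite zx in zn *; rewrite (dotpDr _ w (y - x)) => t1 t2 t3.
have {}t2 := le_trans t2 (ler_wpM2l C0 zn).
have : h * enorm D <= 6 * C * h ^+ 2.
  rewrite -Dw dotpBl; move: t1 t2 t3; rewrite !ler_norml exprMn.
  move=> /andP[t1 t1'] /andP[t2 t2'] /andP[t3 t3']; lra.
by rewrite expr2 mulrA (mulrC h) ler_pM2r.
Qed.

Lemma taylor2_grad_coord_continuous f F C i : taylor2 f F C ->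
  continuous (fun x => F x ord0 i).
Proof.
move=> fC; have C0 := taylor2_ge0 fC; apply/continuous_enormP => x e e0.
have C1 : 0 < 6 * C + 1 by lra.
exists (e / (6 * C + 1)) => [|y]; first exact: divr_gt0.
rewrite ltr_pdivlMr// mulrC => yx; apply: le_lt_trans yx.
rewrite distrC; have := coord_le_enorm (F x - F y) i; rewrite !mxE => /le_trans; apply.
rewrite (le_trans (taylor2_grad_lipschitz x y fC))//.
by rewrite ler_wpM2r ?enorm_ge0// lerDl.
Qed.

Lemma taylor2_grad_le f F C x (L r : R) : taylor2 f F C -> 0 < r -> 0 <= L ->
  (forall y, enorm (y - x) < r -> `|f y - f x| <= L * enorm (y - x)) ->
  enorm (F x) <= L.
Proof.
move=> fC r0 L0 H; have C0 := taylor2_ge0 fC; case: fC => _ _ T.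
apply/ler_addgt0Pr => e e0.
have [->|F0] := eqVneq (F x) 0; first by rewrite enorm0; lra.
have Fn : 0 < enorm (F x) by rewrite enorm_gt0.
(* A step of length [s] along the gradient stays within the radius of the hypothesis, and its
   remainder is at most [s * e]. *)
pose s := Num.min (r / 2) (e / (C + 1)).
have s0 : 0 < s by rewrite lt_min !divr_gt0//; lra.
have sr : s < r by rewrite (@le_lt_trans _ _ (r / 2)) ?ge_min ?lexx//; lra.
have sC : s * (C + 1) <= e.
  by rewrite -ler_pdivlMr; [rewrite ge_min lexx orbT|lra].
pose w := (s / enorm (F x)) *: F x.
have wn : enorm w = s by rewrite enormZ gtr0_norm ?divr_gt0// divfK// gt_eqF.
have Dw : dotp (F x) w = s * enorm (F x).
  by rewrite dotpZr -sqr_enorm expr2 mulrA divfK// gt_eqF.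
have := T x (w + x); have := H (w + x); rewrite addrK wn Dw => /(_ sr) h1 h2.
have : s * enorm (F x) <= s * (L + e).
  have h3 : C * s ^+ 2 <= s * e by rewrite expr2; nra.
  move: h1 h2; rewrite !ler_norml => /andP[h1 h1'] /andP[h2 h2']; nra.
by rewrite ler_pM2l.
Qed.

(** Telescoping over n equal steps of length at most [r]: a Lipschitz bound known only at small
    scale holds between the ends of [0, 1]. *)
Lemma chain_le (h : R -> R) (K r : R) : 0 < r ->
  (forall s t, 0 <= s <= 1 -> 0 <= t <= 1 -> `|s - t| <= r ->
    `|h s - h t| <= K * `|s - t|) -> `|h 1 - h 0| <= K.
Proof.
move=> r0 H; pose n := (Num.truncn r^-1).+1.
have n0 : 0 < n%:R :> R by rewrite ltr0n.
have nr : n%:R^-1 <= r.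
  by rewrite -[r]invrK lef_pV2 ?posrE ?invr_gt0// ltW// truncnS_gt.
have step k : (k < n)%N -> `|h (k.+1%:R / n%:R) - h (k%:R / n%:R)| <= K / n%:R.
  move=> kn; have d1 : k.+1%:R / n%:R - k%:R / n%:R = n%:R^-1 :> R.
    by rewrite -mulrBl -natrB// subSnn mul1r.
  have := H (k.+1%:R / n%:R) (k%:R / n%:R); rewrite d1 (ger0_norm (ltW _)) ?invr_gt0//.
  by apply=> //; rewrite ?divr_ge0//= ler_pdivrMr// mul1r ler_nat// ltnW.
have tele k : (k <= n)%N -> `|h (k%:R / n%:R) - h 0| <= k%:R * (K / n%:R).
  elim: k => [|k IH] kn; first by rewrite mul0r subrr normr0 mul0r.
  rewrite -(subrK (h (k%:R / n%:R)) (h (k.+1%:R / n%:R))) -addrA.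
  rewrite (le_trans (ler_normD _ _))// (le_trans (lerD (step _ kn) (IH (ltnW kn))))//.
  by rewrite -natr1 mulrDl mul1r addrC.
have := tele n (leqnn n); rewrite divff ?gt_eqF// => /le_trans; apply.
by rewrite mulrCA divff ?gt_eqF// mulr1.
Qed.

Lemma taylor2_segment_le f F C x y (L : R) : taylor2 f F C ->
  (forall t, 0 <= t <= 1 -> enorm (F (x + t *: (y - x))) <= L) ->
  `|f y - f x| <= L * enorm (y - x).
Proof.
move=> fC FL; have C0 := taylor2_ge0 fC; case: fC => _ _ T.
have L0 : 0 <= L by rewrite (le_trans _ (FL 0 _))// ?enorm_ge0// lexx ler01.
set N := enorm (y - x); have N0 : 0 <= N by exact: enorm_ge0.
apply/ler_addgt0Pr => e e0.
pose h t := f (x + t *: (y - x)).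
have -> : f y = h 1 by rewrite /h scale1r addrC subrK.
have -> : f x = h 0 by rewrite /h scale0r addr0.
(* On pieces this short the quadratic remainder is at most [e] times the length, so chaining loses
   only [e]. *)
have r0 : 0 < e / (C * N ^+ 2 + 1) by rewrite divr_gt0// ltr_wpDl// mulr_ge0// sqr_ge0.
apply: (@chain_le _ _ _ r0) => s t s01 t01.
rewrite ler_pdivlMr ?ltr_wpDl// ?mulr_ge0 ?sqr_ge0// => st.
have := T (x + t *: (y - x)) (x + s *: (y - x)).
rewrite -/(h s) -/(h t) opprD addrACA subrr add0r -scalerBl enormZ -/N exprMn dotpZr.
have := normr_dotp_le (F (x + t *: (y - x))) (y - x); rewrite -/N.
have := FL t t01; set a := enorm _; set b := dotp _ _ => aL ba TT.
have {aL} bL : `|b| <= L * N by rewrite (le_trans ba)// ler_wpM2r.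
have h1 : `|(s - t) * b| <= `|s - t| * (L * N) by rewrite normrM ler_wpM2l.
have h2 : C * (`|s - t| ^+ 2 * N ^+ 2) <= `|s - t| * e.
  rewrite (_ : C * _ = `|s - t| * (`|s - t| * (C * N ^+ 2))); last by ring.
  by rewrite ler_wpM2l// (le_trans _ st)// ler_wpM2l// lerDl.
rewrite -(subrK ((s - t) * b) (h s - h t)) (le_trans (ler_normD _ _))//.
by rewrite (le_trans (lerD (le_trans TT h2) h1))// -mulrDr mulrC (addrC e).
Qed.

Lemma lebesgue_rV_eball_center x (r : R) : lam (eball x r) = lam (eball 0 r).
Proof.
rewrite -(lebesgue_rV_translate (- x) (measurable_eball 0 r)).
by congr (lam _); apply/seteqP; split=> y; rewrite /eball/= subr0 addrC.
Qed.

End bounded_support.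

(** * Mollification with uniform Taylor bounds *)

Section mollification.
Context {R : realType} {d : nat}.
Local Notation lam := (lebesgue_rV R d).
Implicit Types (phi u : 'rV[R]_d -> R) (G : 'rV[R]_d -> 'rV[R]_d).

(** A correlation rather than a convolution: [fun y => phi (y - z)] is directly the test function to
    which the definition of a weak gradient applies. *)
Definition mollify u phi z : R := \int[lam]_y (u y * phi (y - z)).

(** The sign comes from differentiating [phi (y - z)] in z. *)
Definition mollify_grad u G z : 'rV[R]_d :=
  \row_i - \int[lam]_y (u y * G (y - z) ord0 i).

Lemma bounded_measurable_shift u z : bounded_measurable u ->
  bounded_measurable (fun y => u (y + z)).
Proof.
move=> [mu [M uM]]; split; last by exists M.
under eq_fun do rewrite addrC.
exact: measurableT_comp mu (measurable_addl z).
Qed.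

Lemma mollify_shift u phi z : bounded_measurable u -> bounded_supported phi ->
  mollify u phi z = \int[lam]_y (u (y + z) * phi y).
Proof.
move=> bu bphi; rewrite -(@Rint_shift _ _ (fun y => u (y + z) * phi y) z).
  by apply: eq_Rintegral => y _; rewrite subrK.
by apply: bounded_supportedM => //; exact: bounded_measurable_shift.
Qed.

Lemma weighted_mean_le phi u (B : R) : bounded_measurable u -> bounded_supported phi ->
  (forall y, 0 <= phi y) -> \int[lam]_y phi y = 1 ->
  (forall y, phi y != 0 -> `|u y| <= B) -> `|\int[lam]_y (u y * phi y)| <= B.
Proof.
move=> bu bphi phi0 phi1 uB.
have bup := bounded_supportedM bu bphi.
rewrite (le_trans (le_norm_Rint bup))// -[leRHS]mulr1 -phi1 -RintZ//.
apply: le_Rint; [exact: bounded_supported_norm|exact: bounded_supportedZ|].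
move=> y; rewrite normrM (ger0_norm (phi0 y)).
have [->|/uB uy] := eqVneq (phi y) 0; first by rewrite !mulr0.
by rewrite ler_wpM2r.
Qed.

Lemma bounded_measurableB u v : bounded_measurable u -> bounded_measurable v ->
  bounded_measurable (fun y => u y - v y).
Proof.
move=> [mu [M uM]] [mv [M' vM]]; split; first exact: measurable_funB.
by exists (M + M') => y; rewrite (le_trans (ler_normB _ _))// lerD.
Qed.

Lemma mollify_close u phi z (c B : R) : bounded_measurable u -> bounded_supported phi ->
  (forall y, 0 <= phi y) -> \int[lam]_y phi y = 1 ->
  (forall y, phi y != 0 -> `|u (y + z) - c| <= B) -> `|mollify u phi z - c| <= B.
Proof.
move=> bu bphi phi0 phi1 uB; have bs := bounded_measurable_shift z bu.
rewrite mollify_shift// -[c in `|_ - c|]mulr1 -phi1 -RintZ// -RintB; first last.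
- exact: bounded_supportedZ.
- exact: bounded_supportedM.
under eq_Rintegral do rewrite -mulrBl.
apply: weighted_mean_le => //; apply: bounded_measurableB => //.
exact: bounded_measurable_cst.
Qed.

Lemma mollify_diff_le u phi z z' (B : R) : bounded_measurable u -> bounded_supported phi ->
  (forall y, 0 <= phi y) -> \int[lam]_y phi y = 1 ->
  (forall y, phi y != 0 -> `|u (y + z') - u (y + z)| <= B) ->
  `|mollify u phi z' - mollify u phi z| <= B.
Proof.
move=> bu bphi phi0 phi1 uB.
have bs := bounded_measurable_shift z bu; have bs' := bounded_measurable_shift z' bu.
rewrite !mollify_shift// -RintB; try exact: bounded_supportedM.
under eq_Rintegral do rewrite -mulrBl.
by apply: weighted_mean_le => //; exact: bounded_measurableB.
Qed.

Lemma taylor2_bounded_supported phi G (C r : R) : taylor2 phi G C ->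
  (forall y, r <= enorm y -> phi y = 0) -> bounded_supported phi.
Proof.
move=> T phir; split; first by apply: continuous_measurable_fun; exact: taylor2_continuous T.
by exists C, r => y; split; [case: T|exact: phir].
Qed.

Lemma taylor2_coord_bounded_supported phi G (C r : R) i :
  taylor2 phi G C -> (forall y, 0 <= phi y) -> (forall y, r <= enorm y -> phi y = 0) ->
  bounded_supported (fun y => G y ord0 i).
Proof.
move=> T phi0 phir; split.
  by apply: continuous_measurable_fun; exact: taylor2_grad_coord_continuous T.
exists C, r => y; split; last by move=> /phir py; rewrite (taylor2_min0 T phi0 py) mxE.
by case: T => _ GC _; exact: le_trans (coord_le_enorm _ _) (GC y).
Qed.

Lemma dotp_Rint (h : 'I_d -> 'rV[R]_d -> R) v : (forall i, bounded_supported (h i)) ->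
  dotp (\row_i \int[lam]_y h i y) v = \int[lam]_y (\sum_i h i y * v ord0 i).
Proof.
move=> bh; rewrite Rint_sum => [|i]; last first.
  by under eq_fun do rewrite mulrC; exact: bounded_supportedZ.
apply: eq_bigr => i _; rewrite mxE mulrC -RintZ//.
by apply: eq_Rintegral => y _; rewrite mulrC.
Qed.

Lemma dotp_mollify_grad u phi G (C r : R) z v : bounded_measurable u ->
  taylor2 phi G C -> (forall y, 0 <= phi y) -> (forall y, r <= enorm y -> phi y = 0) ->
  dotp (mollify_grad u G z) v = - \int[lam]_y (u y * dotp (G (y - z)) v).
Proof.
move=> bu T phi0 phir.
have -> : mollify_grad u G z = - \row_i \int[lam]_y (u y * G (y - z) ord0 i).
  by apply/rowP => i; rewrite !mxE.
rewrite dotpNl dotp_Rint => [|i].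
  by congr (- _); apply: eq_Rintegral => y _; rewrite mulr_sumr; apply: eq_bigr => i _; rewrite mulrA.
apply: bounded_supportedM => //.
exact: (@bounded_supported_shift _ _ (fun y => G y ord0 i) z
  (taylor2_coord_bounded_supported i T phi0 phir)).
Qed.

(** The constant depends on [u] only through [M]: in the lower bound the mollified functions change
    with the scale, for a fixed kernel. *)
Lemma mollify_taylor2_uniform phi G (C r M : R) : 0 <= M ->
  taylor2 phi G C -> (forall y, 0 <= phi y) -> (forall y, r <= enorm y -> phi y = 0) ->
  exists D, forall u, bounded_measurable u -> (forall y, `|u y| <= M) ->
    taylor2 (mollify u phi) (mollify_grad u G) D.
Proof.
move=> M0 T phi0 phir; have C0 := taylor2_ge0 T.
have bphi := taylor2_bounded_supported T phir.
have bG i := taylor2_coord_bounded_supported i T phi0 phir.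
have [phiC GC TT] := T.
pose K := fine (lam (eball 0 r)).
have K0 : 0 <= K by exact: fine_ge0.
exists (M * C * K + d%:R * (M * C * K) + 2 * (M * C * K)).
have MCK0 : 0 <= M * C * K by rewrite !mulr_ge0.
have dMCK0 : 0 <= d%:R * (M * C * K) by rewrite mulr_ge0.
move=> u bu uM.
have bound (h : 'rV[R]_d -> R) z : bounded_supported h -> (forall y, `|h y| <= C) ->
    (forall y, r <= enorm y -> h y = 0) -> `|\int[lam]_y (u y * h (y - z))| <= M * C * K.
  move=> bh hC hr; rewrite /K -(lebesgue_rV_eball_center z).
  apply: (@norm_Rint_le _ _ _ (eball z r) _ (r + enorm z)).
  - by apply: bounded_supportedM => //; exact: bounded_supported_shift.
  - exact: measurable_eball.
  - move=> y; rewrite /eball/= => yz; have := enormB_ge y z; lra.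
  - by move=> y; rewrite normrM ler_pM.
  - by move=> y; rewrite /eball/= => /negP; rewrite -leNgt => /hr ->; rewrite mulr0.
split=> [z|z|z z'].
- by rewrite (le_trans (bound _ z bphi phiC phir))//; lra.
- apply: (@le_trans _ _ (d%:R * (M * C * K))); last lra.
  apply: enorm_le_box => i; rewrite mxE normrN; apply: (bound (fun y => G y ord0 i)) => //.
    by move=> y; rewrite (le_trans (coord_le_enorm _ _)).
  by move=> y /phir py; rewrite (taylor2_min0 T phi0 py) mxE.
- rewrite (dotp_mollify_grad _ _ bu T phi0 phir) opprK.
  set N := enorm _.
  (* The remainder of the mollified function is [u] integrated against this remainder of [phi]. It
     is supported in two balls of radius [r], whence the volume 2 K. *)
  pose rem y := phi (y - z') - phi (y - z) + dotp (G (y - z)) (z' - z).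
  have bs1 (x : 'rV[R]_d) := bounded_supported_shift x bphi.
  have bs2 : bounded_supported (fun y => dotp (G (y - z)) (z' - z)).
    apply: bounded_supported_sum => i; under eq_fun do rewrite mulrC.
    by apply: bounded_supportedZ; exact: (bounded_supported_shift z (bG i)).
  have brem : bounded_supported rem.
    by apply: bounded_supportedD => //; exact: bounded_supportedB.
  rewrite -RintB; try exact: bounded_supportedM.
  rewrite -RintD; first last.
  - exact: bounded_supportedM.
  - by apply: bounded_supportedB; exact: bounded_supportedM.
  under eq_Rintegral do rewrite -mulrBr -mulrDr -/(rem _).
  have remC y : `|rem y| <= C * N ^+ 2.
    have := TT (y - z) (y - z').
    have E : y - z' - (y - z) = - (z' - z) by apply/rowP => j; rewrite !mxE; ring.
    by rewrite E dotpNr opprK enormN.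
  have A_r y : (eball z r `|` eball z' r) y -> enorm y <= r + enorm z + enorm z'.
    have e0 := enorm_ge0 z; have e1 := enorm_ge0 z'.
    by move=> []; rewrite /eball/=; [have := enormB_ge y z|have := enormB_ge y z']; lra.
  apply: (@le_trans _ _ (M * (C * N ^+ 2) * fine (lam (eball z r `|` eball z' r)))).
    apply: (@norm_Rint_le _ _ _ _ _ (r + enorm z + enorm z')) => //.
    - exact: bounded_supportedM.
    - by apply: measurableU; exact: measurable_eball.
    - by move=> y; rewrite normrM ler_pM.
    - move=> y /not_orP[]; rewrite /eball/= => /negP + /negP; rewrite -!leNgt => h1 h2.
      by rewrite /rem (phir _ h1) (phir _ h2) (taylor2_min0 T phi0 (phir _ h1)) dotp0l subrr addr0 mulr0.
  have KK : fine (lam (eball z r `|` eball z' r)) <= 2 * K.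
    have fK : lam (eball 0 r) = K%:E.
      by rewrite fineK// ge0_fin_numE//; exact: lebesgue_rV_eball_lty.
    rewrite -lee_fin fineK; last first.
      rewrite ge0_fin_numE//; apply: lebesgue_rV_bounded_lty A_r.
      by apply: measurableU; exact: measurable_eball.
    apply: (@le_trans _ _ (lam (eball z r) + lam (eball z' r))%E).
      by apply: measureU2; exact: measurable_eball.
    by rewrite !lebesgue_rV_eball_center fK -EFinD lee_fin; lra.
  have W0 : 0 <= M * (C * N ^+ 2) by rewrite !mulr_ge0 ?enorm_ge0.
  apply: (le_trans (ler_wpM2l W0 KK)).
  rewrite (_ : M * (C * N ^+ 2) * (2 * K) = 2 * (M * C * K) * N ^+ 2); last by ring.
  by rewrite ler_wpM2r ?sqr_ge0//; lra.
Qed.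

Lemma mollify_taylor2 u phi G (C r : R) : bounded_measurable u ->
  taylor2 phi G C -> (forall y, 0 <= phi y) -> (forall y, r <= enorm y -> phi y = 0) ->
  exists D, taylor2 (mollify u phi) (mollify_grad u G) D.
Proof.
move=> bu T phi0 phir; have [mu [M uM]] := bu.
have M0 : 0 <= M by exact: le_trans (uM 0).
by have [D HD] := mollify_taylor2_uniform M0 T phi0 phir; exists D; exact: HD.
Qed.

End mollification.

(** * Smooth bumps on boxes *)

Section bump_functions.
Context {R : realType} {d : nat}.
Local Notation lam := (lebesgue_rV R d).
Implicit Types (a b x z : 'rV[R]_d) (k : R).

(** For fixed [k] a smooth bump on the open box; as [k] grows it converges to the indicator of the
    box, which lets test functions detect null functions. *)
Definition box_bump k a b x : R :=
  \prod_i (flat 1 (k * x ord0 i + - (k * a ord0 i)) * flat 1 (- k * x ord0 i + k * b ord0 i)).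

Lemma flat1_ge0 (t : R) : 0 <= flat 1 t.
Proof. by rewrite /flat hornerC mul1r; case: ifP => // _; exact: expR_ge0. Qed.

Lemma flat1_le1 (t : R) : flat 1 t <= 1.
Proof.
rewrite /flat hornerC mul1r; case: ifP => // t0.
by rewrite -expR0 ler_expR oppr_le0 invr_ge0 ltW.
Qed.

Lemma flat1_gt0 (t : R) : (0 < flat 1 t) = (0 < t).
Proof. by rewrite /flat hornerC mul1r; case: ifP => t0; rewrite ?expR_gt0 ?ltxx. Qed.

Lemma flat1_cvg (t : R) : 0 < t -> (flat 1 (n.+1%:R * t) @[n --> \oo] --> (1 : R)).
Proof.
move=> t0; apply/cvgrPdist_le => e e0; near=> n.
have nt0 : 0 < n.+1%:R * t by rewrite mulr_gt0.
rewrite ger0_norm ?subr_ge0 ?flat1_le1// /flat nt0 hornerC mul1r.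
have := expR_ge1Dx (- (n.+1%:R * t)^-1).
suff h : (n.+1%:R * t)^-1 <= e by move=> h'; rewrite lerBlDr -lerBlDl (le_trans _ h')// lerB.
rewrite -[e]invrK lef_pV2 ?posrE ?invr_gt0// -ler_pdivrMr//.
rewrite (@le_trans _ _ n%:R) ?ler_nat//.
by near: n; exact: nbhs_infty_ger.
Unshelve. all: by end_near. Qed.

Lemma box_bump_ge0 k a b x : 0 <= box_bump k a b x.
Proof. by apply: prodr_ge0 => i _; rewrite mulr_ge0 ?flat1_ge0. Qed.

Lemma box_bump_le1 k a b x : box_bump k a b x <= 1.
Proof.
apply: (@le_trans _ _ (\prod_(i < d) 1)); last by rewrite big1_eq.
by apply: ler_prod => i _; rewrite mulr_ge0 ?flat1_ge0//= mulr_ile1 ?flat1_ge0 ?flat1_le1.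
Qed.

Lemma box_bump_gt0 k a b x : 0 < k -> open_box a b x -> 0 < box_bump k a b x.
Proof.
move=> k0 xab; apply: prodr_gt0 => i _; have /andP[ax xb] := xab i.
rewrite mulr_gt0// flat1_gt0; first by rewrite -mulrBr mulr_gt0// subr_gt0.
by rewrite mulNr addrC -mulrBr mulr_gt0// subr_gt0.
Qed.

Lemma box_bump_eq0 k a b x : 0 < k -> ~ open_box a b x -> box_bump k a b x = 0.
Proof.
move=> k0 /existsNP[i /negP]; rewrite negb_and -!leNgt => /orP[h|h].
  rewrite /box_bump (bigD1 i)//= (flat_le0 _ (t := _ + - _)) ?mul0r//.
  by rewrite subr_le0 ler_pM2l.
rewrite /box_bump (bigD1 i)//= (flat_le0 _ (t := - k * _ + _)) ?mulr0 ?mul0r//.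
by rewrite mulNr addrC subr_le0 ler_pM2l.
Qed.

Lemma box_bump_shift k a b x z : box_bump k a b (x - z) = box_bump k (a + z) (b + z) x.
Proof.
by apply: eq_bigr => i _; rewrite !mxE; congr (flat 1 _ * flat 1 _); ring.
Qed.

Lemma box_bump_smooth k a b : smooth (box_bump k a b).
Proof.
apply: smooth_prod => i n; apply: CkM; exact: smooth_flat.
Qed.

Lemma box_bump_taylor2 k a b : exists F C, taylor2 (box_bump k a b) F C.
Proof.
apply: taylor2_prod => i.
have [C T] := @taylor2_flat R d 1 k (- (k * a ord0 i)) i.
have [C' T'] := @taylor2_flat R d 1 (- k) (k * b ord0 i) i.
by eexists; eexists; exact: taylor2M T T'.
Qed.

Lemma box_bump_cvg a b x :
  box_bump n.+1%:R a b x @[n --> \oo] --> (\1_(open_box a b) x : R).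
Proof.
have [xab|xab] := pselect (open_box a b x); last first.
  rewrite indicE memNset//; apply: cvg_near_cst; apply: nearW => n.
  by apply: box_bump_eq0.
rewrite indicE mem_set// [X in _ --> X](_ : _ = \prod_(i < d) (1 : R)); last by rewrite big1_eq.
rewrite /box_bump; apply: (@cvg_big R _ _ 1 xpredT (@mul_continuous R)) => i _; rewrite -[X in _ --> X]mulr1; have /andP[ax xb] := xab i.
apply: cvgM.
  by under eq_fun do rewrite -mulrBr; apply: flat1_cvg; rewrite subr_gt0.
by under eq_fun do rewrite mulNr addrC -mulrBr; apply: flat1_cvg; rewrite subr_gt0.
Qed.

(** Smoothness is asked of every translate, since the test functions are the kernels centred at the
    various points of Omega. *)
Definition mollifier (r : R) (phi : 'rV[R]_d -> R) (G : 'rV[R]_d -> 'rV[R]_d) (C : R) :=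
  [/\ taylor2 phi G C, forall y, 0 <= phi y, forall y, r <= enorm y -> phi y = 0,
    \int[lam]_y phi y = 1 & forall z, smooth (fun y => phi (y - z))].

Lemma mollifier_exists (r : R) : 0 < r -> exists phi G C, mollifier r phi G C.
Proof.
move=> r0; pose s := r / (d%:R + 1).
have s0 : 0 < s by rewrite divr_gt0// ltr_wpDl.
pose b := box_bump 1 (0 - const_mx s) (0 + const_mx s).
have [G [C T]] := box_bump_taylor2 1 (0 - const_mx s) (0 + const_mx s).
have br y : r <= enorm y -> b y = 0.
  move=> ry; apply: box_bump_eq0 => //; rewrite open_box_center => ys.
  have : enorm y <= d%:R * s.
    by apply: enorm_le_box => i; have := ys i; rewrite subr0 => /ltW.
  have : d%:R * s < r by rewrite /s mulrA ltr_pdivrMr ?ltr_wpDl// mulrC ltr_pM2l// ltrDl.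
  lra.
have bb : bounded_supported b by exact: taylor2_bounded_supported T br.
pose Z := \int[lam]_y b y.
(* A zero integral would make the bump vanish almost everywhere, whereas it is positive on a box of
   positive measure. *)
have Z0 : 0 < Z.
  rewrite lt_neqAle Rintegral_ge0 ?andbT => [|y _]; last exact: box_bump_ge0.
  apply/negP => /eqP /esym Z0.
  have I0 : (\int[lam]_y (b y)%:E = 0)%E.
    rewrite -(@fineK _ (\int[lam]_y (b y)%:E)%E) -/(Rintegral _ _ _) -/Z ?Z0//.
    by have := bounded_supported_integrable bb; exact: integrable_fin_num.
  have mb : measurable_fun setT (EFin \o b) by apply/measurable_EFinP; case: bb.
  have := (ae_eq_integral_abs lam measurableT mb).1.
  have -> : (\int[lam]_x `|(EFin \o b) x| = 0)%E.
    by rewrite -I0; apply: eq_integral => y _; rewrite gee0_abs// lee_fin box_bump_ge0.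
  move=> /(_ erefl) [A [mA A0 bA]].
  have : (0 < lam (open_box (0 - const_mx s : 'rV[R]_d) (0 + const_mx s)))%E.
    rewrite lebesgue_rV_box => [|i]; last by rewrite !mxE; lra.
    by rewrite lte_fin; apply: prodr_gt0 => i _; rewrite !mxE; lra.
  have : (lam (open_box (0 - const_mx s : 'rV[R]_d) (0 + const_mx s)) <= lam A)%E.
    apply: le_measure; rewrite ?inE//; first exact: measurable_box.
    move=> y ys; apply: bA => /(_ I) [] /eqP; rewrite gt_eqF//.
    exact: box_bump_gt0.
  by rewrite A0 => /le_lt_trans h /h; rewrite ltxx.
exists (fun y => Z^-1 * b y), (fun y => Z^-1 *: G y), (`|Z^-1| * C); split.
- exact: taylor2Z.
- by move=> y; rewrite mulr_ge0 ?invr_ge0 ?(ltW Z0) ?box_bump_ge0.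
- by move=> y /br ->; rewrite mulr0.
- by rewrite RintZ// mulVf// gt_eqF.
- move=> z k; apply: CkM; first exact: Ck_cst.
  rewrite (_ : (fun y : 'rV_d => b (y - z)) = box_bump 1 (0 - const_mx s + z) (0 + const_mx s + z)).
    exact: box_bump_smooth.
  by apply/funext => y; rewrite /b box_bump_shift.
Qed.

End bump_functions.

(** * Geometry of C^2 domains and Lipschitz functions *)

Section strict_differentiability.
Context {R : realType} {d : nat}.
Implicit Types (f : 'rV[R]_d -> R) (x y z v : 'rV[R]_d).

Lemma is_derive_line f z v (t df : R) : is_derive (z + t *: v) v f df ->
  is_derive t (1 : R) (fun t => f (z + t *: v)) df.
Proof.
move=> [dfv <-].
have E : (fun h : R => h^-1 *: (((fun t => f (z + t *: v)) \o shift t) (h *: 1) - f (z + t *: v))) =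
    (fun h : R => h^-1 *: ((f \o shift (z + t *: v)) (h *: v) - f (z + t *: v))).
  apply/funext => h /=; congr (_ *: (f _ - _)).
  by rewrite [h%:A]mulr1 scalerDl addrCA.
by apply: DeriveDef; [rewrite /derivable E|rewrite /derive E].
Qed.

Let path x y k : 'rV[R]_d := \row_i (if (i < k)%N then y ord0 i else x ord0 i).

(** Going from [x] to [y] one coordinate at a time, the mean value theorem compares each step with a
    partial derivative at [x0]. Both ends vary, which is what the estimate along chords near the
    boundary needs. *)
Lemma Ck1_strict_derivative f x0 : Ck 1 f -> exists G : 'rV[R]_d, forall e : R, 0 < e ->
  exists2 r : R, 0 < r & forall x y, enorm (x - x0) < r -> enorm (y - x0) < r ->
    `|f y - f x - dotp G (y - x)| <= e * enorm (y - x).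
Proof.
move=> [_ Hf]; exists (\row_i 'D_(delta_mx 0 i) f x0) => e e0.
pose e' := e / (d%:R + 1); have e'0 : 0 < e' by rewrite divr_gt0// ltr_wpDl.
have [r r0 Hr] : exists2 r : R, 0 < r & forall i z, enorm (z - x0) < r ->
    `|'D_(delta_mx 0 i) f z - 'D_(delta_mx 0 i) f x0| < e'.
  have H i : exists r : R, 0 < r /\ forall z, enorm (z - x0) < r ->
      `|'D_(delta_mx 0 i) f z - 'D_(delta_mx 0 i) f x0| < e'.
    have [_ [cD _]] := Hf i.
    by have /continuous_enormP/(_ x0 e' e'0)[r r0 Hr] := cD; exists r.
  have [rr Hrr] := choice H.
  exists (\big[Num.min/1]_i rr i) => [|i z zr].
    by apply/bigmin_gtP; split=> // i _; have [] := Hrr i.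
  have [_] := Hrr i; apply; rewrite (lt_le_trans zr)//.
  exact: bigmin_le_cond.
(* An intermediate point has each coordinate within 3 r' of that of [x0]: r' for [x], and at most 2
   r' for the displacement along the current axis. *)
pose r' := r / (3 * (d%:R + 1)).
have d1 : 0 < d%:R + 1 :> R by rewrite ltr_wpDl.
have r'0 : 0 < r' by rewrite divr_gt0// mulr_gt0.
have dr' : d%:R * (3 * r') < r.
  rewrite (_ : 3 * r' = r / (d%:R + 1)); last by rewrite /r'; field; rewrite gt_eqF.
  by rewrite mulrA ltr_pdivrMr// mulrC ltr_pM2l// ltrDl.
exists r' => // x y xr yr.
have step (k : 'I_d) : `|f (path x y k.+1) - f (path x y k) - 'D_(delta_mx 0 k) f x0 * (y ord0 k - x ord0 k)|
    <= e' * enorm (y - x).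
  pose h t := f (path x y k + t *: delta_mx 0 k).
  have dh t : is_derive t (1 : R) h ('D_(delta_mx 0 k) f (path x y k + t *: delta_mx 0 k)).
    by apply: is_derive_line; apply: DeriveDef => //; have [] := Hf k.
  pose T := y ord0 k - x ord0 k.
  have hT : h T = f (path x y k.+1).
    congr f; apply/rowP => j; rewrite !mxE eqxx/= ltnS -val_eqE /=.
    have [jk|jk|jk] := ltngtP (j : nat) k; rewrite ?mulr0 ?addr0//.
    by rewrite mulr1 /T (val_inj jk) addrC subrK.
  have h0 : h 0 = f (path x y k) by rewrite /h scale0r addr0.
  have [t tT E] := MVT_total dh T 0.
  rewrite -hT -h0 E subr0 -mulrBl normrM ler_pM//; last first.
    by have := coord_le_enorm (y - x) k; rewrite !mxE.
  apply/ltW/Hr/(le_lt_trans _ dr'); apply: enorm_le_box => j.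
  rewrite !mxE eqxx/= -val_eqE /=.
  have xj : `|x ord0 j - x0 ord0 j| <= r'.
    by rewrite ltW// (le_lt_trans _ xr)//; have := coord_le_enorm (x - x0) j; rewrite !mxE.
  have yj : `|y ord0 j - x0 ord0 j| <= r'.
    by rewrite ltW// (le_lt_trans _ yr)//; have := coord_le_enorm (y - x0) j; rewrite !mxE.
  have [jk|jk|jk] := ltngtP (j : nat) k; rewrite ?mulr0 ?addr0; [lra..|].
  rewrite mulr1; have {}jk := val_inj jk.
  have Tr : `|T| <= 2 * r'.
    rewrite /T -jk -(subrK (x0 ord0 j) (y ord0 j)) -addrA.
    by rewrite (le_trans (ler_normD _ _))// [`|x0 _ _ - _|]distrC; lra.
  rewrite (_ : _ - x0 ord0 j = x ord0 j - x0 ord0 j + t); last by rewrite /=; ring.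
  by rewrite (le_trans (ler_normD _ _))//; move: tT; rewrite !subr0; lra.
have -> : f y - f x - dotp (\row_i 'D_(delta_mx 0 i) f x0) (y - x) =
  \sum_(k < d) (f (path x y k.+1) - f (path x y k) - 'D_(delta_mx 0 k) f x0 * (y ord0 k - x ord0 k)).
  rewrite big_split/= -(big_mkord xpredT (fun k => f (path x y k.+1) - f (path x y k))).
  rewrite telescope_sumr//; congr (f _ - f _ + _).
  - by apply/rowP => i; rewrite mxE ltn_ord.
  - by apply/rowP => i; rewrite mxE.
  - by rewrite -sumrN; apply: eq_bigr => i _; rewrite !mxE.
rewrite (le_trans (ler_norm_sum _ _ _))// (le_trans (ler_sum _ (fun k _ => step k)))//.
rewrite sumr_const card_ord -mulr_natl mulrA ler_wpM2r ?enorm_ge0//.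
by rewrite /e' mulrA ler_pdivrMr ?ltr_wpDl// mulrC ler_pM2l// lerDl.
Qed.

End strict_differentiability.

Lemma convex_lt {R : realFieldType} (tau a b r : R) : 0 <= tau -> tau <= 1 ->
  a < r -> b < r -> (1 - tau) * a + tau * b < r.
Proof. by move=> t0 t1 ar br; have [t|t] := leP tau 2^-1; nra. Qed.

Section pushing_inwards.
Context {R : realType} {d : nat}.
Implicit Types (Omega : set 'rV[R]_d) (x y w : 'rV[R]_d) (eps rho alpha t tau : R).

(* Segments between points of [Omega] near [x0], once pushed by [t] in a fixed
   direction [e], lie in [Omega] together with a tube of radius [alpha * t]. *)
Definition pushable Omega eps x0 rho alpha := exists2 e : 'rV[R]_d, enorm e <= 1 &
  forall x y t tau w, Omega x -> Omega y -> enorm (x - x0) < rho -> enorm (y - x0) < rho ->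
    eps * enorm (y - x) <= t -> t <= rho -> 0 <= tau <= 1 -> enorm w <= alpha * t ->
    Omega (x + tau *: (y - x) + t *: e + w).

Lemma pushable_interior Omega eps x0 : 0 < eps -> open Omega -> Omega x0 ->
  exists rho alpha, [/\ 0 < rho, 0 < alpha & pushable Omega eps x0 rho alpha].
Proof.
move=> eps0 oO Ox0; have [r r0 rO] := open_eballP oO Ox0.
exists (r / 4), 1; split=> //; first lra.
exists 0; first by rewrite enorm0.
move=> x y t tau w Ox Oy xr yr ext tr /andP[tau0 tau1] wt.
apply: rO; rewrite /eball/= scaler0 addr0 mul1r in wt *.
rewrite (_ : _ - x0 = (1 - tau) *: (x - x0) + tau *: (y - x0) + w); last first.
  by apply/rowP => i; rewrite !mxE; ring.
rewrite (le_lt_trans (enormD _ _))// (le_lt_trans (lerD (enormD _ _) wt))//.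
rewrite !enormZ !ger0_norm ?subr_ge0//.
have := enorm_ge0 (x - x0); have := enorm_ge0 (y - x0); nra.
Qed.

(** The push follows the vertical direction of the chart. It gains height [t], of which the excess
    of [gamma] over its chord costs at most t / 4 and the displacement [w] at most t / 2. *)
Lemma pushable_boundary Omega eps x0 : 0 < eps -> C2_boundary Omega ->
  (closure Omega `\` interior Omega) x0 ->
  exists rho alpha, [/\ 0 < rho, 0 < alpha & pushable Omega eps x0 rho alpha].
Proof.
move=> eps0 C2 bx0; have [r [e [gamma [r0 e1 Cg inv chart]]]] := C2 _ bx0.
have [G HG] := Ck1_strict_derivative x0 (Ck_pred Cg).
pose eps' := Num.min 1 (eps / 4).
have eps'0 : 0 < eps' by rewrite lt_min ltr01 divr_gt0.
have eps'1 : eps' <= 1 by rewrite ge_min lexx.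
have eps'4 : eps' <= eps / 4 by rewrite ge_min lexx orbT.
have [r' r'0 Hr'] := HG eps' eps'0.
pose L := enorm G + 1; have L0 : 0 <= L by rewrite addr_ge0// enorm_ge0.
(* [w] changes the height by at most |w| and [gamma] by at most L |w|, so this ratio limits the cost
   to t / 2. *)
pose alpha := (2 * (1 + L))^-1.
have alpha0 : 0 < alpha by rewrite invr_gt0; lra.
have alphaL : alpha * (1 + L) = 2^-1 by rewrite /alpha; field; rewrite gt_eqF//; lra.
have alpha1 : alpha <= 2^-1 by nra.
pose rho := Num.min r r' / 3.
have rho0 : 0 < rho by rewrite divr_gt0// lt_min r0.
have rhor : 3 * rho <= r by rewrite /rho mulrC divfK// ge_min lexx.
have rhor' : 3 * rho <= r' by rewrite /rho mulrC divfK// ge_min lexx orbT.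
have rho1 : rho < r' by lra.
have rho2 : 2 * rho <= r' by lra.
exists rho, alpha; split=> //; exists e; first by rewrite e1.
move=> x y t tau w Ox Oy xr yr ext tr /andP[tau0 tau1] wt.
have N0 := enorm_ge0 (y - x).
have t0 : 0 <= t by rewrite (le_trans _ ext)// mulr_ge0// ltW.
set z := x + tau *: (y - x).
have zx0 : enorm (z - x0) < rho.
  rewrite (_ : _ - x0 = (1 - tau) *: (x - x0) + tau *: (y - x0)); last first.
    by apply/rowP => i; rewrite !mxE; ring.
  rewrite (le_lt_trans (enormD _ _))// !enormZ !ger0_norm ?subr_ge0//.
  exact: convex_lt.
have wrho : enorm w < rho.
  by rewrite (le_lt_trans wt)//; nra.
have zw : enorm (z + w - x0) < 2 * rho.
  by rewrite addrAC (le_lt_trans (enormD _ _))//; lra.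
have te : enorm (t *: e) = t by rewrite enormZ e1 mulr1 ger0_norm.
apply/chart.
  rewrite /eball/= (_ : _ - x0 = (z + w - x0) + t *: e); last first.
    by apply/rowP => i; rewrite !mxE; ring.
  by rewrite (le_lt_trans (enormD _ _))// te; lra.
rewrite (_ : z + t *: e + w = z + w + t *: e); last by rewrite addrAC.
rewrite inv (dotpDl (z + w)) (dotpDl z) dotpZl -[dotp e e]sqr_enorm e1 expr1n mulr1.
have /chart gx : eball x0 r x by rewrite /eball/=; lra.
have /chart gy : eball x0 r y by rewrite /eball/=; lra.
have {}gx := gx.1 Ox; have {}gy := gy.1 Oy.
have zE : dotp z e = (1 - tau) * dotp x e + tau * dotp y e.
  by rewrite /z dotpDl dotpZl dotpBl; ring.
have h1 : `|gamma z - gamma x - dotp G (z - x)| <= eps' * enorm (z - x).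
  by apply: Hr'; [exact: lt_trans xr rho1|exact: lt_trans zx0 rho1].
have h2 : `|gamma z - gamma y - dotp G (z - y)| <= eps' * enorm (z - y).
  by apply: Hr'; [exact: lt_trans yr rho1|exact: lt_trans zx0 rho1].
have h3 : `|gamma (z + w) - gamma z - dotp G (z + w - z)| <= eps' * enorm (z + w - z).
  by apply: Hr'; [exact: lt_trans zx0 rho1|exact: lt_le_trans zw rho2].
have zx : z - x = tau *: (y - x) by rewrite /z addrC addKr.
have zy : z - y = - ((1 - tau) *: (y - x)).
  by apply/rowP => i; rewrite !mxE; ring.
have zwz : z + w - z = w by rewrite addrC addKr.
have t1 : 0 <= 1 - tau by rewrite subr_ge0.
rewrite zx enormZ (ger0_norm tau0) dotpZr in h1.
rewrite zy enormN enormZ (ger0_norm t1) dotpNr dotpZr in h2.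
rewrite zwz in h3.
have Gw := normr_dotp_le G w.
set N := enorm (y - x) in N0 h1 h2 ext *; set W := enorm w in wt wrho h3 Gw *.
have W0 : 0 <= W by exact: enorm_ge0.
have we := normr_dotp_le w e; rewrite e1 mulr1 -/W in we.
clear xr yr zx0 wrho zw te rho0 rhor rhor' tr zx zy zwz r0.
have gw : gamma (z + w) <= gamma z + L * W.
  have := ler_norm (dotp G w); move: h3; rewrite ler_norml => /andP[_]; rewrite /L; nra.
(* The expansions at [z] from both ends, weighted by 1 - tau and tau, have linear parts that
   cancel. *)
have gz : gamma z <= (1 - tau) * gamma x + tau * gamma y + eps' * N.
  move: h1 h2; rewrite !ler_norml => /andP[_ h1] /andP[_ h2].
  have h1' := ler_wpM2l t1 h1; have h2' := ler_wpM2l tau0 h2.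
  have eN : 0 <= eps' * N by rewrite mulr_ge0// ltW.
  have tt : tau * (1 - tau) <= 2^-1 by nra.
  have : 2 * (tau * (1 - tau)) * (eps' * N) <= 1 * (eps' * N) by apply: ler_wpM2r => //; lra.
  lra.
have gxy : (1 - tau) * gamma x + tau * gamma y < dotp z e.
  rewrite zE; have [->|tau0'] := eqVneq tau 0; first by rewrite !mul0r !addr0 subr0 !mul1r.
  by rewrite ler_ltD// ?ler_wpM2l ?ltr_pM2l ?subr_ge0//; [exact: ltW|rewrite lt_neqAle eq_sym tau0'].
have eNt : eps' * N <= t / 4.
  rewrite ler_pdivlMr// (le_trans _ ext)// mulrAC ler_wpM2r//; lra.
have WL : (1 + L) * W <= t / 2.
  by rewrite (le_trans (ler_wpM2l _ wt))//; [lra|rewrite mulrA (mulrC _ alpha) alphaL; lra].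
have := ler_norm (- dotp w e); rewrite normrN; lra.
Qed.

Lemma pushable_shrink Omega eps x0 x1 rho rho' alpha alpha' : 0 < eps ->
  enorm (x1 - x0) <= rho / 2 -> rho' <= rho / 2 -> alpha' <= alpha ->
  pushable Omega eps x0 rho alpha -> pushable Omega eps x1 rho' alpha'.
Proof.
move=> eps0 x10 rr aa [e e1 H]; exists e => // x y t tau w Ox Oy xr yr ext tr tau01 wt.
have t0 : 0 <= t by rewrite (le_trans _ ext)// mulr_ge0 ?enorm_ge0// ltW.
have rho0 : 0 <= rho by have := enorm_ge0 (x1 - x0); lra.
apply: H => //.
- by rewrite (le_lt_trans (enorm_triangle x1 _ _))//; lra.
- by rewrite (le_lt_trans (enorm_triangle x1 _ _))//; lra.
- lra.
- by rewrite (le_trans wt)// ler_wpM2r.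
Qed.

Lemma domain_bounded (Omega : C2_domain R d) :
  exists2 M : R, 0 < M & forall x, domain_set Omega x -> enorm x <= M.
Proof.
have [M [_ HM]] := @dom_bounded _ _ Omega.
exists (d%:R * (`|M| + 1) + 1); first by rewrite ltr_wpDl// mulr_ge0// addr_ge0.
move=> x Ox; rewrite (le_trans (enorm_le_norm x))//.
have := HM (`|M| + 1) _ x Ox => /(_ _)/le_trans H.
rewrite (@le_trans _ _ (d%:R * (`|M| + 1))) ?lerDl// ler_wpM2l//.
by apply: H => //; rewrite ltr_pwDr// ler_norm.
Qed.

Lemma domain_closure_compact (Omega : C2_domain R d) : compact (closure (domain_set Omega)).
Proof.
apply: bounded_closed_compact; last exact: closed_closure.
have [M M0 HM] := domain_bounded Omega.
exists (M + 1); split; first exact: num_real.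
move=> M' MM' x cx; rewrite /= (le_trans (norm_le_enorm x))//.
have [y [Oy yx]] := cx _ (nbhs_eball x ltr01).
have := HM y Oy; have := enormB_ge x y; move: yx; rewrite /eball/= enormB; lra.
Qed.

(** The constants become uniform by compactness of the closure. *)
Lemma C2_domain_pushable (Omega : C2_domain R d) eps : 0 < eps ->
  exists rho alpha, [/\ 0 < rho, 0 < alpha &
    forall x0, domain_set Omega x0 -> pushable (domain_set Omega) eps x0 rho alpha].
Proof.
move=> eps0; set O := domain_set Omega; have oO : open O := @dom_open _ _ Omega.
have cO : compact (closure O).
  exact: domain_closure_compact.
have /compact_near_coveringP nc := cO.
(* Both constants are replaced by a single small [s], the form to which the near-covering
   characterization of compactness applies. *)
have Hs : \forall s \near (0 : R)^'+, closure O `<=` (fun x => pushable O eps x s s).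
  apply: nc => x0 cx0.
  have [rho [alpha [rho0 alpha0 H]]] : exists rho alpha,
      [/\ 0 < rho, 0 < alpha & pushable O eps x0 rho alpha].
    have [Ox0|Ox0] := pselect (O x0); first exact: pushable_interior.
    apply: pushable_boundary => //; first exact: dom_C2.
    by split=> // /interior_subset.
  pose m := Num.min (rho / 2) alpha; have m0 : 0 < m by rewrite lt_min alpha0 divr_gt0.
  exists (eball x0 (rho / 2), [set s : R | s <= m]) => /=.
    split; first by apply: nbhs_eball; exact: divr_gt0.
    by apply: nbhs_right_le.
  move=> [x s] /= [xx0 sm]; apply: (pushable_shrink eps0 _ _ _ H).
  - exact: ltW.
  - by rewrite (le_trans sm)// ge_min lexx.
  - by rewrite (le_trans sm)// ge_min lexx orbT.
have [s [s0 sH]] : exists s : R, 0 < s /\ closure O `<=` (fun x => pushable O eps x s s).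
  near (0 : R)^'+ => s; exists s; split; first by near: s; exact: nbhs_right_gt.
  by near: s.
by exists s, s; split=> // x0 Ox0; apply: sH; exact: subset_closure.
Unshelve. all: by end_near. Qed.

End pushing_inwards.

Section locally_lipschitz.
Context {R : realType} {d : nat}.
Implicit Types (O D : set 'rV[R]_d) (w f : 'rV[R]_d -> R) (x y z : 'rV[R]_d) (L : R).

(* For a continuous [w], this amounts to [|grad w| <= L] almost everywhere. *)
Definition locally_lipschitz_on O L w := forall x (r : R), eball x r `<=` O ->
  forall y z, eball x r y -> eball x r z -> `|w z - w y| <= L * enorm (z - y).

Lemma locally_lipschitz_on_le O L L' w : L <= L' ->
  locally_lipschitz_on O L w -> locally_lipschitz_on O L' w.
Proof.
move=> LL H x r xO y z ry rz; rewrite (le_trans (H x r xO y z ry rz))//.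
by rewrite ler_wpM2r// enorm_ge0.
Qed.

Lemma locally_lipschitz_segment O L w p q (r : R) : 0 < r ->
  locally_lipschitz_on O L w ->
  (forall t, 0 <= t <= 1 -> eball (p + t *: (q - p)) r `<=` O) ->
  `|w q - w p| <= L * enorm (q - p).
Proof.
move=> r0 wL pq; have N0 := enorm_ge0 (q - p); set N := enorm _ in N0 *.
pose h t := w (p + t *: (q - p)).
have -> : w q = h 1 by rewrite /h scale1r addrC subrK.
have -> : w p = h 0 by rewrite /h scale0r addr0.
have r'0 : 0 < r / (2 * (N + 1)) by rewrite divr_gt0//; lra.
apply: (chain_le r'0) => s t s01 t01.
rewrite ler_pdivlMr; last lra.
move=> st; have E : p + s *: (q - p) - (p + t *: (q - p)) = (s - t) *: (q - p).
  by rewrite opprD addrACA subrr add0r scalerBl.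
have := wL _ _ (pq t t01) (p + t *: (q - p)) (p + s *: (q - p)).
rewrite E enormZ -/N mulrCA mulrA (mulrC `|_|) mulrAC; apply; first exact: eball_center.
by rewrite /eball/= E enormZ -/N; have := normr_ge0 (s - t); nra.
Qed.

(** The two moves of a detour: vertically along the push, then across between pushed points, where
    the segment keeps a margin [alpha * t] inside [O]. *)
Lemma pushable_vertical O eps x0 rho alpha L w : open O -> 0 < eps -> 0 < alpha ->
  locally_lipschitz_on O L w -> pushable O eps x0 rho alpha ->
  exists2 e : 'rV[R]_d, enorm e <= 1 &
  [/\ (forall x t, O x -> enorm (x - x0) < rho -> 0 <= t -> t <= rho ->
       `|w (x + t *: e) - w x| <= `|L| * t) &
    (forall x y t, O x -> O y -> enorm (x - x0) < rho -> enorm (y - x0) < rho ->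
       0 < t -> eps * enorm (y - x) <= t -> t <= rho ->
       `|w (y + t *: e) - w (x + t *: e)| <= L * enorm (y - x))].
Proof.
move=> oO eps0 alpha0 wL [e e1 H]; exists e => //; split=> [x t Ox xx0 t0 tr|x y t Ox Oy xr yr t0 ext tr].
  have [r r0 rO] := open_eballP oO Ox.
  pose m := Num.min (r / 2) (alpha * (r / 2)).
  have m0 : 0 < m by rewrite lt_min ?mulr_gt0//; lra.
  have mr : m <= r / 2 by rewrite ge_min lexx.
  have ma : m <= alpha * (r / 2) by rewrite ge_min lexx orbT.
  have := @locally_lipschitz_segment O L w x (x + t *: e) m m0 wL.
  rewrite (addrC x) addrK => /(_ _)/le_trans; apply; last first.
    rewrite enormZ (ger0_norm t0) (le_trans (ler_wpM2r _ (ler_norm L)))//.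
      by rewrite mulr_ge0// enorm_ge0.
    by rewrite ler_wpM2l// ler_piMr.
  move=> s /andP[s0 s1] y; rewrite /eball/= => ys.
  have st0 : 0 <= s * t by rewrite mulr_ge0.
  have ste : enorm (s *: (t *: e)) <= s * t.
    by rewrite scalerA enormZ ger0_norm// ler_piMr.
  (* Close to [x] the room is that of a ball around [x], which may touch the boundary later; further
     up it is the tube of [pushable], of radius proportional to the height. *)
  have [str|str] := ltP (s * t) (r / 2).
    apply: rO; rewrite /eball/= -(subrK (x + s *: (t *: e)) y) -addrA.
    have E : x + s *: (t *: e) - x = s *: (t *: e) by rewrite addrC addKr.
    by rewrite (le_lt_trans (enormD _ _))// E; lra.
  have -> : y = x + 0 *: (x - x) + (s * t) *: e + (y - (x + s *: (t *: e))).
    by apply/rowP => i; rewrite !mxE; ring.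
  apply: H => //; rewrite ?subrr ?enorm0 ?mulr0 ?lexx ?ler01//.
    by rewrite (le_trans _ tr)// ler_piMl.
  rewrite ltW// (lt_le_trans ys)// (le_trans ma)// ler_wpM2l// ltW//.
have := @locally_lipschitz_segment O L w (x + t *: e) (y + t *: e) (alpha * t).
rewrite opprD addrACA subrr addr0; apply; first exact: mulr_gt0.
  exact: wL.
move=> s s01 z; rewrite /eball/= => zs.
have -> : z = x + s *: (y - x) + t *: e + (z - (x + t *: e + s *: (y - x))).
  by apply/rowP => i; rewrite !mxE; ring.
by apply: H => //; exact: ltW.
Qed.

(** Going up by eps' |y - x|, across and down multiplies the length by 1 + 2 eps'. The local slope
    is therefore almost a true Lipschitz constant at small scale, up to the boundary. *)
Lemma domain_almost_lipschitz (Omega : C2_domain R d) (eps : R) : 0 < eps ->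
  exists2 h : R, 0 < h & forall L w, 0 <= L -> locally_lipschitz_on (domain_set Omega) L w ->
  forall x y, domain_set Omega x -> domain_set Omega y -> enorm (y - x) <= h ->
  `|w y - w x| <= L * (1 + eps) * enorm (y - x).
Proof.
move=> eps0; pose eps' := Num.min 1 (eps / 2).
have eps'0 : 0 < eps' by rewrite lt_min ltr01 divr_gt0.
have eps'1 : eps' <= 1 by rewrite ge_min lexx.
have eps'e : eps' <= eps / 2 by rewrite ge_min lexx orbT.
have [rho [alpha [rho0 alpha0 P]]] := C2_domain_pushable Omega eps'0.
exists (rho / 2); first exact: divr_gt0.
move=> L w L0 wL x y Ox Oy xy.
have [->|yx] := eqVneq y x; first by rewrite !subrr enorm0 normr0 mulr0.
have [e e1 [V H]] := pushable_vertical (@dom_open _ _ Omega) eps'0 alpha0 wL (P x Ox).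
set N := enorm (y - x) in xy *; have N0 : 0 < N by rewrite enorm_gt0 subr_eq0.
pose t := eps' * N; have t0 : 0 < t by rewrite mulr_gt0.
have trho : t <= rho by rewrite /t; nra.
have xx : enorm (x - x) < rho by rewrite subrr enorm0.
have yx' : enorm (y - x) < rho by rewrite -/N; lra.
have h1 := V x t Ox xx (ltW t0) trho; have h2 := V y t Oy yx' (ltW t0) trho.
have h3 := H x y t Ox Oy xx yx' t0 (lexx _) trho.
rewrite (ger0_norm L0) -/N in h1 h2 h3.
have -> : w y - w x = (w (y + t *: e) - w (x + t *: e)) - (w (y + t *: e) - w y) + (w (x + t *: e) - w x).
  by ring.
rewrite (le_trans (ler_normD _ _))// (le_trans (lerD (le_trans (ler_normB _ _) (lerD h3 h2)) h1))//.
rewrite /t (_ : _ + _ + _ = L * N * (1 + 2 * eps')); last by ring.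
rewrite [leRHS]mulrAC ler_wpM2l ?mulr_ge0 ?(ltW N0)//; lra.
Qed.

(* A McShane extension whose cone [L'' |z - y|] is made much steeper beyond the
   scale [h / 4]: far away points of [D] become irrelevant, so that near [D] the
   infimum is local and has the slope of [w] at small scale. *)
Lemma lipschitz_extension D w (M L h delta : R) : D !=set0 -> 0 <= L -> 0 < h -> 0 < delta ->
  (forall y, D y -> `|w y| <= M) ->
  (forall x y, D x -> D y -> enorm (y - x) <= h -> `|w y - w x| <= L * enorm (y - x)) ->
  exists (U : 'rV[R]_d -> R) (K tau h' : R), [/\ 0 <= K /\ forall x y, `|U y - U x| <= K * enorm (y - x),
    forall x, `|U x| <= M, forall y, D y -> U y = w y, 0 < tau /\ 0 < h' &
    forall z z' y, D y -> enorm (z - y) < tau -> enorm (z' - z) <= h' ->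
      U z' <= U z + (L + delta) * enorm (z' - z)].
Proof.
move=> [x0 Dx0] L0 h0 delta0 wM wL.
have M0 : 0 <= M by exact: le_trans (wM x0 Dx0).
pose L2 := L + delta; have L20 : 0 < L2 by rewrite /L2; lra.
(* Replacing a competitor at distance at least h / 8 by the nearby [y0] costs at most (L + L2) tau,
   which the extra slope [delta] recovers over that distance. *)
pose tau := Num.min (h / 8) (delta * h / (8 * (L + L2))).
have LL2 : 0 < 8 * (L + L2) by lra.
have tau0 : 0 < tau by rewrite lt_min !divr_gt0// mulr_gt0.
have tauh : tau <= h / 8 by rewrite ge_min lexx.
have taud : (L + L2) * tau <= delta * h / 8.
  have : tau <= delta * h / (8 * (L + L2)) by rewrite ge_min lexx orbT.
  rewrite ler_pdivlMr// => H; rewrite ler_pdivlMr//; lra.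
(* With this slope beyond h / 4, the cone exceeds the oscillation 2 M of [w], with room to spare,
   from distance 3 h / 4 on. *)
pose B := 2 * (2 * M + L2 * h + 1) / h.
have B0 : 0 < B.
  have L2h : 0 < L2 * h by rewrite mulr_gt0.
  by rewrite divr_gt0// mulr_gt0//; lra.
have Bh : B * (h / 2) = 2 * M + L2 * h + 1 by rewrite /B; field; rewrite gt_eqF.
pose c z y := L2 * enorm (z - y) + B * Num.max (enorm (z - y) - h / 4) 0.
have c0 z y : 0 <= c z y.
  by rewrite addr_ge0// mulr_ge0 ?enorm_ge0 ?(ltW L20) ?(ltW B0)// le_max lexx orbT.
have cnear z y : enorm (z - y) <= h / 4 -> c z y = L2 * enorm (z - y).
  by move=> zy; rewrite /c (max_idPr _) ?mulr0 ?addr0// subr_le0.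
have cge z y : L2 * enorm (z - y) <= c z y.
  by rewrite lerDl mulr_ge0 ?(ltW B0)// le_max lexx orbT.
have cfar z y : 3 * h / 4 <= enorm (z - y) -> 2 * M + L2 * h + 1 <= c z y.
  move=> zy; rewrite -Bh -[leLHS]add0r lerD//; first by rewrite mulr_ge0 ?enorm_ge0 ?ltW.
  by rewrite ler_wpM2l ?(ltW B0)// le_max; apply/orP; left; lra.
have clip z z' y : c z' y <= c z y + (L2 + B) * enorm (z' - z).
  have t := enorm_triangle z z' y.
  have m : Num.max (enorm (z' - y) - h / 4) 0 <= Num.max (enorm (z - y) - h / 4) 0 + enorm (z' - z).
    rewrite ge_max; apply/andP; split.
      have : enorm (z - y) - h / 4 <= Num.max (enorm (z - y) - h / 4) 0 by rewrite le_max lexx.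
      lra.
    by rewrite addr_ge0 ?enorm_ge0// le_max lexx orbT.
  rewrite /c; have := ler_wpM2l (ltW B0) m; have := ler_wpM2l (ltW L20) t; lra.
pose S z := [set w y + c z y | y in D].
pose V z := inf (S z).
have Slb z : lbound (S z) (- M).
  move=> _ [y Dy <-]; have := wM y Dy; rewrite ler_norml => /andP[wy _].
  by have := c0 z y; lra.
have Sinf z : has_inf (S z) by split; [exists (w x0 + c z x0), x0|exists (- M)].
have Vle z y : D y -> V z <= w y + c z y.
  by move=> Dy; apply: ge_inf; [exists (- M)|exists y].
have Vge z a : (forall y, D y -> a <= w y + c z y) -> a <= V z.
  by move=> H; apply: lb_le_inf; [exists (w x0 + c z x0), x0|move=> _ [y Dy <-]; exact: H].
have VD y : D y -> V y = w y.
  move=> Dy; apply/eqP; rewrite eq_le; apply/andP; split.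
    by rewrite (le_trans (Vle y y Dy))// cnear subrr enorm0 ?mulr0 ?addr0//; lra.
  apply: Vge => z Dz; have [yz|yz] := leP (enorm (y - z)) h.
    have := wL z y Dz Dy yz; rewrite ler_norml => /andP[_ H].
    have := cge y z; have := enorm_ge0 (y - z); rewrite /L2; nra.
  have := cfar y z; have := wM y Dy; have := wM z Dz; rewrite !ler_norml => /andP[z1 z2] /andP[y1 y2].
  move=> /(_ _); have L2h : 0 <= L2 * h by rewrite mulr_ge0 ?ltW.
  by move=> H; have := H (_ : 3 * h / 4 <= enorm (y - z)); lra.
have Vlip z z' : V z' <= V z + (L2 + B) * enorm (z' - z).
  rewrite -lerBlDr; apply: Vge => y Dy; rewrite lerBlDr (le_trans (Vle z' y Dy))//.
  by have := clip z z' y; lra.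
(* A competitor [y] within h / 8 of [z] is also reached from [z'] by the gentle part of the cone;
   any other competitor is beaten by [y0]. *)
have Vloc z z' y0 : D y0 -> enorm (z - y0) < tau -> enorm (z' - z) <= h / 8 ->
    V z' <= V z + L2 * enorm (z' - z).
  move=> Dy0 zy0 zz'; rewrite -lerBlDr; apply: Vge => y Dy; rewrite lerBlDr.
  have [zy|zy] := ltP (enorm (z - y)) (h / 8).
    have t := enorm_triangle z z' y.
    rewrite (le_trans (Vle z' y Dy))// cnear; last lra.
    by have := cge z y; have := ler_wpM2l (ltW L20) t; lra.
  have t := enorm_triangle z z' y0.
  rewrite (le_trans (Vle z' y0 Dy0))// cnear; last lra.
  have t' : L2 * enorm (z' - y0) <= L2 * enorm (z' - z) + L2 * tau.
    by rewrite -mulrDr ler_wpM2l ?(ltW L20)//; lra.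
  suff : w y0 + L2 * tau <= w y + c z y by lra.
  have [yy0|yy0] := leP (enorm (y0 - y)) h.
    have := wL y y0 Dy Dy0 yy0; rewrite ler_norml => /andP[_ H].
    have t2 : enorm (y0 - y) <= enorm (z - y) + tau.
      by rewrite (le_trans (enorm_triangle z _ _))// enormB; lra.
    have := cge z y; have := ler_wpM2l L0 t2.
    have : delta * (h / 8) <= delta * enorm (z - y) by rewrite ler_wpM2l// ltW.
    rewrite /L2 in taud *; lra.
  have zfar : 3 * h / 4 <= enorm (z - y).
    have := enorm_triangle z y0 y; rewrite (enormB y0 z); lra.
  have := cfar z y zfar; have := wM y Dy; have := wM y0 Dy0.
  rewrite !ler_norml => /andP[_ w1] /andP[w2 _].
  have : L2 * tau <= L2 * h by rewrite ler_wpM2l ?(ltW L20)//; lra.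
  lra.
have minD (a b t : R) : 0 <= t -> a <= b + t -> Num.min M a <= Num.min M b + t.
  by move=> t0 ab; rewrite -lerBlDr le_min !lerBlDr !ge_min ab orbT lerDl t0.
(* Capping at [M] supplies the upper bound; the lower one holds already, the cone being
   nonnegative. *)
exists (fun z => Num.min M (V z)), (L2 + B), tau, (h / 8); split.
- split; first by rewrite addr_ge0// ltW.
  move=> x y; have LB0 : 0 <= (L2 + B) * enorm (y - x).
    by rewrite mulr_ge0 ?enorm_ge0// addr_ge0// ltW.
  rewrite ler_norml lerBlDl minD// andbT lerNl opprB lerBlDl minD//.
  by rewrite enormB.
- move=> x; rewrite ler_norml le_min ge_min lexx /= (le_trans _ M0) ?oppr_le0//= andbT.
  by apply: Vge => y Dy; apply: Slb; exists y.
- move=> y Dy; rewrite VD//; apply/min_idPr.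
  by rewrite (le_trans (ler_norm _))// wM.
- by split=> //; exact: divr_gt0.
- move=> z z' y Dy zy zz'; apply: minD; last exact: Vloc Dy zy zz'.
  by rewrite mulr_ge0 ?enorm_ge0// ltW.
Qed.

Lemma locally_lipschitz_min O L w f : locally_lipschitz_on O L w ->
  locally_lipschitz_on O L f -> locally_lipschitz_on O L (fun x => Num.min (w x) (f x)).
Proof.
have minD (a b c e t : R) : a <= b + t -> c <= e + t -> Num.min a c <= Num.min b e + t.
  by move=> ab ce; rewrite -lerBlDr le_min !lerBlDr !ge_min ab ce orbT.
move=> wL fL x r xO y z ry rz.
have := wL x r xO y z ry rz; have := fL x r xO y z ry rz.
rewrite !ler_norml => /andP[f1 f2] /andP[w1 w2].
by rewrite lerBlDl minD// ?andbT 1?lerNl ?opprB 1?lerBlDl ?minD//; lra.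
Qed.

(** The points that admit such a constant form a nonempty subset of [O], relatively open and closed.
    The constant does not depend on the function, so the supremum defining [intrinsic_dist] is
    finite. *)
Lemma connected_locally_lipschitz_bound O x y : connected O -> open O -> O x -> O y ->
  exists2 C : R, 0 <= C & forall L w, locally_lipschitz_on O L w -> `|w y - w x| <= `|L| * C.
Proof.
move=> cO oO Ox Oy.
pose B := [set y | O y /\ exists2 C : R, 0 <= C &
  forall L w, locally_lipschitz_on O L w -> `|w y - w x| <= `|L| * C].
have step y1 y2 (r : R) : B y1 -> eball y1 r `<=` O -> eball y1 r y2 -> B y2.
  move=> [Oy1 [C C0 HC]] rO y12; split; first exact: rO.
  exists (r + C) => [|L w wL].
    by rewrite addr_ge0// (le_trans (enorm_ge0 (y2 - y1)))// ltW.
  have r0 : 0 < r by rewrite (le_lt_trans _ y12)// enorm_ge0.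
  have := wL y1 r rO y1 y2 (eball_center _ r0) y12 => h.
  rewrite -(subrK (w y1) (w y2)) -addrA (le_trans (ler_normD _ _))// mulrDr.
  apply: lerD; last exact: HC.
  rewrite (le_trans h)// (le_trans (ler_wpM2r (enorm_ge0 _) (ler_norm L)))//.
  by rewrite ler_wpM2l// ltW.
have BO : B = O.
  apply: cO.
  - by exists x; split=> //; exists 0 => // L w _; rewrite subrr normr0 mulr0.
  - exists [set z | exists y1 (r : R), [/\ B y1, eball y1 r `<=` O & eball y1 r z]].
      rewrite openE => z [y1 [r [By1 rO rz]]]; apply/nbhs_enormP.
      exists (r - enorm (z - y1)); first by rewrite subr_gt0.
      by move=> z' zz'; exists y1, r; split=> //; exact: eball_subset zz'.
    apply/seteqP; split=> [z Bz|z [_ [y1 [r [By1 rO rz]]]]]; last exact: step rz.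
    split; first by case: Bz.
    have [r r0 rO] := open_eballP oO (proj1 Bz).
    by exists z, r; split=> //; exact: eball_center.
  - exists (closure B); first exact: closed_closure.
    apply/seteqP; split=> [z Bz|z [Oz cz]].
      by split; [case: Bz|exact: subset_closure].
    have [r r0 rO] := open_eballP oO Oz.
    have [y1 [By1 zy1]] := cz _ (nbhs_eball z (divr_gt0 r0 (ltr0Sn R 1))).
    have y1O : eball y1 (r / 2) `<=` O.
      move=> y2 y12; apply: rO; move: zy1 y12; rewrite /eball/= => h1 h2.
      by rewrite (le_lt_trans (enorm_triangle y1 _ _))//; lra.
    by apply: (step y1 z (r / 2)) => //; move: zy1; rewrite /eball/= enormB.
by have [] : B y by rewrite BO.
Qed.

End locally_lipschitz.

(** * Inner metric and optimal extension of the labels *)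

Section intrinsic_distance.
Context {R : realType} {d : nat} (Omega : C2_domain R d).
Local Notation O := (domain_set Omega).
Implicit Types (x y z : 'rV[R]_d).

(** Dual form of the geodesic distance, expressed without curves. *)
Definition intrinsic_dist x y : R :=
  sup [set f y - f x | f in locally_lipschitz_on O 1].

Let cst_lipschitz (c : R) L : 0 <= L -> locally_lipschitz_on O L (cst c).
Proof. by move=> L0 x r _ y z _ _; rewrite subrr normr0 mulr_ge0// enorm_ge0. Qed.

Let dist_has_sup x y : O x -> O y -> has_sup [set f y - f x | f in locally_lipschitz_on O 1].
Proof.
move=> Ox Oy; split; first by exists 0, (cst 0); [exact: cst_lipschitz|rewrite subrr].
have [C C0 H] := connected_locally_lipschitz_bound (@dom_connected _ _ Omega) (@dom_open _ _ Omega) Ox Oy.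
exists C => _ [f fL <-]; rewrite (le_trans (ler_norm _))// (le_trans (H 1 f fL))//.
by rewrite normr1 mul1r.
Qed.

Lemma intrinsic_dist_ge f x y : O x -> O y -> locally_lipschitz_on O 1 f ->
  f y - f x <= intrinsic_dist x y.
Proof.
move=> Ox Oy fL; apply: ub_le_sup; last by exists f.
by have [] := dist_has_sup Ox Oy.
Qed.

Lemma intrinsic_dist_le x y (c : R) : O x -> O y ->
  (forall f, locally_lipschitz_on O 1 f -> f y - f x <= c) -> intrinsic_dist x y <= c.
Proof.
move=> Ox Oy H; apply: ge_sup; last by move=> _ [f fL <-]; exact: H.
by have [] := dist_has_sup Ox Oy.
Qed.

Lemma intrinsic_distxx x : O x -> intrinsic_dist x x = 0.
Proof.
move=> Ox; apply/eqP; rewrite eq_le intrinsic_dist_le// => [|f _]; last by rewrite subrr.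
have -> : 0 = (cst 0 : 'rV[R]_d -> R) x - (cst 0 : 'rV[R]_d -> R) x by rewrite subrr.
by apply: intrinsic_dist_ge => //; exact: cst_lipschitz.
Qed.

Lemma enorm_le_intrinsic_dist x y : O x -> O y -> enorm (y - x) <= intrinsic_dist x y.
Proof.
move=> Ox Oy; have := @intrinsic_dist_ge (fun z => enorm (z - x)) x y Ox Oy.
rewrite subrr enorm0 subr0; apply => z r _ y1 y2 _ _; rewrite mul1r.
by rewrite (le_trans (enormB_norm _ _))// opprB addrA subrK.
Qed.

Lemma locally_lipschitz_intrinsic_dist x : O x -> locally_lipschitz_on O 1 (intrinsic_dist x).
Proof.
move=> Ox z r rO y1 y2 h1 h2; rewrite mul1r.
have Oy1 := rO _ h1; have Oy2 := rO _ h2.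
have key u v : eball z r u -> eball z r v -> intrinsic_dist x u <= intrinsic_dist x v + enorm (u - v).
  move=> hu hv; apply: intrinsic_dist_le => // [|f fL]; first exact: rO.
  have h := intrinsic_dist_ge Ox (rO _ hv) fL.
  have := fL z r rO v u hv hu; rewrite mul1r ler_norml => /andP[_]; lra.
rewrite ler_norml; have := key _ _ h1 h2; have := key _ _ h2 h1.
by rewrite (enormB y1); move=> k1 k2; apply/andP; split; lra.
Qed.

Lemma locally_lipschitzZ (k L : R) f : 0 <= k -> locally_lipschitz_on O L f ->
  locally_lipschitz_on O (k * L) (fun x => k * f x).
Proof.
move=> k0 fL x r rO y z ry rz.
by rewrite -mulrBr normrM (ger0_norm k0) -mulrA ler_wpM2l// (fL x r).
Qed.

Lemma locally_lipschitz_dist (L : R) f x y : O x -> O y -> 0 <= L ->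
  locally_lipschitz_on O L f -> f y - f x <= L * intrinsic_dist x y.
Proof.
move=> Ox Oy L0 fL.
have d0 : 0 <= intrinsic_dist x y.
  by rewrite (le_trans (enorm_ge0 (y - x)))// enorm_le_intrinsic_dist.
apply/ler_addgt0Pr => e e0.
(* Normalizing [f] requires a positive slope, and [L] may be 0; the excess contributes at most
   [e]. *)
pose k := L + e / (intrinsic_dist x y + 1).
have k0 : 0 < k by rewrite ltr_wpDl// divr_gt0// ltr_wpDl.
have := @intrinsic_dist_ge (fun z => k^-1 * f z) x y Ox Oy.
rewrite -mulrBr ler_pdivrMl// => H.
have : k * intrinsic_dist x y <= L * intrinsic_dist x y + e.
  rewrite /k mulrDl lerD2l mulrAC ler_pdivrMr ?ltr_wpDl// ler_wpM2l ?(ltW e0)//.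
  by rewrite lerDl.
apply: le_trans; apply: H.
apply: (@locally_lipschitz_on_le _ _ _ (k^-1 * L)).
  by rewrite ler_pdivrMl// mulr1 /k lerDl divr_ge0 ?(ltW e0)// addr_ge0.
by apply: locally_lipschitzZ => //; rewrite invr_ge0 ltW.
Qed.

Section optimal_extension.
Context {N : nat} (a : 'I_N -> 'rV[R]_d) (g : 'rV[R]_d -> R).
Hypotheses (a_inj : injective a) (a_dom : forall j, O (a j)).

(** All ordered pairs are taken, so no absolute value is needed; diagonal pairs contribute 0. *)
Definition optimal_slope : R :=
  \big[Num.max/0]_(ij : 'I_N * 'I_N) ((g (a ij.2) - g (a ij.1)) / intrinsic_dist (a ij.1) (a ij.2)).

Lemma optimal_slope_ge0 : 0 <= optimal_slope.
Proof. exact: bigmax_ge_id. Qed.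

Lemma optimal_slope_min L f : 0 <= L -> locally_lipschitz_on O L f ->
  (forall j, f (a j) = g (a j)) -> optimal_slope <= L.
Proof.
move=> L0 fL fg; apply/bigmax_leP; split=> // -[i j] _ /=.
have [->|ij] := eqVneq i j; first by rewrite subrr mul0r.
rewrite ler_pdivrMr; last first.
  rewrite (lt_le_trans _ (enorm_le_intrinsic_dist (a_dom i) (a_dom j)))//.
  by rewrite enorm_gt0 subr_eq0 (inj_eq a_inj) eq_sym.
by rewrite -!fg; exact: locally_lipschitz_dist.
Qed.

(** McShane's formula for the inner metric: the smallest of the cones with slope [optimal_slope]
    issued from the labels. The choice of slope says precisely that no cone passes below another
    label. *)
Lemma optimal_extension_exists : (0 < N)%N -> exists w,
  locally_lipschitz_on O optimal_slope w /\ forall j, w (a j) = g (a j).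
Proof.
move=> N0; pose j0 := Ordinal N0.
pose t j x := g (a j) + optimal_slope * intrinsic_dist (a j) x.
exists (fun x => \big[Num.min/t j0 x]_j t j x); split=> [|j].
  have tL j : locally_lipschitz_on O optimal_slope (t j).
    move=> x r rO y z ry rz; rewrite /t opprD addrACA subrr add0r.
    have := locally_lipschitzZ optimal_slope_ge0 (locally_lipschitz_intrinsic_dist (a_dom j)).
    by rewrite mulr1 => /(_ x r rO y z ry rz).
  elim: (index_enum _) => [|j s IH].
    by under eq_fun do rewrite big_nil; exact: tL.
  by under eq_fun do rewrite big_cons; exact: locally_lipschitz_min.
have tj : t j (a j) = g (a j) by rewrite /t intrinsic_distxx// mulr0 addr0.
have tij i : g (a j) <= t i (a j).
  have [->|ij] := eqVneq i j; first by rewrite tj.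
  have d0 : 0 < intrinsic_dist (a i) (a j).
    rewrite (lt_le_trans _ (enorm_le_intrinsic_dist (a_dom i) (a_dom j)))//.
    by rewrite enorm_gt0 subr_eq0 (inj_eq a_inj) eq_sym.
  rewrite /t -lerBlDl -ler_pdivrMr//.
  exact: (le_bigmax _ (fun ij : 'I_N * 'I_N => (g (a ij.2) - g (a ij.1)) / intrinsic_dist (a ij.1) (a ij.2)) (i, j)).
apply/eqP; rewrite eq_le; apply/andP; split; last by apply/bigmin_geP.
by rewrite -[leRHS]tj bigmin_le_cond.
Qed.

End optimal_extension.
End intrinsic_distance.

(** * Smooth approximation with prescribed labels *)

Section recovery.
Context {R : realType} {d : nat} (Omega : C2_domain R d).
Local Notation O := (domain_set Omega).
Implicit Types (w : 'rV[R]_d -> R) (x y z : 'rV[R]_d).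

Lemma domain_finite_net (h : R) : 0 < h -> exists s : seq 'rV[R]_d,
  (forall y, y \in s -> O y) /\ forall x, O x -> exists2 y, y \in s & enorm (x - y) < h.
Proof.
move=> h0; have := @domain_closure_compact _ _ Omega; rewrite compact_cover.
move=> /(_ 'rV[R]_d O (fun y => eball y h)) [y _||D' D'O cov].
- exact: open_eball.
- move=> x cx; have [y [Oy xy]] := cx _ (nbhs_eball x h0).
  by exists y => //; move: xy; rewrite /eball/= enormB.
- exists (finmap.enum_fset D'); split=> [y yD|x Ox].
    by have := D'O y yD; rewrite in_setE.
  have [y yD' xy] := cov x (subset_closure Ox).
  by exists y.
Qed.

Lemma locally_lipschitz_bounded (L : R) w : 0 <= L -> locally_lipschitz_on O L w ->
  exists2 M : R, 0 <= M & forall x, O x -> `|w x| <= M.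
Proof.
move=> L0 wL; have [h h0 H] := domain_almost_lipschitz Omega ltr01.
have [s [sO sh]] := domain_finite_net h0.
have b0 : 0 <= \big[Num.max/0]_(y <- s) `|w y| by exact: bigmax_ge_id.
exists (\big[Num.max/0]_(y <- s) `|w y| + L * (1 + 1) * h).
  by rewrite addr_ge0// !mulr_ge0 ?(ltW h0)//; lra.
move=> x Ox; have [y ys xy] := sh x Ox.
have := H L w L0 wL y x (sO y ys) Ox (ltW xy).
have : `|w y| <= \big[Num.max/0]_(y <- s) `|w y| by apply: (@le_bigmax_seq _ _ _ s 0 y xpredT (fun y => `|w y|)) => //.
have : L * (1 + 1) * enorm (x - y) <= L * (1 + 1) * h.
  by rewrite ler_wpM2l ?mulr_ge0 ?(ltW xy)//; lra.
have := ler_normD (w x - w y) (w y); rewrite subrK; lra.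
Qed.

Lemma taylor2_shift f F (C : R) z : @taylor2 R d f F C ->
  taylor2 (fun x => f (x - z)) (fun x => F (x - z)) C.
Proof.
move=> [f0 F0 T]; split=> // x y; have := T (x - z) (y - z).
by rewrite (_ : y - z - (x - z) = y - x)//; apply/rowP => i; rewrite !mxE; ring.
Qed.

Lemma taylor2_sum (I : finType) (f : I -> 'rV[R]_d -> R) F (C : I -> R) :
  (forall i, taylor2 (f i) (F i) (C i)) ->
  taylor2 (fun x => \sum_i f i x) (fun x => \sum_i F i x) (\sum_i C i).
Proof.
move=> H; elim: (index_enum I) => [|i s IH].
  rewrite big_nil; under [X in taylor2 X]eq_fun do rewrite big_nil.
  under [X in taylor2 _ X]eq_fun do rewrite big_nil.
  by have := @taylor2_cst R d 0; rewrite normr0.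
rewrite big_cons; under [X in taylor2 X]eq_fun do rewrite big_cons.
under [X in taylor2 _ X]eq_fun do rewrite big_cons.
exact: taylor2D.
Qed.

Lemma small_bump_exists (r : R) : 0 < r -> exists b F C, [/\ @taylor2 R d b F C,
  b 0 = 1 & forall y, r <= enorm y -> b y = 0].
Proof.
move=> r0; pose s := r / (d%:R + 1).
have s0 : 0 < s by rewrite divr_gt0// ltr_wpDl.
have [G [C T]] := box_bump_taylor2 1 (0 - const_mx s : 'rV[R]_d) (0 + const_mx s).
have b0 : 0 < box_bump 1 (0 - const_mx s : 'rV[R]_d) (0 + const_mx s) 0.
  by apply: box_bump_gt0 => //; rewrite open_box_center => i; rewrite subrr mxE normr0.
eexists; eexists; eexists; split.
- exact: (taylor2Z (box_bump 1 (0 - const_mx s : 'rV[R]_d) (0 + const_mx s) 0)^-1 T).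
- by rewrite /= mulVf// gt_eqF.
- move=> y ry; rewrite /= [X in _ * X]box_bump_eq0 ?mulr0// open_box_center => ys.
  have : enorm y <= d%:R * s.
    by apply: enorm_le_box => i; have := ys i; rewrite subr0 => /ltW.
  have : d%:R * s < r by rewrite /s mulrA ltr_pdivrMr ?ltr_wpDl// mulrC ltr_pM2l// ltrDl.
  lra.
Qed.

Lemma lipschitz_bounded_measurable (U : 'rV[R]_d -> R) (K M : R) :
  (forall x y, `|U y - U x| <= K * enorm (y - x)) -> (forall x, `|U x| <= M) ->
  bounded_measurable U.
Proof.
move=> UK UM; split; last by exists M.
apply: continuous_measurable_fun; apply/continuous_enormP => x e e0.
have K1 : 0 < `|K| + 1 by rewrite ltr_wpDl.
exists (e / (`|K| + 1)) => [|y]; first exact: divr_gt0.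
rewrite ltr_pdivlMr// => yx; rewrite (le_lt_trans (UK x y))//.
rewrite (le_lt_trans _ yx)// mulrC ler_wpM2l ?enorm_ge0//.
by rewrite (le_trans (ler_norm K))// lerDl.
Qed.

Lemma mollifier_bounded_supported (r : R) phi G (C : R) : @mollifier R d r phi G C ->
  bounded_supported phi.
Proof. by move=> [T _ phir _ _]; exact: taylor2_bounded_supported T phir. Qed.

Lemma mollifier_support (r : R) phi G (C : R) y : @mollifier R d r phi G C ->
  phi y != 0 -> enorm y < r.
Proof.
by move=> [_ _ phir _ _]; apply: contraNT; rewrite -leNgt => /phir ->.
Qed.

(** [w] is extended beyond Omega with slope close to [L] near Omega, mollified, and corrected at the
    labels by small bumps. The extension makes the gradient bound valid up to the boundary. *)
Lemma smooth_recovery {N : nat} (a : 'I_N -> 'rV[R]_d) w (L e : R) :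
  injective a -> (forall j, O (a j)) -> 0 <= L -> locally_lipschitz_on O L w -> 0 < e ->
  exists U G C, [/\ taylor2 U G C, forall x, O x -> enorm (G x) <= L + e,
    forall x, O x -> `|U x - w x| <= e & forall j, U (a j) = w (a j)].
Proof.
move=> a_inj a_dom L0 wL e0.
have [M M0 wM] := locally_lipschitz_bounded L0 wL.
have eL : 0 < e / (3 * (L + 1)) by rewrite divr_gt0// mulr_gt0//; lra.
have [h h0 AL] := domain_almost_lipschitz Omega eL.
pose L1 := L * (1 + e / (3 * (L + 1))).
have L1e : L1 <= L + e / 3.
  rewrite /L1 mulrDr mulr1 lerD2l (_ : e / (3 * (L + 1)) = e / 3 / (L + 1)); last first.
    by field; apply/lt0r_neq0; lra.
  rewrite mulrA ler_pdivrMr ?ltr_wpDl// mulrC ler_wpM2l ?divr_ge0 ?(ltW e0)//; lra.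
have L10 : 0 <= L1 by rewrite mulr_ge0// addr_ge0 ?(ltW eL)//.
have e3 : 0 < e / 3 by rewrite divr_gt0.
have [V [K [tau [h' [[K0 VK] VM VD [tau0 h'0] Vloc]]]]] :=
  lipschitz_extension (@dom_nonempty _ _ Omega) L10 h0 e3 wM (fun x y => AL L w L0 wL x y).
have bV := lipschitz_bounded_measurable VK VM.
(* At most the smallest distance between labels: a bump of radius [r] at one label vanishes at the
   others. *)
pose r := \big[Num.min/1]_(jk : 'I_N * 'I_N | jk.1 != jk.2) enorm (a jk.1 - a jk.2).
have r0 : 0 < r.
  by apply/bigmin_gtP; split=> // jk jk12; rewrite enorm_gt0 subr_eq0 (inj_eq a_inj).
have [b [F [Cb [Tb b0 br]]]] := small_bump_exists r0.
have Cb0 := taylor2_ge0 Tb.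
(* Mollification moves the values by at most K kappa; kappa makes this error and the values and
   gradients of all the corrections total at most e / 3. *)
pose kappa := Num.min (tau / 2) (e / (3 * (K + 1) * (1 + N%:R * Cb))).
have NCb : 0 < 1 + N%:R * Cb by rewrite ltr_pwDl// mulr_ge0.
have kappa0 : 0 < kappa.
  by rewrite lt_min !divr_gt0// !mulr_gt0//; lra.
have kappat : kappa <= tau / 2 by rewrite ge_min lexx.
have kappaK : K * kappa * (1 + N%:R * Cb) <= e / 3.
  have : kappa <= e / (3 * (K + 1) * (1 + N%:R * Cb)) by rewrite ge_min lexx orbT.
  rewrite ler_pdivlMr; last by rewrite !mulr_gt0//; lra.
  have : 0 <= kappa * (1 + N%:R * Cb) by rewrite mulr_ge0// ltW.
  lra.
have [phi [Gp [Cp mphi]]] := @mollifier_exists R d kappa kappa0.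
have bphi := mollifier_bounded_supported mphi.
have [Tp phi0 phir phi1 _] := mphi.
have [D TU] := mollify_taylor2 bV Tp phi0 phir.
set U0 := mollify V phi in TU.
have U0V x : `|U0 x - V x| <= K * kappa.
  apply: mollify_close => // y /(mollifier_support mphi) yk.
  by rewrite (le_trans (VK x _))// addrK ler_wpM2l// ltW.
have G0 x : O x -> enorm (mollify_grad V Gp x) <= L1 + e / 3.
  move=> Ox; apply: (@taylor2_grad_le _ _ _ _ _ _ _ (Num.min h' (tau / 2)) TU).
  - by rewrite lt_min h'0 divr_gt0.
  - by rewrite addr_ge0// ltW.
  move=> y; rewrite lt_min => /andP[yh yt].
  apply: mollify_diff_le => // z /(mollifier_support mphi) zk.
  have zz : z + y - (z + x) = y - x by apply/rowP => i; rewrite !mxE; ring.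
  have v1 := Vloc (z + x) (z + y) x Ox; have v2 := Vloc (z + y) (z + x) x Ox.
  rewrite zz in v1; rewrite (enormB (z + x)) zz in v2.
  rewrite ler_norml lerBlDl v1 ?andbT; [|by rewrite addrK; lra|exact: ltW].
  rewrite lerNl opprB lerBlDl v2 ?(ltW yh)//.
  have -> : z + y - x = z + (y - x) by rewrite addrA.
  by rewrite (le_lt_trans (enormD _ _))//; lra.
pose c j := w (a j) - U0 (a j).
have cK j : `|c j| <= K * kappa.
  by rewrite /c -VD// distrC.
pose psi j x := c j * b (x - a j).
pose Fpsi j x := c j *: F (x - a j).
have Tpsi j : taylor2 (psi j) (Fpsi j) (`|c j| * Cb).
  by apply: taylor2Z; exact: taylor2_shift.
have TS := taylor2_sum Tpsi.
have Sle : \sum_j (`|c j| * Cb) <= N%:R * Cb * (K * kappa).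
  rewrite (@le_trans _ _ (\sum_(j < N) (K * kappa * Cb)))//.
    by apply: ler_sum => j _; rewrite ler_wpM2r.
  by rewrite sumr_const card_ord -mulr_natl; lra.
have Se : K * kappa + \sum_j (`|c j| * Cb) <= e / 3.
  by apply: le_trans kappaK; lra.
have Kk0 : 0 <= K * kappa by rewrite mulr_ge0// ltW.
exists (fun x => U0 x + \sum_j psi j x), (fun x => mollify_grad V Gp x + \sum_j Fpsi j x), (D + \sum_j (`|c j| * Cb)).
have [S1 S2 _] := TS.
split.
- exact: taylor2D.
- move=> x Ox; rewrite (le_trans (enormD _ _))//.
  by have := G0 x Ox; have := S2 x; lra.
- move=> x Ox; rewrite -VD// addrAC (le_trans (ler_normD _ _))//.
  by have := U0V x; have := S1 x; lra.
- move=> j; rewrite (bigD1 j)//= big1 => [|k kj].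
    by rewrite /psi /c subrr b0; ring.
  rewrite /psi br ?mulr0//.
  by rewrite (@bigmin_le_cond _ _ _ _ (j, k))//= eq_sym.
Qed.

End recovery.

(** * Energy and local Lipschitz constants *)

Section Linfty_domain.
Context {R : realType} {d : nat} (Omega : C2_domain R d).
Local Notation O := (domain_set Omega).
Local Notation lam := (lebesgue_rV R d).
Local Notation nuO := (nu Omega).
Implicit Types (u v : Linfty nuO) (f : 'rV[R]_d -> R).

Lemma measurable_domain : measurable O.
Proof. by apply: open_measurable_rV; exact: dom_open. Qed.

Lemma nuE (A : set 'rV[R]_d) : nuO A = lam (A `&` O).
Proof. by []. Qed.

Lemma nu_gt0 : (0 < nuO setT)%E.
Proof.
have [x Ox] := @dom_nonempty _ _ Omega.
by rewrite nuE setTI; exact: lebesgue_rV_open_gt0 (@dom_open _ _ Omega) Ox.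
Qed.

Lemma lebesgue_domain_lty : (lam O < +oo)%E.
Proof.
have [M _ HM] := domain_bounded Omega.
by apply: lebesgue_rV_bounded_lty HM; exact: measurable_domain.
Qed.

Lemma vol_gt0 : 0 < vol Omega.
Proof.
rewrite /vol nuE setIid fine_gt0// lebesgue_domain_lty andbT.
by have := nu_gt0; rewrite nuE setTI.
Qed.

Lemma lebesgue_domainE : lam O = (vol Omega)%:E.
Proof. by rewrite /vol nuE setIid fineK// ge0_fin_numE// lebesgue_domain_lty. Qed.

Lemma ae_nuP (P : 'rV[R]_d -> Prop) :
  {ae nuO, forall x, P x} <->
  exists2 A : set 'rV[R]_d, measurable A /\ lam A = 0%E & forall x, O x -> ~ A x -> P x.
Proof.
split=> [[A [mA A0 PA]]|[A [mA A0] PA]].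
  exists (A `&` O); first by split=> //; apply: measurableI => //; exact: measurable_domain.
  by move=> x Ox nA; apply: contrapT => nP; apply: nA; split=> //; exact: PA.
exists (A `|` ~` O); split.
- by apply: measurableU => //; apply: measurableC; exact: measurable_domain.
- rewrite nuE setIUl setICl setU0; apply/eqP; rewrite eq_le measure_ge0 andbT -A0.
  apply: le_measure; rewrite ?inE//; try exact: subIsetl.
  by apply: measurableI => //; exact: measurable_domain.
- move=> x /= nP; have [Ox|] := pselect (O x); last by right.
  by left; apply: contrapT => nA; apply: nP; exact: PA.
Qed.

Lemma ae_nu_dense (P : 'rV[R]_d -> Prop) (A : set 'rV[R]_d) x :
  {ae nuO, forall y, P y} -> open A -> A x -> O x -> exists y, [/\ A y, O y & P y].
Proof.
move=> /ae_nuP[B [mB B0] PB] oA Ax Ox; apply: contrapT => H.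
have oAO : open (A `&` O) by apply: openI => //; exact: dom_open.
have := @lebesgue_rV_open_gt0 R d _ x oAO (conj Ax Ox); rewrite ltNge => /negP; apply.
rewrite -B0; apply: le_measure; rewrite ?inE//; first exact: open_measurable_rV.
by move=> y [Ay Oy]; apply: contrapT => nB; apply: H; exists y; split=> //; exact: PB.
Qed.

Lemma Linfty_measurable u : measurable_fun setT (u : 'rV[R]_d -> R).
Proof. exact: (@measurable_funPT _ _ _ _ (repr (LebesgueSpace.sort u))). Qed.

Lemma Lnorm_oo_le (h : 'rV[R]_d -> \bar R) (c : \bar R) :
  ('N[nuO]_+oo[h] <= c)%E <-> {ae nuO, forall x, `|h x| <= c}%E.
Proof.
(* The norm of index +oo is an essential supremum only when the whole space has positive measure. *)
by rewrite unlock /= nu_gt0; split=> [/ess_supP//|H]; apply/ess_supP.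
Qed.

Lemma Linfty_mk f : bounded_measurable f ->
  exists u : Linfty nuO, {ae nuO, forall x, u x = f x}.
Proof.
move=> [mf [M fM]].
have mf' : measurable_fun setT (f : 'rV[R]_d -> measurableTypeR R) := mf.
pose mfun_f : {mfun 'rV[R]_d >-> measurableTypeR R} :=
  HB.pack (f : 'rV[R]_d -> measurableTypeR R) (isMeasurableFun.Build _ _ 'rV[R]_d (measurableTypeR R) f mf').
pose F : {mfun_ nuO, 'rV[R]_d >-> measurableTypeR R} := \pi_({mfun_ nuO, 'rV[R]_d >-> measurableTypeR R})%qT mfun_f.
have Ff : {ae nuO, forall x, F x = f x}.
  have : (repr F == mfun_f %[mod {mfun_ nuO, 'rV[R]_d >-> measurableTypeR R}])%qT by rewrite reprK.
  rewrite eqmodE => /asboolP; apply: filterS => x /= H.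
  by rewrite /aqEqMfun_to_fun; exact: H.
have finF : finite_norm nuO +oo%E (F : 'rV[R]_d -> R).
  apply: (@le_lt_trans _ _ M%:E); last exact: ltry.
  by apply/Lnorm_oo_le; apply: filterS Ff => x /= ->; rewrite lee_fin.
pose u : LspaceType nuO (leey 1) := HB.pack F (isFinLebesgue.Build _ _ _ nuO +oo%E (leey 1) F finF).
by exists u.
Qed.

Lemma Linfty_bound u : exists2 M : R, 0 <= M & {ae nuO, forall x, `|u x| <= M}.
Proof.
have := @Lebesgue_finite _ _ _ _ _ _ u.
rewrite /finite_norm => fu.
have N0 : (0 <= 'N[nuO]_+oo[EFin \o u])%E by exact: Lnorm_ge0.
exists (fine ('N[nuO]_+oo[EFin \o u])%E); first exact: fine_ge0.
have /Lnorm_oo_le : ('N[nuO]_+oo[EFin \o u] <= (fine ('N[nuO]_+oo[EFin \o u]))%:E)%E.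
  by rewrite fineK// ge0_fin_numE.
by apply: filterS => x /=; rewrite lee_fin.
Qed.

(** Clipping, and vanishing off Omega, make the bounds hold everywhere, as the calculus of
    [bounded_supported] functions requires. *)
Lemma Linfty_rep u (M : R) : 0 <= M -> {ae nuO, forall x, `|u x| <= M} ->
  exists f, [/\ bounded_measurable f, forall x, `|f x| <= M,
    forall x, ~ O x -> f x = 0 & {ae nuO, forall x, u x = f x}].
Proof.
move=> M0 uM; pose f x := if `[< O x >] then Num.max (- M) (Num.min M (u x)) else 0.
have fM x : `|f x| <= M.
  rewrite /f; case: ifP => _; last by rewrite normr0.
  by rewrite ler_norml le_max lexx/= ge_max ge_min lexx/= andbT; lra.
exists f; split=> //.
- split; last by exists M.
  have -> : f = (fun x => Num.max (- M) (Num.min M (u x))) \_ O.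
    apply/funext => x; rewrite patchE /f; case: asboolP => Ox.
      by rewrite mem_set.
    by rewrite memNset.
  apply/(measurable_restrictT _ measurable_domain).
  apply: measurable_funS (@subsetT _ O) _ => //.
  apply: measurable_maxr; first exact: measurable_cst.
  by apply: measurable_minr; [exact: measurable_cst|exact: Linfty_measurable].
- by move=> x nOx; rewrite /f; case: asboolP.
- apply/ae_nuP; have /ae_nuP[A AA HA] := uM; exists A => // x Ox nA.
  rewrite /f; case: asboolP => // _.
  have := HA x Ox nA; rewrite ler_norml => /andP[h1 h2].
  by rewrite (min_idPr h2) (max_idPr h1).
Qed.

Lemma Linfty_dist_le u v (c : R) : 0 <= c ->
  Linfty_dist u v <= c <-> {ae nuO, forall x, `|u x - v x| <= c}.
Proof.
move=> c0; rewrite /Linfty_dist.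
have mB : measurable_fun setT (fun x => u x - v x : R).
  by apply: measurable_funB; exact: Linfty_measurable.
set N := ('N[nuO]_+oo[_])%E.
have finN : N \is a fin_num.
  rewrite ge0_fin_numE ?Lnorm_ge0//.
  have [M M0 uM] := Linfty_bound u; have [M' M'0 vM'] := Linfty_bound v.
  apply: (@le_lt_trans _ _ (M + M')%:E); last exact: ltry.
  apply/Lnorm_oo_le; near=> x; rewrite lee_fin (le_trans (ler_normB _ _))// lerD//.
    by near: x.
  by near: x.
rewrite -lee_fin fineK//; split=> [/Lnorm_oo_le|H].
  by apply: filterS => x; rewrite lee_fin.
by apply/Lnorm_oo_le; apply: filterS H => x; rewrite lee_fin.
Unshelve. all: by end_near. Qed.

Lemma nu_Rint f g : measurable_fun setT f -> bounded_supported g ->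
  (forall x, ~ O x -> g x = 0) -> {ae nuO, forall x, f x = g x} ->
  \int[nuO]_x f x = \int[lam]_x g x.
Proof.
move=> mf [mg _] gO fg; rewrite /Rintegral; congr fine.
transitivity (\int[nuO]_x (g x)%:E)%E.
  apply: ae_eq_integral => //; try exact/measurable_EFinP.
  by apply: filterS fg => x /= -> _.
have gE : (fun x => (g x)%:E) = (fun x => (g x)%:E) \_ O.
  apply/funext => x; rewrite patchE; case: ifPn => // /negP; rewrite in_setE => /gO ->.
  by [].
rewrite gE -[LHS]integral_mkcond -[RHS]integral_mkcond.
apply: eq_measure_integral => A mA AO.
by rewrite /= nuE setIidl.
Qed.

Lemma ge0_nu_integral (h : 'rV[R]_d -> \bar R) :
  (\int[nuO]_(x in O) h x = \int[lam]_(x in O) h x)%E.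
Proof. by apply: eq_measure_integral => A mA AO; rewrite nuE setIidl. Qed.

End Linfty_domain.

Section sobolev_to_lipschitz.
Context {R : realType} {d : nat} (Omega : C2_domain R d).
Local Notation O := (domain_set Omega).
Local Notation lam := (lebesgue_rV R d).
Local Notation nuO := (nu Omega).
Implicit Types (w f : 'rV[R]_d -> R) (x y z : 'rV[R]_d).

Lemma within_continuous_enormP w : {within O, continuous w} <->
  forall x, O x -> forall e : R, 0 < e -> exists2 r : R, 0 < r &
    forall y, enorm (y - x) < r -> `|w y - w x| < e.
Proof.
rewrite continuous_open_subspace; last exact: dom_open.
split=> [cw x Ox e e0|cw x].
  have /cw cx : x \in O by rewrite in_setE.
  have := cx (ball (w x) e) (nbhsx_ballx (w x) e e0).
  rewrite nbhs_simpl/= => /nbhs_enormP[r r0 rf].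
  exists r => // y yr; rewrite distrC; exact: rf.
rewrite in_setE => Ox s /(nbhs_ballP (w x)) [e /= e0 es].
have [r r0 rf] := cw x Ox e e0.
apply/nbhs_enormP; exists r => // y yr; apply: es.
by rewrite /ball/= distrC rf.
Qed.

(** Sets of full measure are dense in Omega, so almost everywhere bounds pass to all points by
    continuity. *)
Lemma continuous_rep_bound w (P : 'rV[R]_d -> R) (M : R) : {within O, continuous w} ->
  {ae nuO, forall x, P x = w x} -> {ae nuO, forall x, `|P x| <= M} ->
  forall x, O x -> `|w x| <= M.
Proof.
move=> /within_continuous_enormP cw Pw PM x Ox; apply/ler_addgt0Pr => e e0.
have [r r0 rf] := cw x Ox e e0.
have Q : {ae nuO, forall y, `|w y| <= M}.
  by near=> y; rewrite -(_ : P y = w y) //; near: y.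
have [y [yx Oy Qy]] := ae_nu_dense Q (@open_eball _ _ x r) (eball_center _ r0) Ox.
have := rf y yx; have := ler_normD (w x - w y) (w y); rewrite subrK distrC; lra.
Unshelve. all: by end_near. Qed.

Lemma continuous_rep_measurable w (M : R) : {within O, continuous w} ->
  (forall x, O x -> `|w x| <= M) -> bounded_measurable (w \_ O).
Proof.
move=> /within_continuous_enormP cw wM; split; last first.
  exists `|M| => x; rewrite patchE; case: ifPn => [|_]; last by rewrite normr0.
  by rewrite in_setE => /wM/le_trans; apply; exact: ler_norm.
apply/(measurable_restrictT _ (measurable_domain Omega)).
apply: (measurability _ (RGenOpens.measurableE R)).
move=> _ [_ [a [b ->]] <-]; apply: open_measurable_rV.
rewrite openE => x [Ox /=]; rewrite in_itv/= => /andP[ax xb].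
have e0 : 0 < Num.min (w x - a) (b - w x) by rewrite lt_min !subr_gt0 ax.
have [r r0 rf] := cw x Ox _ e0.
have [r' r'0 rO] := open_eballP (@dom_open _ _ Omega) Ox.
apply/nbhs_enormP; exists (Num.min r r'); first by rewrite lt_min r0.
move=> y; rewrite /eball/= lt_min => /andP[yr yr']; split; first exact: rO.
have := rf y yr; rewrite lt_min => /andP[]; rewrite in_itv/= !ltr_norml.
by move=> /andP[h1 _] /andP[_ h2]; apply/andP; split; lra.
Qed.

Lemma compact_closed_eball z (r : R) : compact [set y : 'rV[R]_d | enorm (y - z) <= r].
Proof.
apply: bounded_closed_compact.
  exists (r + enorm z); split; first exact: num_real.
  move=> M' MM' x /= xz; rewrite (le_trans (norm_le_enorm x))//.
  by have := enormB_ge x z; lra.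
rewrite -[X in closed X]setCK; apply: open_closedC.
rewrite openE => y /= /negP; rewrite -ltNge => yr.
apply/nbhs_enormP; exists (enorm (y - z) - r); first by rewrite subr_gt0.
move=> x; rewrite /eball/= => xy; apply/negP; rewrite -ltNge.
by have := enorm_triangle x y z; rewrite (enormB y x); lra.
Qed.

Lemma taylor2_partial f F (C : R) x i : taylor2 f F C ->
  'D_(delta_mx 0 i) f x = F x ord0 i.
Proof.
move=> T; have [_ ->] := taylor2_is_derive x (delta_mx 0 i) T.
rewrite /dotp (bigD1 i)//= mxE !eqxx mulr1 big1 ?addr0// => j ji.
by rewrite mxE (negPf ji) andbF mulr0.
Qed.

Lemma mollifier_test_function (r : R) phi G C z : mollifier r phi G C ->
  eball z (2 * r) `<=` O -> 0 < r -> test_function Omega (fun y => phi (y - z)).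
Proof.
move=> [T phi0 phir _ sm] zO r0; split; first exact: sm.
exists [set y : 'rV[R]_d | enorm (y - z) <= r]; split.
- exact: compact_closed_eball.
- by move=> y /= yz; apply: zO; rewrite /eball/=; lra.
- by move=> y /negP; rewrite -ltNge => /ltW /phir.
Qed.

(** Common last step for weak gradients and for limits of graph energies: the mean value inequality
    for the mollified function on a segment inside the ball, then a kernel radius tending to 0. *)
Lemma mollify_locally_lipschitz w f (L : R) : {within O, continuous w} ->
  bounded_measurable f -> (forall x, O x -> f x = w x) ->
  (forall r phi G C z, 0 < r -> mollifier r phi G C -> eball z (2 * r) `<=` O ->
    enorm (mollify_grad f G z) <= L) ->
  locally_lipschitz_on O L w.
Proof.
move=> /within_continuous_enormP cw bf fw H x r rO y z yr zr.
have Oy := rO _ yr; have Oz := rO _ zr.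
apply/ler_addgt0Pr => e e0.
have e2 : 0 < e / 2 by rewrite divr_gt0.
have [r1 r10 c1] := cw y Oy _ e2; have [r2 r20 c2] := cw z Oz _ e2.
move: yr zr; rewrite /eball/= => yr zr.
(* Balls of radius 2 k around the segment stay in the ball, and mollification changes [w] by at most
   e / 2 at both ends. *)
pose k := Num.min (Num.min r1 r2) (Num.min ((r - enorm (y - x)) / 2) ((r - enorm (z - x)) / 2)).
have k0 : 0 < k by rewrite !lt_min r10 r20 !divr_gt0// subr_gt0.
have kr1 : k <= r1 by rewrite /k !ge_min lexx.
have kr2 : k <= r2 by rewrite /k !ge_min lexx orbT.
have ky : k <= (r - enorm (y - x)) / 2 by rewrite /k !ge_min lexx !orbT.
have kz : k <= (r - enorm (z - x)) / 2 by rewrite /k !ge_min lexx !orbT.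
have [phi [G [C mphi]]] := @mollifier_exists R d k k0.
have bphi := mollifier_bounded_supported mphi; have [T phi0 phir phi1 _] := mphi.
have [D TU] := mollify_taylor2 bf T phi0 phir.
have incl p : enorm (p - x) <= Num.max (enorm (y - x)) (enorm (z - x)) -> eball p (2 * k) `<=` O.
  rewrite le_max => px q; rewrite /eball/= => qp; apply: rO; rewrite /eball/=.
  by rewrite (le_lt_trans (enorm_triangle p _ _))//; case/orP: px; lra.
have seg : `|mollify f phi z - mollify f phi y| <= L * enorm (z - y).
  apply: (taylor2_segment_le TU) => t /andP[t0 t1].
  apply: (H k phi G C) => //; apply: incl.
  rewrite (_ : _ - x = (1 - t) *: (y - x) + t *: (z - x)); last first.
    by apply/rowP => i; rewrite !mxE; ring.
  rewrite (le_trans (enormD _ _))// !enormZ !ger0_norm ?subr_ge0//.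
  have h1 : enorm (y - x) <= Num.max (enorm (y - x)) (enorm (z - x)) by rewrite le_max lexx.
  have h2 : enorm (z - x) <= Num.max (enorm (y - x)) (enorm (z - x)) by rewrite le_max lexx orbT.
  set m := Num.max _ _ in h1 h2 *; clear -h1 h2 t0 t1; nra.
have close p (r' : R) : O p -> enorm (p - x) <= Num.max (enorm (y - x)) (enorm (z - x)) -> k <= r' ->
    (forall q, enorm (q - p) < r' -> `|w q - w p| < e / 2) -> `|mollify f phi p - w p| <= e / 2.
  move=> Op px kr' cp; apply: mollify_close => // q /(mollifier_support mphi) qk.
  have qp : enorm (q + p - p) < k by rewrite addrK.
  rewrite fw; last by apply: (incl p px); rewrite /eball/=; lra.
  by rewrite ltW// cp// (lt_le_trans qp).
have cy := close y r1 Oy _ kr1 c1; have cz := close z r2 Oz _ kr2 c2.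
have {}cy := cy _; have {}cz := cz _.
have h1 : enorm (y - x) <= Num.max (enorm (y - x)) (enorm (z - x)) by rewrite le_max lexx.
have h2 : enorm (z - x) <= Num.max (enorm (y - x)) (enorm (z - x)) by rewrite le_max lexx orbT.
have {}cy := cy h1; have {}cz := cz h2.
rewrite (_ : w z - w y = (mollify f phi z - mollify f phi y) - (mollify f phi z - w z)
  + (mollify f phi y - w y)); last by ring.
have t1 := ler_normD (mollify f phi z - mollify f phi y - (mollify f phi z - w z)) (mollify f phi y - w y).
have t2 := ler_normB (mollify f phi z - mollify f phi y) (mollify f phi z - w z).
clear -t1 t2 cy cz seg; lra.
Qed.

Lemma Linfty_vector_rep (v : 'I_d -> Linfty nuO) (L : R) : 0 <= L ->
  {ae nuO, forall x, enorm (\row_i (v i x : R)) <= L} ->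
  exists f : 'I_d -> 'rV[R]_d -> R, [/\ forall i, bounded_measurable (f i),
    forall x, enorm (\row_i f i x) <= L, forall i x, ~ O x -> f i x = 0 &
    {ae nuO, forall x, forall i, v i x = f i x}].
Proof.
move=> L0 vL; have mO := measurable_domain Omega.
have mv : measurable_fun setT (fun x => enorm (\row_i (v i x : R))).
  apply: measurableT_comp (@measurable_enorm R d) _.
  by apply: measurable_fun_rV => i; under eq_fun do rewrite mxE; exact: Linfty_measurable.
pose S := O `&` [set x | enorm (\row_i (v i x : R)) <= L].
have mS : measurable S.
  apply: measurableI => //.
  rewrite (_ : [set x | _] = (fun x => enorm (\row_i (v i x : R))) @^-1` `]-oo, L]); last first.
    by apply/seteqP; split=> x /=; rewrite in_itv.
  exact: measurable_preimT.
exists (fun i => (v i : 'rV[R]_d -> R) \_ S).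
have nL x : enorm (\row_i ((v i : 'rV[R]_d -> R) \_ S) x) <= L.
  have [Sx|nSx] := pselect (S x).
    under eq_mx do rewrite patchE mem_set//; by case: Sx.
  under eq_mx do rewrite patchE memNset//.
  rewrite (_ : \row__ 0 = 0) ?enorm0//; by apply/rowP => i; rewrite !mxE.
split=> //.
- move=> i; split.
    apply/(measurable_restrictT _ mS).
    by apply: measurable_funS (@subsetT _ S) _ => //; exact: Linfty_measurable.
  exists L => x; have := coord_le_enorm (\row_i ((v i : 'rV[R]_d -> R) \_ S) x) i.
  by rewrite mxE => /le_trans; apply.
- by move=> i x nOx; rewrite patchE memNset// => -[].
- have /ae_nuP[A AA HA] := vL; apply/ae_nuP; exists A => // x Ox nA i.
  by rewrite patchE mem_set//; split=> //; exact: HA.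
Qed.

(** Testing with the translated kernel identifies the gradient of the mollified function with the
    mollified weak gradient, which is bounded by [L] as an average. *)
Lemma weak_gradient_locally_lipschitz (u : Linfty nuO) (v : 'I_d -> Linfty nuO) w (L : R) :
  0 <= L -> weak_gradient u v -> {ae nuO, forall x, enorm (\row_i (v i x : R)) <= L} ->
  {within O, continuous w} -> {ae nuO, forall x, u x = w x} -> locally_lipschitz_on O L w.
Proof.
move=> L0 wg vL cw uw.
have [M M0 uM] := Linfty_bound u.
have wM := continuous_rep_bound cw uw uM.
have bf := continuous_rep_measurable cw wM; set f := w \_ O in bf.
have fO x : ~ O x -> f x = 0 by move=> nOx; rewrite /f patchE memNset.
have fw x : O x -> f x = w x by move=> Ox; rewrite /f patchE mem_set.
have uf : {ae nuO, forall x, u x = f x}.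
  by have /ae_nuP[A AA HA] := uw; apply/ae_nuP; exists A => // x Ox nA; rewrite fw// HA.
have [g [bg gL gO vg]] := Linfty_vector_rep L0 vL.
apply: (mollify_locally_lipschitz cw bf fw) => r phi G C z r0 mphi zO.
have tphi := mollifier_test_function mphi zO r0.
have bphi := mollifier_bounded_supported mphi; have [T phi0 phir phi1 _] := mphi.
have bsphi := bounded_supported_shift z bphi.
set V := mollify_grad f G z.
have VE : V = \row_i \int[lam]_y (g i y * phi (y - z)).
  apply/rowP => i; rewrite !mxE.
  have bG : bounded_supported (fun y => G (y - z) ord0 i).
    exact: (@bounded_supported_shift _ _ (fun y => G y ord0 i) z (taylor2_coord_bounded_supported i T phi0 phir)).
  have DE y : 'D_(delta_mx 0 i) (fun y => phi (y - z)) y = G (y - z) ord0 i.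
    exact: taylor2_partial (taylor2_shift z T).
  have := wg i _ tphi; under eq_Rintegral do rewrite DE.
  rewrite (@nu_Rint _ _ Omega _ (fun y => f y * G (y - z) ord0 i)); first last.
  - by near=> y; congr (_ * _); near: y.
  - by move=> y /fO ->; rewrite mul0r.
  - exact: bounded_supportedM.
  - by apply: measurable_funM; [exact: Linfty_measurable|case: bG].
  rewrite (@nu_Rint _ _ Omega _ (fun y => g i y * phi (y - z))); first last.
  - by near=> y; congr (_ * _); move: i {bG DE}; near: y.
  - by move=> y /gO ->; rewrite mul0r.
  - exact: bounded_supportedM.
  - by apply: measurable_funM; [exact: Linfty_measurable|case: bsphi].
  by move=> ->; rewrite opprK.
have [->|V0] := eqVneq V 0; first by rewrite enorm0.
have Vn : 0 < enorm V by rewrite enorm_gt0.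
(* The vector [V] is paired with itself: |V|^2 is the average of the products g . V, each at most L
   |V|. *)
rewrite -(ler_pM2r Vn) -expr2 sqr_enorm {1}VE dotp_Rint => [|i]; last exact: bounded_supportedM.
rewrite -[leRHS]mulr1 -phi1 -(Rint_shift z bphi) -RintZ//.
apply: le_Rint.
- apply: bounded_supported_sum => i; under eq_fun do rewrite mulrC.
  by apply: bounded_supportedZ; exact: bounded_supportedM.
- exact: bounded_supportedZ.
move=> y; rewrite (_ : \sum_i _ = dotp (\row_i g i y) V * phi (y - z)); last first.
  by rewrite /dotp mulr_suml; apply: eq_bigr => i _; rewrite mxE; ring.
rewrite ler_wpM2r// (le_trans (dotp_le_enorm _ _))// ler_wpM2r// ltW//.
Unshelve. all: by end_near. Qed.

Lemma ess_sup_enorm_le (v : 'I_d -> Linfty nuO) (L : R) :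
  (ess_sup nuO (fun y => (enorm (\row_i (v i y : R)))%:E) <= L%:E)%E <->
  {ae nuO, forall x, enorm (\row_i (v i x : R)) <= L}.
Proof.
by split=> [/ess_supP|H]; [|apply/ess_supP];  [|move: H]; apply: filterS => x; rewrite lee_fin.
Qed.

Lemma energy_cons_locally_lipschitz g N (a : 'I_N -> 'rV[R]_d) (u : Linfty nuO) (L : R) :
  (energy_cons Omega g a u <= L%:E)%E -> 0 <= L /\ exists w, [/\ locally_lipschitz_on O L w, {ae nuO, forall x, u x = w x} &
    forall j, w (a j) = g (a j)].
Proof.
rewrite /energy_cons; case: ifPn => [/asboolP[w [cw uw wa]]|_]; last by rewrite leye_eq.
rewrite /energy; case: pselect => [h|_]; last by rewrite leye_eq.
case: (cid h) => v wg /= /ess_sup_enorm_le vL.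
have L0 : 0 <= L.
  have [x Ox] := @dom_nonempty _ _ Omega.
  have [y [_ _ /=]] := ae_nu_dense vL (@openT _) I Ox.
  exact: le_trans (enorm_ge0 _).
split=> //; exists w; split=> //; exact: weak_gradient_locally_lipschitz wg vL cw uw.
Qed.

End sobolev_to_lipschitz.

(** * Functions with vanishing integrals *)

Section null_functions.
Context {R : realType} {d : nat}.
Local Notation lam := (lebesgue_rV R d).
Implicit Types (f h : 'rV[R]_d -> R).

Lemma Rint_cvg (f : nat -> 'rV[R]_d -> R) h B : (forall n, measurable_fun setT (f n)) ->
  bounded_supported B -> (forall x n, `|f n x| <= B x) ->
  (forall x, f n x @[n --> \oo] --> h x) ->
  bounded_supported h /\ (\int[lam]_x f n x @[n --> \oo] --> \int[lam]_x h x).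
Proof.
move=> mf bB fB fh; have mh : measurable_fun setT h by apply: measurable_fun_cvg mf _ => x _; exact: fh.
have hB x : `|h x| <= B x.
  have ch : `|f n x| @[n --> \oo] --> `|h x| by apply: cvg_norm; exact: fh.
  rewrite -(cvg_lim _ ch)//; apply: limr_le; first by apply/cvg_ex; eexists; exact: ch.
  by apply: nearW => n.
have bh : bounded_supported h.
  case: bB => mB [M [r BM]]; split=> //; exists M, r => x; have [BxM Bx0] := BM x.
  split; first by rewrite (le_trans (hB x))// (le_trans (ler_norm _)).
  by move=> /Bx0 B0; apply/eqP; rewrite -normr_le0 -B0.
split=> //; rewrite /Rintegral; apply: fine_cvg; rewrite fineK; last first.
  by apply: integrable_fin_num => //; exact: bounded_supported_integrable.
apply: (@dominated_cvg _ _ _ lam setT measurableT (fun n x => (f n x)%:E) (fun x => (h x)%:E) (fun x => (B x)%:E)) => //.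
- by move=> n; exact/measurable_EFinP.
- by move=> x _; apply/fine_cvgP; split; [exact: nearW|exact: fh].
- exact: bounded_supported_integrable.
- by move=> n x _; rewrite lee_fin.
Qed.

Lemma ge0_Rint_eq0 f : bounded_supported f -> (forall x, 0 <= f x) ->
  \int[lam]_x f x = 0 -> {ae lam, forall x, f x = 0}.
Proof.
move=> bf f0 I0; have mf : measurable_fun setT (EFin \o f) by apply/measurable_EFinP; case: bf.
have : (\int[lam]_(x in setT) `|(EFin \o f) x| = 0)%E.
  under eq_integral => x _ do rewrite gee0_abs ?lee_fin//.
  rewrite -(@fineK _ (integral _ _ _)); first by congr EFin.
  by apply: integrable_fin_num => //; exact: bounded_supported_integrable.
move=> /(ae_eq_integral_abs _ measurableT mf); apply: filterS => x /(_ I) /= []; exact.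
Qed.

Let density_measure h : bounded_supported h -> (forall x, 0 <= h x) ->
  exists m : {measure set 'rV[R]_d -> \bar R}, forall A, measurable A ->
    m A = (\int[lam]_x (h x * \1_A x))%:E.
Proof.
move=> bh h0; have mh : measurable_fun setT (EFin \o h) by apply/measurable_EFinP; case: bh.
pose m A := (\int[lam]_(x in A) (h x)%:E)%E.
have m0 : m set0 = 0%E by exact: integral_set0.
have mge0 A : (0 <= m A)%E by apply: integral_ge0 => x _; rewrite lee_fin.
have ms : semi_sigma_additive m.
  by apply: semi_sigma_additive_nng_induced => // x; rewrite lee_fin.
pose mm : {measure set 'rV[R]_d -> \bar R} := HB.pack m (isMeasure.Build _ _ _ m m0 mge0 ms).
exists mm => A mA; rewrite /mm/= /m integral_mkcond.
have -> : (EFin \o h) \_ A = (fun x => (h x * \1_A x)%:E).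
  apply/funext => x; rewrite patchE indicE; case: ifPn => xA; first by rewrite mulr1.
  by rewrite mulr0.
rewrite /Rintegral fineK//; apply: integrable_fin_num => //.
have -> : (fun x => (h x * \1_A x)%:E) = EFin \o (fun x => \1_A x * h x).
  by apply/funext => x /=; rewrite mulrC.
apply: bounded_supported_integrable; apply: bounded_supportedM => //.
split; first exact: measurable_indic.
by exists 1 => x; rewrite indicE ger0_norm//; case: (_ \in _).
Qed.

(** [|h| + h] and [|h| - h] are densities of two measures that agree on boxes, hence on the set
    where [h] is positive and on its complement. *)
Lemma boxes_Rint_eq0 h : bounded_supported h ->
  (forall a b, \int[lam]_x (h x * \1_(open_box a b) x) = 0) -> {ae lam, forall x, h x = 0}.
Proof.
move=> bh hbox; have bn := bounded_supported_norm bh.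
have bp : bounded_supported (fun x => `|h x| + h x) by exact: bounded_supportedD.
have bm : bounded_supported (fun x => `|h x| - h x) by exact: bounded_supportedB.
have p0 x : 0 <= `|h x| + h x by have := ler_norm (- h x); rewrite normrN; lra.
have q0 x : 0 <= `|h x| - h x by have := ler_norm (h x); lra.
have [m1 m1E] := density_measure bp p0.
have [m2 m2E] := density_measure bm q0.
have bI (A : set 'rV[R]_d) f : measurable A -> bounded_supported f -> bounded_supported (fun x => f x * \1_A x).
  move=> mA bf; under eq_fun do rewrite mulrC; apply: bounded_supportedM => //.
  split; first exact: measurable_indic.
  by exists 1 => x; rewrite indicE ger0_norm//; case: (_ \in _).
have diff A : measurable A -> m1 A = m2 A -> \int[lam]_x (h x * \1_A x) = 0.
  move=> mA; rewrite m1E// m2E// => -[] E.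
  have : \int[lam]_x (2 * (h x * \1_A x)) = 0.
    transitivity (\int[lam]_x ((`|h x| + h x) * \1_A x - (`|h x| - h x) * \1_A x)).
      by congr Rintegral; apply/funext => x; ring.
    by rewrite RintB ?E ?subrr//; exact: bI.
  by rewrite RintZ; [move/eqP; rewrite mulf_eq0 pnatr_eq0/= => /eqP|exact: bI].
have mE A : measurable A -> m1 A = m2 A.
  apply: box_measure_unique => [a b _|a b]; last by rewrite m1E ?ltry//; exact: measurable_box.
  have mb := @measurable_box R d a b.
  rewrite m1E// m2E//; congr EFin; apply/eqP; rewrite -subr_eq0 -RintB; [|exact: bI|exact: bI].
  rewrite (_ : Rintegral _ _ _ = \int[lam]_x (2 * (h x * \1_(open_box a b) x))).
    by rewrite RintZ ?hbox ?mulr0//; exact: bI.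
  by congr Rintegral; apply/funext => x; ring.
pose A := [set x | 0 < h x].
have mA : measurable A.
  rewrite (_ : A = h @^-1` `]0, +oo[); first by apply: measurable_preimT => //; case: bh.
  by apply/seteqP; split=> x /=; rewrite in_itv/= andbT.
have mnA : measurable (~` A) by exact: measurableC.
have z1 := ge0_Rint_eq0 (bI _ _ mA bh) _ (diff _ mA (mE _ mA)).
have z2 := ge0_Rint_eq0 (bI _ _ mnA (bounded_supportedZ (-1) bh)) _ _.
have {}z1 : {ae lam, forall x, h x * \1_A x = 0}.
  apply: z1 => x; rewrite indicE; case: (boolP (x \in A)); rewrite ?mulr0// mulr1.
  by rewrite in_setE => /ltW.
have {}z2 : {ae lam, forall x, -1 * h x * \1_(~` A) x = 0}.
  apply: z2 => [x|].
    rewrite indicE; case: (boolP (x \in ~` A)); rewrite ?mulr0// mulr1.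
    by rewrite in_setE => /negP; rewrite -leNgt; lra.
  under eq_Rintegral do rewrite -mulrA.
  by rewrite RintZ ?diff ?mulr0//; [exact: mE|exact: bI].
near=> x; have e1 : h x * \1_A x = 0 by near: x.
have e2 : -1 * h x * \1_(~` A) x = 0 by near: x.
move: e1 e2; rewrite !indicE; case: (boolP (x \in A)) => xA; first by rewrite mulr1.
by rewrite mem_set ?mulr1 => [_|/=]; [lra|move=> /mem_set; exact/negP].
Unshelve. all: by end_near. Qed.

End null_functions.

(** * Almost everywhere convergence of L^2 minimizing sequences *)

Section minimizing_sequence.
Context {R : realType} {d : nat}.
Local Notation lam := (lebesgue_rV R d).
Implicit Types (F : 'rV[R]_d -> 'rV[R]_d) (f h : 'rV[R]_d -> R).

(** The sum of the series has a finite integral, so it is finite almost everywhere; it bounds every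
    term. *)
Lemma summable_ae_bounded (f : nat -> 'rV[R]_d -> R) (c : R) :
  (forall j, bounded_supported (f j)) -> (forall j x, 0 <= f j x) ->
  (forall j, \int[lam]_x f j x <= c * 2^-1 ^+ j) ->
  {ae lam, forall x, exists C, forall j, f j x <= C}.
Proof.
move=> bf f0 fc; pose S x := (\sum_(0 <= j <oo) (f j x)%:E)%E.
have mfj j : measurable_fun setT (fun x => (f j x)%:E) by apply/measurable_EFinP; case: (bf j).
have S0 x : (0 <= S x)%E by apply: nneseries_ge0 => n _ _; rewrite lee_fin.
have IS : (\int[lam]_x S x <= (c * 2)%:E)%E.
  rewrite integral_nneseries//; last by move=> n x _; rewrite lee_fin.
  apply: lime_le.
    by apply: is_cvg_nneseries => n _ _; apply: integral_ge0 => x _; rewrite lee_fin.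
  apply: nearW => n.
  have E j : (\int[lam]_x (f j x)%:E)%E = (\int[lam]_x f j x)%:E.
    rewrite /Rintegral fineK//; apply: integrable_fin_num => //; exact: bounded_supported_integrable.
  under eq_bigr => j _ do rewrite E.
  rewrite sumEFin lee_fin.
  apply: (@le_trans _ _ (\sum_(0 <= j < n) c * 2^-1 ^+ j)); first exact: ler_sum.
  rewrite -mulr_sumr.
  have c0 : 0 <= c.
    by have := fc 0%N; rewrite expr0 mulr1; apply: le_trans; apply: fine_ge0; apply: integral_ge0 => x _; rewrite lee_fin.
  rewrite ler_wpM2l//; elim: n => [|n IH]; first by rewrite big_nil.
  suff -> : \sum_(0 <= j < n.+1) 2^-1 ^+ j = 2 - 2^-1 ^+ n :> R by rewrite gerBl exprn_ge0.
  elim: n {IH} => [|n IH]; first by rewrite big_nat1 expr0; ring.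
  by rewrite big_nat_recr//= IH exprS; lra.
have iS : lam.-integrable setT S.
  apply/integrableP; split; first by apply: ge0_emeasurable_sum => // n x _ _; rewrite lee_fin.
  by under eq_integral => x _ do rewrite gee0_abs//; rewrite (le_lt_trans IS)// ltry.
apply: filterS (integrable_ae measurableT iS) => x /(_ I) finS.
exists (fine (S x)) => j; rewrite -lee_fin fineK//.
apply: (@le_trans _ _ (\sum_(0 <= k < j.+1) (f k x)%:E)%E).
  by rewrite big_nat_recr//= leeDr// sume_ge0// => i _; rewrite lee_fin.
by apply: nneseries_lim_ge => n _ _; rewrite lee_fin.
Qed.

Lemma geometric_steps_cvg (u : nat -> R) (c : R) :
  (forall j, `|u j.+1 - u j| <= c * 2^-1 ^+ j) -> cvgn u.
Proof.
move=> uc; have c0 : 0 <= c by have := uc 0%N; rewrite expr0 mulr1; exact: le_trans.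
have -> : u = (fun n => u 0%N + series (telescope u) n) by apply/funext => n; rewrite -eq_sum_telescope.
apply: is_cvgD; first exact: is_cvg_cst.
apply: normed_cvg; apply: (@series_le_cvg _ _ (geometric c 2^-1)) => //=.
- by move=> n; rewrite mulr_ge0// exprn_ge0// invr_ge0.
- by apply: is_cvg_geometric_series; rewrite ger0_norm ?invr_ge0//; lra.
Qed.

(* Almost minimizers of the L^2 norm over decreasing convex sets are Cauchy by the
   parallelogram identity, so a rapid subsequence converges almost everywhere. *)
Lemma convex_minimizing (S : nat -> set ('rV[R]_d -> 'rV[R]_d)) (B r : R) :
  (forall k F, S k F -> (forall i, measurable_fun setT (fun x => F x ord0 i)) /\
     forall x, enorm (F x) <= B /\ (r <= enorm x -> F x = 0)) ->
  (forall k l, (k <= l)%N -> S l `<=` S k) ->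
  (forall k F F', S k F -> S k F' -> S k (fun x => 2^-1 *: (F x + F' x))) ->
  (forall k, S k !=set0) ->
  exists F : nat -> 'rV[R]_d -> 'rV[R]_d, (forall j, S j (F j)) /\
    {ae lam, forall x, forall i, cvgn (fun j => F j x ord0 i)}.
Proof.
move=> SB Sdec Sconv S0.
have bS k F i : S k F -> bounded_supported (fun x => F x ord0 i).
  move=> SF; have [mF FB] := SB k F SF; split; first exact: mF.
  exists B, r => x; have [FxB Fx0] := FB x; split=> [|/Fx0->]; last by rewrite mxE.
  by rewrite (le_trans (coord_le_enorm _ _)).
have bQ k F k' F' : S k F -> S k' F' -> bounded_supported (fun x => dotp (F x) (F' x)).
  move=> SF SF'; apply: bounded_supported_sum => i; apply: bounded_supportedM; last exact: bS SF'.
  by apply: bounded_supported_measurable; exact: bS SF.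
pose Q F := \int[lam]_x dotp (F x) (F x).
have Q0 F : 0 <= Q F by apply: fine_ge0; apply: integral_ge0 => x _; rewrite lee_fin dotpp_ge0.
pose T := B ^+ 2 * fine (lam (eball 0 r)).
have QT k F : S k F -> Q F <= T.
  move=> SF; have [mF FB] := SB k F SF; rewrite (le_trans (ler_norm _))//.
  apply: norm_Rint_le (bQ _ _ _ _ SF SF) (measurable_eball _ _) _ _ _.
  - by move=> x; rewrite /eball/= subr0 => /ltW; exact.
  - move=> x; rewrite ger0_norm ?dotpp_ge0// -sqr_enorm; have [FxB _] := FB x.
    by rewrite ler_pXn2r ?nnegrE ?enorm_ge0// (le_trans (enorm_ge0 _) FxB).
  - move=> x; rewrite /eball/= subr0 => /negP; rewrite -leNgt => rx.
    by have [_ ->//] := FB x; rewrite dotp0l.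
pose q k := inf (Q @` S k).
have hlb k : has_lbound (Q @` S k) by exists 0 => _ [F _ <-].
have hinf k : has_inf (Q @` S k).
  by split=> //; have [F SF] := S0 k; exists (Q F); exists F.
have qle k F : S k F -> q k <= Q F by move=> SF; apply: ge_inf; [exact: hlb|exists F].
have qmon k l : (k <= l)%N -> q k <= q l.
  move=> kl; apply: lb_le_inf; first by have [F SF] := S0 l; exists (Q F); exists F.
  by move=> _ [F SF <-]; apply: qle; exact: Sdec SF.
have hsup : has_sup (range q).
  split; first by exists (q 0%N); exists 0%N.
  by exists T => _ [k _ <-]; have [F SF] := S0 k; exact: le_trans (qle k F SF) (QT k F SF).
(* The integral of |D_j|^2 is then at most 8 . 8^-j. Multiplied by 4^j it remains summable, so
   almost everywhere |D_j| is at most a constant times 2^-j. *)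
pose e j : R := 8^-1 ^+ j.
have e0 j : 0 < e j by rewrite exprn_gt0// invr_gt0.
pose qs := sup (range q).
have qqs k : q k <= qs by apply: ub_le_sup; [case: hsup|exists k].
have exN j : exists n, qs - e j < q n.
  by have [_ [n _ <-] h] := sup_adherent (e0 j) hsup; exists n.
have [N HN] := choice exN.
(* Nondecreasing and at least both [N j] and [j]: the infimum [q] is within [e j] of its supremum,
   and the sets S (K j) are nested. *)
pose K j := (\sum_(i < j.+1) N i + j)%N.
have KN j : (N j <= K j)%N by rewrite /K big_ord_recr/= addnAC leq_addl.
have KS j : (K j <= K j.+1)%N by rewrite /K [X in (_ <= X + _)%N]big_ord_recr/= leq_add// leq_addr.
have exF j : exists F, S (K j) F /\ Q F < q (K j) + e j.
  by have [_ [F SF <-] h] := inf_adherent (e0 j) (hinf (K j)); exists F.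
have [F HF] := choice exF; exists F; split.
  by move=> j; have [SF _] := HF j; apply: Sdec SF; rewrite /K leq_addl.
pose D j x := F j.+1 x - F j x.
have bD j : bounded_supported (fun x => dotp (D j x) (D j x)).
  have -> : (fun x => dotp (D j x) (D j x)) = fun x =>
      dotp (F j.+1 x) (F j.+1 x) - 2 * dotp (F j.+1 x) (F j x) + dotp (F j x) (F j x).
    by apply/funext => x; rewrite /D dotpBl !dotpBr (dotpC (F j x) (F j.+1 x)); ring.
  have [Sj _] := HF j; have [Sj' _] := HF j.+1.
  apply: bounded_supportedD; last exact: (bQ _ _ _ _ Sj Sj).
  by apply: bounded_supportedB; [exact: (bQ _ _ _ _ Sj' Sj')|apply: bounded_supportedZ; exact: (bQ _ _ _ _ Sj' Sj)].
have QD j : \int[lam]_x dotp (D j x) (D j x) <= 8 * e j.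
  have [Sj Qj] := HF j; have [Sj' Qj'] := HF j.+1.
  have Sj'' := Sdec _ _ (KS j) _ Sj'.
  have Sm := Sconv _ _ _ Sj Sj''.
  have Qm := qle _ _ Sm; have qK : qs - e j < q (K j) := lt_le_trans (HN j) (qmon _ _ (KN j)).
  (* Parallelogram identity. The midpoint belongs to S (K j) by convexity, so its L^2 norm is at
     least [q (K j)]. *)
  have par : \int[lam]_x dotp (D j x) (D j x) =
      2 * Q (F j.+1) + 2 * Q (F j) - 4 * Q (fun x => 2^-1 *: (F j x + F j.+1 x)).
    rewrite /Q -!RintZ; [|exact: (bQ _ _ _ _ Sm Sm)|exact: (bQ _ _ _ _ Sj Sj)|exact: (bQ _ _ _ _ Sj' Sj')].
    have b1 := bounded_supportedZ 2 (bQ _ _ _ _ Sj' Sj').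
    have b2 := bounded_supportedZ 2 (bQ _ _ _ _ Sj Sj).
    have b3 := bounded_supportedZ 4 (bQ _ _ _ _ Sm Sm).
    rewrite -RintD// -RintB//; last exact: bounded_supportedD.
    congr Rintegral; apply/funext => x.
    by rewrite /D dotpBl !dotpBr dotpZl dotpZr dotpDl !dotpDr (dotpC (F j x) (F j.+1 x)); field.
  have h1 := qqs (K j); have h2 := qqs (K j.+1).
  have eS : e j.+1 = 8^-1 * e j by rewrite /e exprS.
  have ej := e0 j; rewrite par; move: Qm Qj Qj' qK h1 h2 eS ej; clear; lra.
have S4 : {ae lam, forall x, exists C, forall j, 4 ^+ j * dotp (D j x) (D j x) <= C}.
  apply: (@summable_ae_bounded _ 8).
  - by move=> j; exact: bounded_supportedZ.
  - by move=> j x; rewrite mulr_ge0 ?dotpp_ge0// exprn_ge0.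
  - move=> j; rewrite RintZ//.
    have -> : 8 * 2^-1 ^+ j = 4 ^+ j * (8 * e j) :> R.
      by rewrite mulrCA /e -exprMn; congr (_ * _ ^+ _); lra.
    by rewrite ler_wpM2l// exprn_ge0.
apply: filterS S4 => x [C HC] i.
apply: (@geometric_steps_cvg _ (Num.sqrt C)) => j.
have := coord_le_enorm (D j x) i; rewrite !mxE => /le_trans; apply.
have C0 : 0 <= C by apply: le_trans (HC 0%N); rewrite mulr_ge0 ?dotpp_ge0// exprn_ge0.
have := HC j; rewrite -sqr_enorm => HCj.
rewrite -(@ler_pXn2r _ 2)// ?nnegrE ?enorm_ge0 ?mulr_ge0 ?sqrtr_ge0 ?exprn_ge0 ?invr_ge0//.
have E : 4 ^+ j * (2^-1 ^+ j) ^+ 2 = 1 :> R.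
  by rewrite -exprM mulnC exprM -exprMn (_ : 4 * 2^-1 ^+ 2 = 1) ?expr1n//; lra.
have j0 : 0 < 4 ^+ j :> R by rewrite exprn_gt0.
have -> : (Num.sqrt C * 2^-1 ^+ j) ^+ 2 = C * (2^-1 ^+ j) ^+ 2 by rewrite exprMn (sqr_sqrtr C0).
by rewrite -(ler_pM2l j0) [leRHS]mulrCA E mulr1.
Qed.

End minimizing_sequence.

(** * Weak gradients: integration by parts, uniqueness, existence *)

Section weak_gradient.
Context {R : realType} {d : nat} (Omega : C2_domain R d).
Local Notation O := (domain_set Omega).
Local Notation lam := (lebesgue_rV R d).
Local Notation nuO := (nu Omega).
Implicit Types (w f phi psi : 'rV[R]_d -> R) (x y z : 'rV[R]_d) (u : Linfty nuO).

Lemma domain_bounded_supported f : bounded_measurable f -> (forall x, ~ O x -> f x = 0) ->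
  bounded_supported f.
Proof.
move=> [mf [M fM]] f0; split=> //; have [r r0 Or] := domain_bounded Omega.
exists M, (r + 1) => x; split=> // rx; apply: f0 => /Or; lra.
Qed.

(** Difference quotients have integral 0 by translation invariance; the Lipschitz bound dominates
    them. *)
Lemma Rint_derive0 psi i (M : R) : bounded_supported psi ->
  (forall x, derivable psi x (delta_mx 0 i)) ->
  (forall x h, `|psi (x + h *: delta_mx 0 i) - psi x| <= M * `|h|) ->
  bounded_supported ('D_(delta_mx 0 i) psi) /\ \int[lam]_x 'D_(delta_mx 0 i) psi x = 0.
Proof.
move=> bpsi dpsi lip; set e := delta_mx 0 i; have e1 : enorm (e : 'rV[R]_d) = 1.
  by rewrite /enorm /dotp (bigD1 i)//= mxE !eqxx mulr1 big1 ?addr0 ?sqrtr1// => j ji; rewrite mxE (negPf ji) andbF mulr0.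
have [mpsi [B [r psir]]] := bpsi.
pose t n : R := n.+1%:R^-1; have t0 n : 0 < t n by rewrite invr_gt0.
have t1 n : t n <= 1 by rewrite invf_le1// ler1n.
(* The double minus puts the quotient in the form [x - z] of the translation lemmas. *)
pose f n x := (t n)^-1 * (psi (x - - (t n *: e)) - psi x).
have bf n : bounded_supported (f n).
  by apply: bounded_supportedZ; apply: bounded_supportedB => //; exact: bounded_supported_shift.
have M0 : 0 <= M by have := lip 0 1; rewrite normr1 mulr1; exact: le_trans.
have If n : \int[lam]_x f n x = 0.
  rewrite RintZ ?RintB ?Rint_shift ?subrr ?mulr0//; first exact: bounded_supported_shift.
  by apply: bounded_supportedB => //; exact: bounded_supported_shift.
(* The shifts have length at most 1, and [r] may be negative. *)
pose G x := M * \1_(eball 0 (`|r| + 2)) x.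
have bG : bounded_supported G.
  apply: bounded_supportedZ; apply: (@bounded_supported_indic _ _ _ (`|r| + 2)); first exact: measurable_eball.
  by move=> x; rewrite /eball/= subr0 => /ltW.
have fG x n : `|f n x| <= G x.
  rewrite /f /G indicE opprK normrM gtr0_norm ?invr_gt0//.
  case: (boolP (x \in _)) => [_|/negP xr].
    by rewrite mulr1 ler_pdivrMl// mulrC (le_trans (lip _ _))// gtr0_norm.
  have {}xr : `|r| + 2 <= enorm x by rewrite leNgt; apply/negP => xr'; apply: xr; rewrite in_setE /eball/= subr0.
  have rr := ler_norm r.
  have [_ ->] := psir x; last by lra.
  have [_ ->] := psir (x + t n *: e); first by rewrite subrr normr0 !mulr0.
  have := enormB_ge (x + t n *: e) (t n *: e); rewrite addrK enormZ e1 mulr1 gtr0_norm//.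
  have := enormD (x + t n *: e) (- (t n *: e)); rewrite addrK enormN enormZ e1 mulr1 gtr0_norm//.
  by have := t1 n; lra.
have cf x : f n x @[n --> \oo] --> 'D_e psi x.
  have dx := dpsi x.
  have tc : t n @[n --> \oo] --> (0 : R)^'.
    move=> A /= H0; have H1 : \forall n \near \oo, (t n != 0 -> A (t n)) := @cvg_harmonic R _ H0.
    by apply: filterS H1 => k; apply; rewrite gt_eqF.
  have := cvg_comp _ _ tc dx; apply: cvg_trans.
  rewrite /derive; apply: near_eq_cvg; apply: nearW => n /=.
  by rewrite /f opprK [_ *: _ + x]addrC.
have [bD cI] := Rint_cvg (fun n => proj1 (bf n)) bG fG cf; split=> //.
rewrite -(cvg_lim _ cI)//; apply: lim_near_cst => //; apply: nearW => n; exact: If.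
Qed.

Lemma test_function_partial phi i : test_function Omega phi ->
  [/\ bounded_supported phi, forall x, ~ O x -> phi x = 0,
    forall x, derivable phi x (delta_mx 0 i), bounded_supported ('D_(delta_mx 0 i) phi) &
    (forall x, ~ O x -> 'D_(delta_mx 0 i) phi x = 0) /\
    exists M, forall x h, `|phi (x + h *: delta_mx 0 i) - phi x| <= M * `|h|].
Proof.
move=> [sm [K [cK KO K0]]]; have [cphi /(_ i)[dphi [cD _]]] := sm 1.
have D0 x : ~ K x -> 'D_(delta_mx 0 i) phi x = 0.
  move=> nK; have oK : open (~` K) by apply: closed_openC; exact: compact_closed.
  have -> : 'D_(delta_mx 0 i) phi x = 'D_(delta_mx 0 i) (cst 0 : 'rV[R]_d -> R) x.
    apply: near_eq_derive.
    have : nbhs x (~` K) by apply: open_nbhs_nbhs; split.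
    by apply: filterS => y /K0.
  exact: derive_cst.
have [b b0 Ob] := domain_bounded Omega.
have bs f : continuous f -> (forall x, ~ K x -> f x = 0) ->
    bounded_supported f /\ exists2 M, 0 <= M & forall x, `|f x| <= M.
  move=> cf f0.
  have [M M0 HM] : exists2 M, 0 <= M & forall x, `|f x| <= M.
    have := continuous_compact (continuous_subspaceT cf) cK.
    move=> /compact_bounded[M0 [_ HM]]; exists (`|M0| + 1); first by rewrite addr_ge0.
    move=> x; have [Kx|/f0->] := pselect (K x); last by rewrite normr0 addr_ge0.
    by apply: HM; [have := ler_norm M0; lra|exists x].
  split; last by exists M.
  split; first exact: continuous_measurable_fun.
  exists M, (b + 1) => x; split=> // bx; apply: f0 => /KO /Ob; lra.
have [bphi _] := bs _ cphi K0; have [bD [M M0 DM]] := bs _ cD D0.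
split=> //; first by move=> x nOx; apply: K0 => /KO.
split; first by move=> x nOx; apply: D0 => /KO.
exists M => x h.
have dl t : is_derive t (1 : R) (fun t => phi (x + t *: delta_mx 0 i)) ('D_(delta_mx 0 i) phi (x + t *: delta_mx 0 i)).
  by apply: is_derive_line; exact: derivableP.
have [c _] := MVT_total dl h 0; rewrite scale0r addr0 subr0 => ->.
by rewrite normrM ler_wpM2r.
Qed.

Lemma Rint_partial_by_parts U G C phi i : taylor2 U G C -> test_function Omega phi ->
  \int[lam]_x (G x ord0 i * phi x + U x * 'D_(delta_mx 0 i) phi x) = 0.
Proof.
move=> TU tphi; have [bphi phi0 dphi bD [D0 [M HM]]] := test_function_partial i tphi.
have [UC _ _] := TU; have C0 := taylor2_ge0 TU.
have bU : bounded_measurable U.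
  by split; [apply: continuous_measurable_fun; exact: taylor2_continuous TU|exists C].
have [_ [B [r phiB]]] := bphi.
have e1 : enorm (delta_mx 0 i : 'rV[R]_d) = 1.
  by rewrite /enorm /dotp (bigD1 i)//= mxE !eqxx mulr1 big1 ?addr0 ?sqrtr1// => j ji; rewrite mxE (negPf ji) andbF mulr0.
have dU x := taylor2_is_derive x (delta_mx 0 i) TU.
have [|x|x h|bI I0] := @Rint_derive0 (fun x => U x * phi x) i (C * M + B * (2 * C)).
- exact: bounded_supportedM.
- by apply: derivableM => //; case: (dU x).
- set y := x + _; have -> : U y * phi y - U x * phi x = U y * (phi y - phi x) + (U y - U x) * phi x by ring.
  rewrite (le_trans (ler_normD _ _))// [leRHS]mulrDl !normrM lerD//.
    by rewrite -mulrA; apply: ler_pM => //; exact: HM.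
  have := taylor2_lipschitz x y TU; rewrite {2}/y addrAC subrr add0r enormZ e1 mulr1.
  have [pB _] := phiB x => H; rewrite mulrC -mulrA ler_pM//.
rewrite -[RHS]I0; congr Rintegral; apply/funext => x.
have dphix : is_derive x (delta_mx 0 i) phi ('D_(delta_mx 0 i) phi x) by exact: derivableP.
have [_ E] := is_deriveM (dU x) dphix.
transitivity ('D_(delta_mx 0 i) (U * phi) x); last by [].
rewrite E -(taylor2_partial x i TU); have [_ ->] := dU x.
by rewrite addrC /GRing.scale/= [phi x * _]mulrC.
Qed.

End weak_gradient.

Section weak_gradient_unique.
Context {R : realType} {d : nat} (Omega : C2_domain R d).
Local Notation O := (domain_set Omega).
Local Notation lam := (lebesgue_rV R d).
Local Notation nuO := (nu Omega).
Implicit Types (w f phi psi : 'rV[R]_d -> R) (x y z : 'rV[R]_d) (u : Linfty nuO).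

Lemma ae_lebesgue_nu (P : 'rV[R]_d -> Prop) : {ae lam, forall x, P x} -> {ae nuO, forall x, P x}.
Proof.
by move=> [A [mA A0 PA]]; apply/ae_nuP; exists A => // x _; apply: contra_notP => nP; exact: PA.
Qed.

Definition closed_box (a b : 'rV[R]_d) : set 'rV[R]_d :=
  [set v | forall i, a ord0 i <= v ord0 i <= b ord0 i].

Lemma compact_closed_box a b : compact (closed_box a b).
Proof.
rewrite (_ : closed_box a b = [set v | forall i, [set t | a ord0 i <= t <= b ord0 i] (v ord0 i)])//.
apply: (@rV_compact R d (fun i => [set t | a ord0 i <= t <= b ord0 i])) => i.
rewrite (_ : [set t | _] = `[a ord0 i, b ord0 i]%classic); first exact: segment_compact.
by apply/seteqP; split=> t /=; rewrite in_itv.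
Qed.

(** Box bumps converge to indicators of boxes, so [h] has integral 0 on every box whose closed
    version lies in Omega; countably many rational ones cover Omega. *)
Lemma test_functions_separate h : bounded_measurable h -> (forall x, ~ O x -> h x = 0) ->
  (forall phi, test_function Omega phi -> \int[lam]_x (h x * phi x) = 0) ->
  {ae lam, forall x, h x = 0}.
Proof.
move=> bmh h0 hphi; have bh := domain_bounded_supported bmh h0.
pose qa (q : {ffun 'I_d -> rat * rat}) : 'rV[R]_d := \row_i ratr (q i).1.
pose qb (q : {ffun 'I_d -> rat * rat}) : 'rV[R]_d := \row_i ratr (q i).2.
have key a b : closed_box a b `<=` O -> {ae lam, forall x, h x * \1_(open_box a b) x = 0}.
  move=> abO; apply: boxes_Rint_eq0.
    under eq_fun do rewrite mulrC; apply: bounded_supportedM => //.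
    split; first by apply: measurable_indic; exact: measurable_box.
    by exists 1 => x; rewrite indicE ger0_norm//; case: (_ \in _).
  move=> a' b'.
  pose c : 'rV[R]_d := \row_i Num.max (a ord0 i) (a' ord0 i).
  pose e : 'rV[R]_d := \row_i Num.min (b ord0 i) (b' ord0 i).
  have ceE : open_box c e = open_box a b `&` open_box a' b'.
    apply/seteqP; split=> x /=.
      move=> H; split=> i; have := H i; rewrite !mxE gt_max lt_min; by move=> /andP[/andP[h1 h2] /andP[h3 h4]]; rewrite ?h1 ?h2 ?h3 ?h4.
    by move=> [H H'] i; have := H i; have := H' i; rewrite !mxE gt_max lt_min => /andP[-> ->] /andP[-> ->].
  have -> : (fun x => h x * \1_(open_box a b) x * \1_(open_box a' b') x) = (fun x => h x * \1_(open_box c e) x).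
    by apply/funext => x; rewrite ceE indicI/= mulrA.
  have tst n : test_function Omega (box_bump n.+1%:R c e).
    split; first exact: box_bump_smooth.
    exists (closed_box a b); split=> //; first exact: compact_closed_box.
    move=> x nx; apply: box_bump_eq0 => //; rewrite ceE => -[abx _]; apply: nx => i.
    by have /andP[/ltW -> /ltW ->] := abx i.
  have mf n : measurable_fun setT (fun x => h x * box_bump n.+1%:R c e x).
    apply: measurable_funM; first by case: bh.
    by have [cb _] := @box_bump_smooth R d n.+1%:R c e 0; exact: continuous_measurable_fun.
  have [||_ cI] := @Rint_cvg R d _ (fun x => h x * \1_(open_box c e) x) _ mf (bounded_supported_norm bh).
  - move=> x n; rewrite normrM ler_piMr// ger0_norm ?box_bump_ge0// box_bump_le1//.
  - by move=> x; apply: cvgM; [exact: cvg_cst|exact: box_bump_cvg].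
  rewrite -(cvg_lim _ cI)//; apply: lim_near_cst => //; apply: nearW => n; exact: hphi.
(* Rational boxes are enumerated through [unpickle], so that the exceptional sets have a null
   union. *)
have H (n : nat) : {ae lam, forall x, forall q, unpickle n = Some q ->
    closed_box (qa q) (qb q) `<=` O -> h x * \1_(open_box (qa q) (qb q)) x = 0}.
  case: (unpickle n) => [q|]; last by apply: aeW.
  have [qO|nqO] := pselect (closed_box (qa q) (qb q) `<=` O); last by apply: aeW => x q' [<-].
  by apply: filterS (key _ _ qO) => x hx q' [<-].
have {H} := ae_foralln H; apply: filterS => x H.
have [Ox|/h0//] := pselect (O x).
have /nbhs_ballP[e /= e0 xO] : nbhs x O by apply: open_nbhs_nbhs; split=> //; exact: dom_open.
have ex i : exists q : rat * rat, x ord0 i - e < ratr q.1 < x ord0 i /\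
   x ord0 i < ratr q.2 < x ord0 i + e.
  have /rat_in_itvoo[a] : x ord0 i - e < x ord0 i by rewrite gtrBl.
  have /rat_in_itvoo[b] : x ord0 i < x ord0 i + e by rewrite ltrDl.
  by rewrite !in_itv /= => ? ?; exists (a, b).
have [q0 qP] := choice ex; pose q := [ffun i => q0 i].
have qx : open_box (qa q) (qb q) x.
  by move=> i; rewrite !mxE ffunE; have [/andP[_ ->] /andP[-> _]] := qP i.
have qO : closed_box (qa q) (qb q) `<=` O.
  move=> y qy; apply: xO; split => // i j; rewrite ord1 /ball/=.
  have := qy j; have [] := qP j; rewrite !mxE !ffunE ltr_norml => /andP[? ?] /andP[? ?] /andP[? ?].
  by apply/andP; split; lra.
have := H (pickle q) q (pickleK q) qO.
by rewrite indicE mem_set// mulr1.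
Qed.

(** [energy] evaluates the gradient that [cid] happens to return; this is why a bound for one
    gradient bounds the energy. *)
Lemma weak_gradient_unique u (v v' : 'I_d -> Linfty nuO) i :
  weak_gradient u v -> weak_gradient u v' -> {ae nuO, forall x, v i x = v' i x}.
Proof.
move=> wv wv'.
have [M M0 vM] := Linfty_bound (v i); have [M' M'0 vM'] := Linfty_bound (v' i).
have [f [bf fM f0 vf]] := Linfty_rep M0 vM.
have [f' [bf' fM' f'0 vf']] := Linfty_rep M'0 vM'.
have : {ae lam, forall x, f x - f' x = 0}.
  apply: test_functions_separate.
  - exact: bounded_measurableB.
  - by move=> x nOx; rewrite f0// f'0// subrr.
  move=> phi tphi; have [bphi phi0 _ _ _] := test_function_partial i tphi.
  have E (g : Linfty nuO) k : bounded_measurable k -> {ae nuO, forall x, g x = k x} ->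
      \int[nuO]_x ((g x : R) * phi x) = \int[lam]_x (k x * phi x).
    move=> bk gk; apply: nu_Rint.
    - by apply: measurable_funM; [exact: Linfty_measurable|case: bphi].
    - exact: bounded_supportedM.
    - by move=> x /phi0 ->; rewrite mulr0.
    - by apply: filterS gk => x ->.
  have := wv i phi tphi; rewrite (wv' i phi tphi) (E _ _ bf vf) (E _ _ bf' vf') => /oppr_inj EE.
  under eq_Rintegral do rewrite mulrBl.
  by rewrite RintB ?EE ?subrr//; exact: bounded_supportedM.
move=> /ae_lebesgue_nu H; near=> x.
have -> : v i x = f x by near: x.
have -> : v' i x = f' x by near: x.
by apply/eqP; rewrite -subr_eq0; apply/eqP; near: x.
Unshelve. all: by end_near. Qed.

Lemma vector_Linfty (f : 'I_d -> 'rV[R]_d -> R) : (forall i, bounded_measurable (f i)) ->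
  exists v : 'I_d -> Linfty nuO, forall i, {ae nuO, forall x, v i x = f i x}.
Proof. move=> bf; have ex i : exists v : Linfty nuO, {ae nuO, forall x, v x = f i x} by exact: Linfty_mk.
by exists (fun i => projT1 (cid (ex i))) => i; exact: projT2 (cid (ex i)). Qed.

Lemma cvg_sum_fin (I : finType) (F : I -> nat -> R) (l : I -> R) :
  (forall i, F i j @[j --> \oo] --> l i) -> \sum_i F i j @[j --> \oo] --> \sum_i l i.
Proof.
move=> H; elim: (index_enum I) => [|i s IH].
  by rewrite big_nil; under eq_fun do rewrite big_nil; exact: cvg_cst.
by rewrite big_cons; under eq_fun do rewrite big_cons; exact: cvgD.
Qed.

Lemma ae_forall_fin (I : finType) (P : I -> 'rV[R]_d -> Prop) :
  (forall i, {ae nuO, forall x, P i x}) -> {ae nuO, forall x, forall i, P i x}.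
Proof.
move=> H; have H' (n : nat) : {ae nuO, forall x, forall i, unpickle n = Some i -> P i x}.
  case: (unpickle n) => [i|]; last by apply: aeW.
  by apply: filterS (H i) => x Px j [<-].
by have := ae_foralln H'; apply: filterS => x Hx i; exact: Hx (pickleK i).
Qed.

Lemma locally_lipschitz_continuous w (L : R) : 0 <= L -> locally_lipschitz_on O L w ->
  {within O, continuous w}.
Proof.
move=> L0 wL; apply/within_continuous_enormP => x Ox e e0.
have [r r0 rO] := open_eballP (@dom_open _ _ Omega) Ox.
exists (Num.min r (e / (L + 1))); first by rewrite lt_min r0 divr_gt0// ltr_wpDl.
move=> y; rewrite lt_min => /andP[yr ye].
rewrite (le_lt_trans (wL x r rO x y (eball_center _ r0) yr))//.
by move: ye; rewrite ltr_pdivlMr ?ltr_wpDl//; have := enorm_ge0 (y - x); nra.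
Qed.

(* The fields bounded by [L + e k] that satisfy the definition of the weak gradient
   up to a relative error [e k] form decreasing convex sets [S k], nonempty by
   smooth approximation; an almost everywhere limit of L^2 almost minimizers
   replaces weak-* compactness. *)
Lemma weak_gradient_exists u w (L : R) : 0 <= L -> locally_lipschitz_on O L w ->
  {ae nuO, forall x, u x = w x} ->
  exists v, weak_gradient u v /\ {ae nuO, forall x, enorm (\row_i (v i x : R)) <= L}.
Proof.
move=> L0 wL uw.
have [M M0 wM] := locally_lipschitz_bounded L0 wL.
have cw := locally_lipschitz_continuous L0 wL.
have bf := continuous_rep_measurable cw wM; set f := w \_ O in bf.
have fO x : ~ O x -> f x = 0 by move=> nOx; rewrite /f patchE memNset.
have fw x : O x -> f x = w x by move=> Ox; rewrite /f patchE mem_set.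
have uf : {ae nuO, forall x, u x = f x}.
  by have /ae_nuP[A AA HA] := uw; apply/ae_nuP; exists A => // x Ox nA; rewrite fw// HA.
have [b b0 Ob] := domain_bounded Omega.
pose e k : R := k.+1%:R^-1; have e0 k : 0 < e k by rewrite invr_gt0.
have eS k l : (k <= l)%N -> e l <= e k by move=> kl; rewrite lef_pV2 ?posrE// ler_nat.
pose S k := [set F : 'rV[R]_d -> 'rV[R]_d | [/\ forall i, measurable_fun setT (fun x => F x ord0 i),
  forall x, enorm (F x) <= L + e k, forall x, ~ O x -> F x = 0 &
  forall i phi, test_function Omega phi ->
    `|\int[lam]_x (F x ord0 i * phi x + f x * 'D_(delta_mx 0 i) phi x)| <=
    e k * \int[lam]_x `|'D_(delta_mx 0 i) phi x|]].
have bmF (F : 'rV[R]_d -> 'rV[R]_d) (B : R) i : measurable_fun setT (fun x => F x ord0 i) ->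
    (forall x, enorm (F x) <= B) -> bounded_measurable (fun x => F x ord0 i).
  by move=> mF FB; split=> //; exists B => x; exact: le_trans (coord_le_enorm _ _) (FB x).
have [|k l kl F [mF FB F0 Ftest]|k F F' [mF FB F0 Ft] [mF' FB' F0' Ft']|k|F [SF cF]] := @convex_minimizing R d S (L + 1) (b + 1).
- move=> k F [mF FB F0 Ftest]; split=> // x; split.
    by rewrite (le_trans (FB x))// lerD2l (le_trans (eS 0%N k _))// /e invr1.
  by move=> bx; apply: F0 => /Ob; lra.
- split=> // [x|i phi tphi]; first by rewrite (le_trans (FB x))// lerD2l eS.
  rewrite (le_trans (Ftest i phi tphi))// ler_wpM2r ?eS//.
  by apply: fine_ge0; apply: integral_ge0 => x _; rewrite lee_fin.
- split=> [i|x|x nOx|i phi tphi].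
  + under eq_fun do rewrite !mxE; apply: measurable_funM => //; exact: measurable_funD.
  + have := enormD (F x) (F' x); rewrite enormZ gtr0_norm ?invr_gt0//.
    by have := FB x; have := FB' x; lra.
  + by rewrite F0// F0'// addr0 scaler0.
  have [bphi phi0 dphi bD _] := test_function_partial i tphi.
  have b1 : bounded_supported (fun x => F x ord0 i * phi x + f x * 'D_(delta_mx 0 i) phi x).
    apply: bounded_supportedD; last exact: bounded_supportedM.
    by apply: bounded_supportedM => //; apply: bmF FB.
  have b2 : bounded_supported (fun x => F' x ord0 i * phi x + f x * 'D_(delta_mx 0 i) phi x).
    apply: bounded_supportedD; last exact: bounded_supportedM.
    by apply: bounded_supportedM => //; apply: bmF FB'.
  pose I K := \int[lam]_x ((K x : 'rV[R]_d) ord0 i * phi x + f x * 'D_(delta_mx 0 i) phi x).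
  have IE : I (fun x => 2^-1 *: (F x + F' x)) = 2^-1 * (I F + I F').
    rewrite /I -RintD// -RintZ; last exact: bounded_supportedD.
    by congr Rintegral; apply/funext => x; rewrite !mxE; field.
  have := Ft i phi tphi; have := Ft' i phi tphi; rewrite -!/(I _) IE normrM (gtr0_norm (_ : 0 < 2^-1)) ?invr_gt0//.
  set J := _ * Rintegral _ _ _.
  by have := ler_normD (I F) (I F'); clear; lra.
(* [smooth_recovery] without labels: by parts, the gradient of an approximation within [e k] of [w]
   satisfies the relaxed definition with error [e k]. *)
- have inj0 : injective (fun j : 'I_0 => (0 : 'rV[R]_d)) by move=> [].
  have ja (j : 'I_0) : O 0 by case: j.
  have [U [G [C [TU GL Uw _]]]] := smooth_recovery inj0 ja L0 wL (e0 k).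
  exists (fun x => if `[< O x >] then G x else 0); split.
  + move=> i; rewrite (_ : (fun _ => _) = (fun x => G x ord0 i) \_ O).
      apply/(measurable_restrictT _ (measurable_domain Omega)).
      apply: measurable_funTS; apply: continuous_measurable_fun.
      exact: taylor2_grad_coord_continuous TU.
    apply/funext => x; rewrite patchE; case: asboolP => Ox; first by rewrite mem_set.
    by rewrite memNset// mxE.
  + move=> x; case: asboolP => [/GL//|_]; rewrite enorm0 addr_ge0// ltW//.
  + by move=> x nOx; case: asboolP.
  move=> i phi tphi; have [bphi phi0 dphi bD [D0 _]] := test_function_partial i tphi.
  have [UC _ _] := TU.
  have bU : bounded_measurable U.
    by split; [apply: continuous_measurable_fun; exact: taylor2_continuous TU|exists C].
  have bG : bounded_measurable (fun x => G x ord0 i).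
    split; first by apply: continuous_measurable_fun; exact: taylor2_grad_coord_continuous TU.
    by have [_ GC _] := TU; exists C => x; rewrite (le_trans (coord_le_enorm _ _)).
  have -> : \int[lam]_x ((if `[< O x >] then G x else 0) ord0 i * phi x + f x * 'D_(delta_mx 0 i) phi x)
      = \int[lam]_x ((f x - U x) * 'D_(delta_mx 0 i) phi x).
    rewrite -[RHS]addr0 -(Rint_partial_by_parts i TU tphi) -RintD; first last.
    - by apply: bounded_supportedD; exact: bounded_supportedM.
    - by apply: bounded_supportedM => //; exact: bounded_measurableB.
    congr Rintegral; apply/funext => x; case: asboolP => Ox; first by ring.
    by rewrite (phi0 x Ox) (D0 x Ox); ring.
  have bfU : bounded_supported (fun x => (f x - U x) * 'D_(delta_mx 0 i) phi x).
    by apply: bounded_supportedM => //; exact: bounded_measurableB.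
  have bND := bounded_supported_norm bD.
  rewrite (le_trans (le_norm_Rint bfU))// -RintZ//; apply: le_Rint.
  + exact: bounded_supported_norm.
  + exact: bounded_supportedZ.
  move=> x; rewrite normrM; have [Ox|nOx] := pselect (O x); last by rewrite D0// normr0 !mulr0.
  by rewrite ler_wpM2r// fw// distrC Uw.
have [A [mA A0 HA]] := cF.
have cFA x i : ~ A x -> cvgn (fun j => F j x ord0 i).
  by move=> nA; apply: contrapT => nc; apply/nA/HA => /(_ i).
(* Fields are set to 0 on the null set [A], so that the limit exists everywhere and is
   measurable. *)
pose F' i j x := F j x ord0 i * \1_(~` A) x; pose g i x := limn (F' i ^~ x).
have mI : measurable_fun setT (\1_(~` A) : 'rV[R]_d -> R) by apply: measurable_indic; exact: measurableC.
have I01 x : 0 <= (\1_(~` A) x : R) <= 1 by rewrite indicE; case: (_ \in _); rewrite /= ?lexx ler01.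
have mF' i j : measurable_fun setT (F' i j) by have [mF _ _ _] := SF j; exact: measurable_funM.
have cg i x : F' i j x @[j --> \oo] --> g i x.
  suff : cvgn (F' i ^~ x) by [].
  have [xA|xA] := pselect (A x).
    rewrite (_ : _ ^~ x = cst 0); first exact: is_cvg_cst.
    by apply/funext => j; rewrite /F' indicE memNset ?mulr0// => /(_ xA).
  rewrite (_ : _ ^~ x = fun j => F j x ord0 i); first exact: cFA.
  by apply/funext => j; rewrite /F' indicE mem_set ?mulr1.
have mg i : measurable_fun setT (g i) by apply: measurable_fun_cvg (mF' i) _ => x _; exact: cg.
have ce : L + e j @[j --> \oo] --> L by rewrite -[X in _ --> X]addr0; apply: cvgD; [exact: cvg_cst|exact: cvg_harmonic].
(* The limit vector is paired with itself: |G|^2 is a limit of scalar products at most (L + e j)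
   |G|. *)
have gL x : enorm (\row_i g i x) <= L.
  set G := \row_i g i x; have [->|G0] := eqVneq G 0; first by rewrite enorm0.
  have Gn : 0 < enorm G by rewrite enorm_gt0.
  rewrite -(ler_pM2r Gn) -expr2 sqr_enorm.
  have cG : \sum_i F' i j x * G ord0 i @[j --> \oo] --> dotp G G.
    rewrite /dotp; apply: cvg_sum_fin => i; apply: cvgM; last exact: cvg_cst.
    by rewrite {1}/G mxE; exact: cg.
  have cL : (L + e j) * enorm G @[j --> \oo] --> L * enorm G by apply: cvgM => //; exact: cvg_cst.
  apply: (ler_cvg_to cG cL); apply: nearW => j; have [_ FB _ _] := SF j.
  rewrite (_ : \sum_i _ = dotp (F j x) G * \1_(~` A) x); last first.
    by rewrite /dotp mulr_suml; apply: eq_bigr => i _; rewrite /F'; ring.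
  have /andP[i0 i1] := I01 x; rewrite (@le_trans _ _ (enorm (F j x) * enorm G))//; last by rewrite ler_wpM2r// ltW.
  rewrite (@le_trans _ _ (enorm (F j x) * enorm G * \1_(~` A) x))//; first by rewrite ler_wpM2r// dotp_le_enorm.
  by rewrite ler_piMr// mulr_ge0 ?enorm_ge0.
have bg i : bounded_measurable (g i).
  split=> //; exists L => x; have := coord_le_enorm (\row_i g i x) i; rewrite mxE => /le_trans; exact.
have [v vg] := vector_Linfty bg; exists v; split; last first.
  have vg' := ae_forall_fin vg; apply: filterS vg' => x vx.
  by rewrite (_ : \row_i _ = \row_i g i x) ?gL//; apply/rowP => i; rewrite !mxE vx.
move=> i phi tphi; have [bphi phi0 dphi bD [D0 _]] := test_function_partial i tphi.
rewrite (@nu_Rint _ _ Omega _ (fun x => f x * 'D_(delta_mx 0 i) phi x)); first last.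
- by apply: filterS uf => x ->.
- by move=> x /D0 ->; rewrite mulr0.
- exact: bounded_supportedM.
- by apply: measurable_funM; [exact: Linfty_measurable|case: bD].
rewrite (@nu_Rint _ _ Omega _ (fun x => g i x * phi x)); first last.
- by apply: filterS (vg i) => x ->.
- by move=> x /phi0 ->; rewrite mulr0.
- exact: bounded_supportedM.
- by apply: measurable_funM; [exact: Linfty_measurable|case: bphi].
set I0 := \int[lam]_x (f x * _); set J := \int[lam]_x `|'D_(delta_mx 0 i) phi x|.
have [||||_ cI] := @Rint_cvg R d (fun j x => F' i j x * phi x) (fun x => g i x * phi x) (fun x => (L + 1) * `|phi x|).
- by move=> j; apply: measurable_funM => //; case: bphi.
- by apply: bounded_supportedZ; exact: bounded_supported_norm.
- move=> x j; have [_ FB _ _] := SF j; rewrite normrM ler_wpM2r// /F' normrM.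
  have /andP[i0 i1] := I01 x; rewrite (ger0_norm i0).
  rewrite (@le_trans _ _ (`|F j x ord0 i| * 1))//; first by rewrite ler_wpM2l.
  rewrite mulr1 (le_trans (coord_le_enorm _ _))// (le_trans (FB x))// lerD2l.
  by rewrite (le_trans (eS 0%N j _))// /e invr1.
- by move=> x; apply: cvgM => //; exact: cvg_cst.
have close j : `|\int[lam]_x (F' i j x * phi x) - - I0| <= e j * J.
  have [mF FB F0 Ft] := SF j; rewrite opprK; have := Ft i phi tphi.
  rewrite RintD; [|apply: bounded_supportedM => //; exact: bmF FB|exact: bounded_supportedM].
  congr (`|_ + _| <= _); rewrite /Rintegral; congr fine; apply: ae_eq_integral => //.
  - by apply/measurable_EFinP; apply: measurable_funM => //; case: bphi.
  - by apply/measurable_EFinP; apply: measurable_funM => //; case: bphi.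
  exists A; split=> // x; apply: contra_notP => nA _.
  by rewrite /F' indicE mem_set ?mulr1.
apply: oppr_inj; rewrite opprK.
suff cI' : \int[lam]_x (F' i j x * phi x) @[j --> \oo] --> - I0 by exact: (cvg_unique _ cI' cI).
have cJ : e j * J @[j --> \oo] --> (0 : R).
  by rewrite -[X in _ --> X](mul0r J); apply: cvgM; [exact: cvg_harmonic|exact: cvg_cst].
apply/cvgrPdist_le => eps eps0; have /cvgrPdist_le/(_ eps eps0) := cJ.
apply: filterS => j; rewrite sub0r normrN distrC => h.
by rewrite (le_trans (close j))// (le_trans (ler_norm _)).
Qed.

Lemma locally_lipschitz_energy_cons g N (a : 'I_N -> 'rV[R]_d) u w (L : R) : 0 <= L ->
  locally_lipschitz_on O L w -> {ae nuO, forall x, u x = w x} ->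
  (forall j, w (a j) = g (a j)) -> (energy_cons Omega g a u <= L%:E)%E.
Proof.
move=> L0 wL uw wa; rewrite /energy_cons; case: asboolP => [_|[]]; last first.
  by exists w; split=> //; exact: locally_lipschitz_continuous wL.
have [v [wv vL]] := weak_gradient_exists L0 wL uw.
rewrite /energy; case: pselect => [h|[]]; last by exists v.
case: (cid h) => v' wv' /=; apply/ess_sup_enorm_le.
have vv' := ae_forall_fin (fun i => weak_gradient_unique i wv wv').
near=> x; rewrite (_ : \row_i _ = \row_i (v i x : R)); first by near: x.
by apply/rowP => i; rewrite !mxE; move: i; near: x; apply: filterS vv' => x H i; rewrite H.
Unshelve. all: by end_near. Qed.

End weak_gradient_unique.

(** * Graph energies *)

Section transport.
Context {R : realType} {d : nat} (Omega : C2_domain R d).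
Local Notation O := (domain_set Omega).
Local Notation lam := (lebesgue_rV R d).
Local Notation nuO := (nu Omega).

Definition transport (x : nat -> 'rV[R]_d) (m : nat) (T : 'rV[R]_d -> 'rV[R]_d) :=
  [/\ (0 < m)%N, measurable_fun O T, forall y, O y -> O (T y) /\ cloud x m (T y),
    forall y, cloud x m y -> T y = y &
    forall A, measurable A -> pushforward (unif Omega) T A = empirical x m A].

Context (x : nat -> 'rV[R]_d) (m : nat) (T : 'rV[R]_d -> 'rV[R]_d) (Txm : transport x m T).

Let m0 : (0 < m)%N. Proof. by case: Txm. Qed.
Let mT : measurable_fun O T. Proof. by case: Txm. Qed.
Let TO y : O y -> O (T y). Proof. by case: Txm => _ _ H _ _ /H[]. Qed.
Let Tcloud y : O y -> cloud x m (T y). Proof. by case: Txm => _ _ H _ _ /H[]. Qed.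

Lemma transport_preimage A : measurable A ->
  lam (T @^-1` A `&` O) = ((vol Omega / m%:R)%:E * \sum_(i < m) \d_(x i) A)%E.
Proof.
move=> mA; case: Txm => _ _ _ _ /(_ A mA); rewrite /pushforward /unif /empirical nuE => H.
have v0 := vol_gt0 Omega.
have -> : lam (T @^-1` A `&` O) = ((vol Omega)%:E * ((vol Omega)^-1%:E * lam (T @^-1` A `&` O)))%E.
  by rewrite muleA -EFinM divff ?mul1e// gt_eqF.
by rewrite H muleA -EFinM.
Qed.

(** [T] sends all of Omega into Omega, so Omega has full empirical mass and none of the [m] atoms
    can lie outside. *)
Lemma cloud_domain c : cloud x m c -> O c.
Proof.
move=> [i /= im <-]; apply: contrapT => nO.
have := transport_preimage (measurable_domain Omega).
have -> : T @^-1` O `&` O = O by apply/seteqP; split=> [y []//|y Oy]; split=> //; exact: TO.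
rewrite lebesgue_domainE.
have m0' : 0 < m%:R :> R by rewrite ltr0n.
have -> : (\sum_(i < m) \d_(x i) O)%E = (\sum_(i < m) (\1_O (x i) : R))%R%:E.
  by rewrite (eq_bigr (fun k : 'I_m => (\1_O (x k) : R)%:E)) ?sumEFin.
move=> /= [] /eqP; rewrite -mulrA -{1}[vol _]mulr1 => /eqP/(mulfI (lt0r_neq0 (vol_gt0 Omega))).
move=> /esym E1; have /eqP : \sum_(k < m) (\1_O (x k) : R) = m%:R.
  by apply: (mulfI (invr_neq0 (lt0r_neq0 m0'))); rewrite E1 mulVf// gt_eqF.
rewrite lt_eqF//.
rewrite (bigD1 (Ordinal im))//= indicE memNset// add0r.
apply: (@le_lt_trans _ _ (\sum_(k < m | k != Ordinal im) 1)).
  by apply: ler_sum => k _; rewrite indicE; case: (_ \in _).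
rewrite sumr_const ltr_nat; have := cardC1 (Ordinal im); rewrite card_ord => E.
by rewrite -(eq_card (A := predC1 (Ordinal im)))// E -ltnS prednK.
Qed.

Lemma measurable_set1_rV (c : 'rV[R]_d) : measurable [set c].
Proof.
rewrite (_ : [set c] = (fun y => enorm (y - c)) @^-1` `]-oo, 0]).
  apply: measurable_preimT => //; apply: measurableT_comp (@measurable_enorm R d) _.
  by under eq_fun do rewrite addrC; exact: measurable_addl.
apply/seteqP; split=> y /=; first by move=> ->; rewrite in_itv/= subrr enorm0.
rewrite in_itv/= => h; have : enorm (y - c) == 0 by rewrite eq_le h enorm_ge0.
by rewrite enorm_eq0 subr_eq0 => /eqP.
Qed.

Lemma measurable_cloud (P : set 'rV[R]_d) : measurable (cloud x m `&` P).
Proof.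
rewrite (_ : _ `&` _ = \bigcup_(i in [set i | (i < m)%N /\ P (x i)]) [set x i]).
  apply: bigcup_measurable => i _; exact: measurable_set1_rV.
apply/seteqP; split=> [y [[i im <-] Px]|y [i [im Px] ->]]; first by exists i.
by split=> //; exists i.
Qed.

Lemma cloud_mass c : cloud x m c -> (0 < lam (T @^-1` [set c] `&` O))%E.
Proof.
move=> [i /= im <-]; rewrite transport_preimage; last exact: measurable_set1_rV.
apply: mule_gt0; first by rewrite lte_fin divr_gt0 ?vol_gt0// ltr0n.
rewrite (bigD1 (Ordinal im))//= diracE mem_set//.
by apply: (@lt_le_trans _ _ 1%E); rewrite ?lte01// leeDl// sume_ge0// => k _; exact: measure_ge0.
Qed.

(** On Omega the map takes its values in the finite cloud, all of whose subsets are measurable;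
    hence [h] can be arbitrary. *)
Lemma transport_bounded_measurable (h : 'rV[R]_d -> R) : bounded_measurable ((h \o T) \_ O).
Proof.
split.
  apply/(measurable_restrictT _ (measurable_domain Omega)) => mO B mB.
  rewrite (_ : O `&` _ = O `&` T @^-1` (cloud x m `&` h @^-1` B)).
    exact: mT (measurable_cloud _).
  apply/seteqP; split=> y [Oy] /=; last by move=> [].
  by move=> By; split=> //; split=> //; exact: Tcloud.
exists (\sum_(i < m) `|h (x i)|) => y; rewrite patchE; case: ifPn => [|_]; last first.
  by rewrite normr0 sumr_ge0.
rewrite in_setE => /Tcloud[i /= im <-] /=.
by rewrite (bigD1 (Ordinal im))//= lerDl sumr_ge0.
Qed.

Lemma transport_bounded_supported (h : 'rV[R]_d -> R) : bounded_supported ((h \o T) \_ O).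
Proof.
apply: (@domain_bounded_supported _ _ Omega); first exact: transport_bounded_measurable.
by move=> y nO; rewrite patchE memNset.
Qed.

Lemma empirical_mean (h : 'rV[R]_d -> R) : (forall y, 0 <= h y) ->
  m%:R^-1 * \sum_(j < m) h (x j) = (vol Omega)^-1 * \int[lam]_y ((h \o T) \_ O) y.
Proof.
move=> h0; have v0 := vol_gt0 Omega; have m0' : 0 < m%:R :> R by rewrite ltr0n.
have mO := measurable_domain Omega.
(* The change of variables is made with versions of [T] and [h] that are measurable on the whole
   space and agree with them on Omega and on the cloud. *)
pose T' y := if `[< O y >] then T y else 0.
have T'E y : O y -> T' y = T y by move=> Oy; rewrite /T'; case: asboolP.
have mT' : measurable_fun setT T'.
  move=> _ B mB; rewrite setTI.
  rewrite (_ : T' @^-1` B = (O `&` T @^-1` B) `|` (~` O `&` [set _ | B 0])).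
    apply: measurableU; first exact: mT.
    have [B0|nB0] := pselect (B 0).
      by rewrite (_ : [set _ | _] = setT) ?setIT; [exact: measurableC|apply/seteqP; split].
    by rewrite (_ : [set _ | _] = set0) ?setI0//; apply/seteqP; split.
  apply/seteqP; split=> y /=; rewrite /T'; case: asboolP => Oy; [by left|by right| |].
    by move=> [[_ //]|[]].
  by move=> [[]|[]].
pose h' c := if `[< cloud x m c >] then h c else 0.
have h'0 c : 0 <= h' c by rewrite /h'; case: ifP.
have mh' : measurable_fun setT h'.
  move=> _ B mB; rewrite setTI.
  rewrite (_ : h' @^-1` B = (cloud x m `&` h @^-1` B) `|` (~` (cloud x m `&` setT) `&` [set _ | B 0])).
    apply: measurableU; first exact: measurable_cloud.
    have [B0|nB0] := pselect (B 0).
      by rewrite (_ : [set _ | _] = setT) ?setIT; [apply: measurableC; rewrite -[X in measurable X]setIT; exact: measurable_cloud|apply/seteqP; split].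
    by rewrite (_ : [set _ | _] = set0) ?setI0//; apply/seteqP; split.
  rewrite setIT; apply/seteqP; split=> y /=; rewrite /h'; case: asboolP => Oy; [by left|by right| |].
    by move=> [[_ //]|[]].
  by move=> [[]|[]].
have mh'E : measurable_fun setT (EFin \o h') by exact/measurable_EFinP.
have k0 : 0 <= vol Omega / m%:R by rewrite divr_ge0 // ltW.
pose mu2 := mscale (NngNum k0) (msum (fun i => \d_(x i)) m).
have I1 : (\int[pushforward_measure nuO mT']_y (h' y)%:E =
    \int[mu2]_y (h' y)%:E)%E.
  apply: eq_measure_integral => A mA _; rewrite /mu2 /= /mscale/= /msum -transport_preimage//.
  rewrite /pushforward nuE; congr (lam _); apply/seteqP; split=> y [TA Oy]; split=> //.
    by move: TA => /=; rewrite T'E.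
  by move: TA => /=; rewrite -T'E.
move: I1; rewrite /mu2 ge0_integral_mscale//; last by move=> c _; rewrite lee_fin.
rewrite ge0_integral_measure_sum//; last by move=> c _; rewrite lee_fin.
under [X in _ = (_ * X)%E]eq_bigr => i _ do rewrite integral_dirac// diracT mul1e.
rewrite sumEFin -EFinM /=.
rewrite [LHS](ge0_integral_pushforward mT' nuO measurableT mh'E); last by move=> c _; rewrite lee_fin.
rewrite preimage_setT.
have -> : (\int[nuO]_y ((EFin \o h') \o T') y = \int[lam]_y (((h \o T) \_ O) y)%:E)%E.
  rewrite (@ge0_negligible_integral _ _ _ nuO setT (~` O))//; first last.
  - by rewrite nuE setICl measure0.
  - by move=> y _; rewrite lee_fin.
  - exact: measurableT_comp.
  - exact: measurableC.
  rewrite setTD setCK ge0_nu_integral integral_mkcond; apply: eq_integral => y _.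
  rewrite !patchE; case: ifPn => // /set_mem Oy /=; rewrite T'E// /h'.
  by case: asboolP => // -[]; exact: Tcloud.
move=> E; rewrite /Rintegral E /=.
have -> : \sum_(i < m) h' (x i) = \sum_(i < m) h (x i).
  by apply: eq_bigr => i _; rewrite /h'; case: asboolP => // -[]; exists (nat_of_ord i) => //=.
by field; rewrite !gt_eqF.
Qed.

End transport.

Section graph_energy.
Context {R : realType} {d : nat} (Omega : C2_domain R d).
Local Notation O := (domain_set Omega).
Local Notation lam := (lebesgue_rV R d).
Local Notation nuO := (nu Omega).
Context (eta : R -> R) (p : R) (p0 : 0 < p) (g : 'rV[R]_d -> R) (N : nat) (a : 'I_N -> 'rV[R]_d).
Context (eta_ge0 : forall t, 0 <= t -> 0 <= eta t).
Context (s : R) (s0 : 0 < s) (x : nat -> 'rV[R]_d) (m : nat) (T : 'rV[R]_d -> 'rV[R]_d)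
  (Txm : transport Omega x m T) (a_cloud : forall j, cloud x m (a j)).
Local Notation etas := (@eta_scaled R d eta s).
Local Notation energy_at c := (fun (w : 'rV[R]_d -> R) z => etas (enorm (c - z)) * `|w c - w z| `^ p).

Lemma eta_scaled_ge0 t : 0 <= t -> 0 <= etas t.
Proof. by move=> t0; rewrite /eta_scaled mulr_ge0 ?invr_ge0 ?exprn_ge0 ?(ltW s0)// eta_ge0 ?divr_ge0// ltW. Qed.

(** Turns an energy bound into one integral inequality per point of the cloud; the default value 0
    of the maximum is harmless because [K * s] is nonnegative. *)
Lemma graph_energy_le_iff w (K : R) : 0 <= K ->
  (graph_energy eta p g a s m x w <= K%:E)%E <-> (forall j, w (a j) = g (a j)) /\
  forall c, cloud x m c ->
    \int[lam]_y ((energy_at c w \o T) \_ O) y <= vol Omega * (K * s) `^ p.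
Proof.
move=> K0; have Ks : 0 <= K * s by rewrite mulr_ge0// ltW.
have v0 := vol_gt0 Omega.
have m0' : 0 < m%:R :> R by case: Txm; rewrite ltr0n.
have X0 c : forall y, 0 <= energy_at c w y.
  by move=> y; rewrite mulr_ge0 ?powR_ge0// eta_scaled_ge0// enorm_ge0.
rewrite /graph_energy; case: asboolP => [wa|nwa]; last first.
  by split=> [|[]//]; rewrite leye_eq.
rewrite lee_fin ler_pdivrMl// mulrC.
pose X i := m%:R^-1 * \sum_(j < m) energy_at (x i) w (x j).
have XE i : X i = (vol Omega)^-1 * \int[lam]_y ((energy_at (x i) w \o T) \_ O) y.
  exact: (empirical_mean Txm (X0 (x i))).
have Xi0 i : 0 <= X i by apply: mulr_ge0; [rewrite invr_ge0 ltW|apply: sumr_ge0 => j _; exact: X0].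
have step i : (X i `^ p^-1 <= K * s) <->
    (\int[lam]_y ((energy_at (x i) w \o T) \_ O) y <= vol Omega * (K * s) `^ p).
  rewrite -(ler_pdivrMl _ _ v0) -XE; split=> h.
    have := ge0_ler_powR (ltW p0) _ _ h; rewrite -powRrM mulVf ?gt_eqF// powRr1//.
    by apply; rewrite nnegrE ?powR_ge0.
  have pV : 0 <= p^-1 by rewrite invr_ge0 ltW.
  have := ge0_ler_powR pV _ _ h; rewrite -powRrM mulfV ?gt_eqF// powRr1//.
  by apply; rewrite nnegrE ?powR_ge0.
split=> [/bigmax_leP[_ H]|[_ H]].
  split=> // _ [i /= im <-]; apply/step; exact: (H (Ordinal im)).
apply/bigmax_leP; split=> // i _; apply/step; apply: H; by exists (nat_of_ord i) => //=.
Qed.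

Lemma graph_energy_ext w w' : (forall c, cloud x m c -> w c = w' c) ->
  graph_energy eta p g a s m x w = graph_energy eta p g a s m x w'.
Proof.
move=> ww'; rewrite /graph_energy.
have wx (i : 'I_m) : w (x i) = w' (x i) by apply: ww'; exists (nat_of_ord i) => //=.
have -> : `[< forall j, w (a j) = g (a j) >] = `[< forall j, w' (a j) = g (a j) >].
  by apply: asbool_equiv_eq; split=> H j; have := H j; rewrite ww'.
pose F (W : 'I_m -> R) : \bar R := (s^-1 * \big[Num.max/0]_(i < m)
  (m%:R^-1 * \sum_(j < m) etas (enorm (x i - x j)) * `|W i - W j| `^ p) `^ p^-1)%:E.
have FE : F (fun i => w (x i)) = F (fun i => w' (x i)) by congr F; apply/funext.
exact: (congr1 (fun z => if `[< forall j, w' (a j) = g (a j) >] then z else +oo%E) FE).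
Qed.

(** Fibres over the cloud have positive mass, so each meets every set of full measure. This yields
    the uniqueness of [w] on the cloud and, later, good points near the labels. *)
Lemma cloud_ae_fibre (P : 'rV[R]_d -> Prop) c : cloud x m c -> {ae nuO, forall y, P y} ->
  exists y, [/\ O y, T y = c & P y].
Proof.
move=> xc /ae_nuP[A [mA A0] PA]; apply: contrapT => H; move: H.
have := cloud_mass Txm xc; apply: contraPP => ne.
have mC : measurable (T @^-1` [set c] `&` O).
  by case: Txm => _ mT _ _ _; rewrite setIC; apply: mT; [exact: measurable_domain|exact: measurable_set1_rV].
apply/negP; rewrite -leNgt -A0; apply: le_measure; rewrite ?inE//.
by move=> y [/= Tyc Oy]; apply: contrapT => nA; apply: ne => H; apply: H; exists y; split=> //; exact: PA.
Qed.

Lemma graph_energy_consE (u : Linfty nuO) w : {ae nuO, forall y, u y = w (T y)} ->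
  graph_energy_cons eta p g a Omega s m x T u = graph_energy eta p g a s m x w.
Proof.
move=> uw; rewrite /graph_energy_cons; case: pselect => [h|[]]; last by exists w.
case: (cid h) => w' uw' /=; apply: graph_energy_ext => c xc.
have : {ae nuO, forall y, w' (T y) = w (T y)}.
  by near=> y; transitivity (u y : R); [apply/esym|]; near: y.
by move=> /(cloud_ae_fibre xc)[y [_ <-]].
Unshelve. all: by end_near. Qed.

Lemma graph_energy_cons_ge0 (u : Linfty nuO) : (0 <= graph_energy_cons eta p g a Omega s m x T u)%E.
Proof.
rewrite /graph_energy_cons; case: pselect => [h|_]; last exact: leey.
case: (cid h) => w' uw' /=; rewrite /graph_energy; case: ifP => _; last exact: leey.
rewrite lee_fin mulr_ge0 ?invr_ge0 ?(ltW s0)//.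
exact: bigmax_ge_id.
Qed.

(** The representative is [w \o T] on Omega. It takes each of its values on a fibre of positive
    mass, so almost sure properties of the values hold everywhere in Omega. *)
Lemma graph_energy_cons_density (u : Linfty nuO) (K : R) : 0 <= K ->
  (graph_energy_cons eta p g a Omega s m x T u <= K%:E)%E ->
  exists U : 'rV[R]_d -> R, [/\ bounded_measurable U, forall y, ~ O y -> U y = 0,
    {ae nuO, forall y, u y = U y},
    (forall Q : R -> Prop, {ae nuO, forall y, Q (u y)} -> forall y, O y -> Q (U y)) /\
    (forall j y, O y -> T y = a j -> U y = g (a j)) &
    forall y, O y -> let f := (fun z => etas (enorm (T y - T z)) * `|U y - U z| `^ p) \_ O in
      bounded_supported f /\ \int[lam]_z f z <= vol Omega * (K * s) `^ p].
Proof.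
move=> K0 H; have := H; rewrite {1}/graph_energy_cons; case: pselect => [h _|_]; last by rewrite leye_eq.
have [w uw] := h; move: H; rewrite (graph_energy_consE uw) => /(graph_energy_le_iff _ K0)[wa Hc].
exists ((w \o T) \_ O); split.
- exact: (transport_bounded_measurable Txm).
- by move=> y nO; rewrite patchE memNset.
- have /ae_nuP[A AA HA] := uw; apply/ae_nuP; exists A => // y Oy nA.
  by rewrite patchE mem_set// HA.
- split; last by move=> j y Oy Tya; rewrite patchE mem_set//= Tya wa.
  move=> Q Qu y Oy; have [_ _ TO _ _] := Txm; have [_ xTy] := TO y Oy.
  have [z [Oz Tz [uz Qz]]] := cloud_ae_fibre xTy (filterI uw Qu).
  by rewrite patchE mem_set//= -Tz -uz.
move=> y Oy f.
have -> : f = (energy_at (T y) w \o T) \_ O.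
  apply/funext => z; rewrite /f !patchE (mem_set Oy).
  by have [zO|//] := boolP (z \in O).
by split; [exact: (transport_bounded_supported Txm)|apply: Hc; case: Txm => _ _ TO _ _; have [] := TO y Oy].
Qed.

End graph_energy.

(** * Oscillation controlled by the graph energy *)

Section asymptotic_equicontinuity.
Context {R : realType} {d : nat} (Omega : C2_domain R d).
Local Notation O := (domain_set Omega).
Local Notation lam := (lebesgue_rV R d).
Local Notation nuO := (nu Omega).
Implicit Types (x y z e : 'rV[R]_d).

Lemma kernel_continuous (eta : R -> R) (r : R) : interaction_kernel eta r ->
  forall t, 0 <= t -> forall e : R, 0 < e -> exists2 h : R, 0 < h &
    forall t', 0 <= t' -> `|t' - t| < h -> `|eta t' - eta t| < e.
Proof.
move=> [/subspace_continuousP ceta _ _ _ _] t t0 e e0.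
have /cvgrPdist_lt/(_ e e0) := ceta t t0.
rewrite near_withinE => /nbhs_ballP[h /= h0 H]; exists h => // t' t'0 tt'.
by rewrite distrC; apply: (H t' _ t'0); rewrite /ball/= distrC.
Qed.

(** By monotonicity a nonzero value somewhere forces eta(0) > 0; continuity at 0 does the rest. *)
Lemma kernel_lower_bound (eta : R -> R) (r : R) : interaction_kernel eta r ->
  (exists2 t, 0 <= t & eta t != 0) ->
  exists c t1 : R, [/\ 0 < c, 0 < t1 & forall t, 0 <= t -> t <= t1 -> c <= eta t].
Proof.
move=> ker [t t0 etat]; have [_ eta0 mono _ _] := ker.
have e0 : 0 < eta 0.
  by rewrite (lt_le_trans _ (mono 0 t _ t0))// lt_neqAle eq_sym etat eta0.
have e2 : 0 < eta 0 / 2 by rewrite divr_gt0.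
have [t1 t10 H] := kernel_continuous ker (lexx 0) e2.
exists (eta 0 / 2), (t1 / 2); split; rewrite ?divr_gt0//.
move=> t' t'0 t'1; have := H t' t'0; rewrite subr0 ger0_norm// => /(_ _)/ltW.
by rewrite ler_norml => h; have /andP[] := h (ltac:(lra)); lra.
Qed.

Lemma lebesgue_rV_eball x (r : R) : 0 < r ->
  lam (eball x r) = (r ^+ d * fine (lam (eball 0 1)))%:E.
Proof.
move=> r0; rewrite lebesgue_rV_eball_center.
have -> : eball 0 r = (fun x => r^-1 *: x) @^-1` eball (0 : 'rV[R]_d) 1.
  apply/seteqP; split=> y; rewrite /eball/= !subr0 enormZ gtr0_norm ?invr_gt0// ltr_pdivrMl// mulr1//.
rewrite lebesgue_rV_scale ?invr_gt0//; last exact: measurable_eball.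
by rewrite exprVn invrK EFinM fineK// ge0_fin_numE// lebesgue_rV_eball_lty.
Qed.

Lemma unit_ball_volume_gt0 : 0 < fine (lam (eball 0 1)).
Proof.
rewrite fine_gt0// lebesgue_rV_eball_lty andbT.
by apply: (@lebesgue_rV_open_gt0 _ _ _ 0); [exact: open_eball|exact: eball_center].
Qed.

Context (eta : R -> R) (p : R).

Definition energy_density (s : R) (T : 'rV[R]_d -> 'rV[R]_d) (U : 'rV[R]_d -> R) y :=
  (fun z => @eta_scaled R d eta s (enorm (T y - T z)) * `|U y - U z| `^ p) \_ O.

(** What a graph energy at most [K] provides, in terms of integrals over Omega only; [D] collects
    the points where the displacement bound is available. *)
Definition energy_bounded (s delta K : R) T U (D : set 'rV[R]_d) :=
  [/\ D `<=` O, {ae nuO, forall y, D y}, forall y, D y -> enorm (T y - y) <= delta &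
    forall y, D y -> bounded_supported (energy_density s T U y) /\
       \int[lam]_z energy_density s T U y z <= vol Omega * (K * s) `^ p].

Context (p1 : 1 < p) (eta0 : forall t, 0 <= t -> 0 <= eta t) (c0 t1 : R) (c0_gt0 : 0 < c0) (t1_gt0 : 0 < t1)
  (eta_c0 : forall t, 0 <= t -> t <= t1 -> c0 <= eta t).

(* Averaging over a ball of radius comparable to [s], inside [Omega] and close to
   both points, gives a common [z] with [|U y - U z|] and [|U y' - U z|] small. *)
Lemma local_oscillation : exists C c h0 k0 : R, [/\ 0 < C, 0 < c, 0 < h0, 0 < k0 &
  forall s delta K T U D, 0 < s -> s <= h0 -> 0 <= delta -> delta <= k0 * s -> 0 < K ->
    energy_bounded s delta K T U D ->
    forall y y', D y -> D y' -> enorm (y' - y) <= c * s -> `|U y - U y'| <= C * K * s].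
Proof.
have [rho [alpha' [rho0 alpha'0 PU]]] := C2_domain_pushable Omega (@ltr01 R).
pose alpha := Num.min alpha' 1; have alpha0 : 0 < alpha by rewrite lt_min alpha'0 ltr01.
have alphale : alpha <= alpha' by rewrite ge_min lexx.
have alpha1 : alpha <= 1 by rewrite ge_min lexx orbT.
(* A point of the ball is within 2 t = t1 s / 2 of [y] and [y'], and two displacements add at most
   t1 s / 2: the rescaled distance of the images is at most [t1], where [eta] is at least [c0]. *)
pose beta := t1 / 4; have beta0 : 0 < beta by rewrite divr_gt0.
have p0 : 0 < p := lt_trans ltr01 p1.
have v0 := vol_gt0 Omega; have om0 := unit_ball_volume_gt0.
set om := fine _ in om0.
pose C1 := 3 * vol Omega / (c0 * ((alpha * beta / 2) ^+ d * om)).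
have ab0 : 0 < alpha * beta / 2 by rewrite divr_gt0// mulr_gt0.
have C10 : 0 < C1 by rewrite divr_gt0 ?mulr_gt0 ?exprn_gt0.
exists (2 * C1 `^ p^-1), (alpha * beta / 2), (rho / beta), (t1 / 4).
split; [by rewrite mulr_gt0 ?powR_gt0|by []|by rewrite divr_gt0|by rewrite divr_gt0|].
move=> s delta K T U D s0 sh de0 de K0 [DO aeD Tde Den] y y' Dy Dy' yy'.
have Oy := DO _ Dy; have Oy' := DO _ Dy'.
pose t := beta * s; have t0 : 0 < t by rewrite mulr_gt0.
have trho : t <= rho by rewrite /t mulrC -ler_pdivlMr.
have [e e1 He] := PU y Oy.
have BO w : enorm w <= alpha * t -> O (y + t *: e + w).
  move=> wt; have := He y y t 0 w Oy Oy; rewrite subrr enorm0 mulr0 scale0r addr0.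
  apply=> //; rewrite ?(ltW t0) ?lexx ?ler01//.
  by rewrite (le_trans wt)// ler_wpM2r// ltW.
pose B := eball (y + t *: e) (alpha * t / 2).
have ale : alpha * t <= t by rewrite ler_piMl// ltW.
have Bz z : B z -> [/\ O z, enorm (z - y) <= 2 * t & enorm (z - y') <= 2 * t].
  rewrite /B /eball/= => zB.
  have h1 : enorm (z - y) <= 3 / 2 * t.
    have := enormD (z - (y + t *: e)) (t *: e); rewrite enormZ gtr0_norm// opprD addrA subrK.
    have := zB; rewrite opprD addrA.
    by have : t * enorm e <= t; [rewrite ler_piMr// ltW|lra].
  split; last 2 first; [lra|..].
    have := enorm_triangle y z y'; rewrite (enormB y y') => h2.
    have : enorm (y' - y) <= alpha * t / 2 by rewrite (le_trans yy')// /t; lra.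
    lra.
  rewrite (_ : z = y + t *: e + (z - (y + t *: e))); last by rewrite addrC subrK.
  have atp : 0 < alpha * t by rewrite mulr_gt0.
  by apply: BO; lra.
have [A [mA A0] HA] := (ae_nuP Omega D).1 aeD.
(* Without the null set [A], every point of the ball is in [D]. *)
pose B' := B `\` A.
have mB' : measurable B' by apply: measurableD => //; exact: measurable_eball.
have at0 : 0 < alpha * t / 2 by rewrite divr_gt0// mulr_gt0.
have lamB : lam B' = ((alpha * t / 2) ^+ d * om)%:E.
  rewrite -(lebesgue_rV_eball (y + t *: e) at0) -/B.
  rewrite (measureDI lam (measurable_eball _ _) mA) -/B.
  rewrite -[LHS]adde0; congr (_ + _)%E; apply/esym/eqP; rewrite -measure_le0 -A0; apply: le_measure; rewrite ?inE//.
  by apply: measurableI => //; exact: measurable_eball.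
pose M := vol Omega * (K * s) `^ p.
pose kap := (K * s) `^ p * C1.
have Ks0 : 0 < K * s by rewrite mulr_gt0.
have kap0 : 0 < kap by rewrite mulr_gt0 ?powR_gt0.
have [bf If] := Den y Dy; have [bf' If'] := Den y' Dy'.
have ex : exists z, [/\ D z, `|U y - U z| `^ p <= kap & `|U y' - U z| `^ p <= kap].
  (* Otherwise the two densities would add up to at least q on B', of total integral 3 M, whereas
     the energy bounds give at most 2 M; this fixes [C1]. *)
  apply: contrapT => nex.
  have low z : B' z -> D z /\ kap <= `|U y - U z| `^ p + `|U y' - U z| `^ p.
    move=> [zB nA]; have [Oz _ _] := Bz z zB; have Dz := HA z Oz nA; split=> //.
    rewrite leNgt; apply/negP => ltk; apply: nex; exists z; split=> //.
      by rewrite (le_trans _ (ltW ltk))// lerDl powR_ge0.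
    by rewrite (le_trans _ (ltW ltk))// lerDr powR_ge0.
  pose q := kap * (s ^- d * c0).
  have sd0 : 0 < s ^+ d by rewrite exprn_gt0.
  have pw z : q * \1_B' z <= energy_density s T U y z + energy_density s T U y' z.
    rewrite /energy_density !patchE indicE.
    case: (boolP (z \in B')) => [/set_mem zB'|_]; last first.
      rewrite mulr0; case: ifP => _; last by rewrite addr0.
      by rewrite addr_ge0// mulr_ge0 ?powR_ge0// /eta_scaled mulr_ge0 ?invr_ge0 ?(ltW sd0)// eta0// divr_ge0 ?enorm_ge0// ltW.
    have [Dz kz] := low z zB'; have [zB _] := zB'; have [Oz zy zy'] := Bz z zB.
    rewrite mem_set// mulr1.
    have es v : D v -> enorm (z - v) <= 2 * t -> s ^- d * c0 <= @eta_scaled R d eta s (enorm (T v - T z)).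
      move=> Dv zv; rewrite /eta_scaled ler_pM2l ?invr_gt0//; apply: eta_c0.
        by rewrite divr_ge0 ?enorm_ge0// ltW.
      rewrite ler_pdivrMr//.
      have h1 := enorm_triangle v (T v) (T z); have h2 := enorm_triangle z v (T z).
      have h3 := Tde v Dv; have h4 := Tde z Dz.
      move: h1 h2; rewrite (enormB v z) (enormB z (T z)) => h1 h2.
      have tE : t = t1 / 4 * s by [].
      by rewrite tE in zv; clear -de h1 h2 h3 h4 zv eta_c0; lra.
    have e1' := es y Dy zy; have e2' := es y' Dy' zy'.
    rewrite /q mulrC (le_trans (ler_wpM2l _ kz))//; first by apply: ltW; rewrite mulr_gt0 ?invr_gt0.
    by rewrite mulrDr lerD// ler_wpM2r// powR_ge0.
  have bI : bounded_supported (\1_B' : 'rV[R]_d -> R).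
    apply: (@bounded_supported_indic _ _ _ (enorm (y + t *: e) + alpha * t / 2)) => // z [].
    rewrite /B /eball/= => zB _; have := enormD (z - (y + t *: e)) (y + t *: e).
    by rewrite subrK => h; rewrite (le_trans h)// addrC lerD2l ltW.
  have := le_Rint (bounded_supportedZ q bI) (bounded_supportedD bf bf') pw.
  rewrite RintZ// RintD// Rint_indic// lamB /=.
  have -> : q * ((alpha * t / 2) ^+ d * om) = 3 * M.
    rewrite /q /kap /C1 /M (_ : alpha * t / 2 = (alpha * beta / 2) * s); last by rewrite /t; ring.
    rewrite [(_ * s) ^+ d]exprMn; have abd : 0 < (alpha * beta / 2) ^+ d by rewrite exprn_gt0.
    move: abd; set ab := (alpha * beta / 2) ^+ d => abd.
    by field; rewrite -?andbA; do ?[apply/andP; split]; rewrite gt_eqF.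
  have M0 : 0 < M by rewrite mulr_gt0 ?powR_gt0.
  by move=> /le_trans/(_ (lerD If If')); rewrite -/M -mulr2n -[_ *+ 2]mulr_natl ler_pM2r// ler_nat ltnn.
have [z [Dz kz kz']] := ex.
have root (v : R) : `|v| `^ p <= kap -> `|v| <= C1 `^ p^-1 * (K * s).
  move=> vk; have pV : 0 <= p^-1 by rewrite invr_ge0 ltW.
  have := ge0_ler_powR pV _ _ vk; rewrite -powRrM mulfV ?gt_eqF// powRr1//.
  rewrite /kap powRM ?powR_ge0 ?(ltW C10)// -powRrM mulfV ?gt_eqF// powRr1 ?(ltW Ks0)//.
  move=> H; rewrite mulrC; apply: H; by rewrite nnegrE ?powR_ge0 ?(ltW kap0).
have r1 := root _ kz; have r2 := root _ kz'.
have := ler_normB (U y - U z) (U y' - U z); rewrite (_ : _ - _ - _ = U y - U y'); last by ring.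
clear -r1 r2; lra.
Qed.

Lemma chain_bound (h : nat -> R) (B : R) n :
  (forall i, (i < n)%N -> `|h i.+1 - h i| <= B) -> `|h n - h 0%N| <= B *+ n.
Proof.
elim: n => [|n IH] H; first by rewrite subrr normr0.
rewrite -(subrK (h n) (h n.+1)) -addrA (le_trans (ler_normD _ _))// mulrS lerD ?H//.
by apply: IH => i /leqW; exact: H.
Qed.

Lemma segment_chain (F : 'rV[R]_d -> R) (B r : R) y z : 0 <= B -> 0 < r ->
  (forall v w, O v -> O w -> enorm (w - v) <= r -> `|F w - F v| <= B) ->
  (forall t, 0 <= t <= 1 -> O (y + t *: (z - y))) ->
  `|F z - F y| <= B * (enorm (z - y) / r + 1).
Proof.
move=> B0 r0 HF yz; set l := enorm (z - y).
pose n := (Num.truncn (l / r)).+1.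
have lr0 : 0 <= l / r by rewrite divr_ge0 ?enorm_ge0// ltW.
have /andP[n1 n2] := Num.Theory.truncn_itv lr0.
have n0 : 0 < n%:R :> R by rewrite ltr0n.
pose h i := F (y + (i%:R / n%:R) *: (z - y)).
have h1 : h n = F z by rewrite /h divff ?gt_eqF// scale1r addrC subrK.
have h0 : h 0%N = F y by rewrite /h mul0r scale0r addr0.
have it i : (i <= n)%N -> 0 <= (i%:R / n%:R : R) <= 1.
  by move=> ni; rewrite divr_ge0 ?ler0n//= ler_pdivrMr// mul1r ler_nat.
have := @chain_bound h B n; rewrite h1 h0 => H; apply: le_trans (H _) _ => [i ni|].
  apply: HF; [exact/yz/it/ltnW|exact/yz/it|].
  rewrite (_ : _ - _ = n%:R^-1 *: (z - y)); last first.
    by apply/rowP => j; rewrite !mxE -natr1; ring.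
  rewrite enormZ gtr0_norm ?invr_gt0// ler_pdivrMl// -ler_pdivrMr//.
  exact: ltW.
by rewrite -mulr_natr ler_wpM2l// /n -natr1 lerD2r.
Qed.

(** [local_oscillation] speaks of points of [D] only, while a segment may miss [D]. Replacing [U] by
    its value at a nearby point of [D] allows chaining along the three segments of a detour. *)
Lemma asymptotic_equicontinuity : exists C rho h0 k0 : R, [/\ 0 < C, 0 < rho, 0 < h0, 0 < k0 &
  forall s delta K T U D, 0 < s -> s <= h0 -> 0 <= delta -> delta <= k0 * s -> 0 < K ->
    energy_bounded s delta K T U D ->
    exists F, [/\ forall y, D y -> F y = U y, forall y, O y -> exists2 z, D z & F y = U z &
      forall y z, O y -> O z -> enorm (z - y) <= rho ->
        `|F z - F y| <= C * K * (enorm (z - y) + s)]].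
Proof.
have [C [c [h0 [k0 [C0 c0' h00 k00 HC]]]]] := local_oscillation.
have [rho [alpha [rho0 alpha0 PU]]] := C2_domain_pushable Omega (@ltr01 R).
exists (C * (12 / c + 3)), (rho / 2), (Num.min h0 (rho / 2)), k0.
split; [by rewrite mulr_gt0// addr_gt0// divr_gt0|by rewrite divr_gt0|by rewrite lt_min h00 divr_gt0|by []|].
move=> s delta K T U D s0; rewrite le_min => /andP[sh sr] de0 de K0 EB.
have osc := HC s delta K T U D s0 sh de0 de K0 EB; have [DO aeD _ _] := EB.
have cs4 : 0 < c * s / 4 by rewrite divr_gt0// mulr_gt0.
(* The tolerance c s / 4 at both ends leaves steps of length c s / 2; points of [D] are kept, so
   that [F] extends [U]. *)
have ex y : exists z, O y -> [/\ D z, enorm (z - y) <= c * s / 4 & D y -> z = y].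
  have [Dy|nDy] := pselect (D y); first by exists y => _; split=> //; rewrite subrr enorm0 ltW.
  have [Oy|nOy] := pselect (O y); last by exists y.
  have [z [zy _ Dz]] := ae_nu_dense aeD (@open_eball _ _ y (c * s / 4)) (eball_center _ cs4) Oy.
  by exists z => _; split=> //; exact: ltW.
have [pt Hpt] := choice ex; pose F y := U (pt y).
have stepF v w : O v -> O w -> enorm (w - v) <= c * s / 2 -> `|F w - F v| <= C * K * s.
  move=> Ov Ow vw; have [Dv pv _] := Hpt v Ov; have [Dw pw _] := Hpt w Ow.
  apply: (osc (pt w) (pt v)) => //.
  have := enorm_triangle v (pt v) (pt w); have := enorm_triangle w v (pt w).
  by rewrite (enormB w (pt w)) (enormB v w); clear -vw pv pw eta_c0; lra.
exists F; split.
- by move=> y Dy; rewrite /F; have [_ _ ->] := Hpt y (DO _ Dy).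
- by move=> y Oy; exists (pt y) => //; have [] := Hpt y Oy.
(* This height is at least |z - y|, as pushing with eps = 1 requires, and the halves of [rho] in the
   witnesses keep it at most [rho]. *)
move=> y z Oy Oz yz; pose t := enorm (z - y) + s.
have t0 : 0 < t by rewrite ltr_wpDl ?enorm_ge0.
have trho : t <= rho by rewrite /t; lra.
have [e e1 He] := PU y Oy.
have nz : enorm (z - y) < rho by lra.
have ny : enorm (y - y) < rho by rewrite subrr enorm0.
have B0 : 0 <= C * K * s by rewrite !mulr_ge0// ltW.
have cs2 : 0 < c * s / 2 by rewrite divr_gt0// mulr_gt0.
have vert v : O v -> enorm (v - y) < rho -> `|F (v + t *: e) - F v| <= C * K * s * (t / (c * s / 2) + 1).
  move=> Ov vy; have := @segment_chain F (C * K * s) (c * s / 2) v (v + t *: e) B0 cs2 stepF.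
  rewrite addrAC subrr add0r => H; apply: le_trans (H _) _ => [q /andP[q0 q1]|].
    have := He v v (q * t) 0 0 Ov Ov vy vy; rewrite subrr enorm0 mulr0 scaler0 !addr0 scalerA.
    apply=> //; rewrite ?mulr_ge0 ?lexx ?ler01 ?(ltW t0)// ?(ltW alpha0)//.
    by rewrite (le_trans _ trho)// ler_piMl// ltW.
  rewrite ler_wpM2l// lerD2r ler_pM2r ?invr_gt0// enormZ gtr0_norm// ler_piMr// ltW//.
have hor : `|F (z + t *: e) - F (y + t *: e)| <= C * K * s * (enorm (z - y) / (c * s / 2) + 1).
  have := @segment_chain F (C * K * s) (c * s / 2) (y + t *: e) (z + t *: e) B0 cs2 stepF.
  rewrite opprD addrACA subrr addr0; apply => q q01.
  have := He y z t q 0 Oy Oz ny nz; rewrite addr0 addrAC mul1r; apply=> //.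
    by rewrite lerDl ltW.
  by rewrite enorm0 mulr_ge0// ltW.
have v1 := vert y Oy ny; have v2 := vert z Oz nz.
have tri : `|F z - F y| <= `|F (y + t *: e) - F y| + `|F (z + t *: e) - F (y + t *: e)| + `|F (z + t *: e) - F z|.
  rewrite (_ : F z - F y = (F (y + t *: e) - F y) + (F (z + t *: e) - F (y + t *: e)) - (F (z + t *: e) - F z)); last by ring.
  by rewrite (le_trans (ler_normB _ _))// lerD2r ler_normD.
rewrite (le_trans tri)// (le_trans (lerD (lerD v1 hor) v2))//.
have l0 := enorm_ge0 (z - y).
rewrite -/t; set l := enorm (z - y) in l0 *.
have -> : C * K * s * (t / (c * s / 2) + 1) + C * K * s * (l / (c * s / 2) + 1) + C * K * s * (t / (c * s / 2) + 1)
    = C * K * ((4 * t + 2 * l) / c + 3 * s) by field; rewrite !gt_eqF.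
have -> : C * (12 / c + 3) * K * t = C * K * ((12 * t) / c + 3 * t) by field; rewrite gt_eqF.
have CK0 : 0 <= C * K by rewrite mulr_ge0// ltW.
rewrite ler_wpM2l//; apply: lerD; last by rewrite ler_wpM2l// /t lerDr.
rewrite ler_pM2r ?invr_gt0// /t -/l; clear -l0 s0 eta_c0; lra.
Qed.

End asymptotic_equicontinuity.

Section real_integrals.
Context {R : realType} {d : nat}.
Local Notation lam := (lebesgue_rV R d).
Implicit Types (f g h : 'rV[R]_d -> R).

Lemma EFin_Rint f : bounded_supported f -> (\int[lam]_x (f x)%:E = (\int[lam]_x f x)%:E)%E.
Proof.
move=> bf; rewrite /Rintegral fineK//; apply: integrable_fin_num => //.
exact: bounded_supported_integrable.
Qed.

Lemma le_Rint_ae f g : bounded_supported f -> bounded_supported g ->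
  (forall x, 0 <= f x) -> (forall x, 0 <= g x) -> {ae lam, forall x, f x <= g x} ->
  \int[lam]_x f x <= \int[lam]_x g x.
Proof.
move=> bf bg f0 g0 fg; rewrite -lee_fin -!EFin_Rint//.
apply: ae_ge0_le_integral => //.
- by move=> x _; rewrite lee_fin.
- by apply/measurable_EFinP; case: bf.
- by move=> x _; rewrite lee_fin.
- by apply/measurable_EFinP; case: bg.
- by apply: filterS fg => x fg _; rewrite lee_fin.
Qed.

Lemma Rint_affine h y (s : R) : 0 < s -> bounded_supported h -> (forall x, 0 <= h x) ->
  bounded_supported (fun z => h (y + s *: z)) /\
  \int[lam]_z h (y + s *: z) = s ^- d * \int[lam]_z h z.
Proof.
move=> s0 bh h0; have [mh [M [r hM]]] := bh.
have mt : measurable_fun setT (fun z : 'rV[R]_d => y + s *: z).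
  exact: measurableT_comp (measurable_addl y) (measurable_scale s).
split.
  split; first exact: measurableT_comp mh mt.
  exists M, ((r + enorm y) / s) => z; have [hz hz0] := hM (y + s *: z); split=> // rz.
  apply: hz0; rewrite addrC -[y]opprK; have := enormB_ge (s *: z) (- y).
  by rewrite enormN enormZ gtr0_norm//; move: rz; rewrite ler_pdivrMr// mulrC; lra.
rewrite /Rintegral.
rewrite (@integral_scale _ _ s (fun z => (h (y + z))%:E))//; first last.
- by move=> x; rewrite lee_fin.
- by apply/measurable_EFinP; exact: measurableT_comp mh (measurable_addl y).
rewrite (@integral_translate _ _ y (fun z => (h z)%:E))//; last exact/measurable_EFinP.
by rewrite fineM// EFin_Rint.
Qed.

Lemma Rint_fubini (f : 'rV[R]_d * 'rV[R]_d -> R) (B r : R) : measurable_fun setT f ->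
  (forall v, 0 <= f v <= B) -> (forall y z, r <= enorm y \/ r <= enorm z -> f (y, z) = 0) ->
  [/\ forall y, bounded_supported (fun z => f (y, z)), forall z, bounded_supported (fun y => f (y, z)),
    bounded_supported (fun y => \int[lam]_z f (y, z)), bounded_supported (fun z => \int[lam]_y f (y, z)) &
    \int[lam]_y \int[lam]_z f (y, z) = \int[lam]_z \int[lam]_y f (y, z)].
Proof.
move=> mf fB fr.
have b1 y : bounded_supported (fun z => f (y, z)).
  split; first by apply: measurableT_comp mf _; apply: measurable_fun_pair => //; exact: measurable_cst.
  exists B, r => z; have /andP[f0 f1] := fB (y, z); rewrite ger0_norm//; split=> // rz.
  by apply: fr; right.
have b2 z : bounded_supported (fun y => f (y, z)).
  split; first by apply: measurableT_comp mf _; apply: measurable_fun_pair => //; exact: measurable_cst.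
  exists B, r => y; have /andP[f0 f1] := fB (y, z); rewrite ger0_norm//; split=> // ry.
  by apply: fr; left.
have mfE : measurable_fun setT (EFin \o f) by exact/measurable_EFinP.
have f0E v : (0 <= (EFin \o f) v)%E by rewrite lee_fin; case/andP: (fB v).
have B0 : 0 <= B by have /andP[] := fB (0, 0); exact: le_trans.
have bnd (h : 'rV[R]_d -> R) : bounded_supported h -> (forall y, 0 <= h y <= B) ->
    (forall y, r <= enorm y -> h y = 0) -> `|\int[lam]_y h y| <= B * fine (lam (eball 0 r)).
  move=> bh hB hr; apply: (@norm_Rint_le _ _ _ _ _ r) => //; first exact: measurable_eball.
  - by move=> y; rewrite /eball/= subr0 => /ltW.
  - by move=> y; have /andP[h0 h1] := hB y; rewrite ger0_norm.
  - by move=> y; rewrite /eball/= subr0 => /negP; rewrite -leNgt => /hr.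
have bF : bounded_supported (fun y => \int[lam]_z f (y, z)).
  split.
    apply/measurable_EFinP; have := @measurable_fun_fubini_tonelli_F _ _ _ _ _ lam _ mfE f0E.
    by congr measurable_fun; apply/funext => y; rewrite /fubini_F /= -EFin_Rint.
  exists (B * fine (lam (eball 0 r))), r => y; split.
    by apply: bnd => // z rz; apply: fr; right.
  move=> ry; rewrite (_ : (fun z => _) = cst 0); last by apply/funext => z; apply: fr; left.
  by rewrite /Rintegral integral0.
have bG : bounded_supported (fun z => \int[lam]_y f (y, z)).
  split.
    apply/measurable_EFinP; have := @measurable_fun_fubini_tonelli_G _ _ _ _ _ lam _ mfE f0E.
    by congr measurable_fun; apply/funext => z; rewrite /fubini_G /= -EFin_Rint.
  exists (B * fine (lam (eball 0 r))), r => z; split.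
    by apply: bnd => // y ry; apply: fr; left.
  move=> rz; rewrite (_ : (fun y => _) = cst 0); last by apply/funext => y; apply: fr; right.
  by rewrite /Rintegral integral0.
split=> //; apply: EFin_inj; rewrite -(EFin_Rint bF) -(EFin_Rint bG).
under eq_integral => y _ do rewrite -EFin_Rint//.
under [RHS]eq_integral => z _ do rewrite -EFin_Rint//.
exact: (@fubini_tonelli _ _ _ _ _ lam lam _ mfE f0E).
Qed.

End real_integrals.

(** * Moments of the interaction kernel *)

Section kernel.
Context {R : realType} {d : nat} (d_gt0 : (0 < d)%N).
Local Notation lam := (lebesgue_rV R d).
Implicit Types (x y z e : 'rV[R]_d).
Context (eta : R -> R) (r_eta p : R) (ker : interaction_kernel eta r_eta) (p1 : 1 < p).

Lemma kernel_ge0 t : 0 <= t -> 0 <= eta t.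
Proof. by case: ker => _ + _ _ _; exact. Qed.

Lemma kernel_le t t' : 0 <= t -> t <= t' -> eta t' <= eta t.
Proof. by case: ker => _ _ + _ _; exact. Qed.

Lemma kernel_radius_gt0 : 0 < r_eta. Proof. by case: ker. Qed.

(** At [r_eta] itself the value 0 comes from continuity. *)
Lemma kernel_support t : r_eta <= t -> eta t = 0.
Proof.
have r0 := kernel_radius_gt0; have [_ e0 mono cl _] := ker.
have out t' : r_eta < t' -> eta t' = 0.
  move=> rt; apply/eqP; apply: contrapT => /negP et.
  have : closure [set t | 0 <= t /\ eta t != 0] t' by apply: subset_closure; split=> //; lra.
  by move=> /cl /= /andP[_]; rewrite leNgt rt.
rewrite le_eqVlt => /orP[/eqP <-|/out//].
apply/eqP; rewrite eq_le e0 ?(ltW r0)// andbT; apply/ler_addgt0Pr => e e_gt0; rewrite add0r.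
have [h h0 H] := kernel_continuous ker (ltW r0) e_gt0.
have := H (r_eta + h / 2); rewrite out; last by lra.
rewrite sub0r normrN [r_eta + _]addrC addrK gtr0_norm ?divr_gt0// => /(_ _ _)/ltW H'.
by apply: le_trans (ler_norm _) (H' _ _); [apply: addr_ge0; lra|lra].
Qed.

Lemma kernel_profile_measurable (theta : R) : 0 <= theta ->
  measurable_fun setT (fun z : 'rV[R]_d => eta (enorm z + theta)).
Proof.
move=> t0; apply: continuous_measurable_fun; apply/continuous_enormP => z e e0.
have [|h h0 H] := @kernel_continuous R eta r_eta ker (enorm z + theta) _ e e0.
  by rewrite addr_ge0 ?enorm_ge0.
exists h => // y yz; apply: H; first by rewrite addr_ge0 ?enorm_ge0.
rewrite opprD addrACA subrr addr0; exact: le_lt_trans (enormB_norm _ _) yz.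
Qed.

Lemma kernel_profile_bounded_supported (theta : R) : 0 <= theta ->
  bounded_supported (fun z : 'rV[R]_d => eta (enorm z + theta)).
Proof.
move=> t0; split; first exact: kernel_profile_measurable.
exists (eta 0), r_eta => z; have z0 := enorm_ge0 z.
rewrite ger0_norm ?kernel_ge0 ?addr_ge0// kernel_le ?addr_ge0//; split=> // rz.
by apply: kernel_support; lra.
Qed.

Lemma powR_dotp_measurable (q : R) e : measurable_fun setT (fun z => `|dotp z e| `^ q).
Proof.
apply: measurableT_comp (measurable_powR q) _; apply: measurableT_comp => //.
by apply: continuous_measurable_fun; exact: continuous_dotpl.
Qed.

Lemma kernel_moment_bounded_supported (theta q : R) e : 0 <= theta -> 0 <= q ->
  bounded_supported (fun z => eta (enorm z + theta) * `|dotp z e| `^ q).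
Proof.
move=> t0 q0; have r0 := kernel_radius_gt0.
split.
  by apply: measurable_funM; [exact: kernel_profile_measurable|exact: powR_dotp_measurable].
exists (eta 0 * (r_eta * enorm e) `^ q), r_eta => z; have z0 := enorm_ge0 z.
have [rz|rz] := lerP r_eta (enorm z).
  by rewrite kernel_support; [rewrite mul0r normr0; split=> //; rewrite mulr_ge0 ?kernel_ge0 ?powR_ge0|lra].
split; last by move=> h; lra.
rewrite ger0_norm ?mulr_ge0 ?powR_ge0 ?kernel_ge0 ?addr_ge0// ler_pM ?kernel_ge0 ?powR_ge0 ?addr_ge0//.
  by rewrite kernel_le ?addr_ge0.
apply: ge0_ler_powR; rewrite ?nnegrE ?mulr_ge0 ?enorm_ge0 ?(ltW r0)//.
by rewrite (le_trans (normr_dotp_le _ _))// ler_wpM2r ?enorm_ge0// ltW.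
Qed.

(** For theta = 0 and e = e1 this is the p-th power of sigma_eta; [theta] makes room for the
    displacement of the transportation map in units of [s]. *)
Definition kernel_moment (theta : R) e : R :=
  \int[lam]_z (eta (enorm z + theta) * `|dotp z e| `^ p).

Let p0 : 0 < p. Proof. exact: lt_trans ltr01 p1. Qed.

Lemma kernel_moment_unit (theta : R) e : 0 <= theta -> enorm e = 1 ->
  kernel_moment theta e = kernel_moment theta (e1 : 'rV[R]_d).
Proof.
move=> t0 en.
(* [integral_unit_dotp] asks for nonnegativity at all reals, and [eta] has a sign only on
   nonnegative ones, whence [|a|]. *)
have f0 (a b : R) : (0 <= (eta (`|a| + theta) * `|b| `^ p)%:E)%E.
  by rewrite lee_fin mulr_ge0 ?powR_ge0 ?kernel_ge0 ?addr_ge0.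
have := @integral_unit_dotp R d (fun a b => (eta (`|a| + theta) * `|b| `^ p)%:E) e (e1 : 'rV[R]_d) f0 en (enorm_e1 d_gt0).
have E (v : 'rV[R]_d) : (fun x => (eta (`|enorm x| + theta) * `|dotp x v| `^ p)%:E) =
    (fun x => (eta (enorm x + theta) * `|dotp x v| `^ p)%:E).
  by apply/funext => x; rewrite (ger0_norm (enorm_ge0 x)).
rewrite !E => H; apply: (congr1 fine (H _)).
by apply/measurable_EFinP; have [] := kernel_moment_bounded_supported (e1 : 'rV[R]_d) t0 (ltW p0).
Qed.

Lemma kernel_moment_ge0 (theta : R) e : 0 <= theta -> 0 <= kernel_moment theta e.
Proof.
move=> t0; apply: fine_ge0; apply: integral_ge0 => x _.
by rewrite lee_fin mulr_ge0 ?powR_ge0 ?kernel_ge0 ?addr_ge0 ?enorm_ge0.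
Qed.

Lemma kernel_moment_le (theta theta' : R) e : 0 <= theta -> theta <= theta' ->
  kernel_moment theta' e <= kernel_moment theta e.
Proof.
move=> t0 tt; have t'0 := le_trans t0 tt.
apply: le_Rint; try by apply: kernel_moment_bounded_supported => //; exact: ltW.
by move=> z; rewrite ler_wpM2r ?powR_ge0// kernel_le ?addr_ge0 ?enorm_ge0// lerD2l.
Qed.

Lemma sigma_eta_powR : sigma_eta d eta r_eta p `^ p = kernel_moment 0 (e1 : 'rV[R]_d).
Proof.
have E : \int[lam]_(z in eball 0 r_eta) (eta (enorm z) * `|dotp z e1| `^ p) = kernel_moment 0 (e1 : 'rV[R]_d).
  rewrite /kernel_moment /Rintegral integral_mkcond; congr fine; apply: eq_integral => z _.
  rewrite patchE addr0; case: ifPn => // /negP; rewrite in_setE /eball/= subr0 => /negP.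
  by rewrite -leNgt => rz; rewrite kernel_support// mul0r.
rewrite /sigma_eta E -powRrM mulVf ?gt_eqF// powRr1//.
exact: kernel_moment_ge0.
Qed.

(** The integrand is positive on an open half ball, so it cannot vanish almost everywhere. *)
Lemma kernel_moment_gt0 : (exists2 t, 0 <= t & eta t != 0) -> 0 < kernel_moment 0 (e1 : 'rV[R]_d).
Proof.
move=> et; have [c [t1 [c0 t10 ec]]] := kernel_lower_bound ker et.
rewrite lt_neqAle kernel_moment_ge0// andbT eq_sym; apply/eqP => I0.
have bm := kernel_moment_bounded_supported (e1 : 'rV[R]_d) (lexx 0) (ltW p0).
have := ge0_Rint_eq0 bm _ I0.
case=> [z|A [mA A0 HA]]; first by rewrite mulr_ge0 ?powR_ge0 ?kernel_ge0 ?addr_ge0 ?enorm_ge0.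
pose B := eball 0 t1 `&` [set z | 0 < dotp z (e1 : 'rV[R]_d)].
have oB : open B.
  apply: openI; first exact: open_eball.
  apply: (@open_comp _ _ (fun z => dotp z (e1 : 'rV[R]_d)) [set t | 0 < t]); last exact: open_gt.
  by move=> z _; apply: continuous_dotpl.
have Bz : B ((t1 / 2) *: e1).
  split; first by rewrite /eball/= subr0 enormZ enorm_e1// mulr1 gtr0_norm ?divr_gt0//; lra.
  by rewrite /= dotpZl -sqr_enorm enorm_e1// expr1n mulr1 divr_gt0.
have := lebesgue_rV_open_gt0 oB Bz; rewrite ltNge => /negP; apply.
rewrite -A0; apply: le_measure; rewrite ?inE//; first exact: open_measurable_rV.
move=> z [zB z0]; apply: HA => /= /eqP; apply/negP; rewrite gt_eqF//.
have z0' := enorm_ge0 z; move: zB; rewrite /eball/= subr0 => /ltW zt.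
by rewrite addr0 mulr_gt0 ?powR_gt0 ?normr_gt0 ?gt_eqF// (lt_le_trans c0)// ec.
Qed.

End kernel.

(** * Sharp lower bound for the graph energy *)

Section gradient_bound.
Context {R : realType} {d : nat} (d_gt0 : (0 < d)%N) (Omega : C2_domain R d).
Local Notation O := (domain_set Omega).
Local Notation lam := (lebesgue_rV R d).
Local Notation nuO := (nu Omega).
Implicit Types (x y z e : 'rV[R]_d).
Context (eta : R -> R) (r_eta p : R) (ker : interaction_kernel eta r_eta) (p1 : 1 < p).
Local Notation moment theta := (kernel_moment eta p theta (e1 : 'rV[R]_d)).

(** Young's inequality for a / l and b^(p - 1), an equality when a = l b. With l = L s this is the
    increment of an affine function of slope [L], which keeps the constant sharp. *)
Lemma weighted_young (a b l : R) : 0 <= a -> 0 <= b -> 0 < l ->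
  a * b `^ (p - 1) <= l / l `^ p / p * a `^ p + (1 - p^-1) * l * b `^ p.
Proof.
move=> a0 b0 l0; have p0 : 0 < p := lt_trans ltr01 p1.
have p10 : 0 < p - 1 by rewrite subr_gt0.
pose q := p / (p - 1); have q0 : 0 < q by rewrite divr_gt0.
have pq : p^-1 + q^-1 = 1 by rewrite /q; field; rewrite !gt_eqF.
have al0 : 0 <= a / l by rewrite divr_ge0// ltW.
have := conjugate_powR al0 (powR_ge0 b (p - 1)) p0 q0 pq.
rewrite -powRrM (_ : (p - 1) * q = p); last by rewrite /q; field; rewrite gt_eqF.
rewrite powRM ?invr_ge0 ?(ltW l0)// => H.
have := ler_wpM2l (ltW l0) H.
have -> : l * (a / l * b `^ (p - 1)) = a * b `^ (p - 1) by field; rewrite gt_eqF.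
move=> /le_trans; apply; rewrite le_eqVlt; apply/orP; left; apply/eqP.
have lp0 : 0 < l `^ p by rewrite powR_gt0.
have -> : l^-1 `^ p = (l `^ p)^-1.
  apply: (mulIf (lt0r_neq0 lp0)); rewrite mulVf ?gt_eqF// -powRM ?invr_ge0 ?(ltW l0)//.
  by rewrite mulVf ?gt_eqF// powR1.
have -> : 1 - p^-1 = q^-1 by rewrite -pq addrC addKr.
by field; rewrite !gt_eqF.
Qed.

Lemma ae_lebesgue_shift (P : 'rV[R]_d -> Prop) z0 : {ae nuO, forall y, P y} ->
  {ae lam, forall y, O (y + z0) -> P (y + z0)}.
Proof.
move=> /ae_nuP[A [mA A0] HA]; exists ((fun y => z0 + y) @^-1` A); split.
- by apply: measurable_preimT mA; exact: measurable_addl.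
- by rewrite lebesgue_rV_translate.
- move=> y /= nP; apply: contrapT => nA; apply: nP => Oy; apply: HA => //; by rewrite addrC.
Qed.

(* Pair the difference quotients of the mollified [U] with the kernel: the factor
   [eta (|z| + 2 delta / s)] absorbs the displacement of [T], and Young's
   inequality, weighted by [phi], makes the energy density appear. *)
Lemma gradient_energy_bound (r M : R) phi G C z0 : 0 < r -> 0 <= M -> mollifier r phi G C ->
  eball z0 (2 * r) `<=` O ->
  exists2 C' : R, 0 <= C' & forall s delta K L T U D, 0 < s -> s * r_eta <= r -> 0 <= delta ->
    0 < K -> 0 < L -> energy_bounded Omega eta p s delta K T U D -> bounded_measurable U ->
    (forall y, `|U y| <= M) -> L `^ p * moment 0 = K `^ p * vol Omega ->
    enorm (mollify_grad U G z0) * moment (2 * delta / s) <= L * moment 0 + C' * s.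
Proof.
move=> r0 M0 mphi z0O; have bphi := mollifier_bounded_supported mphi.
have [Tphi phi0 phir phi1 _] := mphi; have [phiC _ _] := Tphi.
have p0 : 0 < p := lt_trans ltr01 p1; have re0 := kernel_radius_gt0 ker.
have C0 := taylor2_ge0 Tphi.
have [Dc HD] := mollify_taylor2_uniform M0 Tphi phi0 phir.
have Dc0 : 0 <= Dc.
  by apply: (taylor2_ge0 (HD (cst 0) (bounded_measurable_cst 0) _)) => y; rewrite normr0.
pose I0 := \int[lam]_z eta (enorm (z : 'rV[R]_d) + 0).
have I00 : 0 <= I0.
  by apply: fine_ge0; apply: integral_ge0 => z _; rewrite lee_fin (kernel_ge0 ker)// addr0 enorm_ge0.
pose E := Dc * r_eta ^+ 2 * r_eta `^ (p - 1).
have E0 : 0 <= E by rewrite !mulr_ge0 ?powR_ge0 ?exprn_ge0// ltW.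
exists (E * I0); first by rewrite mulr_ge0.
move=> s delta K L T U D s0 sr de0 K0 L0 EB bU UM LK.
pose theta := 2 * delta / s; have th0 : 0 <= theta by rewrite divr_ge0 ?mulr_ge0// ltW.
rewrite -/theta; set V := mollify_grad U G z0; have TU := HD U bU UM.
have m00 : 0 <= moment 0 by exact: (kernel_moment_ge0 p ker (e1 : 'rV[R]_d) (lexx 0)).
have [->|V0] := eqVneq V 0.
  rewrite enorm0 mul0r; apply: addr_ge0; first exact: (mulr_ge0 (ltW L0) m00).
  exact: (mulr_ge0 (mulr_ge0 E0 I00) (ltW s0)).
have Vn : 0 < enorm V by rewrite enorm_gt0.
pose e := (enorm V)^-1 *: V.
have en : enorm e = 1 by rewrite enormZ gtr0_norm ?invr_gt0// mulVf// gt_eqF.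
have VE z : dotp V z = enorm V * dotp z e.
  by rewrite /e dotpZr dotpC mulrA mulfV ?mul1r// gt_eqF.
pose Nz z := eta (enorm z + theta).
have Nz0 z : 0 <= Nz z by rewrite (kernel_ge0 ker)// addr_ge0 ?enorm_ge0.
have NzE z : r_eta <= enorm z -> Nz z = 0 by move=> rz; rewrite /Nz (kernel_support ker)//; lra.
have Nzle z : Nz z <= eta 0 by rewrite (kernel_le ker)// addr_ge0 ?enorm_ge0.
have [mU _] := bU.
pose dU (v : 'rV[R]_d * 'rV[R]_d) := `|U (v.1 + z0 + s *: v.2) - U (v.1 + z0)|.
have mdU : measurable_fun setT dU.
  have m1 : measurable_fun setT (fun v : 'rV[R]_d * 'rV[R]_d => v.1 + z0).
    under eq_fun do rewrite addrC.
    exact: measurableT_comp (measurable_addl z0) (@measurable_fst _ _ _ _).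
  have m2 : measurable_fun setT (fun v : 'rV[R]_d * 'rV[R]_d => v.1 + z0 + s *: v.2).
    apply: measurable_funD_rV => //.
    exact: measurableT_comp (measurable_scale s) (@measurable_snd _ _ _ _).
  apply: measurableT_comp => //; apply: measurable_funB; exact: measurableT_comp mU _.
have dUM v : dU v <= 2 * M.
  have := ler_normB (U (v.1 + z0 + s *: v.2)) (U (v.1 + z0)).
  by have := UM (v.1 + z0 + s *: v.2); have := UM (v.1 + z0); rewrite -/(dU v); lra.
have dU0 v : 0 <= dU v by exact: normr_ge0.
pose f v := phi v.1 * Nz v.2 * dU v `^ p.
have mf : measurable_fun setT f.
  apply: measurable_funM; last exact: measurableT_comp (measurable_powR p) mdU.
  apply: measurable_funM.
    by apply: measurableT_comp (@measurable_fst _ _ _ _); case: bphi.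
  exact: measurableT_comp (kernel_profile_measurable ker th0) (@measurable_snd _ _ _ _).
have fB v : 0 <= f v <= C * eta 0 * (2 * M) `^ p.
  rewrite /f !mulr_ge0 ?powR_ge0//= ler_pM ?mulr_ge0 ?powR_ge0//.
    by rewrite ler_pM//; have := phiC v.1; rewrite ger0_norm.
  by apply: ge0_ler_powR; rewrite ?nnegrE ?mulr_ge0// ltW.
pose rr := Num.max r r_eta.
have fr y z : rr <= enorm y \/ rr <= enorm z -> f (y, z) = 0.
  rewrite /f /rr/= => -[]; rewrite ge_max => /andP[h1 h2].
    by rewrite phir// !mul0r.
  by rewrite NzE// mulr0 mul0r.
pose l := L * s; have l0 : 0 < l by rewrite mulr_gt0.
pose Q z := \int[lam]_y f (y, z).
pose k := l / l `^ p / p; have k0 : 0 <= k := divr_ge0 (divr_ge0 (ltW l0) (powR_ge0 l p)) (ltW p0).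
(* The relation between [K] and [L] makes the energy part weigh exactly 1 / p of l times the
   moment. *)
have kE : k * (vol Omega * (K * s) `^ p) = p^-1 * l * moment 0.
  rewrite powRM ?(ltW K0) ?(ltW s0)// mulrA [vol _ * _]mulrC -LK /k /l powRM ?(ltW L0) ?(ltW s0)//.
  have Lp : 0 < L `^ p by rewrite powR_gt0.
  have sp : 0 < s `^ p by rewrite powR_gt0.
  by field; rewrite !gt_eqF.
pose b z := `|dotp z e|.
have b0 z : 0 <= b z by exact: normr_ge0.
have bphiU z : bounded_supported (fun y => dU (y, z) * phi y).
  apply: bounded_supportedM => //; split; last by exists (2 * M) => y; rewrite ger0_norm.
  by apply: measurableT_comp mdU _; apply: measurable_fun_pair => //; exact: measurable_cst.
have main z : s * enorm V * (Nz z * b z `^ p) <=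
    E * s ^+ 2 * Nz z + k * Q z + (1 - p^-1) * l * (Nz z * b z `^ p).
  have [rz|rz] := lerP r_eta (enorm z).
    rewrite (NzE _ rz) !mul0r !mulr0 add0r addr0; apply: mulr_ge0; first exact: k0.
    by apply: fine_ge0; apply: integral_ge0 => y _; rewrite lee_fin; have /andP[] := fB (y, z).
  (* Taylor expansion of the mollified function from z0 to z0 + s z; its increment is at most the
     average of those of [U]. *)
  have A1 : s * (enorm V * b z) - Dc * (s ^+ 2 * r_eta ^+ 2) <= \int[lam]_y (dU (y, z) * phi y).
    have Ez : z0 + s *: z - z0 = s *: z by rewrite addrAC subrr add0r.
    have [_ _ /(_ z0 (z0 + s *: z))] := TU; rewrite Ez -/V VE dotpZl enormZ (gtr0_norm s0) exprMn.
    rewrite (mollify_shift _ bU bphi) (mollify_shift z0 bU bphi).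
    have bs1 : bounded_supported (fun y => U (y + (z0 + s *: z)) * phi y).
      by apply: bounded_supportedM => //; exact: bounded_measurable_shift.
    have bs2 : bounded_supported (fun y => U (y + z0) * phi y).
      by apply: bounded_supportedM => //; exact: bounded_measurable_shift.
    rewrite -RintB//; set X := Rintegral _ _ _ => HX.
    have HX2 : `|X| <= \int[lam]_y (dU (y, z) * phi y).
      rewrite (le_trans (le_norm_Rint (bounded_supportedB bs1 bs2)))//.
      apply: le_Rint; [exact: bounded_supported_norm (bounded_supportedB bs1 bs2)|exact: bphiU|].
      by move=> y; rewrite -mulrBl normrM (ger0_norm (phi0 y)) /dU/= addrA.
    have HX3 : Dc * (s ^+ 2 * enorm z ^+ 2) <= Dc * (s ^+ 2 * r_eta ^+ 2).
      rewrite ler_wpM2l// ler_wpM2l ?exprn_ge0 ?(ltW s0)//.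
      by rewrite ler_pXn2r ?nnegrE ?enorm_ge0 ?(ltW re0) ?(ltW rz).
    have HX4 : `|enorm V * (s * dotp z e)| = s * (enorm V * b z).
      by rewrite /b !normrM (gtr0_norm Vn) (gtr0_norm s0); ring.
    have := ler_normB X (X - enorm V * (s * dotp z e)); rewrite subKr HX4.
    by move: HX HX2 HX3; clear; lra.
  have bp : bounded_supported (fun y => phi y * dU (y, z) `^ p).
    under eq_fun do rewrite mulrC; apply: bounded_supportedM => //; split.
      apply: measurableT_comp (measurable_powR p) _.
      by apply: measurableT_comp mdU _; apply: measurable_fun_pair => //; exact: measurable_cst.
    exists ((2 * M) `^ p) => y; rewrite ger0_norm ?powR_ge0//.
    by apply: ge0_ler_powR; rewrite ?nnegrE ?mulr_ge0// ltW.
  (* The factor b^(p - 1) completes the linear term to b^p; Young's inequality is averaged against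
     [phi], of mass 1. *)
  have A2 : b z `^ (p - 1) * \int[lam]_y (dU (y, z) * phi y) <=
      k * \int[lam]_y (phi y * dU (y, z) `^ p) + (1 - p^-1) * l * b z `^ p.
    have -> : (1 - p^-1) * l * b z `^ p = \int[lam]_y ((1 - p^-1) * l * b z `^ p * phi y).
      by rewrite (RintZ _ bphi) phi1 mulr1.
    rewrite -(RintZ _ (bphiU z)) -(RintZ _ bp) -RintD; [|exact: bounded_supportedZ|exact: bounded_supportedZ].
    apply: le_Rint; first exact: bounded_supportedZ.
      by apply: bounded_supportedD; exact: bounded_supportedZ.
    move=> y; have := ler_wpM2l (phi0 y) (weighted_young (dU0 (y, z)) (b0 z) l0); rewrite -/k.
    rewrite mulrDr => H.
    rewrite [leLHS](_ : _ = phi y * (dU (y, z) * b z `^ (p - 1))); last by ring.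
    by rewrite (le_trans H)// le_eqVlt; apply/orP; left; apply/eqP; ring.
  have QE : Q z = Nz z * \int[lam]_y (phi y * dU (y, z) `^ p).
    by rewrite -RintZ// /Q; congr Rintegral; apply/funext => y; rewrite /f /=; ring.
  have bpp : b z `^ (p - 1) * b z = b z `^ p.
    rewrite -{2}[b z]powRr1// -powRD ?subrK//; apply/implyP => /eqP; lra.
  have br : b z `^ (p - 1) <= r_eta `^ (p - 1).
    apply: ge0_ler_powR; rewrite ?nnegrE ?subr_ge0 ?(ltW re0) ?(ltW p1)//.
    by rewrite (le_trans (normr_dotp_le _ _))// en mulr1 ltW.
  have A3 : s * enorm V * b z `^ p <= E * s ^+ 2 + k * \int[lam]_y (phi y * dU (y, z) `^ p) + (1 - p^-1) * l * b z `^ p.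
    have B1 := ler_wpM2l (powR_ge0 (b z) (p - 1)) A1.
    have B2 : b z `^ (p - 1) * (Dc * (s ^+ 2 * r_eta ^+ 2)) <= E * s ^+ 2.
      rewrite /E (_ : _ * s ^+ 2 = r_eta `^ (p - 1) * (Dc * (s ^+ 2 * r_eta ^+ 2))); last by ring.
      by rewrite ler_wpM2r// !mulr_ge0 ?exprn_ge0// ltW.
    have B3 : s * enorm V * b z `^ p = b z `^ (p - 1) * (s * (enorm V * b z)) by rewrite -bpp; ring.
    rewrite mulrBr -B3 in B1; move: B1 B2 A2; clear; lra.
  have := ler_wpM2l (Nz0 z) A3; rewrite QE; set J := Rintegral _ _ _ => A4.
  rewrite (_ : s * enorm V * _ = Nz z * (s * enorm V * b z `^ p)); last by ring.
  by rewrite (le_trans A4)// le_eqVlt; apply/orP; left; apply/eqP; ring.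
have [DO aeD Tde Den] := EB.
(* After z -> y0 + s z, the inner integral is dominated by the energy density at y0: |T y0 - T z| is
   at most |y0 - z| + 2 delta, and [eta] is nonincreasing. *)
have inner : {ae lam, forall y, \int[lam]_z f (y, z) <= vol Omega * (K * s) `^ p * phi y}.
  have aeD0 := ae_lebesgue_shift 0 aeD.
  apply: filterS (ae_lebesgue_shift z0 aeD) => y Hy.
  have [py|py] := eqVneq (phi y) 0.
    rewrite py mulr0 (_ : (fun z => _) = cst 0); first by rewrite /Rintegral integral0.
    by apply/funext => z; rewrite /f/= py !mul0r.
  have yr : enorm y < r by exact: mollifier_support mphi py.
  have Oy : O (y + z0) by apply: z0O; rewrite /eball/= addrK; lra.
  have Dy := Hy Oy; set y0 := y + z0 in Oy Dy.
  have [bd Id] := Den y0 Dy.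
  have si0 : 0 < s^-1 by rewrite invr_gt0.
  pose h z := Nz (s^-1 *: (z - y0)) * `|U z - U y0| `^ p.
  have bh : bounded_supported h.
    rewrite /h; under eq_fun do rewrite mulrC; apply: bounded_supportedM.
      split.
        apply: measurableT_comp (measurable_powR p) _; apply: measurableT_comp => //.
        by apply: measurable_funB => //; exact: measurable_cst.
      exists ((2 * M) `^ p) => z; rewrite ger0_norm ?powR_ge0//.
      apply: ge0_ler_powR; rewrite ?nnegrE ?mulr_ge0 ?(ltW p0)//.
      by have := ler_normB (U z) (U y0); have := UM z; have := UM y0; lra.
    apply: (bounded_supported_shift y0 (f := fun z => Nz (s^-1 *: z))).
    have [+ _] := Rint_affine 0 si0 (kernel_profile_bounded_supported ker th0) Nz0.
    by under eq_fun do rewrite add0r.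
  have h0 z : 0 <= h z by rewrite mulr_ge0 ?powR_ge0.
  have [bha Iha] := Rint_affine y0 s0 bh h0.
  have -> : (fun z => f (y, z)) = (fun z => phi y * h (y0 + s *: z)).
    apply/funext => z; have Ez : s^-1 *: (y0 + s *: z - y0) = z.
      by rewrite [y0 + _]addrC addrK scalerA mulVf ?gt_eqF// scale1r.
    by rewrite /h Ez mulrA.
  rewrite RintZ// Iha mulrC ler_wpM2r// -RintZ//; apply: le_trans Id.
  apply: le_Rint_ae => //.
  - exact: bounded_supportedZ.
  - by move=> z; rewrite mulr_ge0// invr_ge0 exprn_ge0// ltW.
  - move=> z; rewrite /energy_density patchE; case: ifP => // _.
    rewrite mulr_ge0 ?powR_ge0// /eta_scaled mulr_ge0 ?invr_ge0 ?exprn_ge0 ?(ltW s0)//.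
    by rewrite (kernel_ge0 ker)// divr_ge0 ?enorm_ge0// ltW.
  apply: filterS aeD0 => z; rewrite addr0 => Dz.
  have nz : enorm (s^-1 *: (z - y0)) = enorm (z - y0) / s by rewrite enormZ gtr0_norm// mulrC.
  rewrite /energy_density patchE; case: ifPn => [/set_mem Oz|/negP nOz].
    rewrite /eta_scaled /h mulrA distrC ler_wpM2r ?powR_ge0// ler_wpM2l ?invr_ge0 ?exprn_ge0 ?(ltW s0)//.
    apply: (kernel_le ker); first by rewrite divr_ge0 ?enorm_ge0// ltW.
    rewrite nz /theta -mulrDl ler_pM2r//.
    have h1 := enorm_triangle y0 (T y0) (T z); have h2 := enorm_triangle z y0 (T z).
    have h3 := Tde _ Dy; have h4 := Tde _ (Dz Oz).
    move: h1 h2 h3 h4; rewrite (enormB y0 z) (enormB z (T z)); clear; lra.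
  (* Outside Omega the kernel vanishes: [y0] is within r of z0, and the interaction range s r_eta is
     at most r. *)
  rewrite /h NzE ?mul0r ?mulr0// nz ler_pdivlMr// leNgt; apply/negP => lt1; apply: nOz.
  apply/mem_set/z0O; rewrite /eball/= (le_lt_trans (enorm_triangle y0 _ _))//.
  by rewrite /y0 addrK -/y0; move: lt1 sr yr; rewrite mulrC; clear; lra.
have bNz : bounded_supported Nz := kernel_profile_bounded_supported ker th0.
have bm : bounded_supported (fun z => Nz z * b z `^ p) := kernel_moment_bounded_supported ker e th0 (ltW p0).
have IN : \int[lam]_z Nz z <= I0.
  apply: (le_Rint bNz (kernel_profile_bounded_supported ker (lexx 0))).
  by move=> z; apply: (kernel_le ker); [rewrite addr0 enorm_ge0|rewrite lerD2l].
have Sm : moment theta <= moment 0 by exact: (kernel_moment_le ker p1 (e1 : 'rV[R]_d) (lexx 0) th0).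
have SE : \int[lam]_z (Nz z * b z `^ p) = moment theta.
  by rewrite -(kernel_moment_unit d_gt0 ker p1 th0 en).
have [_ _ bF bQ swap] := Rint_fubini mf fB fr.
have IQ : \int[lam]_z Q z <= vol Omega * (K * s) `^ p.
  rewrite /Q -swap.
  have -> : vol Omega * (K * s) `^ p = \int[lam]_y (vol Omega * (K * s) `^ p * phi y).
    by rewrite (RintZ _ bphi) phi1 mulr1.
  apply: (le_Rint_ae bF (bounded_supportedZ _ bphi) _ _ inner) => y.
    by apply: fine_ge0; apply: integral_ge0 => z _; rewrite lee_fin; have /andP[] := fB (y, z).
  exact: (mulr_ge0 (mulr_ge0 (ltW (vol_gt0 Omega)) (powR_ge0 _ _)) (phi0 y)).
have bQ' : bounded_supported Q := bQ.
have total : s * enorm V * moment theta <= E * s ^+ 2 * \int[lam]_z Nz z + k * \int[lam]_z Q z + (1 - p^-1) * l * moment theta.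
  have c1 := bounded_supportedZ (E * s ^+ 2) bNz; have c2 := bounded_supportedZ k bQ'.
  have c3 := bounded_supportedZ ((1 - p^-1) * l) bm; have c12 := bounded_supportedD c1 c2.
  rewrite -SE -(RintZ (s * enorm V) bm) -(RintZ (E * s ^+ 2) bNz) -(RintZ k bQ') -(RintZ ((1 - p^-1) * l) bm).
  rewrite -(RintD c1 c2) -(RintD c12 c3).
  exact: (le_Rint (bounded_supportedZ _ bm) (bounded_supportedD c12 c3) main).
have q0 : 0 <= (1 - p^-1) * l.
  by apply: mulr_ge0 (ltW l0); rewrite subr_ge0 invf_le1 ?(ltW p1).
have s20 : 0 <= E * s ^+ 2 := mulr_ge0 E0 (exprn_ge0 2 (ltW s0)).
have T1 := ler_wpM2l s20 IN.
have T2 := ler_wpM2l k0 IQ; rewrite kE in T2.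
have T3 := ler_wpM2l q0 Sm.
(* The weights 1 / p and 1 - 1 / p of the two parts add up to 1. *)
have fin : s * (enorm V * moment theta) <= s * (L * moment 0 + E * I0 * s).
  have Ef : E * s ^+ 2 * I0 + p^-1 * l * moment 0 + (1 - p^-1) * l * moment 0 = s * (L * moment 0 + E * I0 * s).
    by rewrite /l; ring.
  by rewrite -Ef mulrA; exact: (le_trans total (lerD (lerD T1 T2) T3)).
by rewrite (ler_pM2l s0) in fin.
Qed.

End gradient_bound.

(** * Upper bound for smooth functions *)

Section recovery_bound.
Context {R : realType} {d : nat} (d_gt0 : (0 < d)%N) (Omega : C2_domain R d).
Local Notation O := (domain_set Omega).
Local Notation lam := (lebesgue_rV R d).
Local Notation nuO := (nu Omega).
Implicit Types (x y z e : 'rV[R]_d).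
Context (eta : R -> R) (r_eta p : R) (ker : interaction_kernel eta r_eta) (p1 : 1 < p).
Local Notation moment theta := (kernel_moment eta p theta (e1 : 'rV[R]_d)).

Let p0 : 0 < p. Proof. exact: lt_trans ltr01 p1. Qed.

Lemma powR_addr_cvg (a : R) (t : nat -> R) : 0 <= a -> (forall n, 0 < t n) -> (forall n, t n <= 1) ->
  t n @[n --> \oo] --> (0 : R) -> (a + t n) `^ p @[n --> \oo] --> a `^ p.
Proof.
rewrite le_eqVlt => /orP[/eqP <-|a0] t0 t1 ct.
  (* At a = 0 the logarithm is of no use; since t <= 1 and p > 1, t^p lies between 0 and t. *)
  rewrite powR0 ?gt_eqF//; apply: (@squeeze_cvgr _ _ _ _ (cst 0) t) ct; last exact: cvg_cst.
  apply: nearW => n; rewrite powR_ge0 add0r/= -{2}[t n]powRr1 ?(ltW (t0 n))//.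
  by rewrite ger_powR ?(ltW p1)// t0 t1.
have cat : a + t n @[n --> \oo] --> a by rewrite -[X in _ --> X]addr0; apply: cvgD => //; exact: cvg_cst.
have E b : 0 < b -> b `^ p = expR (p * ln b) by move=> b0; rewrite /powR gt_eqF.
rewrite (E a a0).
have -> : (fun n => (a + t n) `^ p) = (fun n => expR (p * ln (a + t n))).
  by apply/funext => n; rewrite E// addr_gt0.
have H : p * ln (a + t n) @[n --> \oo] --> p * ln a.
  by apply: cvgM; [exact: cvg_cst|exact: (cvg_comp _ _ cat (continuous_ln a0))].
have ce : expR y @[y --> p * ln a] --> expR (p * ln a) by exact: continuous_expR.
exact: (cvg_comp _ expR H ce).
Qed.

Lemma dist_max0_le (a b : R) : `|Num.max 0 a - Num.max 0 b| <= `|a - b|.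
Proof.
wlog ab : a b / b <= a => [H|].
  by case/orP: (le_total b a) => ab; [exact: H|rewrite distrC (distrC a); exact: H].
rewrite (ger0_norm (_ : 0 <= a - b)) ?subr_ge0// ger0_norm; last first.
  by rewrite subr_ge0 ge_max !le_max lexx ab orbT.
rewrite lerBlDl ge_max; apply/andP; split.
  by rewrite addr_ge0 ?subr_ge0// le_max lexx.
by rewrite -{1}[a](subrK b) addrC lerD// le_max lexx orbT.
Qed.

(* Both the displacement of [T] and the Taylor remainder are at most [t], after
   rescaling by [s]. *)
Definition relaxed_density (L t : R) e z :=
  eta (Num.max 0 (enorm z - t)) * (L * `|dotp z e| + t) `^ p.

Lemma relaxed_density_ge0 L t e z : 0 <= relaxed_density L t e z.
Proof. by rewrite mulr_ge0 ?powR_ge0 ?(kernel_ge0 ker)// le_max lexx. Qed.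

Lemma relaxed_density_measurable (L t : R) e : 0 <= L -> measurable_fun setT (relaxed_density L t e).
Proof.
move=> L0; apply: measurable_funM.
  apply: continuous_measurable_fun; apply/continuous_enormP => z eps eps0.
  have [|h h0 H] := @kernel_continuous R eta r_eta ker (Num.max 0 (enorm z - t)) _ eps eps0.
    by rewrite le_max lexx.
  exists h => // y yz; apply: H; first by rewrite le_max lexx.
  apply: le_lt_trans yz; apply: le_trans (dist_max0_le _ _) _.
  rewrite (_ : _ - t - _ = enorm y - enorm z); last by ring.
  exact: enormB_norm.
apply: measurableT_comp (measurable_powR p) _; apply: measurable_funD => //.
apply: measurable_funM => //; apply: measurableT_comp => //.
by apply: continuous_measurable_fun; exact: continuous_dotpl.
Qed.

Lemma relaxed_density_bound (L t : R) e z : 0 <= L -> 0 <= t -> t <= 1 -> enorm e <= 1 ->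
  relaxed_density L t e z <= eta 0 * (L * (r_eta + 1) + 1) `^ p * \1_(eball 0 (r_eta + 1)) z.
Proof.
move=> L0 t0 t1 en; have r0 := kernel_radius_gt0 ker; rewrite indicE.
case: (boolP (z \in _)) => [/set_mem|/negP]; rewrite /eball/= ?subr0 => zr.
  rewrite mulr1 ler_pM ?powR_ge0 ?(kernel_ge0 ker) ?le_max ?lexx//.
    by rewrite (kernel_le ker)// le_max lexx.
  apply: ge0_ler_powR; rewrite ?nnegrE ?(ltW p0)//.
  - by rewrite addr_ge0// mulr_ge0.
  - by rewrite addr_ge0// mulr_ge0//; lra.
  rewrite lerD// ler_wpM2l// (le_trans (normr_dotp_le _ _))//.
  by rewrite (le_trans (ler_wpM2l (enorm_ge0 z) en))// mulr1 ltW.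
have {}zr : r_eta + 1 <= enorm z by rewrite leNgt; apply/negP => zr'; apply: zr; rewrite in_setE /eball/= subr0.
rewrite mulr0 /relaxed_density (kernel_support ker) ?mul0r//.
by rewrite le_max; apply/orP; right; lra.
Qed.

Let dominating (L : R) : bounded_supported (fun z => eta 0 * (L * (r_eta + 1) + 1) `^ p * \1_(eball 0 (r_eta + 1)) z : R).
Proof.
apply: bounded_supportedZ; apply: (@bounded_supported_indic _ _ _ (r_eta + 1)).
  exact: measurable_eball.
by move=> z; rewrite /eball/= subr0 => /ltW.
Qed.

Lemma relaxed_density_bounded_supported (L t : R) e : 0 <= L -> 0 <= t -> t <= 1 -> enorm e <= 1 ->
  bounded_supported (relaxed_density L t e).
Proof.
move=> L0 t0 t1 en; split; first exact: relaxed_density_measurable.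
have [_ [M [r HM]]] := dominating L; exists M, r => z; have [h1 h2] := HM z.
rewrite ger0_norm ?relaxed_density_ge0//; split.
  by rewrite (le_trans (relaxed_density_bound z L0 t0 t1 en))// (le_trans _ h1)// ler_norm.
move=> /h2 E; apply/eqP; rewrite eq_le relaxed_density_ge0 andbT -E.
exact: relaxed_density_bound.
Qed.

Lemma relaxed_moment_unit (L t : R) e : 0 <= L -> 0 <= t -> t <= 1 -> enorm e = 1 ->
  \int[lam]_z relaxed_density L t e z = \int[lam]_z relaxed_density L t (e1 : 'rV[R]_d) z.
Proof.
move=> L0 t0 t1 en.
have f0 (a b : R) : (0 <= (eta (Num.max 0 (a - t)) * (L * `|b| + t) `^ p)%:E)%E.
  by rewrite lee_fin mulr_ge0 ?powR_ge0 ?(kernel_ge0 ker)// le_max lexx.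
have H := @integral_unit_dotp R d (fun a b => (eta (Num.max 0 (a - t)) * (L * `|b| + t) `^ p)%:E) e (e1 : 'rV[R]_d) f0 en (enorm_e1 d_gt0).
apply: (congr1 fine (H _)); apply/measurable_EFinP; exact: relaxed_density_measurable.
Qed.

Lemma relaxed_moment_cvg (L eps : R) : 0 <= L -> 0 < eps -> exists t : R, [/\ 0 < t, t <= 1 &
  \int[lam]_z relaxed_density L t (e1 : 'rV[R]_d) z <= L `^ p * moment 0 + eps].
Proof.
move=> L0 eps0; pose t n : R := n.+1%:R^-1.
have t0 n : 0 < t n by rewrite invr_gt0.
have t1 n : t n <= 1 by rewrite invf_le1// ler1n.
have en : enorm (e1 : 'rV[R]_d) <= 1 by rewrite enorm_e1.
have ct : t n @[n --> \oo] --> (0 : R) by exact: cvg_harmonic.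
have [|||_ cI] := @Rint_cvg R d (fun n => relaxed_density L (t n) e1)
  (fun z => L `^ p * (eta (enorm z + 0) * `|dotp z e1| `^ p)) _ _ (dominating L).
- by move=> n; exact: relaxed_density_measurable.
- move=> z n; rewrite ger0_norm ?relaxed_density_ge0//.
  by apply: relaxed_density_bound => //; exact: ltW.
- move=> z; rewrite addr0 mulrCA -powRM//; apply: cvgM; last first.
    by apply: powR_addr_cvg => //; rewrite mulr_ge0.
  apply/cvgrPdist_le => e e0.
  have [h h0 H] := kernel_continuous ker (enorm_ge0 z) e0.
  have /cvgrPdist_lt/(_ h h0) := ct; apply: filterS => n; rewrite sub0r normrN gtr0_norm// => tn.
  rewrite distrC; apply: ltW; apply: H; first by rewrite le_max lexx.
  rewrite -[X in _ - X](max_idPr (enorm_ge0 z)); apply: le_lt_trans (dist_max0_le _ _) _.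
  by rewrite addrAC subrr sub0r normrN gtr0_norm.
have bm := kernel_moment_bounded_supported ker (e1 : 'rV[R]_d) (lexx 0) (ltW p0).
move: cI; rewrite (RintZ _ bm) => /cvgrPdist_lt/(_ eps eps0)[n _ /(_ n (leqnn n))] /= H.
exists (t n); split=> //; move: H; rewrite ltr_norml => /andP[H _]; rewrite /kernel_moment.
move: H; clear; set I := Rintegral _ _ _; set J := Rintegral _ _ _; lra.
Qed.

(** For almost every [z] in Omega, the density at a point [c] of the cloud is at most a rescaled
    relaxed density in the direction of the gradient at [c]. Its integral does not depend on that
    direction and tends to the moment as [t] tends to 0. *)
Lemma recovery_energy_bound (U : 'rV[R]_d -> R) G (C L eps : R) : taylor2 U G C ->
  (forall x, O x -> enorm (G x) <= L) -> 0 <= L -> 0 < eps ->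
  exists h0 k0 : R, [/\ 0 < h0, 0 < k0 & forall s delta (x : nat -> 'rV[R]_d) m T, 0 < s -> s <= h0 ->
    0 <= delta -> delta <= k0 * s -> transport Omega x m T ->
    {ae nuO, forall y, enorm (T y - y) <= delta} -> forall c, cloud x m c ->
    \int[lam]_y (((fun z => @eta_scaled R d eta s (enorm (c - z)) * `|U c - U z| `^ p) \o T) \_ O) y <=
      s `^ p * (L `^ p * moment 0 + eps)].
Proof.
move=> TU GL L0 eps0; have [t [t0 t1 Ht]] := relaxed_moment_cvg L0 eps0.
have C0 := taylor2_ge0 TU; have [_ _ TT] := TU; have r0 := kernel_radius_gt0 ker.
have q0 : 0 < C * (r_eta + 2) ^+ 2 + 1.
  by rewrite ltr_wpDl// mulr_ge0// exprn_ge0//; lra.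
(* The first threshold bounds the Taylor remainder at distance s (r_eta + 2) by s t / 2, the second
   one the effect L delta of the displacement by s t / 2; together they use up [t]. *)
exists (t / 2 / (C * (r_eta + 2) ^+ 2 + 1)), (Num.min t (t / 2 / (L + 1))).
have L1 : 0 < L + 1 by lra.
split; [by rewrite !divr_gt0|by rewrite lt_min t0 !divr_gt0|].
move=> s delta x m T s0 sh de0 de Txm Tde c xc.
have Oc := cloud_domain Txm xc.
pose theta := delta / s; have th0 : 0 <= theta by rewrite divr_ge0// ltW.
have tht : theta <= Num.min t (t / 2 / (L + 1)) by rewrite ler_pdivrMr.
have [th1 th2] : theta <= t /\ L * theta <= t / 2.
  move: tht; rewrite le_min => /andP[h1]; rewrite ler_pdivlMr// => h2; split=> //.
  by move: h2 th0; clear -p1 ker d_gt0 Omega; nra.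
have sC : C * s * (r_eta + 2) ^+ 2 <= t / 2.
  move: sh; rewrite ler_pdivlMr// mulrDr mulr1 => h; move: h s0; clear -p1 ker d_gt0 Omega; nra.
(* Any unit vector serves when the gradient vanishes. *)
have [e [en Ge]] : exists e, enorm e = 1 /\ forall z, `|dotp (G c) z| <= L * `|dotp z e|.
  have [G0|Gn] := eqVneq (G c) 0.
    exists e1; split; first exact: enorm_e1.
    by move=> z; rewrite G0 dotp0l normr0 mulr_ge0.
  have Gp : 0 < enorm (G c) by rewrite enorm_gt0.
  exists ((enorm (G c))^-1 *: G c); split.
    by rewrite enormZ gtr0_norm ?invr_gt0// mulVf// gt_eqF.
  move=> z; rewrite dotpZr normrM gtr0_norm ?invr_gt0// dotpC.
  rewrite mulrA ler_peMl// -[X in X <= _](mulfV (lt0r_neq0 Gp)) ler_pM2r ?invr_gt0//; exact: GL.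
have en1 : enorm e <= 1 by rewrite en.
have bH := relaxed_density_bounded_supported L0 (ltW t0) t1 en1.
have H0 z := relaxed_density_ge0 L t e z.
have si0 : 0 < s^-1 by rewrite invr_gt0.
have [bHa IHa] := Rint_affine (- (s^-1 *: c)) si0 bH H0.
have sd0 : 0 < s ^- d by rewrite invr_gt0 exprn_gt0.
pose H' z := s `^ p * s ^- d * relaxed_density L t e (- (s^-1 *: c) + s^-1 *: z).
have bH' : bounded_supported H' by exact: bounded_supportedZ.
have IH' : \int[lam]_z H' z = s `^ p * \int[lam]_z relaxed_density L t e1 z.
  rewrite /H' (RintZ _ bHa) IHa -(relaxed_moment_unit L0 (ltW t0) t1 en) exprVn invrK.
  by rewrite -mulrA; congr (_ * _); rewrite mulrA mulVf ?mul1r// gt_eqF// exprn_gt0.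
apply: (@le_trans _ _ (\int[lam]_z H' z)); last by rewrite IH' ler_wpM2l ?powR_ge0.
have es0 v : 0 <= v -> 0 <= @eta_scaled R d eta s v.
  by move=> v0; rewrite mulr_ge0 ?(ltW sd0)// (kernel_ge0 ker)// divr_ge0// ltW.
apply: (le_Rint_ae (transport_bounded_supported Txm _) bH').
- move=> y; rewrite patchE; case: ifP => // _ /=.
  by rewrite mulr_ge0 ?powR_ge0// es0 ?enorm_ge0.
- by move=> y; apply: mulr_ge0; [apply: mulr_ge0; [exact: powR_ge0|exact: ltW]|exact: H0].
have := ae_lebesgue_shift 0 Tde; apply: filterS => z; rewrite addr0 => Tz.
rewrite patchE; case: ifPn => [/set_mem Oz|_] /=; last first.
  by apply: mulr_ge0; [apply: mulr_ge0; [exact: powR_ge0|exact: ltW]|exact: H0].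
have {}Tz := Tz Oz.
have zE : - (s^-1 *: c) + s^-1 *: z = s^-1 *: (z - c) by rewrite scalerBr addrC.
rewrite /H' zE /relaxed_density /eta_scaled; set w := s^-1 *: (z - c).
clear bHa IHa bH' IH' bH H0 H' Ht sh de.
have wn : enorm w = enorm (z - c) / s by rewrite enormZ gtr0_norm// mulrC.
have cT : enorm (z - c) - delta <= enorm (c - T z).
  by have := enorm_triangle (T z) z c; rewrite (enormB z (T z)) (enormB (T z) c); lra.
have e1 : eta (enorm (c - T z) / s) <= eta (Num.max 0 (enorm w - t)).
  apply: (kernel_le ker); first by rewrite le_max lexx.
  rewrite ge_max divr_ge0 ?enorm_ge0 ?(ltW s0)//= wn.
  apply: (@le_trans _ _ ((enorm (z - c) - delta) / s)); last by rewrite ler_pM2r.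
  by rewrite mulrBl lerD2l lerN2.
rewrite -!mulrA [X in _ <= X]mulrCA; apply: ler_wpM2l; first exact: ltW.
have [wr|wr] := lerP (r_eta + 1) (enorm w).
  have z0' : eta (enorm (c - T z) / s) <= 0.
    by rewrite (le_trans e1)// (kernel_support ker)// le_max; apply/orP; right; lra.
  have -> : eta (enorm (c - T z) / s) = 0.
    by apply/eqP; rewrite eq_le z0' (kernel_ge0 ker)// divr_ge0 ?enorm_ge0// ltW.
  by rewrite mul0r !mulr_ge0 ?powR_ge0// (kernel_ge0 ker)// le_max lexx.
rewrite mulrCA ler_pM ?powR_ge0//; first by rewrite (kernel_ge0 ker)// divr_ge0 ?enorm_ge0// ltW.
rewrite -powRM ?(ltW s0)//; last by rewrite addr_ge0 ?mulr_ge0// ltW.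
apply: ge0_ler_powR; rewrite ?nnegrE ?(ltW p0)//.
  by rewrite mulr_ge0 ?(ltW s0)// addr_ge0 ?mulr_ge0// ltW.
have zcs : enorm (z - c) = s * enorm w by rewrite wn mulrCA mulfV ?mulr1// gt_eqF.
have dsE : delta = s * theta by rewrite /theta mulrCA mulfV ?mulr1// gt_eqF.
have cTz : enorm (T z - c) <= s * (r_eta + 2).
  have := enorm_triangle z (T z) c; rewrite zcs => h.
  rewrite (le_trans h)// (le_trans (lerD Tz (lexx _)))// dsE -mulrDr ler_pM2l//.
  by move: wr th1 t1; clear -p1 ker d_gt0 Omega; lra.
have dU := TT c (T z).
have d1 : `|dotp (G c) (T z - c)| <= s * (L * `|dotp w e|) + L * delta.
  rewrite (_ : T z - c = (z - c) + (T z - z)); last by apply/rowP => i; rewrite !mxE; ring.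
  rewrite dotpDr (le_trans (ler_normD _ _))// lerD//.
    rewrite (_ : z - c = s *: w); last by rewrite scalerA mulfV ?scale1r// gt_eqF.
    by rewrite dotpZr normrM (gtr0_norm s0) ler_pM2l// Ge.
  by rewrite (le_trans (normr_dotp_le _ _))// ler_pM ?enorm_ge0// GL.
have d2 : C * enorm (T z - c) ^+ 2 <= s * (C * s * (r_eta + 2) ^+ 2).
  rewrite (_ : s * _ = C * (s * (r_eta + 2)) ^+ 2); last by ring.
  by rewrite ler_wpM2l// ler_pXn2r ?nnegrE ?enorm_ge0 ?mulr_ge0 ?(ltW s0)//; lra.
have d3 : s * (C * s * (r_eta + 2) ^+ 2) <= s * (t / 2) by rewrite ler_pM2l.
have d4 : L * delta <= s * (t / 2) by rewrite dsE mulrCA ler_pM2l.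
rewrite distrC; set X := U (T z) - U c in dU *; set Y := dotp (G c) (T z - c) in dU d1.
have := ler_normD (X - Y) Y; rewrite subrK => tri.
rewrite (_ : s * _ = s * (L * `|dotp w e|) + s * (t / 2) + s * (t / 2)); last by field.
move: dU d1 d2 d3 d4 tri; clear -p1 ker d_gt0 Omega; lra.
Qed.

End recovery_bound.

(** * Asymptotics *)

Section transport_rate.
Context {R : realType} {d : nat} (Omega : C2_domain R d).
Local Notation O := (domain_set Omega).
Local Notation nuO := (nu Omega).

(** True only from some rank on: the logarithm vanishes at 1, and the iterated one must be positive
    when d = 1. *)
Lemma rate_gt0 : \forall n \near \oo, 0 < (rate d n.+1 : R).
Proof.
have [k _ Hk] := @nbhs_infty_gtr R (expR 1).
exists k => // n /= kn; have {kn Hk}n1 : expR 1 < n.+1%:R :> R by apply: Hk => /=; exact: leqW.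
have n0 : 0 < n.+1%:R :> R by [].
have ln1 : 1 < ln (n.+1%:R : R) by rewrite -[ltLHS]expRK ltr_ln// posrE expR_gt0.
have ln0 : 0 < ln (n.+1%:R : R) by exact: lt_trans ltr01 ln1.
rewrite /rate; case: ifP => _; first by rewrite sqrtr_gt0 divr_gt0// ln_gt0.
by case: ifP => _; rewrite divr_gt0 ?powR_gt0// sqrtr_gt0.
Qed.

(** The upper limit is at most [C], so the displacement is eventually at most (C + 1) times the
    rate; the strict margin is what extracts a rank from the limit. *)
Lemma transport_maps_near (m : nat -> nat) (x : nat -> 'rV[R]_d) T (s : nat -> R) :
  (forall n, (0 < m n)%N) -> (forall n, 0 < s n) -> (rate d n.+1 / s n : R) @[n --> \oo] --> (0 : R) ->
  transport_maps Omega m x T -> (forall n, transport Omega x (m n) (T n)) /\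
  exists delta : nat -> R, [/\ forall n, 0 <= delta n, delta n / s n @[n --> \oo] --> 0 &
    \forall n \near \oo, {ae nuO, forall y, enorm (T n y - y) <= delta n}].
Proof.
move=> m0 s0 crs [mT TO Tid push [c [C /= [c0 cC _ HC]]]]; split.
  by move=> n; split; [exact: m0|exact: mT|exact: TO|exact: Tid|exact: push].
have C0 : 0 <= C by exact: le_trans c0 cC.
have r0 n : 0 <= (rate d n.+1 : R).
  rewrite /rate; case: ifP => _; first exact: sqrtr_ge0.
  by case: ifP => _; rewrite divr_ge0 ?powR_ge0 ?sqrtr_ge0.
exists (fun n => (C + 1) * rate d n.+1); split.
- by move=> n; rewrite mulr_ge0// addr_ge0.
- under eq_fun do rewrite -mulrA; rewrite -(mulr0 (C + 1)); apply: cvgM => //; exact: cvg_cst.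
have : (limn_esup (fun n => ess_sup nuO (fun y => (enorm (T n y - y))%:E) * ((rate d n.+1 : R)^-1)%:E) < (C + 1)%:E)%E.
  by apply: le_lt_trans HC _; rewrite lte_fin ltrDl.
(* The upper limit is the infimum, over the neighbourhoods [V] of infinity, of the suprema on
   [V]. *)
move=> /ereal_inf_lt[_ [V V1 <-] VC].
near=> n; have rn : 0 < (rate d n.+1 : R) by near: n; exact: rate_gt0.
have Vn : V n by near: n; exact: V1.
have /ltW : (ess_sup nuO (fun y => (enorm (T n y - y))%:E) * ((rate d n.+1 : R)^-1)%:E < (C + 1)%:E)%E.
  by apply: le_lt_trans VC; apply: ereal_sup_ubound; exists n.
rewrite lee_pdivrMr// -EFinM => /ess_supP; apply: filterS => y; by rewrite lee_fin.
Unshelve. all: by end_near. Qed.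

End transport_rate.

Section lower_bound.
Context {R : realType} {d : nat} (Omega : C2_domain R d).
Local Notation O := (domain_set Omega).
Local Notation lam := (lebesgue_rV R d).
Local Notation nuO := (nu Omega).

Lemma mollify_grad_dist f h (e r C : R) phi G z : bounded_measurable f -> bounded_measurable h ->
  mollifier r phi G C -> {ae lam, forall y, `|f y - h y| <= e} ->
  enorm (mollify_grad f G z) <= enorm (mollify_grad h G z) + e * \sum_(i < d) \int[lam]_y `|G y ord0 i|.
Proof.
move=> bf bh [T phi0 phir _ _] fh.
have bG i := taylor2_coord_bounded_supported i T phi0 phir.
have bGz i : bounded_supported (fun y => G (y - z) ord0 i).
  exact: (@bounded_supported_shift _ _ (fun y => G y ord0 i) z (bG i)).
rewrite -[X in enorm X <= _](subrK (mollify_grad h G z)) addrC (le_trans (enormD _ _))// lerD2l.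
rewrite (le_trans (enorm_le_sum _))// mulr_sumr; apply: ler_sum => i _; rewrite !mxE opprK addrC.
have b1 := bounded_supportedM bf (bGz i); have b2 := bounded_supportedM bh (bGz i).
have b12 := bounded_supportedB b2 b1.
rewrite -(RintB b2 b1) (le_trans (le_norm_Rint b12))//.
have bn := bounded_supported_norm (bG i).
rewrite -(Rint_shift z bn) -RintZ; last exact: (@bounded_supported_shift _ _ (fun y => `|G y ord0 i|) z bn).
have e0 : 0 <= e.
  have [y Oy] := @dom_nonempty _ _ Omega.
  have [y' [_ _ /=]] := ae_nu_dense (ae_lebesgue_nu Omega fh) (@openT _) I Oy.
  exact: le_trans (normr_ge0 _).
apply: le_Rint_ae.
- exact: bounded_supported_norm.
- by apply: bounded_supportedZ; exact: (@bounded_supported_shift _ _ (fun y => `|G y ord0 i|) z bn).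
- by move=> y; exact: normr_ge0.
- by move=> y; rewrite mulr_ge0.
by apply: filterS fh => y fh; rewrite -mulrBl normrM distrC ler_wpM2r.
Qed.

Context (eta : R -> R) (r_eta p : R) (ker : interaction_kernel eta r_eta) (p1 : 1 < p).
Local Notation moment theta := (kernel_moment eta p theta (e1 : 'rV[R]_d)).

Lemma kernel_moment_cvg (theta : nat -> R) : (forall k, 0 <= theta k) ->
  theta k @[k --> \oo] --> 0 -> moment (theta k) @[k --> \oo] --> moment 0.
Proof.
move=> t0 ct; have p0 : 0 < p := lt_trans ltr01 p1.
have bm t (t0' : 0 <= t) := kernel_moment_bounded_supported ker (e1 : 'rV[R]_d) t0' (ltW p0).
have [|||_] := @Rint_cvg R d (fun k z => eta (enorm z + theta k) * `|dotp z e1| `^ p)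
  (fun z => eta (enorm z + 0) * `|dotp z e1| `^ p) _ _ (bm 0 (lexx 0)).
- by move=> k; have [] := bm _ (t0 k).
- move=> z k; rewrite ger0_norm ?mulr_ge0 ?powR_ge0 ?(kernel_ge0 ker) ?addr_ge0 ?enorm_ge0//.
  by rewrite ler_wpM2r ?powR_ge0// (kernel_le ker) ?addr_ge0 ?enorm_ge0// lerD2l.
- move=> z; apply: cvgM; last exact: cvg_cst.
  apply/cvgrPdist_le => e e0; have [h h0 H] := kernel_continuous ker (enorm_ge0 z) e0.
  have /cvgrPdist_lt/(_ h h0) := ct; apply: filterS => k; rewrite sub0r normrN => tk.
  by rewrite distrC addr0 ltW// H ?addr_ge0 ?enorm_ge0// addrAC subrr add0r.
by [].
Qed.

Context (g : 'rV[R]_d -> R) (N : nat) (a : 'I_N -> 'rV[R]_d).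

Lemma graph_energy_cons_bounded (s delta K M : R) (x : nat -> 'rV[R]_d) m T (u : Linfty nuO) :
  0 < s -> 0 <= K -> transport Omega x m T ->
  {ae nuO, forall y, enorm (T y - y) <= delta} -> (forall j, cloud x m (a j)) ->
  {ae nuO, forall y, `|u y| <= M} ->
  (graph_energy_cons eta p g a Omega s m x T u <= K%:E)%E ->
  exists U, [/\ bounded_measurable U /\ forall y, O y -> `|U y| <= M, forall y, ~ O y -> U y = 0,
    {ae nuO, forall y, u y = U y}, (forall j y, O y -> T y = a j -> U y = g (a j)) &
    energy_bounded Omega eta p s delta K T U [set y | O y /\ enorm (T y - y) <= delta]].
Proof.
move=> s0 K0 Txm Td ax uM EK; have p0 : 0 < p := lt_trans ltr01 p1.
have [U [bU UO uU [UQ Ua] Ud]] := graph_energy_cons_density p0 (kernel_ge0 ker) s0 Txm ax K0 EK.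
exists U; split=> //.
  by split=> // y Oy; exact: (UQ (fun t => `|t| <= M)) uM y Oy.
split; first by move=> y [].
- by have /ae_nuP[A AA HA] := Td; apply/ae_nuP; exists A => // y Oy nA; split=> //; exact: HA.
- by move=> y [].
by move=> y [Oy _]; exact: Ud.
Qed.

End lower_bound.

(** * Limits of functions of bounded graph energy *)

Section energy_liminf.
Context {R : realType} {d : nat} (d_gt0 : (0 < d)%N) (Omega : C2_domain R d).
Local Notation O := (domain_set Omega).
Local Notation lam := (lebesgue_rV R d).
Local Notation nuO := (nu Omega).
Context (eta : R -> R) (r_eta p : R) (ker : interaction_kernel eta r_eta) (p1 : 1 < p)
  (eta_neq0 : exists2 t : R, 0 <= t & eta t != 0).
Local Notation moment theta := (kernel_moment eta p theta (e1 : 'rV[R]_d)).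
Context (s delta : nat -> R) (s0 : forall k, 0 < s k) (cs : s k @[k --> \oo] --> (0 : R))
  (d0 : forall k, 0 <= delta k) (cd : delta k / s k @[k --> \oo] --> (0 : R)).

Lemma asymptotically_small : delta k @[k --> \oo] --> (0 : R).
Proof.
rewrite (_ : (fun k => delta k) = (fun k => delta k / s k * s k)).
  by rewrite -(mulr0 0); apply: cvgM.
by apply/funext => k; rewrite divfK// gt_eqF.
Qed.

(** The scale [s k] in the equicontinuity estimate disappears in the limit, which gives a Lipschitz
    bound, not yet sharp, at the points where all the functions behave well. *)
Lemma limit_lipschitz (T : nat -> 'rV[R]_d -> 'rV[R]_d) U (D : nat -> set 'rV[R]_d) (e : nat -> R) v K :
  0 < K -> (forall k, energy_bounded Omega eta p (s k) (delta k) K (T k) (U k) (D k)) ->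
  e k @[k --> \oo] --> (0 : R) ->
  exists L rho : R, [/\ 0 <= L, 0 < rho & forall y z,
    (forall k, D k y /\ `|U k y - v y| <= e k) -> (forall k, D k z /\ `|U k z - v z| <= e k) ->
    enorm (z - y) <= rho -> `|v z - v y| <= L * enorm (z - y)].
Proof.
move=> K0 EB ce; have [c [t1 [c0 t10 ec]]] := kernel_lower_bound ker eta_neq0.
have [C [rho [h0 [k0 [C0 rho0 h00 k00 H]]]]] :=
  asymptotic_equicontinuity Omega p1 (kernel_ge0 ker) c0 t10 ec.
exists (C * K), rho; split=> [||y z Hy Hz yz] //; first by rewrite mulr_ge0// ltW.
have lim : C * K * (enorm (z - y) + s k) + (e k + e k) @[k --> \oo] --> C * K * (enorm (z - y) + 0) + (0 + 0).
  apply: cvgD; last exact: cvgD.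
  by apply: cvgM; [exact: cvg_cst|apply: cvgD => //; exact: cvg_cst].
move: lim; rewrite !addr0 => lim; apply: (cvgr_to_ge lim).
have /cvgrPdist_lt/(_ _ h00) ns := cs; have /cvgrPdist_lt/(_ _ k00) nd := cd.
near=> k.
have sk : s k <= h0.
  have : `|0 - s k| < h0 by near: k; exact: ns.
  by rewrite sub0r normrN (gtr0_norm (s0 k)) => /ltW.
have dk : delta k <= k0 * s k.
  have : `|0 - delta k / s k| < k0 by near: k; exact: nd.
  by rewrite sub0r normrN ger0_norm ?divr_ge0 ?(ltW (s0 k))// => /ltW; rewrite ler_pdivrMr.
have [F [FU FD Fe]] := H _ _ _ _ _ _ (s0 k) sk (d0 k) dk K0 (EB k).
have [[Dy ey] [Dz ez]] := (Hy k, Hz k); have [DO _ _ _] := EB k.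
have := Fe y z (DO _ Dy) (DO _ Dz) yz; rewrite (FU _ Dy) (FU _ Dz) => Uyz.
have -> : v z - v y = (v z - U k z) + (U k z - U k y) + (U k y - v y) by ring.
rewrite (le_trans (ler_normD _ _))// (le_trans (lerD (ler_normD _ _) (lexx _)))//.
by rewrite (distrC (v z)) -addrA addrCA lerD// lerD.
Unshelve. all: by end_near. Qed.

(** For a fixed kernel, the bounds on mollified gradients pass to the limit: the error in C' s
    vanishes and the moment at 2 delta / s converges. *)
Lemma limit_slope U (T : nat -> 'rV[R]_d -> 'rV[R]_d) (D : nat -> set 'rV[R]_d) (e : nat -> R) f K L M :
  0 < K -> 0 < L -> L `^ p * moment 0 = K `^ p * vol Omega -> 0 <= M ->
  (forall k, energy_bounded Omega eta p (s k) (delta k) K (T k) (U k) (D k)) ->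
  (forall k, bounded_measurable (U k)) -> (forall k y, `|U k y| <= M) -> bounded_measurable f ->
  (forall k, {ae lam, forall y, `|f y - U k y| <= e k}) -> e k @[k --> \oo] --> (0 : R) ->
  forall r phi G C z, 0 < r -> mollifier r phi G C -> eball z (2 * r) `<=` O ->
    enorm (mollify_grad f G z) <= L.
Proof.
move=> K0 L0 LK M0 EB bU UM bf fU ce r phi G C z r0 mphi zO.
have [C' C'0 H] := gradient_energy_bound d_gt0 ker p1 r0 M0 mphi zO.
set B := \sum_(i < d) \int[lam]_y `|G y ord0 i|.
have th0 k : 0 <= 2 * delta k / s k by rewrite divr_ge0 ?mulr_ge0// ltW.
have ct : 2 * delta k / s k @[k --> \oo] --> (0 : R).
  under eq_fun do rewrite -mulrA; rewrite -(mulr0 2); apply: cvgM => //; exact: cvg_cst.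
have cm := @kernel_moment_cvg R d _ _ _ ker p1 _ th0 ct.
have m0 := kernel_moment_gt0 d_gt0 ker p1 eta_neq0.
rewrite -(ler_pM2r m0).
have c1 : enorm (mollify_grad f G z) * moment (2 * delta k / s k) @[k --> \oo] -->
    enorm (mollify_grad f G z) * moment 0 by apply: cvgM cm; exact: cvg_cst.
have c2 : L * moment 0 + C' * s k + e k * B * moment (2 * delta k / s k) @[k --> \oo] -->
    L * moment 0 + C' * 0 + 0 * B * moment 0.
  apply: cvgD; last by apply: cvgM cm; apply: cvgM ce _; exact: cvg_cst.
  by apply: cvgD; [exact: cvg_cst|apply: cvgM cs; exact: cvg_cst].
move: c2; rewrite mulr0 !mul0r !addr0 => c2; apply: (ler_cvg_to c1 c2).
have /cvgrPdist_lt/(_ _ (divr_gt0 r0 (kernel_radius_gt0 ker))) ns := cs.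
near=> k.
have sr : s k * r_eta <= r.
  have : `|0 - s k| < r / r_eta by near: k; exact: ns.
  by rewrite sub0r normrN (gtr0_norm (s0 k)) ltr_pdivlMr ?(kernel_radius_gt0 ker)// => /ltW.
have h1 := H _ _ _ _ _ _ _ (s0 k) sr (d0 k) K0 L0 (EB k) (bU k) (UM k) LK.
have h2 := mollify_grad_dist Omega z bf (bU k) mphi (fU k).
have mk : 0 <= moment (2 * delta k / s k) by exact: (kernel_moment_ge0 p ker (e1 : 'rV[R]_d) (th0 k)).
apply: le_trans (ler_wpM2r mk h2) _; rewrite mulrDl; exact: lerD h1 (lexx _).
Unshelve. all: by end_near. Qed.

Context (g : 'rV[R]_d -> R) (N : nat) (a : 'I_N -> 'rV[R]_d).
Context (x : nat -> 'rV[R]_d) (m : nat -> nat) (T : nat -> 'rV[R]_d -> 'rV[R]_d)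
  (Txm : forall k, transport Omega x (m k) (T k))
  (Td : forall k, {ae nuO, forall y, enorm (T k y - y) <= delta k})
  (ax : forall k j, cloud x (m k) (a j)).

(** A non-sharp Lipschitz bound provides a continuous representative, on which the labels make
    sense; the sharp slope then comes from mollification. *)
Lemma energy_liminf (u : nat -> Linfty nuO) (v : Linfty nuO) (e : nat -> R) (K L M : R) : 0 < K -> 0 < L ->
  L `^ p * moment 0 = K `^ p * vol Omega ->
  (forall k, {ae nuO, forall y, `|u k y| <= M}) ->
  (forall k, {ae nuO, forall y, `|u k y - v y| <= e k}) -> e k @[k --> \oo] --> (0 : R) ->
  (forall k, (graph_energy_cons eta p g a Omega (s k) (m k) x (T k) (u k) <= K%:E)%E) ->
  (energy_cons Omega g a v <= L%:E)%E.
Proof.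
move=> K0 L0 LK uM uv ce EK.
have exU k := graph_energy_cons_bounded ker p1 (s0 k) (ltW K0) (Txm k) (Td k) (ax k) (uM k) (EK k).
have [U HU] := choice exU.
pose D k := [set y | O y /\ enorm (T k y - y) <= delta k].
have EB k : energy_bounded Omega eta p (s k) (delta k) K (T k) (U k) (D k) by case: (HU k).
have [L1 [rho [L10 rho0 Hlip]]] := limit_lipschitz (v : 'rV[R]_d -> R) K0 EB ce.
(* Countably many almost sure properties gathered in one set of full measure; the continuous
   representative extends the restriction of [v] to it. *)
pose E := [set y | O y /\ forall k, D k y /\ `|U k y - v y| <= e k].
have aeO : {ae nuO, forall y, O y} by have [DO aeD _ _] := EB 0%N; exact: filterS aeD.
have aeE : {ae nuO, forall y, E y}.
  apply: (filterI aeO); apply: ae_foralln => k; have [_ aeD _ _] := EB k.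
  have [_ _ uU _ _] := HU k.
  by near=> y; split; [near: y|have <- : u k y = U k y; near: y; [exact: uU|exact: uv]].
have [y0 Oy0] := @dom_nonempty _ _ Omega.
have [y1 [_ _ Ey1]] := ae_nu_dense aeE (@openT _) I Oy0.
have M0 : 0 <= M.
  have [[_ UM] _ _ _ _] := HU 0%N; apply: le_trans (UM _ Ey1.1); exact: normr_ge0.
have vM y : E y -> `|v y| <= M + e 0%N.
  move=> [Oy /(_ 0%N)[_ h]]; have [[_ UM] _ _ _ _] := HU 0%N.
  rewrite (_ : v y = U 0%N y - (U 0%N y - v y)); last by ring.
  by rewrite (le_trans (ler_normB _ _))// lerD// UM.
have vL y z : E y -> E z -> enorm (z - y) <= rho -> `|v z - v y| <= L1 * enorm (z - y).
  by move=> [_ Ey] [_ Ez]; exact: Hlip.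
have [w [K' [_ [_ [[K'0 wK] wM wv _ _]]]]] :=
  lipschitz_extension (ex_intro _ y1 Ey1) L10 rho0 ltr01 vM vL.
have bw := lipschitz_bounded_measurable wK wM.
have vw : {ae nuO, forall y, v y = w y} by apply: filterS aeE => y /wv ->.
(* The fibre of [T k] over a label contains a point of [E], at distance at most [delta k] from the
   label, where [U k] takes the label value. *)
have wa j : w (a j) = g (a j).
  apply/eqP; rewrite -subr_eq0 -normr_le0.
  have lim : K' * delta k + e k @[k --> \oo] --> K' * 0 + 0.
    by apply: cvgD ce; apply: cvgM asymptotically_small; exact: cvg_cst.
  move: lim; rewrite mulr0 addr0 => lim; apply: (cvgr_to_ge lim); apply: nearW => k.
  have [y [Oy Ty Ey]] := cloud_ae_fibre (Txm k) (ax k j) aeE.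
  have [_ /(_ k)[[_ dy] ey]] := Ey; have [_ _ _ Ua _] := HU k.
  move: ey; rewrite (Ua j y Oy Ty) -(wv y Ey) => ey.
  rewrite (_ : w (a j) - g (a j) = (w (a j) - w y) - (g (a j) - w y)); last by ring.
  rewrite (le_trans (ler_normB _ _))// lerD// (le_trans (wK _ _))// ler_wpM2l//.
  by rewrite -Ty.
pose f y := w y * \1_O y.
have fO y : O y -> f y = w y by move=> Oy; rewrite /f indicE mem_set ?mulr1.
have fN y : ~ O y -> f y = 0 by move=> Oy; rewrite /f indicE memNset ?mulr0.
have bf : bounded_measurable f.
  apply: bounded_supported_measurable; apply: bounded_supportedM => //.
  have [r r_gt0 Or] := domain_bounded Omega; apply: (@bounded_supported_indic _ _ _ r) => //.
  exact: measurable_domain.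
have cw : {within O, continuous w}.
  apply/within_continuous_enormP => y _ eps eps0; exists (eps / (K' + 1)).
    by rewrite divr_gt0// ltr_wpDl.
  move=> z; rewrite ltr_pdivlMr ?ltr_wpDl// => yz; apply: le_lt_trans (wK y z) _.
  by apply: le_lt_trans _ yz; rewrite mulrC ler_wpM2l ?enorm_ge0// lerDl.
have UO k y : O y \/ U k y = 0.
  by have [Oy|nO] := pselect (O y); [left|right; have [_ h _ _ _] := HU k; exact: h].
have UM k y : `|U k y| <= M.
  have [[_ h] _ _ _ _] := HU k; case: (UO k y) => [|->]; [exact: h|by rewrite normr0].
have bU k : bounded_measurable (U k) by have [[]] := HU k.
have fU k : {ae lam, forall y, `|f y - U k y| <= e k}.
  have /ae_nuP[A [mA A0] HA] := aeE; exists A; split=> // y /= ny; apply: contrapT => nA; apply: ny.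
  case: (UO k y) => [Oy|U0].
    by have Ey := HA y Oy nA; rewrite fO// (wv y Ey) distrC; have [_ /(_ k)[]] := Ey.
  have [Oy|nO] := pselect (O y).
    by have Ey := HA y Oy nA; rewrite fO// (wv y Ey) distrC; have [_ /(_ k)[]] := Ey.
  rewrite fN// U0 subrr normr0; have [_ /(_ k)[_]] := Ey1; exact: le_trans (normr_ge0 _).
have slope := limit_slope K0 L0 LK M0 EB bU UM bf fU ce.
apply: (locally_lipschitz_energy_cons (ltW L0) _ vw wa).
exact: (mollify_locally_lipschitz cw bf fO slope).
Unshelve. all: by end_near. Qed.

End energy_liminf.

(** * Compactness in the essential sup norm *)

Section ultrafilter_limits.
Context {R : realType}.

Lemma ultra_bounded_limit (X : Type) (F : set_system X) (h : X -> R) (M : R) : UltraFilter F ->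
  F [set t | `|h t| <= M] -> exists c, forall e : R, 0 < e -> F [set t | `|h t - c| < e].
Proof.
move=> FU FM; have PF : ProperFilter F by exact: ultra_proper.
pose G := h @ F.
have GP : ProperFilter G by apply: fmap_proper_filter.
have GM : G `[- M, M]%classic.
  have : F (h @^-1` `[- M, M]%classic); last by [].
  by apply: filterS FM => t /=; rewrite in_itv/= -ler_norml.
have [c [_ Gc]] := @segment_compact R (- M) M G GP GM.
exists c => e e0; case: (in_ultra_setVsetC [set t | `|h t - c| < e] FU) => // FC.
have Bc : nbhs c [set y : R | `|y - c| < e].
  by apply/nbhs_ballP; exists e => // y; rewrite /ball/= distrC.
have GC : G [set y | ~ `|y - c| < e] by exact: FC.
by have [y []] := Gc _ _ GC Bc.
Qed.

Lemma filter_forall_seq (X : Type) (Y : eqType) (F : set_system X) (P : Y -> set X) (l : seq Y) :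
  Filter F -> (forall y, y \in l -> F (P y)) -> F [set t | forall y, y \in l -> P y t].
Proof.
move=> FF; elim: l => [|y l IH] H; first by apply: filterS filterT => t _ y.
have F1 : F (P y) by apply: H; rewrite mem_head.
have F2 : F [set t | forall z, z \in l -> P z t].
  by apply: IH => z zl; apply: H; rewrite in_cons zl orbT.
by apply: filterS (filterI F1 F2) => t [Pyt Pt] z; rewrite in_cons => /orP[/eqP ->|/Pt].
Qed.

End ultrafilter_limits.

Section precompactness.
Context {R : realType} {d : nat} (Omega : C2_domain R d).
Local Notation O := (domain_set Omega).
Local Notation nuO := (nu Omega).
Context (A rho M : R) (A0 : 0 <= A) (rho0 : 0 < rho).

Definition almost_lipschitz (sigma : R) (v : Linfty nuO) (F : 'rV[R]_d -> R) :=
  [/\ {ae nuO, forall y, v y = F y}, forall y, O y -> `|F y| <= M &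
    forall y z, O y -> O z -> enorm (z - y) <= rho -> `|F z - F y| <= A * (enorm (z - y) + sigma)].

Lemma almost_lipschitz_le (sigma tau : R) v F : sigma <= tau ->
  almost_lipschitz sigma v F -> almost_lipschitz tau v F.
Proof.
move=> st [vF FM FL]; split=> // y z Oy Oz yz.
by apply: le_trans (FL y z Oy Oz yz) _; rewrite ler_wpM2l// lerD2l.
Qed.

(** Arzela-Ascoli along an ultrafilter: pointwise limits exist by boundedness, are Lipschitz because
    the error [sigma] is arbitrarily small, and are uniform thanks to a finite net. *)
Lemma ultra_almost_lipschitz_cvg (F : set_system (Linfty nuO)) (rep : Linfty nuO -> 'rV[R]_d -> R) :
  UltraFilter F -> (forall sigma, 0 < sigma -> F [set v | almost_lipschitz sigma v (rep v)]) ->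
  exists v, (exists w, almost_lipschitz 0 v w) /\ F --> v.
Proof.
move=> FU FA.
have ex y : exists c, O y -> forall e, 0 < e -> F [set v | `|rep v y - c| < e].
  have [Oy|nO] := pselect (O y); last by exists 0.
  have [|c Hc] := @ultra_bounded_limit _ _ _ (fun v => rep v y) M FU; last by exists c.
  by apply: filterS (FA _ ltr01) => v [_ vM _]; exact: vM.
have [w Hw] := choice ex.
have wM y : O y -> `|w y| <= M.
  move=> Oy; apply/ler_addgt0Pr => e e0.
  have [v [[_ vM _] /= ve]] := filter_ex (filterI (FA _ ltr01) (Hw y Oy e e0)).
  rewrite -[w y](subKr (rep v y)) (le_trans (ler_normB _ _))// lerD ?vM//.
  exact: ltW.
have wL y z : O y -> O z -> enorm (z - y) <= rho -> `|w z - w y| <= A * enorm (z - y).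
  move=> Oy Oz yz; apply/ler_addgt0Pr => e e0.
  have e3 : 0 < e / 3 by rewrite divr_gt0.
  have A1 : 0 < A + 1 by rewrite ltr_wpDl.
  have e3A : 0 < e / 3 / (A + 1) by rewrite divr_gt0.
  have [v [[[_ _ vL] /= vy] /= vz]] :=
    filter_ex (filterI (filterI (FA _ e3A) (Hw y Oy _ e3)) (Hw z Oz _ e3)).
  have h := vL y z Oy Oz yz.
  have h3 : A * (e / 3 / (A + 1)) <= e / 3.
    by rewrite mulrA ler_pdivrMr// mulrC ler_wpM2l ?(ltW e3)// lerDl.
  rewrite (_ : w z - w y = (rep v z - rep v y) - (rep v z - w z) + (rep v y - w y)); last by ring.
  rewrite (le_trans (ler_normD _ _))// (le_trans (lerD (ler_normB _ _) (lexx _)))//.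
  rewrite mulrDr in h.
  move: h h3 vy vz; set a1 := `|_|; set a2 := `|_|; set a3 := `|_|; set a4 := A * _; set a5 := A * _.
  by clear; lra.
have [W [K' [_ [_ [[K'0 WK] WM Ww _ _]]]]] :=
  lipschitz_extension (@dom_nonempty _ _ Omega) A0 rho0 ltr01 wM wL.
have [v vW] := Linfty_mk Omega (lipschitz_bounded_measurable WK WM).
have vw : {ae nuO, forall y, v y = w y}.
  by have /ae_nuP[B BB HB] := vW; apply/ae_nuP; exists B => // y Oy nB; rewrite HB// Ww.
exists v; split.
  by exists w; split=> // y z Oy Oz yz; rewrite addr0; exact: wL.
move=> B /nbhs_ballP[e /= e0 vB]; apply: filterS vB _.
have e8 : 0 < e / 8 by rewrite divr_gt0.
have A1 : 0 < A + 1 by rewrite ltr_wpDl.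
pose h := Num.min rho (e / 8 / (A + 1)).
have hA : A * h <= e / 8.
  have : h <= e / 8 / (A + 1) by rewrite /h ge_min lexx orbT.
  rewrite ler_pdivlMr// => /(le_trans _); apply; rewrite mulrC ler_wpM2l ?lerDl//.
  by rewrite /h le_min (ltW rho0) divr_ge0// ltW.
have h0 : 0 < h by rewrite lt_min rho0 divr_gt0.
have [l [lO lnet]] := domain_finite_net Omega h0.
have Fl : F [set v' | forall y, y \in l -> `|rep v' y - w y| < e / 8].
  by apply: (@filter_forall_seq _ _ F (fun y => [set v' | `|rep v' y - w y| < e / 8])) => y yl; exact: Hw (lO y yl) _ e8.
have : F (ball v e); last by [].
apply: filterS (filterI (FA h h0) Fl) => v' [[v'r _ rL] /= rw].
have : Linfty_dist v v' <= e / 2.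
  apply/Linfty_dist_le; first by rewrite divr_ge0// ltW.
  have H1 : {ae nuO, forall y, v' y = rep v' y /\ v y = w y} by exact: filterI.
  have /ae_nuP[B1 [mB1 B10] HB1] := H1.
  apply/ae_nuP; exists B1 => // y Oy nB; have [-> ->] := HB1 y Oy nB.
  have [z zl yz] := lnet y Oy; have Oz := lO z zl.
  have zr : enorm (z - y) <= rho by rewrite enormB (le_trans (ltW yz))// /h ge_min lexx.
  have r1 := rL y z Oy Oz zr; have w1 := wL y z Oy Oz zr; have c1 := rw z zl.
  have A2 : A * enorm (z - y) <= e / 8.
    by rewrite (le_trans _ hA)// ler_wpM2l// enormB ltW.
  rewrite mulrDr in r1.
  rewrite (_ : w y - rep v' y = (rep v' z - rep v' y) - (rep v' z - w z) - (w z - w y)); last by ring.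
  rewrite (le_trans (ler_normB _ _))// (le_trans (lerD (ler_normB _ _) (lexx _)))//.
  by move: r1 w1 c1 A2 hA; clear; lra.
by move=> /le_lt_trans; apply; rewrite ltr_pdivrMr// ltr_pMr// ltr1n.
Qed.

(** The range together with all Lipschitz functions is compact: an ultrafilter on it either contains
    a finite set or is almost Lipschitz to every precision. *)
Lemma almost_lipschitz_precompact (u : nat -> Linfty nuO) (F : nat -> 'rV[R]_d -> R) (sigma : nat -> R) :
  sigma n @[n --> \oo] --> (0 : R) -> (\forall n \near \oo, almost_lipschitz (sigma n) (u n) (F n)) ->
  precompact (range u).
Proof.
move=> cs aL; pose lip v := exists w, almost_lipschitz 0 v w.
pose rep v := match pselect (lip v) with
  | left h => projT1 (cid h)
  | right _ => match pselect (exists n, u n = v) with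
    | left h => F (projT1 (cid h))
    | right _ => fun=> 0
    end
  end.
pose B := range u `|` lip.
have rep_fin (tau : R) : 0 < tau -> finite_set [set v | B v /\ ~ almost_lipschitz tau v (rep v)].
  move=> t0; have /cvgrPdist_lt/(_ tau t0) st := cs.
  have [k _ Hk] : \forall n \near \oo, almost_lipschitz (sigma n) (u n) (F n) /\ `|0 - sigma n| < tau.
    exact: filterI.
  apply: (@sub_finite_set _ _ (u @` `I_k)); last by apply: finite_image; exact: finite_II.
  move=> v [Bv]; rewrite /rep; case: pselect => [h []|nl].
    by case: (cid h) => w /= vw; apply: almost_lipschitz_le vw; exact: ltW.
  case: pselect => [h|nu]; last by case: Bv => [[n _ nv]|//]; case: nu; exists n.
  case: (cid h) => n /= nv H; exists n => //=; rewrite ltnNge; apply/negP => kn; apply: H.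
  have [H1 H2] := Hk n kn; rewrite -nv; apply: almost_lipschitz_le H1.
  by move: H2; rewrite sub0r normrN => /ltW; apply: le_trans; exact: ler_norm.
have cB : compact B.
  rewrite compact_ultra => G GU GB.
  have [[tau t0 Gt]|H] := pselect (exists2 tau : R, 0 < tau & G [set v | B v /\ ~ almost_lipschitz tau v (rep v)]).
    have := finite_compact (rep_fin tau t0); rewrite compact_ultra => /(_ G GU Gt)[v [[Bv _] Gv]].
    by exists v.
  have [|v [lv Gv]] := @ultra_almost_lipschitz_cvg G rep GU; last by exists v; split=> //; right.
  move=> tau t0; case: (in_ultra_setVsetC [set v | almost_lipschitz tau v (rep v)] GU) => // GC.
  by case: H; exists tau => //; exact: filterI.
exists B; first by move=> v uv; left.
by split=> //; apply: compact_closed cB; exact: metric_hausdorff.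
Qed.

End precompactness.

(** * Minimal energies and almost minimizers *)

Section minimizers.
Context {R : realType} {d : nat} (d_gt0 : (0 < d)%N) (Omega : C2_domain R d).
Local Notation O := (domain_set Omega).
Local Notation nuO := (nu Omega).
Context (eta : R -> R) (r_eta p : R) (ker : interaction_kernel eta r_eta) (p1 : 1 < p)
  (eta_neq0 : exists2 t : R, 0 <= t & eta t != 0).
Local Notation moment theta := (kernel_moment eta p theta (e1 : 'rV[R]_d)).

Let p0 : 0 < p. Proof. exact: lt_trans ltr01 p1. Qed.

Definition energy_constant : R := sigma_eta d eta r_eta p * vol Omega `^ (- p^-1).
Local Notation kappa := energy_constant.

Lemma sigma_eta_gt0 : 0 < sigma_eta d eta r_eta p.
Proof.
have m0 := kernel_moment_gt0 d_gt0 ker p1 eta_neq0; move: m0; rewrite -(sigma_eta_powR ker p1).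
have s0 : 0 <= sigma_eta d eta r_eta p by exact: powR_ge0.
move=> h; rewrite lt_neqAle s0 andbT; apply: contraTN h => /eqP <-.
by rewrite powR0 ?gt_eqF// ltxx.
Qed.

Lemma energy_constant_gt0 : 0 < kappa.
Proof. by rewrite mulr_gt0 ?sigma_eta_gt0// powR_gt0// vol_gt0. Qed.

(** Links a continuum slope [L] to the graph energy level kappa L, in the form that both one-sided
    bounds use. *)
Lemma energy_constant_powR (L : R) : 0 <= L ->
  L `^ p * moment 0 = (kappa * L) `^ p * vol Omega.
Proof.
move=> L0; have k0 := energy_constant_gt0; have v0 := vol_gt0 Omega.
rewrite powRM ?(ltW k0)// /energy_constant powRM ?powR_ge0//.
rewrite (sigma_eta_powR ker p1) -powRrM mulNr mulVf ?gt_eqF//.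
by rewrite powR_inv1 ?(ltW v0)// mulrC -!mulrA; congr (_ * _); rewrite mulrCA mulVf ?mulr1// gt_eqF.
Qed.

Context (g : 'rV[R]_d -> R) (N : nat) (N_gt0 : (0 < N)%N) (a : 'I_N -> 'rV[R]_d)
  (a_inj : injective a) (a_dom : forall j, O (a j)).
Local Notation slope := (optimal_slope Omega a g).

Lemma optimal_slope_le_energy (v : Linfty nuO) : (slope%:E <= energy_cons Omega g a v)%E.
Proof.
have H (L : R) : (energy_cons Omega g a v <= L%:E)%E -> slope <= L.
  move=> /energy_cons_locally_lipschitz[L0 [w [wL _ wa]]].
  exact: (optimal_slope_min a_inj a_dom L0 wL wa).
case E : (energy_cons Omega g a v) => [L| |]; last 2 first.
- exact: leey.
(* The value -oo is excluded: it would put the nonnegative slope below -1. *)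
- have /H : (energy_cons Omega g a v <= (-1)%:E)%E by rewrite E leNye.
  by rewrite leNgt (lt_le_trans _ (optimal_slope_ge0 _ _ _)).
by rewrite lee_fin; apply: H; rewrite E.
Qed.

Lemma optimal_energy : exists v, energy_cons Omega g a v = slope%:E.
Proof.
have [w [wL wa]] := optimal_extension_exists (Omega := Omega) g a_inj a_dom N_gt0.
have l0 := optimal_slope_ge0 Omega a g.
have [M M0 wM] := locally_lipschitz_bounded l0 wL.
have [h h0 Hh] := domain_almost_lipschitz Omega (@ltr01 R).
have [W [K' [_ [_ [[K'0 WK] WM Ww _ _]]]]] :=
  lipschitz_extension (@dom_nonempty _ _ Omega) (mulr_ge0 l0 (addr_ge0 ler01 ler01)) h0 ltr01 wM
    (Hh _ _ l0 wL).
have [v vW] := Linfty_mk Omega (lipschitz_bounded_measurable WK WM).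
exists v; apply/eqP; rewrite eq_le optimal_slope_le_energy andbT.
apply: (locally_lipschitz_energy_cons l0 wL) wa.
by have /ae_nuP[B BB HB] := vW; apply/ae_nuP; exists B => // y Oy nB; rewrite HB// Ww.
Qed.

Context (s : nat -> R) (s0 : forall n, 0 < s n) (cs : s n @[n --> \oo] --> (0 : R)).
Context (x : nat -> 'rV[R]_d) (m : nat -> nat) (T : nat -> 'rV[R]_d -> 'rV[R]_d)
  (Txm : forall n, transport Omega x (m n) (T n)) (ax : forall n j, cloud x (m n) (a j)).
Context (delta : nat -> R) (d0 : forall n, 0 <= delta n) (cd : delta n / s n @[n --> \oo] --> (0 : R))
  (Td : \forall n \near \oo, {ae nuO, forall y, enorm (T n y - y) <= delta n}).
Local Notation E n := (graph_energy_cons eta p g a Omega (s n) (m n) x (T n)).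

Lemma near_small_scales (h k : R) : 0 < h -> 0 < k ->
  \forall n \near \oo, [/\ s n <= h, delta n <= k * s n & {ae nuO, forall y, enorm (T n y - y) <= delta n}].
Proof.
move=> h0 k0; have /cvgrPdist_lt/(_ _ h0) ns := cs; have /cvgrPdist_lt/(_ _ k0) nd := cd.
near=> n; split; last by near: n; exact: Td.
- have : `|0 - s n| < h by near: n; exact: ns.
  by rewrite sub0r normrN (gtr0_norm (s0 n)) => /ltW.
- have : `|0 - delta n / s n| < k by near: n; exact: nd.
  by rewrite sub0r normrN ger0_norm ?divr_ge0 ?(ltW (s0 n))// => /ltW; rewrite ler_pdivrMr.
Unshelve. all: by end_near. Qed.

Lemma inf_energy_limsup (eps : R) : 0 < eps ->
  \forall n \near \oo, (ereal_inf (range (E n)) <= (kappa * slope + eps)%:E)%E.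
Proof.
move=> eps0; have l0 := optimal_slope_ge0 Omega a g; have k0 := energy_constant_gt0.
have [w [wL wa]] := optimal_extension_exists (Omega := Omega) g a_inj a_dom N_gt0.
have e20 : 0 < eps / 2 / kappa by rewrite !divr_gt0.
have [U [G [C [TU GL _ Ua]]]] := smooth_recovery a_inj a_dom l0 wL e20.
pose L := slope + eps / 2 / kappa; have L0 : 0 <= L by rewrite addr_ge0// ltW.
have kL : kappa * L = kappa * slope + eps / 2.
  by rewrite mulrDr mulrCA mulfV ?mulr1// gt_eqF.
pose K := kappa * slope + eps.
have K1 : 0 <= kappa * L by rewrite mulr_ge0// ltW.
have KK : kappa * L < K by rewrite kL ltrD2l ltr_pdivrMr// ltr_pMr// ltr1n.
have K0 : 0 <= K by rewrite (le_trans K1)// ltW.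
(* The error that turns the level kappa L into exactly [K] after taking p-th powers. *)
pose eps' := vol Omega * (K `^ p - (kappa * L) `^ p).
have eps'0 : 0 < eps' by rewrite mulr_gt0 ?vol_gt0// subr_gt0 gt0_ltr_powR ?nnegrE.
have [h [k [h0 k0' H]]] := recovery_energy_bound d_gt0 ker p1 TU GL L0 eps'0.
have := near_small_scales h0 k0'; apply: filterS => n [sn dn Tn].
have [u uU] := Linfty_mk Omega (transport_bounded_measurable (Txm n) U).
have {}uU : {ae nuO, forall y, u y = U (T n y)}.
  have /ae_nuP[B BB HB] := uU; apply/ae_nuP; exists B => // y Oy nB.
  by rewrite HB// patchE mem_set.
have eta_ge0 := kernel_ge0 ker.
apply: ge_ereal_inf; exists (E n u); first by exists u.
rewrite (graph_energy_consE eta p g (s n) (Txm n) (ax n) uU).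
apply/(graph_energy_le_iff p0 g a eta_ge0 (s0 n) (Txm n) U K0); split.
  by move=> j; rewrite Ua wa.
move=> c xc; apply: le_trans (H _ _ _ _ _ (s0 n) sn (d0 n) dn (Txm n) Tn c xc) _.
rewrite (energy_constant_powR L0) /eps' (powRM _ K0 (ltW (s0 n))) mulrBr.
by rewrite [leLHS](_ : _ = vol Omega * (K `^ p * s n `^ p))//; ring.
Qed.

Let E_ge0 n u : (0 <= E n u)%E.
Proof. exact: graph_energy_cons_ge0. Qed.

Context (u : nat -> Linfty nuO) (M : R) (uM : forall n, {ae nuO, forall y, `|u n y| <= M}).

(** Quantifying over tolerance and rank, rather than giving a subsequence, fits cluster points
    directly. *)
Lemma subsequence_energy (v : Linfty nuO) (K : R) : 0 < K ->
  (forall (e : R) k, 0 < e -> exists n, [/\ (k <= n)%N, Linfty_dist v (u n) < e & (E n (u n) <= K%:E)%E]) ->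
  (energy_cons Omega g a v <= (K / kappa)%:E)%E.
Proof.
move=> K0 H; have k0 := energy_constant_gt0.
have [n0 _ Tn0] := Td.
have e0 k : 0 < k.+1%:R^-1 :> R by rewrite invr_gt0.
(* Starting beyond [n0] makes the displacement bound hold along the whole subsequence. *)
have [psi Hpsi] := choice (fun k => H _ (maxn k n0) (e0 k)).
have psik k : (k <= psi k)%N by have [h _ _] := Hpsi k; exact: leq_trans (leq_maxl _ _) h.
have psin k : (n0 <= psi k)%N by have [h _ _] := Hpsi k; exact: leq_trans (leq_maxr _ _) h.
have cpsi (f : nat -> R) : f n @[n --> \oo] --> (0 : R) -> f (psi k) @[k --> \oo] --> (0 : R).
  move=> /cvgrPdist_lt cf; apply/cvgrPdist_lt => e /cf[k _ Hk]; exists k => // j /= kj.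
  by apply: Hk => /=; exact: leq_trans kj (psik j).
have L0 : 0 < K / kappa by rewrite divr_gt0.
apply: (energy_liminf d_gt0 ker p1 eta_neq0 (s := s \o psi) (delta := delta \o psi) _ (cpsi _ cs)
  _ (cpsi _ cd) (m := m \o psi) (T := T \o psi) _ _ _ (u := u \o psi) (e := fun k => k.+1%:R^-1) K0 L0) => //.
- by move=> k; exact: s0.
- by move=> k; exact: d0.
- by move=> k; exact: Txm.
- by move=> k; apply: Tn0; exact: psin.
- by move=> k j; exact: ax.
- by rewrite (energy_constant_powR (ltW L0)) [kappa * _]mulrC divfK ?gt_eqF.
- by move=> k; exact: uM.
- move=> k; have [_ /ltW h _] := Hpsi k; move: h; rewrite Linfty_dist_le ?ltW//.
  by apply: filterS => y; rewrite distrC.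
- exact: cvg_harmonic.
by move=> k; have [] := Hpsi k.
Qed.

Lemma bounded_energy_precompact (K : R) : 0 < K ->
  (\forall n \near \oo, (E n (u n) <= K%:E)%E) -> precompact (range u).
Proof.
move=> K0 EK; have [c [t1 [c0 t10 ec]]] := kernel_lower_bound ker eta_neq0.
have [C [rho [h [k [C0 rho0 h0 k0 H]]]]] :=
  asymptotic_equicontinuity Omega p1 (kernel_ge0 ker) c0 t10 ec.
have A0 : 0 <= C * K by rewrite mulr_ge0// ltW.
have ex n : exists F, [/\ s n <= h, delta n <= k * s n & {ae nuO, forall y, enorm (T n y - y) <= delta n}] ->
    (E n (u n) <= K%:E)%E -> almost_lipschitz (C * K) rho M (s n) (u n) F.
  have [[sn dn Tn]|nH] := pselect [/\ s n <= h, delta n <= k * s n & {ae nuO, forall y, enorm (T n y - y) <= delta n}];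
    last by exists (fun=> 0).
  have [En|nE] := pselect (E n (u n) <= K%:E)%E; last by exists (fun=> 0).
  have [U [[bU UM] _ uU _ EB]] :=
    graph_energy_cons_bounded ker p1 (s0 n) (ltW K0) (Txm n) Tn (ax n) (uM n) En.
  have [F [FU FD FL]] := H _ _ _ _ _ _ (s0 n) sn (d0 n) dn K0 EB.
  exists F => _ _; have [DO aeD _ _] := EB; split=> //.
    by apply: filterS (filterI aeD uU) => y [Dy ->]; rewrite FU.
  by move=> y Oy; have [z Dz ->] := FD y Oy; apply: UM; exact: DO.
have [F HF] := choice ex; apply: (almost_lipschitz_precompact (M := M) A0 rho0 (F := F) cs).
near=> n; apply: HF; near: n; [exact: near_small_scales|exact: EK].
Unshelve. all: by end_near. Qed.

Context (minimizing : (E n (u n) - ereal_inf (range (E n)))%E @[n --> \oo] --> 0%E).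

Lemma energy_limsup (eps : R) : 0 < eps ->
  \forall n \near \oo, (E n (u n) <= (kappa * slope + eps)%:E)%E.
Proof.
move=> eps0; have e2 : 0 < eps / 2 by rewrite divr_gt0.
have e2E : (0 < (eps / 2)%:E)%E by rewrite lte_fin.
have small : \forall n \near \oo, (E n (u n) - ereal_inf (range (E n)) < (eps / 2)%:E)%E.
  have : nbhs (0%E : \bar R) [set y | (y < (eps / 2)%:E)%E].
    by apply: open_nbhs_nbhs; split; [exact: open_ereal_lt_ereal|].
  exact: minimizing.
near=> n.
have i0 : (0 <= ereal_inf (range (E n)))%E.
  by apply: le_ereal_inf_tmp => _ [v _ <-]; exact: E_ge0.
have i1 : (ereal_inf (range (E n)) <= (kappa * slope + eps / 2)%:E)%E.
  by near: n; exact: inf_energy_limsup.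
(* Extended subtraction can be undone only when the infimum is finite; this comes from the recovery
   bound. *)
have fi : ereal_inf (range (E n)) \is a fin_num.
  by rewrite ge0_fin_numE// (le_lt_trans i1)// ltry.
have : (E n (u n) - ereal_inf (range (E n)) < (eps / 2)%:E)%E by near: n; exact: small.
rewrite lteBlDr// => /ltW /le_trans; apply.
by rewrite (_ : kappa * slope + eps = eps / 2 + (kappa * slope + eps / 2)) ?EFinD ?leeD2l//; field.
Unshelve. all: by end_near. Qed.

Lemma minimizing_precompact : precompact (range u).
Proof.
apply: (@bounded_energy_precompact (kappa * slope + 1)); last exact: energy_limsup.
by rewrite ltr_wpDl// mulr_ge0 ?optimal_slope_ge0// ltW// energy_constant_gt0.
Qed.

Lemma cluster_energy v : cluster (u @ \oo) v -> energy_cons Omega g a v = slope%:E.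
Proof.
move=> cv; have k0 := energy_constant_gt0; have l0 := optimal_slope_ge0 Omega a g.
apply/eqP; rewrite eq_le optimal_slope_le_energy andbT; apply/lee_addgt0Pr => e e0.
have ke : 0 < kappa * e by rewrite mulr_gt0.
have K0 : 0 < kappa * slope + kappa * e by rewrite ltr_wpDl// mulr_ge0// ltW.
rewrite -EFinD (_ : slope + e = (kappa * slope + kappa * e) / kappa); last first.
  by rewrite -mulrDr mulrAC mulfV ?mul1r// gt_eqF.
apply: subsequence_energy => // e' k e'0.
have Bv : nbhs v [set v' | Linfty_dist v v' < e'] by apply/nbhs_ballP; exists e'.
have Fk : (u @ \oo) (u @` [set n | (k <= n)%N /\ (E n (u n) <= (kappa * slope + kappa * e)%:E)%E]).
  have [k' _ Hk'] := energy_limsup ke.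
  exists (maxn k k') => // n /=; rewrite geq_max => /andP[kn k'n]; exists n => //; split=> //.
  exact: Hk'.
by have [_ [[n [kn En] <-] /= dn]] := cv _ _ Fk Bv; exists n; split.
Qed.

(** Otherwise infinitely many terms have energy below the level; by precompactness they accumulate
    at a function whose continuum energy is below the minimum. *)
Lemma energy_liminf_ge (eps : R) : 0 < eps ->
  \forall n \near \oo, ((kappa * slope - eps)%:E <= E n (u n))%E.
Proof.
move=> eps0; apply: contrapT => nH; have k0 := energy_constant_gt0.
pose K := kappa * slope - eps.
have bad k : exists n, (k <= n)%N /\ (E n (u n) <= K%:E)%E.
  apply: contrapT => H; apply: nH; exists k => // n /= kn; rewrite leNgt; apply/negP => /ltW En.
  by apply: H; exists n.
(* If the level is nonpositive there is nothing to prove, energies being nonnegative. *)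
have K0 : 0 < K.
  rewrite ltNge; apply/negP => K0; apply: nH; apply: nearW => n.
  by apply: le_trans (E_ge0 n (u n)); rewrite lee_fin.
(* The filter generated by the tails of the bad terms; its cluster points are those of the bad
   subsequence. *)
pose F := filter_from setT (fun k => u @` [set n | (k <= n)%N /\ (E n (u n) <= K%:E)%E]).
have FF : ProperFilter F.
  apply: filter_from_proper; last by move=> k _; have [n nk] := bad k; exists (u n), n.
  apply: filter_from_filter; first by exists 0%N.
  move=> i j _ _; exists (maxn i j) => // _ [n [+ En] <-]; rewrite geq_max => /andP[ni nj].
  by split; exists n.
have := minimizing_precompact; rewrite precompactE => /(_ F FF)[|v [_ Fv]].
  by exists 0%N => // _ [n _ <-]; apply: subset_closure; exists n.
have : (energy_cons Omega g a v <= (K / kappa)%:E)%E.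
  apply: subsequence_energy => // e k e0.
  have Bv : nbhs v [set v' | Linfty_dist v v' < e] by apply/nbhs_ballP; exists e.
  have Fk : F (u @` [set n | (k <= n)%N /\ (E n (u n) <= K%:E)%E]) by exists k.
  by have [_ [[n [kn En] <-] /= dn]] := Fv _ _ Fk Bv; exists n; split.
move=> /(le_trans (optimal_slope_le_energy v)); rewrite lee_fin ler_pdivlMr// mulrC leNgt => /negP; apply.
by rewrite /K ltrBlDr ltrDl.
Qed.

Lemma minimizing_energy_cvg : E n (u n) @[n --> \oo] --> (kappa * slope)%:E.
Proof.
apply/fine_cvgP; split.
  near=> n; rewrite ge0_fin_numE ?E_ge0//.
  apply: (@le_lt_trans _ _ (kappa * slope + 1)%:E); last exact: ltry.
  by near: n; exact: energy_limsup.
apply/cvgrPdist_le => e e0; near=> n.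
have h1 : (E n (u n) <= (kappa * slope + e)%:E)%E by near: n; exact: energy_limsup.
have h2 : ((kappa * slope - e)%:E <= E n (u n))%E by near: n; exact: energy_liminf_ge.
have f : E n (u n) \is a fin_num by rewrite ge0_fin_numE ?E_ge0// (le_lt_trans h1)// ltry.
move: h1 h2; rewrite -(fineK f) /= !lee_fin => h1 h2.
move: h1 h2; set y := fine _; rewrite ler_norml; set l := kappa * slope => h1 h2.
by apply/andP; split; [rewrite lerBrDl lerBlDr|rewrite lerBlDl -lerBlDr].
Unshelve. all: by end_near. Qed.

End minimizers.

Theorem theorem3 (R : realType) (d : nat) (d_gt0 : (0 < d)%N)
  (p : R) (p_gt1 : 1 < p)
  (Omega : C2_domain R d)
  (eta : R -> R) (r_eta : R) (eta_kernel : interaction_kernel eta r_eta)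
  (eta_neq0 : exists2 t : R, 0 <= t & eta t != 0)
  (s : nat -> R) (s_gt0 : forall n, 0 < s n)
  (s_cvg0 : s @ \oo --> 0)
  (rate_s : (rate d n.+1 / s n) @[n --> \oo] --> 0)
  (g : 'rV[R]_d -> R) (g_lip : [lipschitz g y | y in closure (domain_set Omega)])
  (N : nat) (N_gt0 : (0 < N)%N)
  (a : 'I_N -> 'rV[R]_d) (a_inj : injective a) (a_dom : forall j, domain_set Omega (a j))
  (m : nat -> nat) (m_gtN : (N < m 0)%N) (m_incr : forall n, (m n < m n.+1)%N)
  (dW : measure_display) (W : measurableType dW) (P : probability W R)
  (x : nat -> {RV P >-> 'rV[R]_d})
  (x_label : forall (j : 'I_N) omega, x j omega = a j)
  (x_iid : iid_with_law (fun i => x (N + i)%N) (unif Omega)) :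
  exists2 v0 : Linfty (nu Omega),
    (forall v, (energy_cons Omega g a v0 <= energy_cons Omega g a v)%E) &
    {ae P, forall omega,
      forall T : nat -> 'rV[R]_d -> 'rV[R]_d,
        transport_maps Omega m (fun i => x i omega) T ->
      let E n : Linfty (nu Omega) -> \bar R :=
        graph_energy_cons eta p g a Omega (s n) (m n) (fun i => x i omega) (T n) in
      forall u : nat -> Linfty (nu Omega),
        (exists M : R, forall n, ('N[nu Omega]_+oo[EFin \o u n] <= M%:E)%E) ->
        (E n (u n) - ereal_inf (range (E n)))%E @[n --> \oo] --> 0%E ->
      [/\ precompact (range u),
          E n (u n) @[n --> \oo] -->
            ((sigma_eta d eta r_eta p * vol Omega `^ (- p^-1))%:E *
               energy_cons Omega g a v0)%E &
          forall v, cluster (u @ \oo) v ->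
            forall w, (energy_cons Omega g a v <= energy_cons Omega g a w)%E]}.
Proof.
have [v0 Ev0] := optimal_energy g N_gt0 a_inj a_dom.
have min0 v : (energy_cons Omega g a v0 <= energy_cons Omega g a v)%E.
  by rewrite Ev0; exact: optimal_slope_le_energy.
exists v0; first exact: min0.
apply: aeW => omega T tm /= u bu cE; have [M uM] := bu.
have Nm n : (N < m n)%N.
  by elim: n => // n IH; exact: ltn_trans IH (m_incr n).
have m0 n : (0 < m n)%N by exact: leq_ltn_trans (leq0n N) (Nm n).
have [Txm [delta [d0 cd Td]]] := transport_maps_near m0 s_gt0 rate_s tm.
(* The labels are the first [N] sample points, and N < m n puts them in every cloud. *)
have ax n j : cloud (fun i => x i omega) (m n) (a j).
  by exists j; rewrite ?x_label//=; exact: ltn_trans (ltn_ord j) (Nm n).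
have uM' n : {ae nu Omega, forall y, `|u n y| <= M}.
  by have /Lnorm_oo_le := uM n; apply: filterS => y; rewrite /= lee_fin.
split.
- exact: (minimizing_precompact d_gt0 eta_kernel p_gt1 eta_neq0 N_gt0 a_inj a_dom s_gt0 s_cvg0 Txm ax d0 cd Td uM' cE).
- rewrite Ev0 -EFinM.
  exact: (minimizing_energy_cvg d_gt0 eta_kernel p_gt1 eta_neq0 N_gt0 a_inj a_dom s_gt0 s_cvg0 Txm ax d0 cd Td uM' cE).
move=> v cv w.
rewrite (cluster_energy d_gt0 eta_kernel p_gt1 eta_neq0 N_gt0 a_inj a_dom s_gt0 s_cvg0 Txm ax d0 cd Td uM' cE cv).
by rewrite -Ev0.
Qed.
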